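(* Let $\varphi:\mathbb P^1\to\mathbb P^1$ be a branched Galois covering of degree $8$ with Galois group the dihedral group $D_4$ of order $8$; up to Möbius transformations, $\varphi$ is $[x,y]\mapsto-\alpha_4^2/\gamma^4$, where $\alpha_4=(x^4-y^4)/2$, $\beta_4=(x^4+y^4)/2$, $\gamma=xy$. Let $g([x,y]):\mathbb P^1\to\mathbb P^3$ be a holomorphic curve which is a Galois lift, with covering $\varphi$, of a sextic curve $F$ in $\mathcal V_5$, so $f_1\circ g=F\circ\varphi$. Then, up to Möbius transformations on $\mathbb P^1$ and $PSL_2$-equivalence, $\deg g=9$ or $11$, and the following classification holds. (1) If $\deg g=9$, then $$g=\begin{pmatrix} a_1 & a_2 & a_3 \\ b_1 & b_2 & b_3 \end{pmatrix}\begin{pmatrix} x\alpha_4^2 & x\gamma^4 & -\alpha_4\gamma\frac{\partial\beta_4}{\partial y} \\ y\alpha_4^2 & y\gamma^4 & \alpha_4\gamma\frac{\partial\beta_4}{\partial x} \end{pmatrix}^T.$$ This class depends on two free parameters and belongs to the generally ramified family. (2) If $\deg g=11$, then $$g=\begin{pmatrix} a_1 & a_2 & a_3 \\ b_1 & b_2 & b_3 \end{pmatrix}\begin{pmatrix} -x\alpha_4\gamma^3 & x\beta_4\gamma^3 & \alpha_4\beta_4\frac{\partial\alpha_4}{\partial y} \\ y\alpha_4\gamma^3 & y\beta_4\gamma^3 & \alpha_4\beta_4\frac{\partial\alpha_4}{\partial x} \end{pmatrix}^T,$$ where $\begin{pmatrix} a_1 & a_2 & a_3 \\ b_1 & b_2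 & b_3 \end{pmatrix}\in G(2,3)$ is the unique plane which is perpendicular to $$\big(-(t+1)^2(t^2+1)t^3,\ (t^4+1)t^3,\ -(t^3+1)(t^4+1)(t^3+t^2+t+1)\big)$$ under the bilinear inner product. This class depends on one free parameter $t$ and belongs to the exceptional transversal family.
   Context: The ground field is $\mathbb C$. $V_n$ is the space of binary forms of degree $n$ in $u,v$, with $SL_2=SL_2(\mathbb C)$ acting by $(A\cdot f)(u,v)=f(A^{-1}(u,v)^T)$. $\mathcal V_5\subset\mathbb P(V_6)=\mathbb P^6$ is the closure of $PSL_2\cdot[uv(u^4-v^4)]$; it is the disjoint union of this open orbit, the $2$-dimensional orbit $PSL_2\cdot[u^5v]$ and the $1$-dimensional orbit $PSL_2\cdot[u^6]$. A sextic curve is a holomorphic curve $F:\mathbb P^1\to\mathcal V_5\subset\mathbb P^6$ of degree $6$, linearly full in $\mathbb P^6$, not contained in $\overline{PSL_2\cdot[u^5v]}$. It is in the generally ramified family if it is tangent to the $1$-dimensional orbit at some point where it meets that orbit; otherwise it is in the exceptional transversal family. A class of curves $g$ is said to belong to one of these families if the corresponding curves $F$ do. Points of $\mathbb P^3$ are nonzero $2\times2$ matrices $\begin{pmatrix} a & b \\ c & d \end{pmatrix}$ up to scale, and $f_1:\mathbb P^3\dashrightarrow\mathbb P(V_6)$ sends this matrix to $[(du-bv)(av-cu)((du-bv)^4-(av-cu)^4)]$; on $PSL_2$ it is the orbit map of $[uv(u^4-v^4)]$. $S_4^*\subset SU(2)$ is the binary octahedral group (order $48$) generated by $\mathrm{diag}(e^{\pi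 i/4},e^{-\pi i/4})$ and $\frac1{\sqrt2}\begin{pmatrix} 1 & -1 \\ 1 & 1 \end{pmatrix}$; its image in $PSL_2$ is the stabilizer of $[uv(u^4-v^4)]$. A branched covering $\varphi$ is Galois if its group $G=\{\sigma:\varphi\circ\sigma=\varphi\}$ has order $\deg\varphi$. A map $g:\mathbb P^1\to\mathbb P^3$ of degree $n$ is a $2\times2$ matrix of degree-$n$ forms in $x,y$ without common factor. It is a Galois lift of $F$ with covering $\varphi$ if $f_1\circ g=F\circ\varphi$ and the homomorphism $\sigma\mapsto g(\sigma(q))^{-1}g(q)$ (independent of generic $q$) from $G$ to the stabilizer of $[uv(u^4-v^4)]$ is injective. Two curves $g,\tilde g:\mathbb P^1\to\mathbb P^3$ are $PSL_2$-equivalent if $AgB^T=\tilde g$ for some $A\in SL_2$, $B\in S_4^*$. Möbius transformations may be applied to both copies of $\mathbb P^1$ (source and target of $\varphi$). $G(2,k)$ is the Grassmannian of $2$-planes in $\mathbb C^k$; a $2\times k$ matrix of rank $2$ denotes its row space (in (1) the coefficient matrix also has rank $2$). The bilinear inner product is $\sum_i p_iq_i$ (no conjugation). *)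

(* Defs.v *)
From mathcomp Require Import all_boot all_order all_algebra all_fingroup.
From mathcomp Require Import all_solvable.
From mathcomp Require Export mpoly complex reals.

Set Implicit Arguments.
Unset Strict Implicit.
Unset Printing Implicit Defensive.

Import GRing.Theory Num.Theory.
Notation D4 := ('D_8)%G.

Local Open Scope ring_scope.

(* The binary forms in (u,v) and those in (x,y) are both homogeneous elements
   of {mpoly K[2]}: the variables 'X_0, 'X_1 stand for u, v in points of V_n
   and for x, y in the entries of a curve. *)
Notation forms K := {mpoly K[2]}.

Definition X0 {K : nzRingType} : forms K := 'X_(0 : 'I_2).
Definition X1 {K : nzRingType} : forms K := 'X_(1 : 'I_2).

(* Over a field: equality of points of a projective space.  Over K = C[x,y]:
   equality of rational maps from P^1 to a projective space. *)
Definition proj_eq (K : idomainType) m n (v w : 'M[K]_(m, n)) : Prop :=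
  exists p q : K, [/\ p != 0, q != 0 & p *: v = q *: w].

(* V_6 is identified with K^7: the entry i is the coefficient of u^(6-i) v^i. *)
Definition coefs6 (K : nzRingType) (f : forms K) : 'rV[K]_7 :=
  \row_(i < 7) f@_(U_(0%R : 'I_2) *+ (6 - i) + U_(1%R : 'I_2) *+ i)%MM.

(* The formula of f_1.  For K = C it acts on (representatives of) points of
   P^3; for K = C[x,y] it computes f_1 o g. *)
Definition f1 (K : comNzRingType) (M : 'M[K]_2) : 'rV[K]_7 :=
  let l1 := M 1 1 *: X0 - M 0 1 *: X1 in
  let l2 := M 0 0 *: X1 - M 1 0 *: X0 in
  coefs6 (l1 * l2 * (l1 ^+ 4 - l2 ^+ 4)).

Section Curves.

Variable C : numClosedFieldType.
Implicit Types (n : nat) (p q : 'rV[C]_2).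

(* A holomorphic map of degree n from P^1 to the projective space of m x k
   matrices. *)
Definition is_curve n m k (g : 'M[forms C]_(m, k)) : Prop :=
  (forall i j, g i j \is n.-homog) /\
  (forall h : forms C, (forall i j, exists f, g i j = h * f) ->
     exists c : C, h = c%:MP).

Definition point_of m k (g : 'M[forms C]_(m, k)) p : 'M[C]_(m, k) :=
  map_mx (fun f : forms C => f.@[p 0]) g.

Definition precomp m k (g : 'M[forms C]_(m, k)) (phi : 'cV[forms C]_2) :
    'M[forms C]_(m, k) :=
  map_mx (comp_mpoly [tuple phi i 0 | i < 2]) g.

Definition const_forms m k (A : 'M[C]_(m, k)) : 'M[forms C]_(m, k) :=
  map_mx (@mpolyC 2 C) A.

(* The linear map (x,y)^T |-> A (x,y)^T as a pair of linear forms; for A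
   invertible it is the Moebius transformation of P^1 given by A. *)
Definition moebius (A : 'M[C]_2) : 'cV[forms C]_2 :=
  const_forms A *m \col_(i < 2) 'X_i.

Definition act (A : 'M[C]_2) (f : forms C) : forms C :=
  f \mPo [tuple moebius (invmx A) i 0 | i < 2].

(* PSL_2 . [f] in P(V_6), as the set of representatives of its points. *)
Definition orbit6 (f : forms C) (v : 'rV[C]_7) : Prop :=
  exists (A : 'M[C]_2) (c : C),
    [/\ \det A = 1, c != 0 & v = c *: coefs6 (act A f)].

(* Zariski closure in P^6; on an orbit of PSL_2 it agrees with the closure
   for the classical topology. *)
Definition closure6 (S : 'rV[C]_7 -> Prop) (v : 'rV[C]_7) : Prop :=
  forall (d : nat) (P : {mpoly C[7]}), P \is d.-homog ->
    (forall w, S w -> P.@[w 0] = 0) -> P.@[v 0] = 0.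

Definition V5 : 'rV[C]_7 -> Prop :=
  closure6 (orbit6 (X0 * X1 * (X0 ^+ 4 - X1 ^+ 4))).

Definition linearly_full (F : 'rV[forms C]_7) : Prop :=
  forall c : 'cV[C]_7, F *m const_forms c = 0 -> c = 0.

Definition sextic_curve (F : 'rV[forms C]_7) : Prop :=
  [/\ is_curve 6 F,
      forall p, p != 0 -> V5 (point_of F p),
      linearly_full F &
      exists p, p != 0 /\ ~ closure6 (orbit6 (X0 ^+ 5 * X1)) (point_of F p)].

(* The parametrization [s,t] |-> [(su + tv)^6] of the orbit PSL_2 . [u^6]. *)
Definition rational_normal6 : 'rV[forms C]_7 :=
  coefs6 ((X0 *: X0 + X1 *: X1 : forms (forms C)) ^+ 6).

(* The two rows span the tangent line of the curve at p. *)
Definition tangent_line (F : 'rV[forms C]_7) p : 'M[C]_(2, 7) :=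
  \matrix_(i < 2, j < 7) (F 0 j)^`M(i).@[p 0].

Definition generally_ramified (F : 'rV[forms C]_7) : Prop :=
  exists p q, [/\ p != 0, q != 0, orbit6 (X0 ^+ 6) (point_of F p),
    proj_eq (point_of F p) (point_of rational_normal6 q) &
    (tangent_line F p == tangent_line rational_normal6 q)%MS].

Definition exceptional_transversal (F : 'rV[forms C]_7) : Prop :=
  ~ generally_ramified F.

(* (1 + i) / sqrt 2 = exp (pi i / 4). *)
Definition zeta8 : C := (1 + 'i) / sqrtC 2.

Definition mx22 (a b c d : C) : 'M[C]_2 :=
  \matrix_(i < 2, j < 2)
    if i == 0 then (if j == 0 then a else b) else (if j == 0 then c else d).

Inductive S4star : 'M[C]_2 -> Prop :=
  | S4star_diag : S4star (mx22 zeta8 0 0 zeta8^-1)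
  | S4star_rot : S4star ((sqrtC 2)^-1 *: mx22 1 (-1) 1 1)
  | S4star_1 : S4star 1%:M
  | S4star_mul A B : S4star A -> S4star B -> S4star (A *m B)
  | S4star_inv A : S4star A -> S4star (invmx A).

Definition deck (phi : 'cV[forms C]_2) (sigma : 'M[C]_2) : Prop :=
  sigma \in unitmx /\ proj_eq (precomp phi (moebius sigma)) phi.

(* s induces a group isomorphism from G onto the group of deck
   transformations of phi, seen in PGL_2. *)
Definition deck_group_isog (phi : 'cV[forms C]_2)
    (gT : finGroupType) (G : {group gT}) : Prop :=
  exists s : gT -> 'M[C]_2,
    [/\ forall a, a \in G -> deck phi (s a),
        forall a b, a \in G -> b \in G -> proj_eq (s (a * b)%g) (s a *m s b),
        forall a b, a \in G -> b \in G -> proj_eq (s a) (s b) -> a = b &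
        forall sigma, deck phi sigma -> exists2 a, a \in G & proj_eq sigma (s a)].

Definition galois_covering n (phi : 'cV[forms C]_2)
    (gT : finGroupType) (G : {group gT}) : Prop :=
  [/\ is_curve n phi, deck_group_isog phi G & #|G| = n].

(* The class of \adj (g o sigma) *m g in PGL_2(C(x,y)) is that of
   q |-> g(sigma(q))^-1 g(q). *)
Definition galois_lift (phi : 'cV[forms C]_2) (F : 'rV[forms C]_7)
    (g : 'M[forms C]_2) : Prop :=
  proj_eq (f1 g) (precomp F phi) /\
  (forall sigma tau, deck phi sigma -> deck phi tau ->
     proj_eq (\adj (precomp g (moebius sigma)) *m g)
             (\adj (precomp g (moebius tau)) *m g) ->
     proj_eq sigma tau).

Definition covering_equiv (phi phi' : 'cV[forms C]_2) (mu nu : 'M[C]_2) :=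
  [/\ mu \in unitmx, nu \in unitmx &
      proj_eq phi' (const_forms nu *m precomp phi (moebius mu))].

Definition PSL2_equiv (g g' : 'M[forms C]_2) : Prop :=
  exists A B : 'M[C]_2, [/\ \det A = 1, S4star B &
    proj_eq g' (const_forms A *m g *m (const_forms B)^T)].

(* Equivalence of a curve g with covering phi and a curve g' with covering
   phi': the source Moebius transformation mu acts on g and phi at once. *)
Definition lift_equiv (phi : 'cV[forms C]_2) (g : 'M[forms C]_2)
    (phi' : 'cV[forms C]_2) (g' : 'M[forms C]_2) : Prop :=
  exists mu nu : 'M[C]_2, covering_equiv phi phi' mu nu /\
    PSL2_equiv (precomp g (moebius mu)) g'.

Definition alpha4 : forms C := 2^-1 *: (X0 ^+ 4 - X1 ^+ 4).
Definition beta4 : forms C := 2^-1 *: (X0 ^+ 4 + X1 ^+ 4).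
Definition gamma : forms C := X0 * X1.

Definition d_x (f : forms C) : forms C := f^`M(0 : 'I_2).
Definition d_y (f : forms C) : forms C := f^`M(1 : 'I_2).

Definition phi_D4 : 'cV[forms C]_2 :=
  \col_(i < 2) if i == 0 then - alpha4 ^+ 2 else gamma ^+ 4.

Definition mx_of_seqs m k (s : seq (seq (forms C))) : 'M[forms C]_(m, k) :=
  \matrix_(i < m, j < k) nth 0 (nth [::] s i) j.

Definition N9 : 'M[forms C]_(2, 3) := mx_of_seqs 2 3
  [:: [:: X0 * alpha4 ^+ 2; X0 * gamma ^+ 4; - (alpha4 * gamma * d_y beta4)];
      [:: X1 * alpha4 ^+ 2; X1 * gamma ^+ 4; alpha4 * gamma * d_x beta4]].

Definition N11 : 'M[forms C]_(2, 3) := mx_of_seqs 2 3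
  [:: [:: - (X0 * alpha4 * gamma ^+ 3); X0 * beta4 * gamma ^+ 3;
          alpha4 * beta4 * d_y alpha4];
      [:: X1 * alpha4 * gamma ^+ 3; X1 * beta4 * gamma ^+ 3;
          alpha4 * beta4 * d_x alpha4]].

Definition g9 (M : 'M[C]_(2, 3)) : 'M[forms C]_2 := const_forms M *m N9^T.
Definition g11 (M : 'M[C]_(2, 3)) : 'M[forms C]_2 := const_forms M *m N11^T.

Definition normal11 (t : C) : 'rV[C]_3 :=
  \row_(i < 3) nth 0
    [:: - ((t + 1) ^+ 2 * (t ^+ 2 + 1) * t ^+ 3);
        (t ^+ 4 + 1) * t ^+ 3;
        - ((t ^+ 3 + 1) * (t ^+ 4 + 1) * (t ^+ 3 + t ^+ 2 + t + 1))] i.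

Definition perp_plane (w : 'rV[C]_3) (M : 'M[C]_(2, 3)) : Prop :=
  \rank M = 2%N /\ M *m w^T = 0.

Definition unique_perp_plane (w : 'rV[C]_3) (M : 'M[C]_(2, 3)) : Prop :=
  perp_plane w M /\ (forall M', perp_plane w M' -> (M' == M)%MS).

(* Pluecker coordinates, up to order and sign. *)
Definition pluecker (M : 'M[C]_(2, 3)) (i : 'I_3) : C := \det (col' i M).

Definition lift_of_sextic n (phi : 'cV[forms C]_2) (g : 'M[forms C]_2) : Prop :=
  is_curve n g /\ exists F, sextic_curve F /\ galois_lift phi F g.

(* "Depends on two free parameters": on a nonempty Zariski open subset of the
   surface G(2,3), every plane M gives a curve g9 M of degree 9 lifting a sextic
   curve, and each such curve is equivalent to g9 M' for only finitely many
   planes M'. *)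
Definition two_free_parameters9 : Prop :=
  (exists (d : nat) (P : {mpoly C[3]}), [/\ P \is d.-homog, P != 0 &
     forall M, \rank M = 2%N -> P.@[pluecker M] != 0 ->
       lift_of_sextic 9 phi_D4 (g9 M)]) /\
  (forall M, \rank M = 2%N -> lift_of_sextic 9 phi_D4 (g9 M) ->
     exists s : seq 'M[C]_(2, 3), forall M', \rank M' = 2%N ->
       lift_equiv phi_D4 (g9 M) phi_D4 (g9 M') ->
       has (fun K => (K == M')%MS) s).

(* "Depends on one free parameter t": all but finitely many t give a curve of
   degree 11 lifting a sextic curve, and each such curve is equivalent to those
   given by only finitely many t'. *)
Definition one_free_parameter11 : Prop :=
  (exists s : seq C, forall t, t \notin s ->
     forall M, unique_perp_plane (normal11 t) M ->
       lift_of_sextic 11 phi_D4 (g11 M)) /\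
  (forall t M, unique_perp_plane (normal11 t) M ->
     lift_of_sextic 11 phi_D4 (g11 M) ->
     exists s : seq C, forall t' M', unique_perp_plane (normal11 t') M' ->
       lift_equiv phi_D4 (g11 M) phi_D4 (g11 M') -> t' \in s).

End Curves.

(* Main.v *)
From HB Require Import structures.
Require Import Defs.
From mathcomp Require Import all_boot all_order all_algebra all_fingroup.
From mathcomp Require Import all_solvable.
From mathcomp Require Import ring zify.
From mathcomp Require Import boolp.

(** Invertible matrices act on the projective line, and the roots of the sextic f1 N
    are the images under N of six points, the vertices of an octahedron inscribed in
    the Riemann sphere. Hence f1 g determines g up to a constant matrix on the right
    that permutes the six points ([same_image_octa]); up to scalars, these matrices
    form the binary octahedral group ([octa_S4scal]).

    Let g be a lift of F with covering phi. For a deck transformation sigma, both g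
    and g o sigma lift F, so g o sigma = g B with B constant and octahedral
    ([deck_octa]); the injectivity required of a Galois lift makes sigma |-> B
    faithful. Conjugating in the dihedral and octahedral groups, one arranges that the
    deck group is generated by (x,y) |-> (i x, y) and the exchange of x and y, and
    that they act on g through diag(i,1) and through the exchange of the two columns
    ([lift_symmetry], [swap_sign]). The second column of g is then the first one with
    x and y exchanged, and all exponents of x in the first column are congruent modulo
    4 ([symmetric_families]): the degree is odd, and in degree 9 and in degree 11
    three monomials remain, that is, exactly the matrices g9 M and g11 M.

    The degree n of g is bounded by looking at the curves g v for the six vertices v.
    Let c_v be the common factor of the entries of g v. After division by the c_v the
    six curves have as their product the sextic F o phi of degree 48, and the c_v are
    pairwise coprime divisors of det g, which has degree 2n. So 6n - 48 <= 2n, and as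
    6n - 48 >= 0 this gives 8 <= n <= 12 ([degree_bounds]).

    In degree 9, f1 (g9 M) is a multiple of F9 M o phi for an explicit sextic curve F9
    M. At the zero of the factor m12 t - m02 s (in the coordinates s, t of the target
    of phi) of det g9 this curve is the sixth power of a linear form l, and its first
    order variations are divisible by l^5: it is tangent to the curve of sixth powers
    ([ramified_F9]).

    In degree 11 the same computation yields a curve F11 M of degree 7, so F11 M = L F
    for a linear form L, and at the root of L one of the six linear factors of F11 M
    vanishes. For two of the factors this contradicts the fullness of F
    ([not_degenerate]); for the others it is a linear relation between the columns of
    M, which says that M is orthogonal to normal11 t ([normal_exists]). Moreover det
    g11 is the product of the c_v and of a multiple of beta. If F were a sixth power
    at phi (x,y), the six reduced curves would take the same value there, which
    outside the zeros of beta forces two of the c_v to vanish together; over the zeros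
    of beta, that is, at s = t, the first order expansion of F11 M excludes tangency
    ([not_ramified11]).

    Conversely, a linearly full curve F with f1 g = h (F o phi) has its values in the
    closure of the open orbit, and not all of them in the closure of the surface
    orbit, which lies in the zero set of the quadratic invariant of sextics
    ([sextic_of_lift]); and a symmetric g is a Galois lift of it
    ([symmetric_galois_lift]). So the existence parts come down to fullness for
    generic parameters: in degree 9 the expansion of F9 M is triangular ([full_F9]),
    in degree 11 fullness is the nonvanishing of a polynomial in t, which is checked
    at t = 1 ([span_at1]). For the finiteness parts, the self-equivalences of phi
    normalize its deck group and are therefore finitely many up to scalars
    ([self_equiv_entries]), as are the octahedral matrices. Once these are chosen, g
    is determined up to a constant matrix on the left, hence the plane is determined
    ([equiv_planes]), and in degree 11 the plane determines t up to finitely many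
    values ([normal11_finite]). *)

Set Implicit Arguments.
Unset Strict Implicit.
Unset Printing Implicit Defensive.

Import GRing.Theory Num.Theory.
Local Open Scope ring_scope.

(** * Binary forms as functions *)

Section BinaryForms.

Variable K : comNzRingType.
Implicit Types (f : forms K) (x y : K) (n : nat).

Definition pt2 x y : 'I_2 -> K := fun i => if i == 0 then x else y.

Definition ev f x y : K := f.@[pt2 x y].

Lemma meval_row f (p : 'I_2 -> K) : f.@[p] = ev f (p 0) (p 1).
Proof. by apply: meval_eq => i; rewrite /pt2; case: eqP => [->|/eqP]; case: i => -[|[]] // ? _; congr p; exact/val_inj. Qed.

Lemma evD f g x y : ev (f + g) x y = ev f x y + ev g x y.
Proof. exact: mevalD. Qed.
Lemma evB f g x y : ev (f - g) x y = ev f x y - ev g x y.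
Proof. exact: mevalB. Qed.
Lemma evN f x y : ev (- f) x y = - ev f x y.
Proof. exact: mevalN. Qed.
Lemma evM f g x y : ev (f * g) x y = ev f x y * ev g x y.
Proof. exact: mevalM. Qed.
Lemma evX f n x y : ev (f ^+ n) x y = ev f x y ^+ n.
Proof. exact: rmorphXn. Qed.
Lemma evZ c f x y : ev (c *: f) x y = c * ev f x y.
Proof. exact: mevalZ. Qed.
Lemma evC c x y : ev c%:MP x y = c.
Proof. exact: mevalC. Qed.
Lemma ev0 x y : ev 0 x y = 0.
Proof. exact: meval0. Qed.
Lemma ev1 x y : ev 1 x y = 1.
Proof. exact: meval1. Qed.
Lemma evX0 x y : ev X0 x y = x.
Proof. exact: mevalXU. Qed.
Lemma evX1 x y : ev X1 x y = y.
Proof. exact: mevalXU. Qed.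
Lemma ev_sum (I : Type) (r : seq I) (P : pred I) (F : I -> forms K) x y :
  ev (\sum_(i <- r | P i) F i) x y = \sum_(i <- r | P i) ev (F i) x y.
Proof. exact: raddf_sum. Qed.
Lemma ev_prod (I : Type) (r : seq I) (P : pred I) (F : I -> forms K) x y :
  ev (\prod_(i <- r | P i) F i) x y = \prod_(i <- r | P i) ev (F i) x y.
Proof. exact: rmorph_prod. Qed.

Definition evE := (evD, evB, evN, evM, evX, evZ, evC, ev0, ev1, evX0, evX1).

Lemma mdeg2 (m : 'X_{1..2}) : mdeg m = (m 0%R + m 1%R)%N.
Proof. by rewrite mdegE big_ord_recl big_ord1; congr (_ + m _)%N; exact/val_inj. Qed.

Definition mon2 i j : 'X_{1..2} := (U_(0%R : 'I_2) *+ i + U_(1%R : 'I_2) *+ j)%MM.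

Lemma mon2_0 i j : mon2 i j 0 = i.
Proof. by rewrite /mon2 mnmDE !mulmnE !mnm1E /= mul1n mul0n addn0. Qed.
Lemma mon2_1 i j : mon2 i j 1 = j.
Proof. by rewrite /mon2 mnmDE !mulmnE !mnm1E /= mul1n mul0n. Qed.

Lemma mon2E (m : 'X_{1..2}) : m = mon2 (m 0) (m 1).
Proof.
apply/mnmP => i; case: (boolP (i == 0)) => [/eqP->|i0]; first by rewrite mon2_0.
have ->: i = 1 by apply/val_inj; case: i i0 => -[|[]].
by rewrite mon2_1.
Qed.

Lemma mpolyX2 (m : 'X_{1..2}) : 'X_[m] = X0 ^+ m 0 * X1 ^+ m 1 :> forms K.
Proof. by rewrite mpolyXE_id big_ord_recl big_ord1; congr (_ * 'X_ _ ^+ m _); exact/val_inj. Qed.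

Definition hform n (c : nat -> K) : forms K :=
  \sum_(i < n.+1) c i *: (X0 ^+ i * X1 ^+ (n - i)).

Lemma ev_hform n c x y :
  ev (hform n c) x y = \sum_(i < n.+1) c i * (x ^+ i * y ^+ (n - i)).
Proof. by rewrite ev_sum; apply: eq_bigr => i _; rewrite !evE. Qed.

Lemma homog_X0 : (X0 : forms K) \is 1.-homog.
Proof. by rewrite dhomogX; apply/eqP/mdeg1. Qed.
Lemma homog_X1 : (X1 : forms K) \is 1.-homog.
Proof. by rewrite dhomogX; apply/eqP/mdeg1. Qed.

Lemma homog_hform n c : hform n c \is n.-homog.
Proof.
apply: rpred_sum => -[i /= ilt] _; apply: dhomogZ.
rewrite -{2}(subnKC (ilt : (i <= n)%N)); apply: dhomogM.
  by have := dhomogMn i homog_X0; rewrite mul1n.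
by have := dhomogMn (n - i) homog_X1; rewrite mul1n.
Qed.

Lemma homog_hformE n f : f \is n.-homog ->
  f = hform n (fun i => f@_(mon2 i (n - i))).
Proof.
move=> hf; apply/mpolyP => m; rewrite raddf_sum /=.
have cE (i : 'I_n.+1) : X0 ^+ i * X1 ^+ (n - i) = 'X_[mon2 i (n - i)] :> forms K.
  by rewrite mpolyX2 mon2_0 mon2_1.
have [mn|mn] := eqVneq (mdeg m) n; last first.
  rewrite (dhomog_nemf_coeff hf mn) big1 // => i _.
  rewrite mcoeffZ cE mcoeffX; case: eqP => [E|_]; last by rewrite mulr0.
  move: mn; rewrite -E mdeg2 mon2_0 mon2_1; case: i {E} => i /= ?.
  by rewrite subnKC ?eqxx.
have m0 : (m 0%R < n.+1)%N by rewrite -mn mdeg2; lia.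
rewrite (bigD1 (Ordinal m0)) // mcoeffZ cE mcoeffX /=.
have E : mon2 (m 0%R) (n - m 0%R)%N = m.
  by rewrite [RHS]mon2E; congr mon2; rewrite -mn mdeg2; lia.
rewrite E eqxx mulr1 big1 ?addr0 // => i ne.
rewrite mcoeffZ cE mcoeffX; case: eqP => [E'|_]; last by rewrite mulr0.
by case/eqP: ne; apply/val_inj; rewrite /= -E' mon2_0.
Qed.

Lemma homog_exists n f : f \is n.-homog -> exists c, f = hform n c.
Proof. by move=> /homog_hformE ->; eexists. Qed.

Lemma ev_homog n f t x y : f \is n.-homog -> ev f (t * x) (t * y) = t ^+ n * ev f x y.
Proof.
move=> /homog_exists [c ->]; rewrite !ev_hform mulr_sumr; apply: eq_bigr => i _.
rewrite !exprMn; have -> : t ^+ n = t ^+ i * t ^+ (n - i).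
  by rewrite -exprD subnKC //; case: i.
ring.
Qed.

End BinaryForms.

Section FormsOverField.

Variable C : numClosedFieldType.
Implicit Types (f g h : forms C) (x y : C) (n : nat).

(** The restriction of a form to the affine line t |-> (a + a' t, b + b' t). *)
Definition line (a b a' b' : C) f : {poly C} :=
  mmap polyC (fun i : 'I_2 => if i == 0 then a%:P + a' *: 'X else b%:P + b' *: 'X) f.

Lemma line_is_additive a b a' b' : additive (line a b a' b').
Proof. exact: mmap_is_additive. Qed.
HB.instance Definition _ a b a' b' :=
  GRing.isAdditive.Build (forms C) {poly C} (line a b a' b') (line_is_additive a b a' b').
Lemma line_is_mult a b a' b' : multiplicative (line a b a' b').
Proof. exact: mmap_is_multiplicative. Qed.
HB.instance Definition _ a b a' b' :=
  GRing.isMultiplicative.Build (forms C) {poly C} (line a b a' b') (line_is_mult a b a' b').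

Lemma horner_line a b a' b' f t :
  (line a b a' b' f).[t] = ev f (a + a' * t) (b + b' * t).
Proof.
elim/mpolyind: f => [|c m f _ _ IH]; first by rewrite raddf0 horner0 ev0.
rewrite raddfD /= hornerD evD IH; congr (_ + _).
rewrite -mul_mpolyC rmorphM /= [in RHS]evM evC hornerM.
rewrite /line mmapC hornerC mmapX /mmap1 big_ord_recl big_ord1 /=.
rewrite mpolyX2 !evE hornerM !horner_exp !hornerE.
by rewrite (_ : lift ord0 ord0 = 1) //; apply/val_inj.
Qed.

Lemma poly_eq0_fun (p : {poly C}) : (forall t, p.[t] = 0) -> p = 0.
Proof.
move=> h; apply/eqP; apply: contraT => p0.
have := @max_poly_roots _ p [seq i%:R | i <- iota 0 (size p)] p0.
rewrite size_map size_iota ltnn => -> //; first by apply/allP => t _; rewrite rootE h.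
by rewrite map_inj_uniq ?iota_uniq // => i j /eqP; rewrite eqr_nat => /eqP.
Qed.

(** The field is infinite, so that polynomials are determined by their values. *)
Lemma ev_eq0 f : (forall x y, ev f x y = 0) -> f = 0.
Proof.
move=> h; apply/mpolyP => m; rewrite mcoeff0.
pose G (x : C) : {poly C} := \sum_(m <- msupp f) f@_m * x ^+ m 0 *: 'X^(m 1).
have G0 x : G x = 0.
  apply: poly_eq0_fun => y; rewrite -[RHS](h x y) /ev mevalE horner_sum.
  apply: eq_bigr => k _; rewrite hornerZ hornerXn big_ord_recl big_ord1 /= mulrA.
  by congr (_ * _ * _ ^+ k _); apply/val_inj.
pose H j : {poly C} := \sum_(m <- msupp f | m 1 == j) f@_m *: 'X^(m 0).
have H0 j : H j = 0.
  apply: poly_eq0_fun => x; have /= := congr1 (fun p : {poly C} => p`_j) (G0 x).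
  rewrite coef0 /G coef_sum => <-; rewrite /H horner_sum big_mkcond; apply: eq_bigr => k _.
  by rewrite coefZ coefXn eq_sym; case: eqP => _; rewrite ?hornerZ ?hornerXn ?mulr1 ?mulr0.
have := congr1 (fun p : {poly C} => p`_(m 0)) (H0 (m 1)).
rewrite coef0 coef_sum; have [mf|/memN_msupp_eq0 //] := boolP (m \in msupp f).
rewrite big_mkcond (bigD1_seq m) ?msupp_uniq //= eqxx coefZ coefXn eqxx mulr1.
rewrite big1 ?addr0 // => k km; case: eqP => // k1; rewrite coefZ coefXn.
case: eqP => [k0|_]; last by rewrite mulr0.
by case/eqP: km; rewrite (mon2E k) (mon2E m) k1 k0.
Qed.

Lemma ev_inj f g : (forall x y, ev f x y = ev g x y) -> f = g.
Proof.
by move=> h; apply/eqP; rewrite -subr_eq0; apply/eqP/ev_eq0 => x y; rewrite evB h subrr.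
Qed.

(** The linear form vanishing at (a, b). *)
Definition lform (a b : C) : forms C := b *: X0 - a *: X1.

Lemma ev_lform a b x y : ev (lform a b) x y = b * x - a * y.
Proof. by rewrite !evE. Qed.

Lemma homog_lform a b : lform a b \is 1.-homog.
Proof. by apply: rpredB; apply: dhomogZ; rewrite ?homog_X0 ?homog_X1. Qed.

Definition nz (x y : C) := (x != 0) || (y != 0).

Lemma lform_neq0 a b : nz a b -> lform a b != 0.
Proof.
move=> ab; apply/eqP => E.
have := ev_lform a b 1 0; have := ev_lform a b 0 1; rewrite E !ev0 !mulr0 !mulr1.
by rewrite sub0r subr0 => /eqP; rewrite eq_sym oppr_eq0 => /eqP a0 b0;
  move: ab; rewrite /nz a0 -b0 eqxx.
Qed.

Lemma lform_root a b x y : nz a b -> b * x - a * y = 0 -> nz x y ->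
  exists2 k, k != 0 & x = k * a /\ y = k * b.
Proof.
move=> ab /eqP; rewrite subr_eq0 => /eqP E xy.
case/orP: (ab) => [a0|b0].
  exists (x / a); last by split; [rewrite divfK | rewrite mulrAC -[x * b]mulrC E mulrC mulKf].
  rewrite mulf_neq0 ?invr_eq0 //; apply/eqP => x0; move: xy; rewrite /nz x0 eqxx /=.
  by apply/negP; rewrite negbK; move/esym/eqP: E; rewrite x0 mulr0 mulf_eq0 (negPf a0).
exists (y / b); last by split; [rewrite mulrAC -[y * a]mulrC -E mulrC mulKf | rewrite divfK].
rewrite mulf_neq0 ?invr_eq0 //; apply/eqP => y0; move: xy; rewrite /nz y0 eqxx orbF.
by apply/negP; rewrite negbK; move/eqP: E; rewrite y0 mulr0 mulf_eq0 (negPf b0).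
Qed.

Lemma homog0E f : f \is 0.-homog -> exists c, f = c%:MP.
Proof.
move=> /homog_exists [c ->]; exists (c 0%N); rewrite /hform big_ord1.
by rewrite subnn !expr0 mulr1 -mul_mpolyC mulr1.
Qed.

Lemma div_lform n f a b : f \is n.-homog -> nz a b -> ev f a b = 0 ->
  exists2 g, g \is n.-1.-homog & f = lform a b * g.
Proof.
case: n => [|n] hf ab f0.
  have [c fc] := homog0E hf; move: f0; rewrite fc evC => ->.
  by exists 0; rewrite ?rpred0 // mulr0 mpolyC0.
have [b0|b0] := eqVneq b 0.
  have a0 : a != 0 by move: ab; rewrite /nz b0 eqxx orbF.
  have [c fc] := homog_exists hf.
  have cn : c n.+1 = 0.
    move: f0; rewrite fc b0 ev_hform big_ord_recr /= subnn expr0 mulr1 big1 ?add0r.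
      by move/eqP; rewrite mulf_eq0 expf_eq0 /= (negPf a0) orbF => /eqP.
    by case=> i /= ? _; rewrite (_ : n.+1 - i = (n - i).+1)%N; [rewrite exprS mul0r !mulr0|lia].
  exists (- a^-1 *: hform n c); first by rewrite dhomogZ ?homog_hform.
  rewrite fc; apply: ev_inj => x y; rewrite evM ev_lform evZ !ev_hform b0 mul0r sub0r.
  rewrite big_ord_recr /= cn mul0r addr0 !mulNr mulrN opprK.
  rewrite -!mulrA [y * _]mulrCA mulVKf // mulr_sumr.
  apply: eq_bigr => -[i /= ?] _; rewrite (_ : n.+1 - i = (n - i).+1)%N; last lia.
  by rewrite exprS; ring.
have [c fc] := homog_exists hf.
pose P : {poly C} := \poly_(i < n.+2) c i.
have P0 : root P (a / b).
  apply/rootP; apply: (mulfI (expf_neq0 n.+1 b0)); rewrite mulr0 -[RHS]f0 fc ev_hform.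
  rewrite horner_poly mulr_sumr; apply: eq_bigr => -[i /= ?] _.
  rewrite (_ : b ^+ n.+1 = b ^+ i * b ^+ (n.+1 - i)); last by rewrite -exprD subnKC //; lia.
  by rewrite expr_div_n; field; rewrite expf_neq0.
have [Q PQ] := factor_theorem P (a / b) P0.
have sQ : (size Q <= n.+1)%N.
  have [->|Q0] := eqVneq Q 0; first by rewrite size_poly0.
  have : (size P <= n.+2)%N by apply: size_poly.
  by rewrite PQ size_Mmonic ?monicXsubC // size_XsubC addn2.
have cE i : (i < n.+2)%N -> c i = P`_i by rewrite coef_poly => ->.
have PE x y : y != 0 -> ev f x y = y ^+ n.+1 * P.[x / y].
  move=> y0; rewrite fc ev_hform horner_poly mulr_sumr; apply: eq_bigr => -[i /= ?] _.
  rewrite (_ : y ^+ n.+1 = y ^+ i * y ^+ (n.+1 - i)); last by rewrite -exprD subnKC //; lia.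
  by rewrite expr_div_n; field; rewrite expf_neq0.
have QE x y : y != 0 -> ev (hform n (nth 0 Q)) x y = y ^+ n * Q.[x / y].
  move=> y0; rewrite ev_hform (horner_coef_wide _ sQ) mulr_sumr; apply: eq_bigr => -[i /= ?] _.
  rewrite (_ : y ^+ n = y ^+ i * y ^+ (n - i)); last by rewrite -exprD subnKC //; lia.
  by rewrite expr_div_n; field; rewrite expf_neq0.
exists (b^-1 *: hform n (nth 0 Q)); first by rewrite dhomogZ ?homog_hform.
apply: (mulIf (_ : X1 != 0)).
  by apply/eqP => /(congr1 (fun f : forms C => ev f 0 1)) /eqP; rewrite evX1 ev0 oner_eq0.
apply: ev_inj => x y; rewrite !evM ev_lform evZ evX1.
have [->|y0] := eqVneq y 0; first by rewrite !mulr0.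
by rewrite PE // QE // PQ hornerM hornerXsubC exprS; field; rewrite b0 y0.
Qed.

Lemma homog_root n f : f \is n.+1.-homog -> exists x y, nz x y /\ ev f x y = 0.
Proof.
move=> hf; have [c fc] := homog_exists hf.
have [c0|c0] := eqVneq (c n.+1) 0.
  exists 1, 0; split; first by rewrite /nz oner_eq0.
  rewrite fc ev_hform big_ord_recr /= c0 mul0r addr0 big1 // => -[i /= ?] _.
  by rewrite (_ : n.+1 - i = (n - i).+1)%N; [rewrite exprS mul0r !mulr0|lia].
pose P : {poly C} := \poly_(i < n.+2) c i.
have : size P != 1%N by rewrite size_poly_eq.
case/closed_rootP => x /rootP Px.
exists x, 1; split; first by rewrite /nz oner_eq0 orbT.
rewrite fc ev_hform -[RHS]Px horner_poly; apply: eq_bigr => i _.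
by rewrite expr1n mulr1.
Qed.

Lemma homogM n m f g : f \is n.-homog -> g \is m.-homog -> f * g \is (n + m).-homog.
Proof. exact: dhomogM. Qed.

(** A family of forms without common zero behaves like a unit for divisibility:
    each root of f is a root of g, since some w j does not vanish there. *)
Lemma gauss_div (I : Type) (w : I -> forms C) d n f g :
  f \is d.-homog -> f != 0 -> g \is n.-homog ->
  (forall x y, nz x y -> exists j, ev (w j) x y != 0) ->
  (forall j, exists k, g * w j = f * k) ->
  exists2 q, q \is (n - d).-homog & g = f * q.
Proof.
move=> hf f0 hg hw; elim: d n f g hf f0 hg => [|d IH] n f g hf f0 hg hd.
  have [c fc] := homog0E hf.
  have c0 : c != 0 by apply: contraNneq f0 => c0; rewrite fc c0 mpolyC0.
  exists (c^-1 *: g); first by rewrite subn0 dhomogZ.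
  by rewrite fc mul_mpolyC scalerA divff // scale1r.
have [g0|g0] := eqVneq g 0; first by exists 0; rewrite ?rpred0 // g0 mulr0.
have [a [b [ab fab]]] := homog_root hf.
have [f' hf' fE] := div_lform hf ab fab.
have gab : ev g a b = 0.
  have [j wj] := hw _ _ ab; have [k E] := hd j.
  have /eqP := congr1 (fun h => ev h a b) E.
  by rewrite !evM fab mul0r mulf_eq0 (negPf wj) orbF => /eqP.
have [g' hg' gE] := div_lform hg ab gab.
have l0 := lform_neq0 ab.
have [||q hq gq] := IH n.-1 f' g' hf' _ hg'.
- by apply: contraNneq f0 => f'0; rewrite fE f'0 mulr0.
- move=> j; have [k E] := hd j; exists k.
  by apply: (mulfI l0); rewrite !mulrA -gE -fE.
exists q; last by rewrite gE fE gq mulrA.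
case: n {hd hg} hg' hq => [|n] hg' hq; last by rewrite subSS.
by rewrite sub0n in hq *.
Qed.

End FormsOverField.

Section Curves.

Variable C : numClosedFieldType.
Implicit Types (f h : forms C) (x y a b c : C) (n : nat).

Definition mev m k (g : 'M[forms C]_(m, k)) x y : 'M[C]_(m, k) :=
  map_mx (fun f => ev f x y) g.

Lemma mevP m k (g : 'M[forms C]_(m, k)) x y i j : mev g x y i j = ev (g i j) x y.
Proof. by rewrite mxE. Qed.

Lemma point_ofE m k (g : 'M[forms C]_(m, k)) (p : 'rV[C]_2) : point_of g p = mev g (p 0 0) (p 0 1).
Proof. by apply/matrixP => i j; rewrite !mxE meval_row. Qed.

Lemma row_nz (p : 'rV[C]_2) : (p != 0) = nz (p 0 0) (p 0 1).
Proof.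
apply/idP/idP => [p0|]; last first.
  by apply: contraL => /eqP ->; rewrite /nz !mxE eqxx.
rewrite /nz -negb_and; apply: contra p0 => /andP[/eqP a /eqP b].
apply/eqP/matrixP => i j; rewrite (ord1 i) mxE.
have [->|j0] := eqVneq j 0; first exact: a.
by have ->: j = 1 by [apply/val_inj; case: j j0 => -[|[]]].
Qed.

Definition rv2 a b : 'rV[C]_2 := \row_i (if i == 0 then a else b).
Lemma rv2_0 a b : rv2 a b 0 0 = a. Proof. by rewrite mxE. Qed.
Lemma rv2_1 a b : rv2 a b 0 1 = b. Proof. by rewrite mxE. Qed.

Lemma mev_inj m k (g g' : 'M[forms C]_(m, k)) :
  (forall x y, mev g x y = mev g' x y) -> g = g'.
Proof.
move=> E; apply/matrixP => i j; apply: ev_inj => x y.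
by have /matrixP/(_ i j) := E x y; rewrite !mxE.
Qed.

Lemma mevZ m k f (g : 'M[forms C]_(m, k)) x y : mev (f *: g) x y = ev f x y *: mev g x y.
Proof. by apply/matrixP => i j; rewrite !mxE evM. Qed.

Lemma mev_mul m k l (g : 'M[forms C]_(m, k)) (h : 'M[forms C]_(k, l)) x y :
  mev (g *m h) x y = mev g x y *m mev h x y.
Proof.
by apply/matrixP => i j; rewrite !mxE ev_sum; apply: eq_bigr => l' _; rewrite evM !mxE.
Qed.

Lemma mev_const m k (A : 'M[C]_(m, k)) x y : mev (const_forms A) x y = A.
Proof. by apply/matrixP => i j; rewrite !mxE evC. Qed.

Lemma mev_tr m k (g : 'M[forms C]_(m, k)) x y : mev g^T x y = (mev g x y)^T.
Proof. by apply/matrixP => i j; rewrite !mxE. Qed.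

Lemma mev0 m k x y : mev (0 : 'M[forms C]_(m, k)) x y = 0.
Proof. by apply/matrixP => i j; rewrite !mxE ev0. Qed.

Definition homogm n m k (g : 'M[forms C]_(m, k)) := forall i j, g i j \is n.-homog.

(** No common zero on the projective line. *)
Definition nocz m k (g : 'M[forms C]_(m, k)) := forall x y, nz x y -> mev g x y != 0.

Lemma noczP m k (g : 'M[forms C]_(m, k)) x y : mev g x y != 0 ->
  exists i j, ev (g i j) x y != 0.
Proof.
move=> g0; apply: contrapT => hn; case/eqP: g0; apply/matrixP => i j; rewrite !mxE.
by apply: contrapT => /eqP gij; apply: hn; exists i, j.
Qed.

(** A polynomial without nonzero root is constant: its restriction to each line
    y = b with b nonzero is constant, so it depends on y only, and then its
    restriction to x = 1 is constant as well. *)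
Lemma no_root_const h : (forall x y, nz x y -> ev h x y != 0) -> exists c, h = c%:MP.
Proof.
move=> h0.
have const (p : {poly C}) : (forall t, p.[t] != 0) -> forall t, p.[t] = p.[0].
  move=> p0 t; have : size p == 1%N.
    apply: contraT => /closed_rootP [z /rootP pz]; by move: (p0 z); rewrite pz eqxx.
  by case/size_poly1P => c _ ->; rewrite !hornerC.
have E1 x y : y != 0 -> ev h x y = ev h 0 y.
  move=> y0; have := const (line 0 y 1 0 h) _ x; rewrite !horner_line !mul0r !addr0 !add0r !mul1r.
  by apply=> t; rewrite horner_line h0 // /nz mul0r addr0 y0 orbT.
have E2 : h = h \mPo [tuple (fun i : 'I_2 => if i == 0 then 0 else X1 : forms C) i | i < 2].
  apply: (mulIf (_ : X1 != 0)).
    by apply/eqP => /(congr1 (fun f : forms C => ev f 0 1)) /eqP; rewrite evX1 ev0 oner_eq0.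
  apply: ev_inj => x y; rewrite !evM evX1.
  have [->|y0] := eqVneq y 0; first by rewrite !mulr0.
  by rewrite (E1 x) // /ev comp_mpoly_meval [in RHS]meval_row !tnth_mktuple /= meval0 mevalXU.
have E3 x y : ev h x y = ev h 0 y.
  rewrite {1}E2 /ev comp_mpoly_meval [in LHS]meval_row !tnth_mktuple /= meval0 mevalXU.
  by rewrite meval_row.
exists (ev h 1 0); apply: ev_inj => x y; rewrite evC E3 -(E3 1).
have := const (line 1 0 0 1 h) _ y; rewrite !horner_line !mul0r !addr0 !add0r !mul1r.
by apply=> t; rewrite horner_line h0 // /nz mul0r addr0 oner_eq0.
Qed.

(** Common zeros and common factors correspond: a nonconstant polynomial has a
    nonzero root, and a common zero of forms splits off a linear form from each of
    them. *)
Lemma curveP n m k (g : 'M[forms C]_(m, k)) :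
  is_curve n g <-> homogm n g /\ nocz g.
Proof.
split=> [[hg hd]|[hg nz_g]].
  split=> // x y xy; apply/eqP => g0.
  have gd i j : exists f, g i j = lform x y * f.
    have [|f _ ->] := div_lform (hg i j) xy; last by exists f.
    by move/matrixP/(_ i j): g0; rewrite !mxE.
  have [c E] := hd _ gd.
  have c0 : c = 0.
    have := congr1 (fun f : forms C => ev f x y) E.
    by rewrite /= evC ev_lform => <-; rewrite mulrC subrr.
  by have := lform_neq0 xy; rewrite E c0 mpolyC0 eqxx.
split=> // h hd; apply: no_root_const => x y xy.
have [i [j gij]] := noczP (nz_g _ _ xy); have [f E] := hd i j.
by apply: contraNneq gij => h0; rewrite E evM h0 mul0r.
Qed.

Lemma proj_cross (K : idomainType) m k (v w : 'M[K]_(m, k)) : proj_eq v w ->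
  forall i j i' j', v i j * w i' j' = v i' j' * w i j.
Proof.
move=> [p [q [p0 q0 E]]] i j i' j'; apply: (mulfI p0).
have /matrixP E' := E.
by have := E' i j; have := E' i' j'; rewrite !mxE !mulrA => -> ->; rewrite mulrAC.
Qed.

Lemma proj_of_cross (K : idomainType) m k (v w : 'M[K]_(m, k)) : v != 0 -> w != 0 ->
  (forall i j i' j', v i j * w i' j' = v i' j' * w i j) -> proj_eq v w.
Proof.
move=> v0 w0 E.
have [i [j vij]] : exists i j, v i j != 0.
  apply: contrapT => hn; case/eqP: v0; apply/matrixP => i j; rewrite mxE.
  by apply: contrapT => /eqP vij; apply: hn; exists i, j.
exists (w i j), (v i j); split=> //.
  apply: contraNneq w0 => wij; apply/eqP/matrixP => i' j'; rewrite mxE.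
  by apply: (mulfI vij); rewrite E wij !mulr0.
by apply/matrixP => i' j'; rewrite !mxE mulrC E.
Qed.

Lemma proj_sym (K : idomainType) m k (v w : 'M[K]_(m, k)) : proj_eq v w -> proj_eq w v.
Proof. by case=> p [q [p0 q0 E]]; exists q, p. Qed.

Lemma proj_trans (K : idomainType) m k (v w z : 'M[K]_(m, k)) :
  proj_eq v w -> proj_eq w z -> proj_eq v z.
Proof.
move=> [p [q [p0 q0 E]]] [p' [q' [p0' q0' E']]].
exists (p' * p), (q * q'); split; [exact: mulf_neq0 | exact: mulf_neq0 | ].
rewrite -[LHS]scalerA E [LHS]scalerA [p' * q]mulrC -[LHS]scalerA E'.
exact: scalerA.
Qed.

Lemma proj_scale (K : idomainType) m k (v w : 'M[K]_(m, k)) (c : K) : c != 0 ->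
  v = c *: w -> proj_eq v w.
Proof. by move=> c0 ->; exists 1, c; rewrite oner_neq0 scale1r. Qed.

Lemma proj_field (K : fieldType) m k (v w : 'M[K]_(m, k)) : proj_eq v w ->
  exists2 c : K, c != 0 & v = c *: w.
Proof.
move=> [p [q [p0 q0 E]]]; exists (p^-1 * q); first by rewrite mulf_neq0 ?invr_eq0.
by rewrite -scalerA -E scalerA mulVf // scale1r.
Qed.

(** The ratio of v to w has no poles, because w has no common zero. *)
Lemma proj_eq_factor n d m k (v w : 'M[forms C]_(m, k)) :
  homogm n v -> homogm d w -> nocz w -> proj_eq v w ->
  exists q, [/\ q \is (n - d).-homog, q != 0 & v = q *: w].
Proof.
move=> hv hw w0 E; have X := proj_cross E.
have w10 : nz 1 (0 : C) by rewrite /nz oner_eq0.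
have [i [j wij0]] := noczP (w0 _ _ w10).
have wij : w i j != 0 by apply: contraNneq wij0 => ->; rewrite ev0.
have [|ij|q hq vq] := @gauss_div _ _ (fun p : 'I_m * 'I_k => w p.1 p.2) d n (w i j) (v i j) (hw i j) wij (hv i j).
- by move=> x y xy; have [i' [j' h]] := noczP (w0 _ _ xy); exists (i', j').
- by exists (v ij.1 ij.2); rewrite X mulrC.
have vqw : v = q *: w.
  apply/matrixP => i' j'; rewrite mxE; apply: (mulIf wij).
  by rewrite -X vq; ring.
exists q; split=> //; apply: contraTneq isT => q0.
have [p [q' [p0 q'0]]] := E; rewrite vqw q0 scale0r scaler0 => /esym/matrixP/(_ i j).
by rewrite !mxE => /eqP; rewrite mulf_eq0 (negPf q'0) (negPf wij).
Qed.

Lemma proj_eq_const n m k (v w : 'M[forms C]_(m, k)) :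
  homogm n v -> homogm n w -> nocz w -> proj_eq v w ->
  exists2 c, c != 0 & v = c%:MP *: w.
Proof.
move=> hv hw w0 E; have [q [hq q0 vq]] := proj_eq_factor hv hw w0 E.
rewrite subnn in hq; have [c qc] := homog0E hq; exists c; last by rewrite -qc.
by apply: contraNneq q0 => c0; rewrite qc c0 mpolyC0.
Qed.

Lemma mev_neq0 m k (g : 'M[forms C]_(m, k)) : g != 0 -> exists x y, mev g x y != 0.
Proof.
move=> g0; apply: contrapT => h; case/eqP: g0; apply: mev_inj => x y; rewrite mev0.
by apply: contrapT => /eqP xy; apply: h; exists x, y.
Qed.

Lemma nocz_neq0 m k (g : 'M[forms C]_(m, k)) : nocz g -> g != 0.
Proof.
move=> /(_ 1 0); rewrite /nz oner_eq0 => /(_ isT); apply: contraNneq => ->.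
by rewrite mev0.
Qed.

(** Each of the two is a multiple of the other by a form. *)
Lemma proj_eq_degree n d m k (v w : 'M[forms C]_(m, k)) :
  homogm n v -> homogm d w -> nocz v -> nocz w -> proj_eq v w -> n = d.
Proof.
move=> hv hw v0 w0 E.
have le n' d' (v' w' : 'M[forms C]_(m, k)) : homogm n' v' -> homogm d' w' -> nocz w' ->
    v' != 0 -> proj_eq v' w' -> (d' <= n')%N.
  move=> hv' hw' w0' v0' E'; have [q [hq q0 vq]] := proj_eq_factor hv' hw' w0' E'.
  case: leqP => // lt; move: hq; rewrite (_ : n' - d' = 0)%N; last by lia.
  have [x [y]] := mev_neq0 v0'; move=> /noczP[i [j vij]] /homog0E [c qc].
  have : v' i j \is d'.-homog by rewrite vq mxE qc mul_mpolyC dhomogZ.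
  move=> hd; have v'ij : v' i j != 0 by apply: contraNneq vij => ->; rewrite ev0.
  by move: lt; rewrite (dhomog_uniq v'ij (hv' i j) hd) ltnn.
by apply/eqP; rewrite eqn_leq (le _ _ w v) ?(le _ _ v w) ?nocz_neq0 //; exact: proj_sym.
Qed.

(** Taking out the common zeros one at a time. *)
Lemma primitive_part n m k (v : 'M[forms C]_(m, k)) : homogm n v -> v != 0 ->
  exists d (c : forms C) (v' : 'M[forms C]_(m, k)), [/\ (d <= n)%N, c \is d.-homog, homogm (n - d) v', nocz v' & v = c *: v'].
Proof.
elim: n v => [|n IH] v hv v0.
  exists 0%N, 1, v; split; rewrite ?scale1r ?subn0 // ?dhomog1 //.
  move=> x y xy; have [x' [y' /noczP[i [j v']]]] := mev_neq0 v0.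
  apply: contraNneq v' => /matrixP/(_ i j); rewrite !mxE.
  by have [c ->] := homog0E (hv i j); rewrite !evC => ->.
have [nv|hn] := pselect (nocz v).
  by exists 0%N, 1, v; split; rewrite ?scale1r ?subn0 // ?dhomog1.
have [x [y [xy vxy]]] : exists x y, nz x y /\ mev v x y = 0.
  apply: contrapT => h; apply: hn => x y xy; apply/eqP => vxy; apply: h.
  by exists x, y.
have dv i j : exists f, f \is n.-homog /\ v i j = lform x y * f.
  have [|f hf ->] := div_lform (hv i j) xy; last by exists f.
  by move/matrixP/(_ i j): vxy; rewrite !mxE.
pose v1 : 'M[forms C]_(m, k) := \matrix_(i, j) projT1 (cid (dv i j)).
have v1E i j : v1 i j \is n.-homog /\ v i j = lform x y * v1 i j.
  by rewrite mxE; case: cid.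
have vE : v = lform x y *: v1 by apply/matrixP => i j; rewrite mxE; case: (v1E i j).
have [||d [c [v' [dn hc hv' nv' E]]]] := IH v1.
- by move=> i j; case: (v1E i j).
- by apply: contraNneq v0 => v10; rewrite vE v10 scaler0.
exists d.+1, (lform x y * c), v'; split=> //.
- exact: (homogM (homog_lform x y) hc).
- by rewrite vE E scalerA.
Qed.

Lemma ev_moebius (A : 'M[C]_2) i x y :
  ev (moebius A i 0) x y = A i 0 * x + A i 1 * y.
Proof.
rewrite /moebius mxE big_ord_recl big_ord1 !mxE /= evD !evM !evC.
by rewrite evX0 (_ : lift ord0 ord0 = 1) ?evX1 //; apply/val_inj.
Qed.

Lemma ev_comp f (phi : 'cV[forms C]_2) x y :
  ev (f \mPo [tuple phi i 0 | i < 2]) x y = ev f (ev (phi 0 0) x y) (ev (phi 1 0) x y).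
Proof. by rewrite /ev comp_mpoly_meval meval_row !tnth_mktuple. Qed.

Lemma mev_precomp m k (g : 'M[forms C]_(m, k)) phi x y :
  mev (precomp g phi) x y = mev g (ev (phi 0 0) x y) (ev (phi 1 0) x y).
Proof. by apply/matrixP => i j; rewrite !mxE ev_comp. Qed.

Lemma mev_moebius m k (g : 'M[forms C]_(m, k)) A x y :
  mev (precomp g (moebius A)) x y = mev g (A 0 0 * x + A 0 1 * y) (A 1 0 * x + A 1 1 * y).
Proof. by rewrite mev_precomp !ev_moebius. Qed.

Lemma homog_comp n d f (phi : 'cV[forms C]_2) : f \is n.-homog -> homogm d phi ->
  f \mPo [tuple phi i 0 | i < 2] \is (d * n).-homog.
Proof.
move=> /homog_exists [c ->] hphi; rewrite /hform raddf_sum /=.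
apply: rpred_sum => -[i /= ilt] _; rewrite comp_mpolyZ; apply: dhomogZ.
rewrite rmorphM !rmorphXn /= !comp_mpolyXU.
have E (j : 'I_2) : [tuple phi i 0 | i < 2]`_j = phi j 0.
  by rewrite -tnth_nth tnth_mktuple.
rewrite !E (_ : n = i + (n - i))%N; last lia.
by rewrite mulnDr (_ : i + (n - i) - i = n - i)%N; [apply: homogM; apply: dhomogMn|lia].
Qed.

Lemma homogm_precomp n d m k (g : 'M[forms C]_(m, k)) phi : homogm n g -> homogm d phi ->
  homogm (d * n) (precomp g phi).
Proof. by move=> hg hphi i j; rewrite mxE; apply: homog_comp. Qed.

Lemma homogm_moebius A : homogm 1 (@moebius C A).
Proof.
move=> i j; rewrite mxE; apply: rpred_sum => k _; rewrite !mxE mul_mpolyC dhomogZ //.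
by rewrite dhomogX; apply/eqP/mdeg1.
Qed.

Lemma moebius_nz (A : 'M[C]_2) x y : A \in unitmx -> nz x y ->
  nz (A 0 0 * x + A 0 1 * y) (A 1 0 * x + A 1 1 * y).
Proof.
move=> uA xy.
pose v : 'cV[C]_2 := \col_i (if i == 0 then x else y).
have : A *m v != 0.
  apply: contraL xy => /eqP /(congr1 (mulmx (invmx A))); rewrite mulKmx // mulmx0 => v0.
  have := congr1 (fun v : 'cV[C]_2 => v 0 0) v0; have := congr1 (fun v : 'cV[C]_2 => v 1 0) v0.
  by rewrite !mxE /= => -> ->; rewrite /nz eqxx.
apply: contraR; rewrite /nz -negb_and negbK => /andP[/eqP h0 /eqP h1].
apply/eqP/matrixP => i j; rewrite !mxE big_ord_recl big_ord1 !mxE /=.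
rewrite (_ : lift ord0 ord0 = 1); last exact/val_inj.
have [->|i0] := eqVneq i 0; first exact: h0.
by have -> : i = 1 by [apply/val_inj; case: i i0 => -[|[]]].
Qed.

Lemma curve_moebius n m k (g : 'M[forms C]_(m, k)) A : A \in unitmx ->
  is_curve n g -> is_curve n (precomp g (moebius A)).
Proof.
move=> uA /curveP[hg g0]; apply/curveP; split.
  by rewrite -[n]mul1n; apply: homogm_precomp => //; apply: homogm_moebius.
by move=> x y xy; rewrite mev_moebius g0 // moebius_nz.
Qed.

Lemma homogm_mulC n m k l (g : 'M[forms C]_(m, k)) (A : 'M[C]_(k, l)) :
  homogm n g -> homogm n (g *m const_forms A).
Proof.
move=> hg i j; rewrite mxE; apply: rpred_sum => k' _.
by rewrite mxE mulrC mul_mpolyC dhomogZ.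
Qed.

Lemma homogm_Cmul n m k l (g : 'M[forms C]_(k, l)) (A : 'M[C]_(m, k)) :
  homogm n g -> homogm n (const_forms A *m g).
Proof.
move=> hg i j; rewrite mxE; apply: rpred_sum => k' _.
by rewrite mxE mul_mpolyC dhomogZ.
Qed.

Lemma nocz_mulC m k (g : 'M[forms C]_(m, k)) (A : 'M[C]_k) : A \in unitmx ->
  nocz g -> nocz (g *m const_forms A).
Proof.
move=> uA g0 x y xy; rewrite mev_mul mev_const; apply: contra (g0 x y xy).
by move=> /eqP /(congr1 (mulmxr (invmx A))) /=; rewrite mulmxK // mul0mx => /eqP.
Qed.

Lemma nocz_Cmul m k (g : 'M[forms C]_(m, k)) (A : 'M[C]_m) : A \in unitmx ->
  nocz g -> nocz (const_forms A *m g).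
Proof.
move=> uA g0 x y xy; rewrite mev_mul mev_const; apply: contra (g0 x y xy).
by move=> /eqP /(congr1 (mulmx (invmx A))) /=; rewrite mulKmx // mulmx0 => /eqP.
Qed.

Lemma coef1_lin a b a' b' i j :
  ((a%:P + a' *: 'X) ^+ i * (b%:P + b' *: 'X) ^+ j : {poly C})`_1
  = i%:R * a' * a ^+ i.-1 * b ^+ j + j%:R * b' * a ^+ i * b ^+ j.-1.
Proof.
have D c c' k : ((c%:P + c' *: 'X : {poly C}) ^+ k)^`().[0] = k%:R * c' * c ^+ k.-1.
  rewrite deriv_exp hornerMn hornerM horner_exp derivD derivZ derivC derivX add0r.
  by rewrite hornerZ hornerC mulr1 hornerD hornerC hornerZ hornerX mulr0 addr0 -mulr_natl mulrA.
have -> (p : {poly C}) : p`_1 = p^`().[0] by rewrite horner_coef0 coef_deriv mulr1n.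
rewrite derivM hornerD !hornerM !D !horner_exp.
have E c c' : (c%:P + c' *: 'X : {poly C}).[0] = c by rewrite hornerD hornerC hornerZ hornerX mulr0 addr0.
by rewrite !E; ring.
Qed.

(** First order expansion of a form along a line. *)
Lemma line1 a b a' b' f :
  (line a b a' b' f)`_1 = a' * ev f^`M(0) a b + b' * ev f^`M(1) a b.
Proof.
elim/mpolyind: f => [|c m f _ _ IH].
  by rewrite raddf0 coef0 !mderiv0 !ev0 !mulr0 addr0.
rewrite raddfD /= coefD !mderivD !evD IH.
suff -> : (line a b a' b' (c *: 'X_[m]))`_1 =
   a' * ev (c *: 'X_[m])^`M(0) a b + b' * ev (c *: 'X_[m])^`M(1) a b by ring.
rewrite -mul_mpolyC rmorphM /= /line mmapC mmapX /mmap1 big_ord_recl big_ord1 /=.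
rewrite coefCM !mderiv_mulC !mderivX !evM !evZ !evC !mpolyX2 !evE.
rewrite (_ : lift ord0 ord0 = 1); last exact/val_inj.
rewrite !mnmBE !mnm1E /= !subn0 !subn1.

by rewrite (_ : m ord0 = m 0%R) // coef1_lin; ring.
Qed.

End Curves.

(** * Binary sextics *)

HB.lock Definition sx (K : comNzRingType) (v : 'rV[K]_7) (u w : K) : K :=
  \sum_(i < 7) v 0 i * (u ^+ (6 - i) * w ^+ i).

(** Substitution of a linear change of variables in sextics. *)
HB.lock Definition act6 (K : comNzRingType) (A : 'M[K]_2) : 'M[K]_7 :=
  \matrix_(i < 7) coefs6 ((A 0 0 *: X0 + A 0 1 *: X1) ^+ (6 - i) *
                          (A 1 0 *: X0 + A 1 1 *: X1) ^+ i).

Section SexticVectors.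

Variable K : comNzRingType.
Implicit Types (v : 'rV[K]_7) (u w : K).

Lemma sxE v u w : sx v u w = \sum_(i < 7) v 0 i * (u ^+ (6 - i) * w ^+ i).
Proof. by rewrite sx.unlock. Qed.

Lemma sxD v v' u w : sx (v + v') u w = sx v u w + sx v' u w.
Proof. by rewrite !sxE -big_split; apply: eq_bigr => i _; rewrite !mxE mulrDl. Qed.
Lemma sxZ c v u w : sx (c *: v) u w = c * sx v u w.
Proof. by rewrite !sxE mulr_sumr; apply: eq_bigr => i _; rewrite !mxE -!mulrA. Qed.
Lemma sx0 u w : sx 0 u w = 0.
Proof. by rewrite !sxE big1 // => i _; rewrite mxE mul0r. Qed.

Lemma sx_coefs6 (f : forms K) u w : f \is 6.-homog -> sx (coefs6 f) u w = ev f u w.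
Proof.
move=> hf; rewrite {2}(homog_hformE hf) ev_hform sxE (reindex_inj rev_ord_inj) /=.
apply: eq_bigr => -[i /= ilt] _; rewrite mxE /= subSS.
have -> : (6 - (6 - i) = i)%N by lia.
by [].
Qed.

Definition f0 (X Y : K) : K := X * Y * (X ^+ 4 - Y ^+ 4).

Lemma f0_homog (l1 l2 : forms K) : l1 \is 1.-homog -> l2 \is 1.-homog ->
  l1 * l2 * (l1 ^+ 4 - l2 ^+ 4) \is 6.-homog.
Proof.
move=> h1 h2.
apply: (dhomogM (dhomogM h1 h2)); apply: rpredB; [exact: (dhomogMn 4 h1)|exact: (dhomogMn 4 h2)].
Qed.

Lemma sx_f1 (M : 'M[K]_2) u w :
  sx (f1 M) u w = f0 (M 1 1 * u - M 0 1 * w) (M 0 0 * w - M 1 0 * u).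
Proof.
rewrite /f1 sx_coefs6 /= ?evE //; apply: f0_homog;
by apply: rpredB; apply: dhomogZ; rewrite ?homog_X0 ?homog_X1.
Qed.

Lemma sx_act6 v A u w :
  sx (v *m act6 A) u w = sx v (A 0 0 * u + A 0 1 * w) (A 1 0 * u + A 1 1 * w).
Proof.
have H (i : 'I_7) : sx (coefs6 ((A 0 0 *: X0 + A 0 1 *: X1) ^+ (6 - i) *
     (A 1 0 *: X0 + A 1 1 *: X1) ^+ i)) u w =
   (A 0 0 * u + A 0 1 * w) ^+ (6 - i) * (A 1 0 * u + A 1 1 * w) ^+ i.
  rewrite sx_coefs6 ?evE //.
  have hl (a b : K) : a *: X0 + b *: X1 \is 1.-homog.
    by apply: rpredD; apply: dhomogZ; rewrite ?homog_X0 ?homog_X1.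
  have := dhomogM (dhomogMn (6 - i) (hl (A 0 0) (A 0 1))) (dhomogMn i (hl (A 1 0) (A 1 1))).
  by rewrite !mul1n; case: i => i /= ilt; rewrite subnK.
rewrite sxE; under eq_bigr do rewrite mxE mulr_suml.
rewrite exchange_big sxE; apply: eq_bigr => i _ /=; rewrite -H sxE mulr_sumr.
by apply: eq_bigr => j _; rewrite -mulrA act6.unlock [(\matrix_i _) _ _]mxE.
Qed.

End SexticVectors.

Lemma sx_map (K L : comNzRingType) (phi : {rmorphism K -> L}) (v : 'rV[K]_7) u w :
  phi (sx v u w) = sx (map_mx phi v) (phi u) (phi w).
Proof.
by rewrite !sxE rmorph_sum; apply: eq_bigr => i _; rewrite !rmorphM !rmorphXn mxE.
Qed.

Lemma map_f1 (K L : comNzRingType) (phi : {rmorphism K -> L}) (M : 'M[K]_2) :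
  map_mx phi (f1 M) = f1 (map_mx phi M).
Proof.
apply/rowP => i; rewrite !mxE -mcoeff_map_mpoly; congr mcoeff.
rewrite !(rmorphM, rmorphB, rmorphXn) /=.
have E (a : K) i' : map_mpoly phi (a *: 'X_i') = phi a *: 'X_i' :> forms L.
  by rewrite map_mpolyZ map_mpolyX.
by rewrite !E.
Qed.

Section SexticsOverField.

Variable C : numClosedFieldType.
Implicit Types (v : 'rV[C]_7) (u w : C) (g : 'M[forms C]_2) (F : 'rV[forms C]_7).

Lemma sx_inj v v' : (forall u w, sx v u w = sx v' u w) -> v = v'.
Proof.
move=> E; apply/rowP => i.
pose P (x : 'rV[C]_7) : {poly C} := \poly_(j < 7) x 0 (inord j).
have PE x t : (P x).[t] = sx x 1 t.
  rewrite horner_poly sxE; apply: eq_bigr => j _; rewrite expr1n mul1r.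
  by congr (x _ _ * _); apply/val_inj; rewrite /= inordK.
have : P v - P v' = 0.
  by apply: poly_eq0_fun => t; rewrite hornerD hornerN !PE E subrr.
move/eqP; rewrite subr_eq0 => /eqP /(congr1 (fun p : {poly C} => p`_i)).
by rewrite !coef_poly ltn_ord inord_val.
Qed.

Lemma mev_f1 g x y : mev (f1 g) x y = f1 (mev g x y).
Proof. exact: (map_f1 (@meval 2 C (pt2 x y))). Qed.

Lemma ord2P (i : 'I_2) : i = 0 \/ i = 1.
Proof. by case: i => -[|[|//]] ?; [left|right]; apply/val_inj. Qed.

Lemma mx2P (K : nzRingType) (A B : 'M[K]_2) : A 0 0 = B 0 0 -> A 0 1 = B 0 1 -> A 1 0 = B 1 0 -> A 1 1 = B 1 1 -> A = B.
Proof.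
by move=> *; apply/matrixP => i j; case: (ord2P i) => ->; case: (ord2P j) => ->.
Qed.

Lemma mul2E (K : nzRingType) m k (A : 'M[K]_(m, 2)) (B : 'M[K]_(2, k)) i j :
  (A *m B) i j = A i 0 * B 0 j + A i 1 * B 1 j.
Proof.
rewrite mxE big_ord_recl big_ord1 (_ : lift ord0 ord0 = 1) //; exact/val_inj.
Qed.

Lemma act6M (A B : 'M[C]_2) : act6 A *m act6 B = act6 (A *m B).
Proof.
apply/row_matrixP => i; rewrite !rowE mulmxA.
by apply: sx_inj => u w; rewrite !sx_act6 !mul2E; congr sx; ring.
Qed.

Lemma act6_1 : act6 (1%:M : 'M[C]_2) = 1%:M.
Proof.
apply/row_matrixP => i; rewrite !rowE mulmx1.
by apply: sx_inj => u w; rewrite !sx_act6 !mxE /= !mul1r !mul0r addr0 add0r.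
Qed.

Lemma act6_unit (A : 'M[C]_2) : A \in unitmx -> act6 A \in unitmx.
Proof.
move=> uA; have : act6 A *m act6 (invmx A) = 1%:M by rewrite act6M mulmxV // act6_1.
by case/mulmx1_unit => h _; exact: h.
Qed.

Lemma det2 (K : comNzRingType) (A : 'M[K]_2) : \det A = A 0 0 * A 1 1 - A 0 1 * A 1 0.
Proof.
rewrite (expand_det_row _ 0) !big_ord_recl big_ord0 /= /cofactor /= !det_mx11 !mxE /=.
rewrite expr0 expr1 mul1r mulN1r mulrN addr0.
have [E0 E1 E2] : [/\ lift ord0 ord0 = 1 :> 'I_2, lift 0 0 = 1 :> 'I_2 & lift (1 : 'I_2) 0 = 0 :> 'I_2].
  by split; apply/val_inj.
by rewrite ?E1 ?E0 ?E1 ?E2.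
Qed.

Lemma unit2 (A : 'M[C]_2) : (A \in unitmx) = (A 0 0 * A 1 1 - A 0 1 * A 1 0 != 0).
Proof. by rewrite unitmxE unitfE det2. Qed.

Definition mk2 (K : nzRingType) (a b c d : K) : 'M[K]_2 :=
  \matrix_(i, j) if i == 0 then if j == 0 then a else b else if j == 0 then c else d.

Lemma mk2E (K : nzRingType) (a b c d : K) : ((mk2 a b c d 0 0 = a) * (mk2 a b c d 0 1 = b) * (mk2 a b c d 1 0 = c) * (mk2 a b c d 1 1 = d))%type.
Proof. by rewrite !mxE. Qed.

Lemma adj2 (K : comNzRingType) (A : 'M[K]_2) :
  \adj A = mk2 (A 1 1) (- A 0 1) (- A 1 0) (A 0 0).
Proof.
have [E0 E1] : lift (0 : 'I_2) 0 = 1 /\ lift (1 : 'I_2) 0 = 0 by split; apply/val_inj.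
apply/mx2P; rewrite !mk2E !mxE /cofactor det_mx11 !mxE /= ?E0 ?E1.
- by rewrite expr0 mul1r.
- by rewrite expr1 mulN1r.
- by rewrite expr1 mulN1r.
- by rewrite (_ : 1 %% 2 + 1 %% 2 = 2)%N // -signr_odd expr0 mul1r.
Qed.

Lemma f1Z c (M : 'M[C]_2) : f1 (c *: M) = c ^+ 6 *: f1 M.
Proof. by apply: sx_inj => u w; rewrite sxZ !sx_f1 !mxE /f0; ring. Qed.

Lemma sx_neq0 v : v != 0 -> exists u w, sx v u w != 0.
Proof.
move=> v0; apply: contrapT => h; case/eqP: v0; apply: sx_inj => u w; rewrite sx0.
by apply: contrapT => /eqP uw; apply: h; exists u, w.
Qed.

(** The coefficients of (e u + f w)^5 (e' u + f' w). *)
Definition vec51 (e f e' f' : C) : 'rV[C]_7 := \row_(i < 7) nth 0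
  [:: e ^+ 5 * e'; e ^+ 5 * f' + 5 * e ^+ 4 * f * e';
      5 * e ^+ 4 * f * f' + 10 * e ^+ 3 * f ^+ 2 * e';
      10 * e ^+ 3 * f ^+ 2 * f' + 10 * e ^+ 2 * f ^+ 3 * e';
      10 * e ^+ 2 * f ^+ 3 * f' + 5 * e * f ^+ 4 * e';
      5 * e * f ^+ 4 * f' + f ^+ 5 * e'; f ^+ 5 * f'] i.

Lemma sx_vec51 e f e' f' u w :
  sx (vec51 e f e' f') u w = (e * u + f * w) ^+ 5 * (e' * u + f' * w).
Proof. by rewrite sxE !big_ord_recl big_ord0 !mxE /=; ring. Qed.

Lemma f1_vec51 (M : 'M[C]_2) : f1 M =
  vec51 (M 1 1) (- M 0 1) (- M 1 0) (M 0 0) - vec51 (- M 1 0) (M 0 0) (M 1 1) (- M 0 1).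
Proof.
apply: sx_inj => u w; rewrite sx_f1 sxD -scaleN1r sxZ !sx_vec51 /f0; ring.
Qed.

Definition coefs_act (A : 'M[C]_2) (f : forms C) : f \is 6.-homog -> forall u w,
  sx (coefs6 (Defs.act A f)) u w = ev f (invmx A 0 0 * u + invmx A 0 1 * w)
                                   (invmx A 1 0 * u + invmx A 1 1 * w).
Proof.
move=> hf u w; rewrite sx_coefs6; first by rewrite /Defs.act ev_comp !ev_moebius.
by rewrite /Defs.act -[6%N]mul1n; apply: homog_comp => //; exact: homogm_moebius.
Qed.

Lemma orbit6_intro (f : forms C) v e f' e' f'' c : f \is 6.-homog -> c != 0 ->
  e * f'' - f' * e' = 1 ->
  (forall u w, sx v u w = c * ev f (e * u + f' * w) (e' * u + f'' * w)) ->
  orbit6 f v.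
Proof.
move=> hf c0 d1 E; pose B := mk2 e f' e' f''.
have dB : \det B = 1 by rewrite det2 !mk2E.
exists (invmx B), c; split=> //; first by rewrite det_inv dB invr1.
by apply: sx_inj => u w; rewrite E sxZ coefs_act // invmxK !mk2E.
Qed.

Lemma homog_u5v : (X0 ^+ 5 * X1 : forms C) \is 6.-homog.
Proof. exact: (homogM (dhomogMn 5 (homog_X0 C)) (homog_X1 C)). Qed.
Lemma homog_u6 : (X0 ^+ 6 : forms C) \is 6.-homog.
Proof. exact: (dhomogMn 6 (homog_X0 C)). Qed.
Lemma homog_f0 : (X0 * X1 * (X0 ^+ 4 - X1 ^+ 4) : forms C) \is 6.-homog.
Proof.
apply: (homogM (homogM (homog_X0 C) (homog_X1 C))).
by apply: rpredB; [exact: (dhomogMn 4 (homog_X0 C))|exact: (dhomogMn 4 (homog_X1 C))].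
Qed.

Lemma orbit_u5v c e f e' f' v : c != 0 -> e * f' - f * e' != 0 ->
  v = c *: vec51 e f e' f' -> orbit6 (X0 ^+ 5 * X1) v.
Proof.
move=> c0; set d := e * f' - f * e' => d0 ->.
apply: (@orbit6_intro _ _ e f (e' / d) (f' / d) (c * d)); rewrite ?homog_u5v ?mulf_neq0 //.
  by rewrite -[RHS](divff d0) /d; field.
by move=> u w; rewrite sxZ sx_vec51 !evE; field.
Qed.

Lemma orbit_u6 c e f v : c != 0 -> nz e f ->
  (forall u w, sx v u w = c * (e * u + f * w) ^+ 6) -> orbit6 (X0 ^+ 6) v.
Proof.
move=> c0 ef E; have [e0|e0] := eqVneq e 0.
  have f0 : f != 0 by move: ef; rewrite /nz e0 eqxx.
  apply: (@orbit6_intro _ _ e f (- f^-1) 0 c); rewrite ?homog_u6 //.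
    by rewrite e0 mul0r mulrN divff // sub0r opprK.
  by move=> u w; rewrite E !evE.
apply: (@orbit6_intro _ _ e f 0 e^-1 c); rewrite ?homog_u6 //.
  by rewrite divff // mulr0 subr0.
by move=> u w; rewrite E !evE.
Qed.

Lemma orbit_f1 (M : 'M[C]_2) : \det M != 0 ->
  orbit6 (X0 * X1 * (X0 ^+ 4 - X1 ^+ 4)) (f1 M).
Proof.
move=> d0; pose s := sqrtC (\det M).
have s0 : s != 0 by rewrite sqrtC_eq0.
have s2 : s ^+ 2 = M 0 0 * M 1 1 - M 0 1 * M 1 0 by rewrite sqrtCK det2.
apply: (@orbit6_intro _ _ (M 1 1 / s) (- M 0 1 / s) (- M 1 0 / s) (M 0 0 / s) (s ^+ 6)).
- exact: homog_f0.
- by rewrite expf_neq0.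
- apply: (mulIf (expf_neq0 2 s0)); rewrite mul1r.
  by transitivity (M 0 0 * M 1 1 - M 0 1 * M 1 0); [field; exact: s0 | rewrite s2].
by move=> u w; rewrite sx_f1 !evE /f0; field.
Qed.

(** A polynomial that vanishes on a line except at one point vanishes at this point
    too. *)
Lemma closure_line (S : 'rV[C]_7 -> Prop) v (w : 'rV[C]_7) :
  (forall t, t != 0 -> S (v + t *: w)) -> closure6 S v.
Proof.
move=> Sv d P hP P0.
pose q : {poly C} := mmap polyC (fun i => (v 0 i)%:P + w 0 i *: 'X) P.
have qE t : q.[t] = P.@[(v + t *: w) 0].
  rewrite /q /mmap horner_sum mevalE; apply: eq_bigr => m _.
  rewrite hornerM hornerC /mmap1 horner_prod; congr (_ * _); apply: eq_bigr => i _.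
  by rewrite horner_exp hornerD hornerC hornerZ hornerX !mxE [t * _]mulrC.
have : q * 'X = 0.
  apply: poly_eq0_fun => t; rewrite hornerM hornerX.
  by have [->|t0] := eqVneq t 0; [rewrite mulr0 | rewrite qE P0 ?mul0r //; apply: Sv].
move/eqP; rewrite mulf_eq0 polyX_eq0 orbF => /eqP q0.
by have := qE 0; rewrite q0 horner0 scale0r addr0.
Qed.

(** Degenerate matrices are sent to sixth powers, which are limits of points
    of the surface orbit. *)
Lemma closure_f1_det0 (M : 'M[C]_2) : \det M = 0 ->
  closure6 (orbit6 (X0 ^+ 5 * X1)) (f1 M).
Proof.
rewrite det2 => d0.
have [e [f [a [b [E1 E2 E3 E4]]]]] : exists e f a b,
    [/\ M 1 1 = a * e, - M 0 1 = a * f, - M 1 0 = b * e & M 0 0 = b * f].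
  have [d1|d1] := eqVneq (M 1 1) 0; last first.
    exists (M 1 1), (- M 0 1), 1, (- M 1 0 / M 1 1); rewrite !mul1r divfK //; split=> //.
    by apply: (mulIf d1); move/eqP: d0; rewrite subr_eq0 => /eqP ->; field.
  have [b1|b1] := eqVneq (M 0 1) 0.
    by exists (- M 1 0), (M 0 0), 0, 1; rewrite !mul0r !mul1r d1 b1 oppr0.
  exists 0, 1, (- M 0 1), (M 0 0); rewrite !mulr0 !mulr1; split=> //.
  by move/eqP: d0; rewrite d1 mulr0 sub0r oppr_eq0 mulf_eq0 (negPf b1) => /eqP ->; rewrite oppr0.
have fE : f1 M = f0 a b *: vec51 e f e f.
  apply: sx_inj => u w; rewrite sx_f1 sxZ sx_vec51 E1 E4.
  have -> : M 0 1 = - (a * f) by rewrite -E2 opprK.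
  have -> : M 1 0 = - (b * e) by rewrite -E3 opprK.
  by rewrite /f0; ring.
have [k0|k0] := eqVneq (f1 M) 0.
  rewrite k0; apply: (@closure_line _ _ (vec51 1 0 0 1)) => t t0; rewrite add0r.
  by apply: (orbit_u5v t0 _ erefl); rewrite mulr1 mul0r subr0 oner_eq0.
have c0 : f0 a b != 0 by apply: contraNneq k0 => c0; rewrite fE c0 scale0r.
have ef : nz e f.
  apply: contraNT k0; rewrite negb_or !negbK => /andP[/eqP e0 /eqP f00].
  by rewrite fE e0 f00; apply/eqP/sx_inj => u w; rewrite sxZ sx_vec51 sx0; ring.
have [e' [f' d1]] : exists e' f', e * f' - f * e' != 0.
  case/orP: ef => h; [exists 0, 1|exists 1, 0].
    by rewrite mulr1 mulr0 subr0.
  by rewrite mulr0 mulr1 sub0r oppr_eq0.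
apply: (@closure_line _ _ (f0 a b *: vec51 e f e' f')) => t t0.
apply: (@orbit_u5v (f0 a b) e f (e + t * e') (f + t * f')) => //.
  have -> : e * (f + t * f') - f * (e + t * e') = t * (e * f' - f * e') by ring.
  by rewrite mulf_neq0.
by rewrite fE; apply: sx_inj => u w; rewrite sxD !sxZ !sx_vec51; ring.
Qed.

(** The quadratic invariant of sextics, which separates the orbit of
    uv(u^4 - v^4) from the closure of the surface orbit. *)
Definition quad6 : {mpoly C[7]} :=
  120 *: ('X_(inord 0) * 'X_(inord 6)) - 20 *: ('X_(inord 1) * 'X_(inord 5))
  + 8 *: ('X_(inord 2) * 'X_(inord 4)) - 3 *: ('X_(inord 3) * 'X_(inord 3)).

Lemma quad6_homog : quad6 \is 2.-homog.
Proof.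
have h i j c : (c *: ('X_i * 'X_j) : {mpoly C[7]}) \is 2.-homog.
  apply: dhomogZ; apply: (@dhomogM _ _ mdeg 1 'X_i 1 'X_j);
  by rewrite dhomogX; apply/eqP/mdeg1.
by apply: rpredB; [apply: rpredD; [apply: rpredB|]|]; exact: h.
Qed.

Lemma quad6E v : quad6.@[v 0] = 120 * (v 0 (inord 0) * v 0 (inord 6))
  - 20 * (v 0 (inord 1) * v 0 (inord 5)) + 8 * (v 0 (inord 2) * v 0 (inord 4))
  - 3 * (v 0 (inord 3) * v 0 (inord 3)).
Proof. by rewrite /quad6 mevalB mevalD mevalB !mevalZ !mevalM !mevalXU. Qed.

Lemma quad6_f1 (M : 'M[C]_2) : quad6.@[(f1 M) 0] = 20 * \det M ^+ 6.
Proof. by rewrite quad6E f1_vec51 det2 !mxE /= !inordK //=; ring. Qed.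

Lemma quad6_u5v v : orbit6 (X0 ^+ 5 * X1) v -> quad6.@[v 0] = 0.
Proof.
move=> [A [c [_ _ ->]]].
have -> : coefs6 (Defs.act A (X0 ^+ 5 * X1)) =
    vec51 (invmx A 0 0) (invmx A 0 1) (invmx A 1 0) (invmx A 1 1).
  by apply: sx_inj => u w; rewrite coefs_act ?homog_u5v // sx_vec51 !evE.
by rewrite quad6E !mxE /= !inordK //=; ring.
Qed.

Lemma quad6_closure v : closure6 (orbit6 (X0 ^+ 5 * X1)) v -> quad6.@[v 0] = 0.
Proof. by move=> h; apply: (h 2 _ quad6_homog) => w; apply: quad6_u5v. Qed.

End SexticsOverField.

(** * The dihedral covering and the two families of matrices *)

Section Families.

Variable C : numClosedFieldType.
Implicit Types (x y u w s t : C) (M : 'M[C]_(2, 3)).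

(** Homogeneity can be read off the associated function, because the
    components of different degrees scale differently. *)
Lemma homog_of_ev n (f : forms C) :
  (forall t x y, ev f (t * x) (t * y) = t ^+ n * ev f x y) -> f \is n.-homog.
Proof.
move=> hf; pose k := maxn (msize f) n.+1.
have fE : f = \sum_(d < k) pihomog mdeg d f.
  by rewrite -pihomog_partitionE // leq_maxl.
suff -> : f = pihomog mdeg n f by apply: pihomogP.
have h0 d : d != n -> pihomog mdeg d f = 0.
  move=> dn; apply: ev_eq0 => x y.
  pose P : {poly C} := \poly_(d < k) ev (pihomog mdeg d f) x y.
  have PE : P = ev f x y *: 'X^n.
    apply/eqP; rewrite -subr_eq0; apply/eqP/poly_eq0_fun => t.
    rewrite hornerD hornerN hornerZ hornerXn horner_poly [ev f x y * _]mulrC -hf.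
    rewrite {2}fE ev_sum; apply/eqP; rewrite subr_eq0; apply/eqP; apply: eq_bigr => i _.
    by rewrite (ev_homog _ _ _ (pihomogP _ _ _)) mulrC.
  have := congr1 (fun p : {poly C} => p`_d) PE; rewrite coefZ coefXn (negPf dn) mulr0 coef_poly.
  case: ltnP => // kd _; rewrite (_ : pihomog mdeg d f = 0) ?ev0 //.
  rewrite pihomogE big_seq_cond big1 // => m /andP[mf /eqP md].
  have := msize_mdeg_lt mf; rewrite ltnNge.
  have /negP[] : ~~ (msize f <= mdeg m)%N by rewrite -ltnNge msize_mdeg_lt.
  by rewrite md (leq_trans _ kd) // leq_maxl.
have nk : (n < k)%N by rewrite leq_maxr.
by rewrite {1}fE (bigD1 (Ordinal nk)) //= big1 ?addr0 // => i ni; rewrite h0.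
Qed.

Definition al x y : C := (x ^+ 4 - y ^+ 4) / 2.
Definition be x y : C := (x ^+ 4 + y ^+ 4) / 2.

Lemma ev_alpha x y : ev (alpha4 C) x y = al x y.
Proof. by rewrite !evE /al mulrC. Qed.
Lemma ev_beta x y : ev (beta4 C) x y = be x y.
Proof. by rewrite !evE /be mulrC. Qed.
Lemma ev_gamma x y : ev (gamma C) x y = x * y.
Proof. by rewrite !evE. Qed.

Lemma albe x y : be x y ^+ 2 = al x y ^+ 2 + (x * y) ^+ 4.
Proof. by rewrite /be /al; field. Qed.

Lemma ev_deriv4 i x y :
  ev ((X0 ^+ 4 : forms C)^`M(i)) x y = (i == 0)%:R * (4 * x ^+ 3) /\
  ev ((X1 ^+ 4 : forms C)^`M(i)) x y = (i == 1)%:R * (4 * y ^+ 3).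
Proof.
have h (j : 'I_2) : (('X_j : forms C) ^+ 4)^`M(i) = (j == i)%:R *: (4 *: 'X_j ^+ 3).
  rewrite mpolyXn mderivX mulmnE mnm1E; case: eqP => [->|_]; last by rewrite mul0n !scale0r.
  rewrite mul1n scale1r mpolyXn; congr (_ *: 'X_[_]).
  apply/mnmP => k; rewrite mnmBE !mulmnE mnm1E; case: eqP => _; lia.
by rewrite /X0 /X1 !h; split; rewrite !evE eq_sym.
Qed.

Lemma ev_d_beta x y : ev (d_y (beta4 C)) x y = 2 * y ^+ 3 /\
  ev (d_x (beta4 C)) x y = 2 * x ^+ 3.
Proof.
rewrite /d_x /d_y /beta4 !mderivZ !mderivD !evZ !evD.
have [-> ->] := ev_deriv4 0 x y; have [-> ->] := ev_deriv4 1 x y.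
by split; rewrite /=; field.
Qed.

Lemma ev_d_alpha x y : ev (d_y (alpha4 C)) x y = - (2 * y ^+ 3) /\
  ev (d_x (alpha4 C)) x y = 2 * x ^+ 3.
Proof.
rewrite /d_x /d_y /alpha4 !mderivZ !mderivB !evZ !evB.
have [-> ->] := ev_deriv4 0 x y; have [-> ->] := ev_deriv4 1 x y.
by split; rewrite /=; field.
Qed.

Lemma phi0E x y : ev (phi_D4 C 0 0) x y = - al x y ^+ 2.
Proof. by rewrite mxE /= evN evX ev_alpha. Qed.
Lemma phi1E x y : ev (phi_D4 C 1 0) x y = (x * y) ^+ 4.
Proof. by rewrite mxE /= evX ev_gamma. Qed.

Lemma homog_phi : homogm 8 (phi_D4 C).
Proof.
move=> i j; rewrite ord1; apply: homog_of_ev => t x y.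
by case: (ord2P i) => ->; rewrite ?phi0E ?phi1E /al; field.
Qed.

(** The dihedral covering is onto, even on the cones: given s and t, the values
    of x^4 and y^4 are be + al and be - al for suitable square roots, and x and
    y can then be chosen with a prescribed product. *)
Lemma phi_surj s t : exists x y, - al x y ^+ 2 = s /\ (x * y) ^+ 4 = t.
Proof.
pose a := sqrtC (- s); pose b := sqrtC (t - s).
have a2 : a ^+ 2 = - s by rewrite sqrtCK.
have b2 : b ^+ 2 = t - s by rewrite sqrtCK.
exists (4.-root (b + a)), (4.-root (b - a)).
have [E1 E2] : (4.-root (b + a)) ^+ 4 = b + a /\ (4.-root (b - a)) ^+ 4 = b - a.
  by rewrite !rootCK.
split; last first.
  by transitivity (b ^+ 2 - a ^+ 2); [rewrite exprMn E1 E2; ring | rewrite a2 b2; ring].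
rewrite /al E1 E2 (_ : (b + a - (b - a)) / 2 = a); last by field.
by rewrite a2 opprK.
Qed.

Lemma phi_surj_nz s t : nz s t -> exists x y, [/\ nz x y, - al x y ^+ 2 = s & (x * y) ^+ 4 = t].
Proof.
move=> st; have [x [y [E1 E2]]] := phi_surj s t; exists x, y; split=> //.
apply: contraLR st; rewrite !negb_or !negbK => /andP[/eqP x0 /eqP y0].
by rewrite -E1 -E2 x0 y0 /al !expr0n /= subrr mul0r mulr0 !expr0n oppr0 eqxx.
Qed.

Lemma phi_nz x y : nz x y -> nz (- al x y ^+ 2) ((x * y) ^+ 4).
Proof.
move=> xy; apply: contraT; rewrite negb_or !negbK oppr_eq0 !expf_eq0 /= mulf_eq0.
rewrite /al mulf_eq0 invr_eq0 pnatr_eq0 orbF => /andP[/eqP h /orP[] /eqP h0];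
  move: h xy; rewrite /nz h0 expr0n /= ?sub0r ?subr0 => /eqP;
  by rewrite ?oppr_eq0 expf_eq0 /= => /eqP ->; rewrite eqxx.
Qed.

(** ** Values of the families *)

Lemma mul3E (K : nzRingType) m k (A : 'M[K]_(m, 3)) (B : 'M[K]_(3, k)) i j :
  (A *m B) i j = A i 0 * B 0 j + A i 1 * B 1 j + A i 2 * B 2 j.
Proof.
rewrite mxE !big_ord_recl big_ord0 addr0 addrA.
have [-> ->] : lift ord0 (lift ord0 ord0) = 2 :> 'I_3 /\ lift ord0 ord0 = 1 :> 'I_3.
  by split; apply/val_inj.
by [].
Qed.

Lemma g9E M x y i :
  (mev (g9 M) x y i 0 = M i 0 * (x * al x y ^+ 2) + M i 1 * (x * (x * y) ^+ 4)
     - M i 2 * (al x y * (x * y) * (2 * y ^+ 3))) *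
  (mev (g9 M) x y i 1 = M i 0 * (y * al x y ^+ 2) + M i 1 * (y * (x * y) ^+ 4)
     + M i 2 * (al x y * (x * y) * (2 * x ^+ 3))).
Proof.
have [E1 E2] := ev_d_beta x y.
by split; rewrite /g9 mev_mul mev_const mev_tr mul3E !mxE /= !evE ?E1 ?E2
  ?ev_alpha ?ev_gamma ?evE -?[(x ^+ 4 - y ^+ 4) / 2]/(al x y) /al; field.
Qed.

Lemma g11E M x y i :
  (mev (g11 M) x y i 0 = - M i 0 * (x * al x y * (x * y) ^+ 3) + M i 1 * (x * be x y * (x * y) ^+ 3)
     - M i 2 * (al x y * be x y * (2 * y ^+ 3))) *
  (mev (g11 M) x y i 1 = M i 0 * (y * al x y * (x * y) ^+ 3) + M i 1 * (y * be x y * (x * y) ^+ 3)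
     + M i 2 * (al x y * be x y * (2 * x ^+ 3))).
Proof.
have [E1 E2] := ev_d_alpha x y.
by split; rewrite /g11 mev_mul mev_const mev_tr mul3E !mxE /= !evE ?E1 ?E2
  ?ev_alpha ?ev_gamma ?evE /al /be; field.
Qed.

Lemma homog_g9 M : homogm 9 (g9 M).
Proof.
move=> i j; apply: homog_of_ev => t x y; rewrite -!mevP.
by case: (ord2P j) => ->; rewrite !g9E /al; field.
Qed.

Lemma homog_g11 M : homogm 11 (g11 M).
Proof.
move=> i j; apply: homog_of_ev => t x y; rewrite -!mevP.
by case: (ord2P j) => ->; rewrite !g11E /al /be; field.
Qed.

Definition m01 M : C := M 0 0 * M 1 1 - M 0 1 * M 1 0.
Definition m02 M : C := M 0 0 * M 1 2 - M 0 2 * M 1 0.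
Definition m12 M : C := M 0 1 * M 1 2 - M 0 2 * M 1 1.

Lemma det_g9 M x y : \det (mev (g9 M) x y) =
  4 * al x y * be x y * (x * y) * (m02 M * al x y ^+ 2 + m12 M * (x * y) ^+ 4).
Proof. by rewrite det2 !g9E /m02 /m12 /al /be; field. Qed.

Lemma det_g11 M x y : \det (mev (g11 M) x y) = al x y * be x y * (x * y) ^+ 3 *
  (- 2 * m01 M * (x * y) ^+ 4 - 4 * m02 M * al x y ^+ 2 + 4 * m12 M * be x y ^+ 2).
Proof. by rewrite det2 !g11E /m02 /m12 /m01 /al /be; field. Qed.

End Families.

(** ** The curves F *)

Section Quotients.

Variable K : comNzRingType.

(** The common shape of the sextics F of both families. With G a square root of G2,
    the forms E + G and E - G are, up to monomials in x and y, the two linear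
    factors of f1 g exchanged with each other by the exchange of x and y: this
    leaves E invariant and changes the sign of G, so that only G2 descends to the
    target of the covering. *)
Definition q6 (a c E G2 : K) : K :=
  (E ^+ 2 - G2) * (a * (E ^+ 4 + 6 * E ^+ 2 * G2 + G2 ^+ 2) + c * E * (E ^+ 2 + G2)).

(** The sextics of the two families on the target of the covering, in degree 11 with
    a linear factor in s and t that F does not have: s and t stand for - alpha4^2
    and gamma^4, hence t - s for beta4^2. *)
Definition phi9 (s t X Z N : K) : K :=
  q6 1 (- (8 * ((t - s) * N))) (t * Z - s * X - 2 * (s * N))
     (- (4 * (s * ((t - s) * N ^+ 2)))).

Definition psi11 (s t X Z N : K) : K :=
  q6 (3 * t - 4 * s) (4 * ((t - s) * ((t - 4 * s) * (X - Z + 2 * N))))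
     ((t - s) * Z + s * X) (- (s * ((t - s) * (X - Z + 2 * N) ^+ 2))).

End Quotients.

Section QuotientMaps.

Variables (K L : comNzRingType) (f : {rmorphism K -> L}).

Lemma phi9_map s t X Z N : f (phi9 s t X Z N) = phi9 (f s) (f t) (f X) (f Z) (f N).
Proof. by rewrite /phi9 /q6; ring. Qed.

Lemma psi11_map s t X Z N : f (psi11 s t X Z N) = psi11 (f s) (f t) (f X) (f Z) (f N).
Proof. by rewrite /psi11 /q6; ring. Qed.

End QuotientMaps.

Section QuotientForms.

Variable K : comNzRingType.
Implicit Types (M : 'M[K]_(2, 3)) (s t u w : K) (f E : forms K).

(** Pairing with (u, w) by the symplectic form turns the columns of M into linear
    forms, in terms of which the linear factors of f1 g are expressed. *)
Definition cf M (j : 'I_3) u w : K := M 1 j * u - M 0 j * w.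

Definition cform M (j : 'I_3) : forms K := M 1 j *: X0 - M 0 j *: X1.

Lemma homog_cform M j : cform M j \is 1.-homog.
Proof. by apply: rpredB; apply: dhomogZ; rewrite ?homog_X0 ?homog_X1. Qed.

Lemma homog_CM (n : nat) (c : K) f : f \is n.-homog -> c%:MP * f \is n.-homog.
Proof. by rewrite mul_mpolyC; apply: dhomogZ. Qed.

Lemma homog_natM (n k : nat) f : f \is n.-homog -> k%:R * f \is n.-homog.
Proof. by rewrite mulr_natl; apply: rpredMn. Qed.

Lemma homog_q6 (a : K) (c E G2 : forms K) :
  c \is 1.-homog -> E \is 1.-homog -> G2 \is 2.-homog -> q6 a%:MP c E G2 \is 6.-homog.
Proof.
move=> hc hE hG; rewrite /q6.
have hE2 : E ^+ 2 \is 2.-homog by exact: (dhomogMn 2 hE).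
have h1 : E ^+ 2 - G2 \is 2.-homog by apply: rpredB.
have h2 : E ^+ 4 + 6 * E ^+ 2 * G2 + G2 ^+ 2 \is 4.-homog.
  apply: rpredD; last exact: (dhomogMn 2 hG).
  apply: rpredD; first exact: (dhomogMn 4 hE).
  by rewrite -mulrA; apply: homog_natM; apply: (dhomogM hE2 hG).
have h3 : c * E * (E ^+ 2 + G2) \is 4.-homog.
  by rewrite -mulrA; apply: (dhomogM hc); apply: (dhomogM hE); apply: rpredD.
by apply: (dhomogM h1); apply: rpredD => //; apply: homog_CM.
Qed.

Lemma homog_phi9 M s t :
  phi9 s%:MP t%:MP (cform M 0) (cform M 1) (cform M 2) \is 6.-homog.
Proof.
have hX := homog_cform M 0; have hZ := homog_cform M 1; have hN := homog_cform M 2.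
rewrite /phi9 -mpolyCB -[1]mpolyC1; apply: homog_q6.
- by rewrite rpredN; apply: homog_natM; apply: homog_CM.
- apply: rpredB; first by apply: rpredB; apply: homog_CM.
  by apply: homog_natM; apply: homog_CM.
- rewrite rpredN; apply: homog_natM; do 2![apply: homog_CM]; exact: (dhomogMn 2 hN).
Qed.

Lemma homog_psi11 M s t :
  psi11 s%:MP t%:MP (cform M 0) (cform M 1) (cform M 2) \is 6.-homog.
Proof.
have hX := homog_cform M 0; have hZ := homog_cform M 1; have hN := homog_cform M 2.
have E1 : 3 * t%:MP - 4 * s%:MP = (3 * t - 4 * s)%:MP :> forms K.
  by rewrite mpolyCB !mpolyCM !mpolyC_nat.
have E2 : t%:MP - 4 * s%:MP = (t - 4 * s)%:MP :> forms K.
  by rewrite mpolyCB !mpolyCM !mpolyC_nat.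
have hH : cform M 0 - cform M 1 + 2 * cform M 2 \is 1.-homog.
  by apply: rpredD; [apply: rpredB|apply: homog_natM].
rewrite /psi11 E1 E2 -mpolyCB; apply: homog_q6.
- by apply: homog_natM; do 2![apply: homog_CM].
- by apply: rpredD; apply: homog_CM.
- by rewrite rpredN; do 2![apply: homog_CM]; exact: (dhomogMn 2 hH).
Qed.

Lemma ev_cform M j u w : ev (cform M j) u w = cf M j u w.
Proof. by rewrite !evE. Qed.

Definition sext9 s t M : 'rV[K]_7 :=
  coefs6 (phi9 s%:MP t%:MP (cform M 0) (cform M 1) (cform M 2)).
Definition sext11 s t M : 'rV[K]_7 :=
  coefs6 (psi11 s%:MP t%:MP (cform M 0) (cform M 1) (cform M 2)).

Lemma sx_sext9 s t M u w :
  sx (sext9 s t M) u w = phi9 s t (cf M 0 u w) (cf M 1 u w) (cf M 2 u w).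
Proof.
rewrite /sext9 sx_coefs6 ?homog_phi9 // -!ev_cform.
have := phi9_map (@meval 2 K (pt2 u w)) s%:MP t%:MP (cform M 0) (cform M 1) (cform M 2).
by rewrite /= !mevalC.
Qed.

Lemma sx_sext11 s t M u w :
  sx (sext11 s t M) u w = psi11 s t (cf M 0 u w) (cf M 1 u w) (cf M 2 u w).
Proof.
rewrite /sext11 sx_coefs6 ?homog_psi11 // -!ev_cform.
have := psi11_map (@meval 2 K (pt2 u w)) s%:MP t%:MP (cform M 0) (cform M 1) (cform M 2).
by rewrite /= !mevalC.
Qed.

End QuotientForms.

Section QuotientCurves.

Variable C : numClosedFieldType.
Implicit Types (x y u w s t : C) (M : 'M[C]_(2, 3)).

Definition F9 M : 'rV[forms C]_7 := sext9 X0 X1 (const_forms M).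
Definition F11 M : 'rV[forms C]_7 := sext11 X0 X1 (const_forms M).

Definition sxf (F : 'rV[forms C]_7) u w : forms C := sx F u%:MP w%:MP.

Lemma ev_sxf F u w s t : ev (sxf F u w) s t = sx (mev F s t) u w.
Proof.
have := sx_map (@meval 2 C (pt2 s t)) F u%:MP w%:MP.
by rewrite /= !mevalC.
Qed.

Lemma ev_cf M j s t u w : ev (cf (const_forms M) j u%:MP w%:MP) s t = cf M j u w.
Proof. by rewrite /cf !evE !mxE !evC. Qed.

Lemma sx_F9 M s t u w :
  sx (mev (F9 M) s t) u w = phi9 s t (cf M 0 u w) (cf M 1 u w) (cf M 2 u w).
Proof.
rewrite -ev_sxf /sxf sx_sext9 -!(ev_cf M _ s t).
apply: etrans; first exact: (phi9_map (@meval 2 C (pt2 s t))).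
by congr phi9; [exact: evX0 | exact: evX1].
Qed.

Lemma sx_F11 M s t u w :
  sx (mev (F11 M) s t) u w = psi11 s t (cf M 0 u w) (cf M 1 u w) (cf M 2 u w).
Proof.
rewrite -ev_sxf /sxf sx_sext11 -!(ev_cf M _ s t).
apply: etrans; first exact: (psi11_map (@meval 2 C (pt2 s t))).
by congr psi11; [exact: evX0 | exact: evX1].
Qed.

Lemma homogm_F9 M : homogm 6 (F9 M).
Proof.
move=> i j; rewrite ord1; apply: homog_of_ev => c s t.
suff : mev (F9 M) (c * s) (c * t) = c ^+ 6 *: mev (F9 M) s t.
  by move/matrixP/(_ 0 j); rewrite !mxE.
by apply: sx_inj => u w; rewrite sxZ !sx_F9 /phi9 /q6; ring.
Qed.

Lemma homogm_F11 M : homogm 7 (F11 M).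
Proof.
move=> i j; rewrite ord1; apply: homog_of_ev => c s t.
suff : mev (F11 M) (c * s) (c * t) = c ^+ 7 *: mev (F11 M) s t.
  by move/matrixP/(_ 0 j); rewrite !mxE.
by apply: sx_inj => u w; rewrite sxZ !sx_F11 /psi11 /q6; ring.
Qed.

Lemma f1_g9 M x y : f1 (mev (g9 M) x y) =
  (2 * al x y * (x * y)) *: mev (F9 M) (- al x y ^+ 2) ((x * y) ^+ 4).
Proof.
apply: sx_inj => u w; rewrite sxZ sx_F9 sx_f1 /cf !g9E.
set X := M 1 0 * u - M 0 0 * w; set Z := M 1 1 * u - M 0 1 * w; set N := M 1 2 * u - M 0 2 * w.
pose a := al x y; pose b := be x y.
have [x4 y4] : x ^+ 4 = b + a /\ y ^+ 4 = b - a by rewrite /a /b /al /be; split; field.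
pose E := a ^+ 2 * X + (x * y) ^+ 4 * Z + 2 * a ^+ 2 * N; pose G := 2 * a * b * N.
set l1 := _ * u - _ * w; set l2 := _ * w - _ * u.
have -> : l1 = y * (E + G).
  transitivity (y * (a ^+ 2 * X + (x * y) ^+ 4 * Z + 2 * a * x ^+ 4 * N)).
    by rewrite /l1 /X /Z /N /a; ring.
  by rewrite x4 /E /G; ring.
have -> : l2 = - x * (E - G).
  transitivity (- x * (a ^+ 2 * X + (x * y) ^+ 4 * Z - 2 * a * y ^+ 4 * N)).
    by rewrite /l2 /X /Z /N /a; ring.
  by rewrite y4 /E /G; ring.
have g4 : (x * y) ^+ 4 = b ^+ 2 - a ^+ 2 by rewrite albe -/a; ring.
have -> : f0 (y * (E + G)) (- x * (E - G)) =
   - (x * y) * (E ^+ 2 - G ^+ 2) * (y ^+ 4 * (E + G) ^+ 4 - x ^+ 4 * (E - G) ^+ 4).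
  by rewrite /f0; ring.
rewrite x4 y4 /phi9 /q6 -/a /E /G g4; ring.
Qed.

(** The linear factors of f1 (g11 M), freed from the monomials x^3 and y^3; see
    g11_l1 and g11_l2. *)
Definition L1 M x y u w : C := let a := al x y in let b := be x y in
  b ^+ 2 * cf M 1 u w - a ^+ 2 * cf M 0 u w
  + a * b * (cf M 0 u w - cf M 1 u w + 2 * cf M 2 u w).
Definition L2 M x y u w : C := let a := al x y in let b := be x y in
  - (b ^+ 2 * cf M 1 u w - a ^+ 2 * cf M 0 u w
  - a * b * (cf M 0 u w - cf M 1 u w + 2 * cf M 2 u w)).

Lemma g11_l1 M x y u w : mev (g11 M) x y 1 1 * u - mev (g11 M) x y 0 1 * w = x ^+ 3 * L1 M x y u w.
Proof. by rewrite !g11E /L1 /cf /al /be; field. Qed.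

Lemma g11_l2 M x y u w : mev (g11 M) x y 0 0 * w - mev (g11 M) x y 1 0 * u = y ^+ 3 * L2 M x y u w.
Proof. by rewrite !g11E /L2 /cf /al /be; field. Qed.

(** The right-hand side is l1 l2 (l1^4 - l2^4) without its factor (x y)^3, for l1 =
    x^3 L1 and l2 = y^3 L2. *)
Lemma psi11_factor M x y u w :
  - 2 * al x y * psi11 (- al x y ^+ 2) ((x * y) ^+ 4) (cf M 0 u w) (cf M 1 u w) (cf M 2 u w)
  = L1 M x y u w * L2 M x y u w *
    (x ^+ 12 * L1 M x y u w ^+ 4 - y ^+ 12 * L2 M x y u w ^+ 4).
Proof.
pose a := al x y; pose b := be x y.
have [x4 y4] : x ^+ 4 = b + a /\ y ^+ 4 = b - a by rewrite /a /b /al /be; split; field.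
have g4 : (x * y) ^+ 4 = b ^+ 2 - a ^+ 2 by rewrite albe -/a; ring.
rewrite (exprM x 4 3) (exprM y 4 3) x4 y4 g4 /psi11 /q6 /L1 /L2 -/a -/b; ring.
Qed.

Lemma f1_g11 M x y : f1 (mev (g11 M) x y) =
  (- 2 * al x y * (x * y) ^+ 3) *: mev (F11 M) (- al x y ^+ 2) ((x * y) ^+ 4).
Proof.
apply: sx_inj => u w; rewrite sxZ sx_F11 sx_f1 g11_l1 g11_l2.
have E := psi11_factor M x y u w.
transitivity ((x * y) ^+ 3 * (L1 M x y u w * L2 M x y u w *
    (x ^+ 12 * L1 M x y u w ^+ 4 - y ^+ 12 * L2 M x y u w ^+ 4))).
  by rewrite /f0; ring.
by rewrite -E; ring.
Qed.

End QuotientCurves.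

(** * The octahedral group as the stabilizer of six points *)

Section Octahedral.

Variable C : numClosedFieldType.
Implicit Types (x y : C) (A B : 'M[C]_2).

Notation ii := ('i : C).

Lemma ii2 : ii ^+ 2 = -1. Proof. exact: sqrCi. Qed.
Lemma ii_neq0 : ii != 0. Proof. exact: neq0Ci. Qed.
Lemma ii4 : ii ^+ 4 = 1. Proof. by rewrite (exprM _ 2 2) ii2 sqrrN expr1n. Qed.
Lemma two_neq0 : 2 != 0 :> C. Proof. by rewrite pnatr_eq0. Qed.

Definition mu4 : seq C := [:: 1; ii; -1; - ii].

Lemma mu4P x : x ^+ 4 = 1 -> x \in mu4.
Proof.
move=> x4; have /eqP : (x - 1) * (x - ii) * (x + 1) * (x + ii) = 0.
  rewrite (_ : _ * _ = (x ^+ 2 - 1) * (x ^+ 2 - ii ^+ 2)); last by ring.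
  by rewrite ii2; transitivity (x ^+ 4 - 1); [ring | rewrite x4 subrr].
rewrite !mulf_eq0 !subr_eq0 !addr_eq0 /mu4 !inE.
by case/orP => [/orP[/orP[|]|]|] ->; rewrite ?orbT.
Qed.

Lemma eq4P x y : x ^+ 4 = y ^+ 4 -> exists2 e, e ^+ 4 = 1 & x = e * y.
Proof.
have [->|y0] := eqVneq y 0.
  by rewrite expr0n => /eqP; rewrite expf_eq0 /= => /eqP ->; exists 1; rewrite ?expr1n ?mulr0.
move=> E; exists (x / y); last by rewrite divfK.
by rewrite expr_div_n E divff // expf_neq0.
Qed.

(** Permutations of the roots of uv(u^4 - v^4) by projectivities, in terms of matrix
    entries: those that fix 0 and infinity, those that exchange them, and those that
    send them to other roots. *)
Definition octa B :=
  [\/ [/\ B 0 1 = 0, B 1 0 = 0, B 0 0 != 0 & B 0 0 ^+ 4 = B 1 1 ^+ 4],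
      [/\ B 0 0 = 0, B 1 1 = 0, B 0 1 != 0 & B 0 1 ^+ 4 = B 1 0 ^+ 4] |
      [/\ B 0 0 != 0, B 0 1 ^+ 4 = B 0 0 ^+ 4, B 1 0 ^+ 4 = B 0 0 ^+ 4 &
          B 0 0 * B 1 1 = - (B 0 1 * B 1 0)]].

Definition vperm B := forall X Y : C, f0 X Y = 0 ->
  f0 (B 0 0 * X + B 0 1 * Y) (B 1 0 * X + B 1 1 * Y) = 0.

(** A cubic polynomial cannot have the four fourth roots of unity as roots. *)
Lemma roots4_coef (p q r s : C) :
  (forall e, e ^+ 4 = 1 -> p * e + q * e ^+ 2 + r * e ^+ 3 + s = 0) ->
  p = 0 /\ q = 0 /\ s = 0.
Proof.
move=> h; have m1 : (-1 : C) ^+ 4 = 1 by rewrite -signr_odd expr0.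
have mi : (- ii) ^+ 4 = 1 by rewrite exprNn ii4 mulr1.
have := h 1 (expr1n _ _); have := h (-1) m1; have := h ii ii4; have := h (- ii) mi.
set e1 := (X in X = 0); set e2 := (X in _ -> X = 0 -> _).
set e3 := (X in _ -> _ -> X = 0 -> _); set e4 := (X in _ -> _ -> _ -> X = 0 -> _).
move=> E1 E2 E3 E4.
have four : 4 != 0 :> C by rewrite pnatr_eq0.
split; [|split]; apply: (mulfI four); rewrite mulr0.
- transitivity (e4 - e3 - ii * e2 + ii * e1); first by rewrite /e1 /e2 /e3 /e4; ring: ii2.
  by rewrite E1 E2 E3 E4 !mulr0 !subr0 addr0.
- transitivity (e4 + e3 - e2 - e1); first by rewrite /e1 /e2 /e3 /e4; ring: ii2.
  by rewrite E1 E2 E3 E4 addr0 !subr0.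
- transitivity (e4 + e3 + e2 + e1); first by rewrite /e1 /e2 /e3 /e4; ring: ii2.
  by rewrite E1 E2 E3 E4 !addr0.
Qed.

(** At the six points the transformed sextic vanishes. All of its coefficients are
    therefore zero, except those of u^5 v and u v^5, which are opposite; this
    determines the shape of B. *)
Lemma vperm_octa B : B \in unitmx -> vperm B -> octa B.
Proof.
rewrite unit2 /octa; set a := B 0 0; set b := B 0 1; set c := B 1 0; set d := B 1 1.
move=> d0 hB.
have nz k : (k.+1)%:R != 0 :> C by rewrite pnatr_eq0.
have Q0 : a * c * (a ^+ 4 - c ^+ 4) = 0.
  by have := hB 1 0; rewrite !mulr0 !mulr1 !addr0 /f0 => -> //; rewrite mul1r mul0r.
have Q6 : b * d * (b ^+ 4 - d ^+ 4) = 0.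
  by have := hB 0 1; rewrite !mulr0 !mulr1 !add0r /f0 => -> //; rewrite !mul0r.
(* The coefficients of the transformed sextic, apart from the extreme ones, which vanish by Q0 and Q6. *)
pose c1 := 5 * a ^+ 4 * b * c + a ^+ 5 * d - (5 * c ^+ 4 * d * a + c ^+ 5 * b).
pose c5 := 5 * a * b ^+ 4 * d + b ^+ 5 * c - (5 * c * d ^+ 4 * b + d ^+ 5 * a).
pose c2 := 10 * a ^+ 3 * b ^+ 2 * c + 5 * a ^+ 4 * b * d
    - (10 * c ^+ 3 * d ^+ 2 * a + 5 * c ^+ 4 * d * b).
pose c3 := 10 * a ^+ 2 * b ^+ 3 * c + 10 * a ^+ 3 * b ^+ 2 * d
    - (10 * c ^+ 2 * d ^+ 3 * a + 10 * c ^+ 3 * d ^+ 2 * b).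
pose c4 := 5 * a * b ^+ 4 * c + 10 * a ^+ 2 * b ^+ 3 * d
    - (5 * c * d ^+ 4 * a + 10 * c ^+ 2 * d ^+ 3 * b).
have Qe e : e ^+ 4 = 1 -> c1 * e + c2 * e ^+ 2 + c3 * e ^+ 3 + c4 + c5 * e = 0.
  move=> e4; have e40 : f0 1 e = 0 by rewrite /f0 expr1n e4 subrr mulr0.
  have e5 : e ^+ 5 = e by rewrite exprS e4 mulr1.
  have e6 : e ^+ 6 = e ^+ 2 by rewrite (exprD _ 2 4) e4 mulr1.
  have := hB 1 e e40; rewrite -/a -/b -/c -/d !mulr1 => E; rewrite -[RHS]E.
  transitivity (a * c * (a ^+ 4 - c ^+ 4) + c1 * e + c2 * e ^+ 2 + c3 * e ^+ 3 +
     c4 * e ^+ 4 + c5 * e ^+ 5 + b * d * (b ^+ 4 - d ^+ 4) * e ^+ 6).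
    by rewrite Q0 Q6 e4 e5; ring.
  by rewrite /f0 /c1 /c2 /c3 /c4 /c5; ring.
have [F15 [F2 F4]] : c1 + c5 = 0 /\ c2 = 0 /\ c4 = 0.
  by apply: (@roots4_coef _ _ c3) => e /Qe <-; ring.
have [a0|a0] := eqVneq a 0.
  apply: Or32; move: d0; rewrite a0 mul0r sub0r oppr_eq0 mulf_eq0 negb_or => /andP[b0 c0].
  have dd : d = 0.
    apply: (mulfI (mulf_neq0 (nz 4) (mulf_neq0 (expf_neq0 4 c0) b0))).
    by rewrite mulr0 -[RHS]oppr0 -F2 /c2 a0; ring.
  split=> //; apply/eqP; rewrite -subr_eq0; apply/eqP.
  by apply: (mulfI (mulf_neq0 b0 c0)); rewrite mulr0 -[RHS]F15 /c1 /c5 a0 dd; ring.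
have [d1|d1] := eqVneq d 0.
  move: d0; rewrite d1 mulr0 sub0r oppr_eq0 mulf_eq0 negb_or => /andP[b0 c0].
  have : 5 * a * (b ^+ 4 * c) = 0 by rewrite -[RHS]F4 /c4 d1; ring.
  move/eqP; rewrite !mulf_eq0 (negPf (nz 4)) (negPf a0) (negPf b0) (negPf c0).
  by [].
have [b0|b0] := eqVneq b 0.
  have cc : c = 0.
    have : 10 * c ^+ 3 * (d ^+ 2 * a) = 0 by rewrite -[RHS]oppr0 -F2 /c2 b0; ring.
    move/eqP; rewrite !mulf_eq0 (negPf (nz 9)) (negPf d1) (negPf a0) !orbF !orbb.
    by move/eqP.
  apply: Or31; split=> //; apply/eqP; rewrite -subr_eq0; apply/eqP.
  by apply: (mulfI (mulf_neq0 a0 d1)); rewrite mulr0 -[RHS]F15 /c1 /c5 b0 cc; ring.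
have [c0|c0] := eqVneq c 0.
  have : 10 * b ^+ 3 * (a ^+ 2 * d) = 0 by rewrite -[RHS]F4 /c4 c0; ring.
  move/eqP; rewrite !mulf_eq0 (negPf (nz 9)) (negPf d1) (negPf a0) (negPf b0).
  by [].
apply: Or33; split=> //.
- have ac : a ^+ 4 = c ^+ 4.
    by apply/eqP; rewrite -subr_eq0; move/eqP: Q0; rewrite !mulf_eq0 (negPf a0) (negPf c0).
  have bd : b ^+ 4 = d ^+ 4.
    by apply/eqP; rewrite -subr_eq0; move/eqP: Q6; rewrite !mulf_eq0 (negPf b0) (negPf d1).
  apply/eqP; rewrite -subr_eq0; apply/eqP; apply: (mulfI (mulf_neq0 (nz 3) d0)).
  rewrite mulr0 -[RHS]F15 /c1 /c5 !(exprS _ 4) -ac -bd; ring.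
- by apply/eqP; rewrite eq_sym -subr_eq0; move/eqP: Q0; rewrite !mulf_eq0 (negPf a0) (negPf c0).
have ac : c ^+ 4 = a ^+ 4.
  by apply/eqP; rewrite eq_sym -subr_eq0; move/eqP: Q0; rewrite !mulf_eq0 (negPf a0) (negPf c0).
have bd : d ^+ 4 = b ^+ 4.
  by apply/eqP; rewrite eq_sym -subr_eq0; move/eqP: Q6; rewrite !mulf_eq0 (negPf b0) (negPf d1).
have /eqP : (a * b) ^+ 2 - (c * d) ^+ 2 = 0.
  apply: (mulfI (mulf_neq0 (nz 9) (mulf_neq0 a0 c0))); rewrite mulr0 -[RHS]F2.
  transitivity (c2 - 5 * b * d * (a ^+ 4 - c ^+ 4)); first by rewrite /c2; ring.
  by rewrite ac subrr mulr0 subr0.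
have [e e4 ce] := eq4P ac; have [f f4 df] := eq4P bd.
rewrite subr_eq0 eqf_sqr => h.
have ef : e ^+ 2 * f ^+ 2 = 1.
  apply: (mulfI (expf_neq0 2 (mulf_neq0 a0 b0))).
  transitivity ((c * d) ^+ 2); first by rewrite ce df; ring.
  by case/orP: h => /eqP ->; rewrite ?sqrrN mulr1.
have e0 : e != 0 by apply: contraNneq c0 => e0; rewrite ce e0 mul0r.
have : (f - e) * (f + e) = 0.
  transitivity (f ^+ 2 - e ^+ 2 * (e ^+ 2 * f ^+ 2)); first by rewrite ef; ring.
  by transitivity (f ^+ 2 * (1 - e ^+ 4)); [ring | rewrite e4 subrr mulr0].
move/eqP; rewrite mulf_eq0 subr_eq0 => /orP[/eqP fe|].
  by case/eqP: d0; rewrite ce df fe; ring.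
by rewrite addr_eq0 => /eqP fe; rewrite ce df fe; ring.
Qed.

Lemma octa_tr B : octa B -> octa B^T.
Proof.
case=> [[E1 E2 E3 E4]|[E1 E2 E3 E4]|[E1 E2 E3 E4]]; rewrite /octa !mxE.
- by apply: Or31.
- apply: Or32; split=> //.
  by apply: contraNneq E3 => h; move/eqP: E4; rewrite h expr0n expf_eq0.
- by apply: Or33; split=> //; rewrite E4 mulrC.
Qed.

Lemma octa_unit B : octa B -> B \in unitmx.
Proof.
rewrite unit2; case=> [[E1 E2 E3 E4]|[E1 E2 E3 E4]|[E1 E2 E3 E4]].
- rewrite E1 mul0r subr0 mulf_neq0 //; apply: contraNneq E3 => h.
  by move/eqP: E4; rewrite h expr0n expf_eq0.
- rewrite E1 mul0r sub0r oppr_eq0 mulf_neq0 //; apply: contraNneq E3 => h.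
  by move/eqP: E4; rewrite h expr0n expf_eq0.
have h x : x ^+ 4 = B 0 0 ^+ 4 -> x != 0.
  by move=> E; apply: contraNneq E1 => x0; move/eqP: E; rewrite x0 expr0n eq_sym expf_eq0.
by rewrite E4 -opprD oppr_eq0 -mulr2n -mulr_natl !mulf_neq0 ?two_neq0 ?h.
Qed.

Definition S4scal B := exists c S, [/\ c != 0, S4star S & B = c *: S].

Lemma S4scal_mul A B : S4scal A -> S4scal B -> S4scal (A *m B).
Proof.
move=> [a [S [a0 hS ->]]] [b [T [b0 hT ->]]]; exists (a * b), (S *m T).
by split; rewrite ?mulf_neq0 //; [exact: S4star_mul | rewrite -scalemxAl -scalemxAr scalerA].
Qed.

Lemma S4scal_scale c B : c != 0 -> S4scal B -> S4scal (c *: B).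
Proof.
move=> c0 [b [T [b0 hT ->]]]; exists (c * b), T.
by split; rewrite ?mulf_neq0 // scalerA.
Qed.

Lemma zeta8_neq0 : zeta8 C != 0.
Proof.
rewrite /zeta8 mulf_neq0 // ?invr_eq0 ?sqrtC_eq0 ?two_neq0 //.
apply/eqP => h; have : ii ^+ 2 = 1.
  by rewrite (_ : ii = -1) ?sqrrN ?expr1n //; apply/eqP; rewrite eq_sym -subr_eq0 -opprD h oppr0.
by rewrite ii2 => /eqP; rewrite eq_sym -subr_eq0 opprK -mulr2n pnatr_eq0.
Qed.

Lemma zeta8_sq : zeta8 C ^+ 2 = ii.
Proof.
rewrite /zeta8 expr_div_n sqrtCK sqrrD ii2 expr1n mul1r.
by apply: (mulIf two_neq0); rewrite divfK ?two_neq0 // -mulr_natl; ring.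
Qed.

Lemma S4scal_diag x : x ^+ 4 = 1 -> S4scal (mk2 x 0 0 1).
Proof.
have gen : S4scal (mk2 ii 0 0 1).
  exists (zeta8 C), (mx22 (zeta8 C) 0 0 (zeta8 C)^-1).
  split; [exact: zeta8_neq0 | exact: S4star_diag | apply/mx2P; rewrite !mxE /= ?mulr0 //].
    by rewrite -expr2 zeta8_sq.
  by rewrite divff // zeta8_neq0.
have D y z : mk2 y 0 0 1 *m mk2 z 0 0 1 = mk2 (y * z) 0 0 1 :> 'M[C]_2.
  by apply/mx2P; rewrite mul2E !mk2E ?mulr0 ?mul0r ?addr0 ?add0r ?mulr1.
have h2 := S4scal_mul gen gen; have h3 := S4scal_mul h2 gen; have h4 := S4scal_mul h3 gen.
move=> /mu4P; rewrite /mu4 !inE; case/or4P => /eqP ->.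
- by move: h4; rewrite !D -!expr2 -!exprSr ii4.
- exact: gen.
- by move: h2; rewrite !D -expr2 ii2.
- by move: h3; rewrite !D -expr2 ii2 mulN1r.
Qed.

Lemma S4scal_rot : S4scal (mk2 1 (-1) 1 1).
Proof.
exists (sqrtC 2), ((sqrtC 2)^-1 *: mx22 1 (-1) 1 1); split; first by rewrite sqrtC_eq0 two_neq0.
  exact: S4star_rot.
rewrite scalerA divff ?sqrtC_eq0 ?two_neq0 // scale1r.
by apply/mx2P; rewrite !mxE.
Qed.

(** Each shape is a product of diagonal matrices of order dividing 4, up to scalars,
    and of the rotation by a quarter turn. *)
Lemma octa_S4scal B : octa B -> S4scal B.
Proof.
have diag a d : d != 0 -> a ^+ 4 = d ^+ 4 -> S4scal (mk2 a 0 0 d).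
  move=> d0 ad; have -> : mk2 a 0 0 d = d *: mk2 (a / d) 0 0 1.
    by apply/mx2P; rewrite !mxE /= ?mulr0 ?mulr1 // mulrC divfK.
  apply: S4scal_scale => //; apply: S4scal_diag.
  by rewrite expr_div_n ad divff // expf_neq0.
move=> hB; case: (hB) => [[E1 E2 E3 E4]|[E1 E2 E3 E4]|[E1 E2 E3 E4]].
- have -> : B = mk2 (B 0 0) 0 0 (B 1 1) by apply/mx2P; rewrite !mk2E.
  by apply: diag => //; apply: contraNneq E3 => h; move/eqP: E4; rewrite h expr0n expf_eq0.
- have c0 : B 1 0 != 0 by apply: contraNneq E3 => h; move/eqP: E4; rewrite h expr0n expf_eq0.
  have -> : B = 2^-1 *: (mk2 (- B 0 1) 0 0 (B 1 0) *m (mk2 1 (-1) 1 1 *m mk2 1 (-1) 1 1)).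
    by apply/mx2P; rewrite !mxE !big_ord_recl !big_ord0 !mxE !big_ord_recl !big_ord0 !mxE /= ?E1 ?E2; field.
  apply: S4scal_scale; first by rewrite invr_eq0 two_neq0.
  apply: S4scal_mul; last exact: (S4scal_mul S4scal_rot S4scal_rot).
  by apply: diag => //; rewrite exprNn -signr_odd expr0 mul1r.
have h x : x ^+ 4 = B 0 0 ^+ 4 -> x != 0.
  by move=> E; apply: contraNneq E1 => x0; move/eqP: E; rewrite x0 expr0n eq_sym expf_eq0.
have -> : B = mk2 (B 0 0) 0 0 (B 1 0) *m mk2 1 (-1) 1 1 *m mk2 1 0 0 (- (B 0 1 / B 0 0)).
  apply/mx2P; rewrite !mul2E !mk2E; [by field | by field | by field |].
  by apply: (mulfI E1); rewrite E4; field.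
apply: S4scal_mul; first by apply: S4scal_mul; [apply: diag; rewrite ?h | exact: S4scal_rot].
apply: diag; first by rewrite oppr_eq0 mulf_neq0 ?invr_eq0 // h.
by rewrite exprNn -signr_odd expr0 mul1r expr_div_n E2 divff ?expf_neq0 // expr1n.
Qed.

(** The sextic is mapped to a multiple of itself by each generator. *)
Lemma S4star_stab S : S4star S -> S \in unitmx /\
  exists2 c, c != 0 & forall X Y : C,
    f0 (S 0 0 * X + S 0 1 * Y) (S 1 0 * X + S 1 1 * Y) = c * f0 X Y.
Proof.
elim=> {S} [|||A B _ [uA [a a0 hA]] _ [uB [b b0 hB]]|A _ [uA [a a0 hA]]].
- have z0 := zeta8_neq0; have z4 : zeta8 C ^+ 4 = -1 by rewrite (exprM _ 2 2) zeta8_sq ii2.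
  move: (zeta8 C) z0 z4 => z z0 z4.
  split; first by rewrite unit2 !mxE /= mulr0 subr0 divff ?oner_eq0.
  exists (-1) => [|X Y]; first by rewrite oppr_eq0 oner_eq0.
  rewrite !mxE /= !mul0r addr0 add0r /f0 !exprMn z4 exprVn z4 invrN1.
  by field.
- have s0 : sqrtC 2 != 0 :> C by rewrite sqrtC_eq0 two_neq0.
  have s2 : sqrtC 2 ^+ 2 = 2 :> C by rewrite sqrtCK.
  split.
    rewrite unit2 !mxE /= (_ : _ - _ = 2 * (sqrtC 2)^-1 ^+ 2); last by ring.
    by rewrite exprVn s2 divff ?two_neq0 ?oner_eq0.
  exists (-1) => [|X Y]; first by rewrite oppr_eq0 oner_eq0.
  rewrite !mxE /= !mulr1 mulrN1 /f0.
  have -> : forall s : C, (s * X + - s * Y) * (s * X + s * Y) * ((s * X + - s * Y) ^+ 4 - (s * X + s * Y) ^+ 4)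
      = - (s ^+ 2) ^+ 3 * 8 * (X * Y * (X ^+ 4 - Y ^+ 4)) by move=> s; ring.
  by rewrite exprVn s2; field.
- split; first exact: unitmx1.
  by exists 1; rewrite ?oner_eq0 // => X Y; rewrite !mxE /= !mul1r !mul0r addr0 add0r.
- split; first by rewrite unitmx_mul uA.
  exists (a * b); first by rewrite mulf_neq0.
  move=> X Y; rewrite -mulrA -hB -hA !mul2E; congr f0; ring.
- split; first by rewrite unitmx_inv.
  exists a^-1; first by rewrite invr_eq0.
  move=> X Y; apply: (mulfI a0); rewrite mulVKf // -hA.
  set u := invmx A 0 0 * X + _; set w := invmx A 1 0 * X + _.
  have /matrixP E : A *m invmx A = 1%:M by rewrite mulmxV.
  have := E 0 0; have := E 0 1; have := E 1 0; have := E 1 1; rewrite !mul2E !mxE /= => E11 E10 E01 E00.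
  congr f0; rewrite /u /w.
    transitivity ((A 0 0 * invmx A 0 0 + A 0 1 * invmx A 1 0) * X + (A 0 0 * invmx A 0 1 + A 0 1 * invmx A 1 1) * Y); first by ring.
    by rewrite E00 E01 mul1r mul0r addr0.
  transitivity ((A 1 0 * invmx A 0 0 + A 1 1 * invmx A 1 0) * X + (A 1 0 * invmx A 0 1 + A 1 1 * invmx A 1 1) * Y); first by ring.
  by rewrite E10 E11 mul1r mul0r add0r.
Qed.

Lemma S4star_octa S : S4star S -> octa S.
Proof.
move=> /S4star_stab [uS [c c0 hS]]; apply: vperm_octa => // X Y h.
by rewrite hS h mulr0.
Qed.

(** One matrix for each of the 24 rotations of the octahedron. *)
Definition octa_reps : seq 'M[C]_2 :=
  [seq mk2 x 0 0 1 | x <- mu4] ++ [seq mk2 0 x 1 0 | x <- mu4] ++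
  [seq mk2 1 d e (- (d * e)) | d <- mu4, e <- mu4].

Lemma octa_repsP B : octa B -> exists2 r, r \in octa_reps & exists2 c, c != 0 & B = c *: r.
Proof.
rewrite /octa_reps; case=> [[E1 E2 E3 E4]|[E1 E2 E3 E4]|[E1 E2 E3 E4]].
- have d0 : B 1 1 != 0 by apply: contraNneq E3 => h; move/eqP: E4; rewrite h expr0n expf_eq0.
  have [e e4 ae] := eq4P E4; exists (mk2 e 0 0 1).
    by rewrite mem_cat; apply/orP; left; apply/mapP; exists e; rewrite ?mu4P.
  by exists (B 1 1) => //; apply/mx2P; rewrite !mxE /= ?mulr0 ?mulr1 // mulrC.
- have c0 : B 1 0 != 0 by apply: contraNneq E3 => h; move/eqP: E4; rewrite h expr0n expf_eq0.
  have [e e4 ae] := eq4P E4; exists (mk2 0 e 1 0).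
    rewrite !mem_cat; apply/orP; right; apply/orP; left.
    by apply/mapP; exists e; rewrite ?mu4P.
  by exists (B 1 0) => //; apply/mx2P; rewrite !mxE /= ?mulr0 ?mulr1 // mulrC.
have [d d4 bd] := eq4P E2; have [e e4 ce] := eq4P E3.
exists (mk2 1 d e (- (d * e))).
  rewrite mem_cat; apply/orP; right; rewrite mem_cat; apply/orP; right.
  by apply/allpairsP; exists (d, e); split; rewrite ?mu4P.
exists (B 0 0) => //; apply/mx2P; rewrite !mxE /= ?mulr1 //; try by rewrite mulrC.
by apply: (mulfI E1); rewrite E4 bd ce; ring.
Qed.

(** ** Comparing two lifts of the same curve *)

(** Over the field of constants the sextic splits into linear factors, so that its
    zeros over K are multiples of constant points. *)
Lemma f0_factor (K : idomainType) (phi : {rmorphism C -> K}) (P Q : K) : f0 P Q = 0 ->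
  exists n v0 v1, [/\ nz v0 v1, P = n * phi v0 & Q = n * phi v1].
Proof.
move/eqP; rewrite /f0 !mulf_eq0 => /orP[/orP[|]/eqP ->|].
- by exists Q, 0, 1; rewrite /nz oner_eq0 orbT rmorph0 rmorph1 mulr0 mulr1.
- by exists P, 1, 0; rewrite /nz oner_eq0 rmorph0 rmorph1 mulr0 mulr1.
have -> : P ^+ 4 - Q ^+ 4 = (P - Q) * (P + Q) * (P - phi ii * Q) * (P + phi ii * Q).
  have : phi ii ^+ 2 = -1 by rewrite -rmorphXn ii2 rmorphN1.
  by move=> h; transitivity ((P - Q) * (P + Q) * (P ^+ 2 - (phi ii) ^+ 2 * Q ^+ 2)); [rewrite h; ring | ring].
rewrite !mulf_eq0 !subr_eq0 !addr_eq0.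
case/orP => [/orP[/orP[|]|]|] /eqP ->; exists Q.
- by exists 1, 1; rewrite /nz oner_eq0 rmorph1 mulr1.
- by exists (-1), 1; rewrite /nz oner_eq0 orbT rmorphN1 rmorph1 mulrN1 mulr1.
- by exists ii, 1; rewrite /nz oner_eq0 orbT rmorph1 mulr1 mulrC.
- by exists (- ii), 1; rewrite /nz oner_eq0 orbT rmorph1 rmorphN mulr1 mulrN mulrC.
Qed.

Lemma sx_f1_mul (K : comNzRingType) (g g' : 'M[K]_2) X Y :
  sx (f1 g) (g' 0 0 * X + g' 0 1 * Y) (g' 1 0 * X + g' 1 1 * Y) =
  f0 ((\adj g *m g') 0 0 * X + (\adj g *m g') 0 1 * Y)
     ((\adj g *m g') 1 0 * X + (\adj g *m g') 1 1 * Y).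
Proof. by rewrite sx_f1 !mul2E adj2 !mk2E; congr f0; ring. Qed.

(** A projectivity over the function field that sends each of the six points to
    one of the six points is constant, being determined by three of them. *)
Lemma const_octa (N : 'M[forms C]_2) : \det N != 0 ->
  (forall X Y : C, f0 X Y = 0 ->
     f0 (N 0 0 * X%:MP + N 0 1 * Y%:MP) (N 1 0 * X%:MP + N 1 1 * Y%:MP) = 0) ->
  exists n B, [/\ n != 0, octa B & N = n *: const_forms B].
Proof.
rewrite det2 => detN key.
have [a00 [a01 [a10 [a11 NE0]]]] : exists a b c d, N = mk2 a b c d.
  by exists (N 0 0), (N 0 1), (N 1 0), (N 1 1); apply/mx2P; rewrite !mk2E.
rewrite {N}NE0 !mk2E in detN key *.
(* The images of (1,0), (0,1) and (1,1) are multiples of constant points. *)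
have [n1 [v0 [v1 [vnz E00 E10]]]] : exists n v0 v1, [/\ nz v0 v1, a00 = n * v0%:MP & a10 = n * v1%:MP].
  apply: (@f0_factor (forms C) (@mpolyC 2 C)).
  have h : f0 (1 : C) 0 = 0 by rewrite /f0 mulr0 mul0r.
  by have := key _ _ h; rewrite mpolyC1 mpolyC0 !mulr0 !mulr1 !addr0.
have [n2 [w0 [w1 [wnz E01 E11]]]] : exists n v0 v1, [/\ nz v0 v1, a01 = n * v0%:MP & a11 = n * v1%:MP].
  apply: (@f0_factor (forms C) (@mpolyC 2 C)).
  have h : f0 (0 : C) 1 = 0 by rewrite /f0 !mul0r.
  by have := key _ _ h; rewrite mpolyC1 mpolyC0 !mulr0 !mulr1 !add0r.
have [n3 [z0 [z1 [znz Ez0 Ez1]]]] : exists n v0 v1, [/\ nz v0 v1,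
    a00 + a01 = n * v0%:MP & a10 + a11 = n * v1%:MP].
  apply: (@f0_factor (forms C) (@mpolyC 2 C)).
  have h : f0 (1 : C) 1 = 0 by rewrite /f0 subrr mulr0.
  by have := key _ _ h; rewrite mpolyC1 !mulr1.
have dE : a00 * a11 - a01 * a10 = n1 * n2 * (v0 * w1 - w0 * v1)%:MP.
  by rewrite E00 E10 E01 E11 mpolyCB !mpolyCM; ring.
move: (detN); rewrite dE !mulf_eq0 !negb_or => /andP[/andP[n10 n20] vw].
(* The third image is the sum of the first two, hence the ratio of n1 and n2 is constant. *)
have rel : n1 * (v0 * z1 - z0 * v1)%:MP + n2 * (w0 * z1 - z0 * w1)%:MP = 0.
  transitivity ((a00 + a01) * z1%:MP - (a10 + a11) * z0%:MP).
    by rewrite E00 E10 E01 E11 !mpolyCB !mpolyCM; ring.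
  by rewrite Ez0 Ez1; ring.
rewrite mpolyC_eq0 in vw.
have wz : w0 * z1 - z0 * w1 != 0.
  apply: contraNneq vw => wz; move: rel; rewrite wz mpolyC0 mulr0 addr0 => /eqP.
  rewrite mulf_eq0 (negPf n10) mpolyC_eq0 => /eqP vz.
  case/orP: znz => zz; apply/eqP; apply: (mulfI zz); rewrite mulr0.
    transitivity (w0 * (v0 * z1 - z0 * v1) - v0 * (w0 * z1 - z0 * w1)); first by ring.
    by rewrite vz wz; ring.
  transitivity (w1 * (v0 * z1 - z0 * v1) - v1 * (w0 * z1 - z0 * w1)); first by ring.
  by rewrite vz wz; ring.
pose k := - (v0 * z1 - z0 * v1) / (w0 * z1 - z0 * w1).
have n2E : n2 = n1 * k%:MP.
  have wz' : (w0 * z1 - z0 * w1)%:MP != 0 :> forms C by rewrite mpolyC_eq0.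
  apply: (mulIf wz'); rewrite -mulrA -mpolyCM /k divfK // mpolyCN mulrN.
  by apply/eqP; rewrite -subr_eq0 opprK addrC rel.
clearbody k; pose B := mk2 v0 (k * w0) v1 (k * w1).
have NE : mk2 a00 a01 a10 a11 = n1 *: const_forms B.
  apply/mx2P; rewrite mk2E !mxE /=.
  - exact: E00.
  - by rewrite E01 n2E mpolyCM mulrA.
  - exact: E10.
  - by rewrite E11 n2E mpolyCM mulrA.
have uB : B \in unitmx.
  rewrite unit2 !mk2E; apply: contraNneq vw => h.
  have k0 : k != 0 by apply: contraNneq n20 => k0; rewrite n2E k0 mpolyC0 mulr0.
  by apply/eqP; apply: (mulfI k0); rewrite mulr0 -[RHS]h; ring.
exists n1, B; split=> //; apply: vperm_octa => // X Y XY; rewrite !mk2E.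
have h : n1 ^+ 6 * (f0 (v0 * X + k * w0 * Y) (v1 * X + k * w1 * Y))%:MP = 0.
  rewrite -[RHS](key X Y XY) E00 E10 E01 E11 n2E /f0.
  by rewrite !(mpolyCM, mpolyCB, mpolyCD, rmorphXn) /=; ring.
by move/eqP: h; rewrite mulf_eq0 expf_eq0 (negPf n10) /= mpolyC_eq0 => /eqP.
Qed.

(** If f1 g = f1 g' as rational maps then g' = g B for a constant B in the
    stabilizer of the six points. *)
Lemma same_image_octa (g g' : 'M[forms C]_2) : \det g != 0 -> \det g' != 0 ->
  proj_eq (f1 g') (f1 g) ->
  exists2 B, octa B & proj_eq g' (g *m const_forms B).
Proof.
move=> dg dg' [p [q [p0 q0 E]]].
have [|X Y XY0|n [B [n0 oB NE]]] := @const_octa (\adj g *m g').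
- have -> : \det (\adj g *m g') = \det g * \det g'.
    by rewrite !det2 !mul2E adj2 !mk2E; ring.
  exact: mulf_neq0.
- rewrite -sx_f1_mul; apply: (mulfI q0); rewrite mulr0 -sxZ -E sxZ sx_f1_mul.
  rewrite mul_adj_mx !mxE /= !mulr1n !mulr0n !mul0r addr0 add0r.
  have -> : f0 (\det g' * X%:MP) (\det g' * Y%:MP) = \det g' ^+ 6 * (f0 X Y)%:MP.
    by rewrite /f0 !(mpolyCM, mpolyCB, rmorphXn) /=; ring.
  by rewrite XY0 mpolyC0 !mulr0.
exists B; first exact: oB.
exists (\det g), n; split; [exact: dg | exact: n0 |].
by rewrite scalemxAr -NE mulmxA mul_mx_adj mul_scalar_mx.
Qed.

End Octahedral.

(** * Dihedral coverings *)

Lemma D4_generators : exists x y : 'D_8, [/\ (x ^+ 4 = 1)%g, (y ^+ 2 = 1)%g,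
  (y * x = x ^+ 3 * y)%g, (x * x != 1)%g &
  bijective (fun ij : 'I_4 * 'I_2 => (x ^+ ij.1 * y ^+ ij.2)%g)].
Proof.
have [|[x y] [oG _ ox /setDP[_ ny]] [oy xy]] := @generators_2dihedral _ [set: 'D_8]%G 3 isT.
  exact: isog_refl.
have x4 : (x ^+ 4 = 1)%g by have := expg_order x; rewrite ox.
have y2 : (y ^+ 2 = 1)%g by have := expg_order y; rewrite oy.
have yy : (y * y = 1)%g by rewrite -y2 expgS expg1.
have yV : (y^-1 = y)%g by apply/eqP; rewrite eq_invg_mul yy.
exists x, y; split=> //.
- have x3 : (x^-1 = x ^+ 3)%g by apply/eqP; rewrite eq_invg_mul -expgS x4.
  by rewrite -x3 -xy conjgE yV -!mulgA yy mulg1.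
- by have := @order_dvdn _ x 2; rewrite ox expgS expg1 => <-.
apply: inj_card_bij; last first.
  rewrite card_prod !card_ord -cardsT.
  by have := @card_2dihedral 3 isT; rewrite cardsT => ->.
move=> [i j] [k l] /= E.
have inX (a b : nat) : (x ^+ a * (x ^+ b)^-1 \in <[x]>)%g.
  by rewrite groupM ?groupV ?mem_cycle.
have [jl|jl] := eqVneq j l.
  move: E; rewrite jl => /mulIg /eqP; rewrite eq_expg_mod_order ox !modn_small // => /eqP ik.
  by congr (_, _); apply: val_inj.
case/negP: ny.
have : (y ^+ j * (y ^+ l)^-1 = (x ^+ i)^-1 * x ^+ k)%g.
  by apply: (mulgI (x ^+ i)%g); rewrite !mulgA E mulgK mulgV mul1g.
have inX' (a b : nat) : ((x ^+ a)^-1 * x ^+ b \in <[x]>)%g.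
  by rewrite groupM ?groupV ?mem_cycle.
case: j jl {E} => -[|[|//]] hj; case: l => -[|[|//]] hl jl //=;
  rewrite ?expg0 ?expg1 ?invg1 ?mulg1 ?mul1g ?yV => ->; exact: inX'.
Qed.

Section DihedralCovers.

Variable C : numClosedFieldType.
Implicit Types (x y c : C) (A B : 'M[C]_2) (phi : 'cV[forms C]_2).

Notation ii := ('i : C).

Lemma hform_coef0 n (c : nat -> C) : (forall x y, ev (hform n c) x y = 0) ->
  forall k, (k <= n)%N -> c k = 0.
Proof.
move=> h k kn; pose P : {poly C} := \poly_(i < n.+1) c i.
have : P = 0.
  apply: poly_eq0_fun => t; rewrite horner_poly -[RHS](h t 1) ev_hform.
  by apply: eq_bigr => i _; rewrite expr1n mulr1.
by move/(congr1 (fun p : {poly C} => p`_k)); rewrite coef_poly ltnS kn coef0.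
Qed.

Lemma curve_phi : is_curve 8 (phi_D4 C).
Proof.
apply/curveP; split; first exact: homog_phi.
move=> x y /phi_nz; rewrite -phi0E -phi1E => h; apply: contraTneq h => E.
by rewrite -!mevP E !mxE /nz eqxx.
Qed.

Definition rotm k : 'M[C]_2 := mk2 (ii ^+ k) 0 0 1.
Definition refm k : 'M[C]_2 := mk2 0 (ii ^+ k) 1 0.
Definition dm k (b : bool) := if b then refm k else rotm k.

Lemma ii_mod k : ii ^+ k = ii ^+ (k %% 4).
Proof. by rewrite {1}(divn_eq k 4) exprD mulnC exprM ii4 expr1n mul1r. Qed.

Lemma mu4_pow x : x ^+ 4 = 1 -> exists2 k, (k < 4)%N & x = ii ^+ k.
Proof.
move/mu4P; rewrite /mu4 !inE; case/or4P => /eqP ->.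
- by exists 0%N.
- by exists 1%N.
- by exists 2%N; rewrite // ii2.
- by exists 3%N; rewrite // exprS ii2 mulrN1.
Qed.

Lemma dm_octa k b : octa (dm k b).
Proof.
case: b; [apply: Or32|apply: Or31]; rewrite !mk2E; split=> //;
by rewrite ?expf_neq0 ?ii_neq0 // -exprM mulnC exprM ii4 !expr1n.
Qed.

Lemma dm_unit k b : dm k b \in unitmx.
Proof. exact: octa_unit (dm_octa k b). Qed.

(** Deck transformations preserve the zeros of gamma, which makes them diagonal or
    antidiagonal, and those of alpha, among which is (1,1), which makes the ratio of
    their entries a fourth root of unity. *)
Lemma deck_phi_D4 sigma : deck (phi_D4 C) sigma <->
  exists c k b, [/\ c != 0, (k < 4)%N & sigma = c *: dm k b].
Proof.
split=> [[us hs]|[c [k [b [c0 k4 ->]]]]]; last first.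
  split; first by rewrite unitmxZ ?unitfE // dm_unit.
  have e0 : (c ^+ 8)%:MP != 0 :> forms C by rewrite mpolyC_eq0 expf_neq0.
  apply: (proj_scale e0); apply: mev_inj => x y; rewrite mevZ evC mev_moebius.
  have k8 : (ii ^+ k) ^+ 4 = 1 by rewrite -exprM mulnC exprM ii4 expr1n.
  apply/matrixP => i j; rewrite ord1 mevP [in RHS]mxE mevP.
  have sE i' j' : (c *: dm k b) i' j' = c * dm k b i' j' by rewrite mxE.
  rewrite !sE {sE}; case: b; rewrite !mk2E ?mulr0 ?mul0r ?addr0 ?add0r ?mulr1;
    case: (ord2P i) => ->; rewrite !(phi0E, phi1E) /al.
  - transitivity (- (((ii ^+ k) ^+ 4 * (c * y) ^+ 4 - (c * x) ^+ 4) / 2) ^+ 2); first by field.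
    by rewrite k8; field.
  - by transitivity ((ii ^+ k) ^+ 4 * (c * y * (c * x)) ^+ 4); [ring | rewrite k8; ring].
  - transitivity (- (((ii ^+ k) ^+ 4 * (c * x) ^+ 4 - (c * y) ^+ 4) / 2) ^+ 2); first by field.
    by rewrite k8; field.
  - by transitivity ((ii ^+ k) ^+ 4 * (c * x * (c * y)) ^+ 4); [ring | rewrite k8; ring].
have [||k k0 E] := proj_eq_const _ (@homog_phi C) _ hs.
- by rewrite -[8%N]mul1n; apply: homogm_precomp; [exact: homog_phi | exact: homogm_moebius].
- by case/curveP: curve_phi.
move: us; rewrite unit2; set a := sigma 0 0; set b := sigma 0 1; set c := sigma 1 0; set d := sigma 1 1.
move=> d0.
have E0 x y : ((a * x + b * y) ^+ 4 - (c * x + d * y) ^+ 4) ^+ 2 = k * (x ^+ 4 - y ^+ 4) ^+ 2.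
  have := congr1 (fun m => mev m x y 0 0) E; rewrite mev_moebius mevZ [in RHS]mxE evC.
  rewrite !mevP !phi0E /al -/a -/b -/c -/d => h.
  have four : - 4^-1 != 0 :> C by rewrite oppr_eq0 invr_eq0 pnatr_eq0.
  apply: (mulfI four); transitivity (- (((a * x + b * y) ^+ 4 - (c * x + d * y) ^+ 4) / 2) ^+ 2).
    by field.
  by rewrite h; field.
have E1 x y : ((a * x + b * y) * (c * x + d * y)) ^+ 4 = k * (x * y) ^+ 4.
  have := congr1 (fun m => mev m x y 1 0) E; rewrite mev_moebius mevZ [in RHS]mxE evC.
  by rewrite !mevP !phi1E -/a -/b -/c -/d.
have ac : a * c = 0.
  have := E1 1 0; rewrite !mulr0 !mulr1 !addr0 expr0n mulr0 => /eqP.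
  by rewrite expf_eq0 => /eqP.
have bd : b * d = 0.
  have := E1 0 1; rewrite !mulr0 !mulr1 !add0r expr0n mulr0 => /eqP.
  by rewrite expf_eq0 => /eqP.
have F := E0 1 1; rewrite !mulr1 subrr expr0n mulr0 in F.
move/eqP: F; rewrite expf_eq0 subr_eq0 /= => /eqP F.
have [c0|c0] := eqVneq c 0.
  have [a0 d1] : a != 0 /\ d != 0.
    by apply/andP; rewrite -negb_or -mulf_eq0; move: d0; rewrite c0 mulr0 subr0.
  have b0 : b = 0 by apply: (mulIf d1); rewrite mul0r.
  rewrite b0 c0 addr0 add0r in F; have [e e4 ae] := eq4P F; have [m m4 em] := mu4_pow e4.
  exists d, m, false; split=> //; apply/mx2P; rewrite !mxE /= -/a -/b -/c -/d ?mulr0 ?mulr1 //.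
  by rewrite ae em mulrC.
have a0 : a = 0 by apply: (mulIf c0); rewrite mul0r.
have b0 : b != 0 by apply: contraNneq d0 => b0; rewrite a0 b0 !mul0r subrr.
have d1 : d = 0 by apply: (mulfI b0); rewrite mulr0.
rewrite a0 d1 addr0 add0r in F; have [e e4 be'] := eq4P F; have [m m4 em] := mu4_pow e4.
exists c, m, true; split=> //; apply/mx2P; rewrite !mxE /= -/a -/b -/c -/d ?mulr0 ?mulr1 //.
by rewrite be' em mulrC.
Qed.

Lemma rot_rot i k : rotm i *m rotm k = rotm (i + k).
Proof. by apply/mx2P; rewrite mul2E !mk2E ?mulr0 ?mul0r ?addr0 ?add0r ?mulr1 // exprD. Qed.
Lemma rot_ref i k : rotm i *m refm k = refm (i + k).
Proof. by apply/mx2P; rewrite mul2E !mk2E ?mulr0 ?mul0r ?addr0 ?add0r ?mulr1 // exprD. Qed.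
Lemma ref_rot i k : refm i *m rotm k = (ii ^+ k) *: refm (i + 3 * k).
Proof.
apply/mx2P; rewrite mul2E !mxE /= ?mulr0 ?mul0r ?addr0 ?add0r ?mulr1 ?mul1r //.
by rewrite exprD exprM mulrCA -exprMn -exprS ii4 expr1n mulr1.
Qed.
Lemma ref_ref i k : refm i *m refm k = (ii ^+ k) *: rotm (i + 3 * k).
Proof.
apply/mx2P; rewrite mul2E !mxE /= ?mulr0 ?mul0r ?addr0 ?add0r ?mulr1 ?mul1r //.
by rewrite exprD exprM mulrCA -exprMn -exprS ii4 expr1n mulr1.
Qed.

Lemma rotm_mod k : rotm k = rotm (k %% 4). Proof. by rewrite /rotm ii_mod. Qed.
Lemma refm_mod k : refm k = refm (k %% 4). Proof. by rewrite /refm ii_mod. Qed.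

Lemma ii_pow_inj j k : (j < 4)%N -> (k < 4)%N -> ii ^+ j = ii ^+ k -> j = k.
Proof.
have n1 : (1 : C) != -1 by rewrite -subr_eq0 opprK -mulr2n pnatr_eq0.
have i1 : ii != 1 by apply: contraNneq n1 => i1; rewrite -ii2 i1 expr1n.
have i2 : ii != -1 by apply: contraNneq n1 => i1'; rewrite -ii2 i1' sqrrN expr1n.
have i3 : ii != - ii.
  by rewrite -subr_eq0 opprK -mulr2n -mulr_natl mulf_neq0 ?two_neq0 ?ii_neq0.
have E3 : ii ^+ 3 = - ii by rewrite exprS ii2 mulrN1.
have f : ((1 == ii = false) * (1 == -1 :> C = false) * (1 == - ii = false) *
          (ii == -1 = false) * (ii == - ii = false) * (-1 == - ii = false))%type.
  by do !split; apply/negbTE; rewrite // 1?eq_sym // ?eqr_oppLR ?opprK // eqr_opp eq_sym.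
by case: j => [|[|[|[|//]]]] _; case: k => [|[|[|[|//]]]] _ //;
  rewrite ?expr0 ?expr1 ?E3 ?ii2 => /eqP; rewrite ?f // eq_sym f.
Qed.

Lemma dm_proj_inj j b k b' : (j < 4)%N -> (k < 4)%N ->
  proj_eq (dm j b) (dm k b') -> j = k /\ b = b'.
Proof.
move=> j4 k4 /proj_field [c c0 /matrixP E].
have := E 1 0; have := E 1 1; have := E 0 0; have := E 0 1.
case: b {E}; case: b'; rewrite !mxE /= ?mulr1 ?mulr0.
- by move=> h _ _ c1; split=> //; apply: ii_pow_inj => //; rewrite h -c1 mul1r.
- by move=> _ _ _ /eqP; rewrite oner_eq0.
- by move=> _ _ /eqP; rewrite oner_eq0.
by move=> _ h c1 _; split=> //; apply: ii_pow_inj => //; rewrite h -c1 mul1r.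
Qed.

Lemma deck_D4_isog : deck_group_isog (phi_D4 C) D4.
Proof.
have [x [y [x4 y2 yx _ [inv invK Kinv]]]] := D4_generators.
pose s a := let ij := inv a in dm ij.1 (ij.2 == 1).
have xm k : (x ^+ k = x ^+ (k %% 4))%g.
  by rewrite {1}(divn_eq k 4) expgD mulnC expgM x4 expg1n mul1g.
have yxk k : (y * x ^+ k = x ^+ (3 * k) * y)%g.
  elim: k => [|k IH]; first by rewrite muln0 !expg0 mulg1 mul1g.
  by rewrite expgSr mulgA IH -mulgA yx mulgA -expgD mulnSr.
have sE k (b : bool) : s (x ^+ k * y ^+ b)%g = dm k b.
  have kk : (k %% 4 < 4)%N by rewrite ltn_mod.
  have bb : (b < 2)%N by case: b.
  have -> : (x ^+ k * y ^+ b = x ^+ (Ordinal kk) * y ^+ (Ordinal bb))%g by rewrite xm.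
  rewrite /s (invK (Ordinal kk, Ordinal bb)) /=.
  rewrite (_ : (Ordinal bb == 1) = b); last by case: b bb.
  by case: b {bb}; rewrite /= -?rotm_mod -?refm_mod.
have aE a : exists k (b : bool), a = (x ^+ k * y ^+ b)%g.
  exists (inv a).1, ((inv a).2 == 1); rewrite -{1}(Kinv a) /=.
  by case: (inv a) => k [[|[|//]] hl].
exists s; split.
- move=> a _; apply/deck_phi_D4; exists 1, (inv a).1, ((inv a).2 == 1).
  by rewrite oner_neq0 scale1r.
- move=> a a' _ _; have [k [b ->]] := aE a; have [k' [b' ->]] := aE a'.
  have -> : (x ^+ k * y ^+ b * (x ^+ k' * y ^+ b') = x ^+ (if b then (k + 3 * k')%N else (k + k')%N)
      * y ^+ (b (+) b' : bool))%g.
    case: b; rewrite ?expg0 ?mulg1 ?expg1 /=; last by rewrite mulgA -expgD.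
    rewrite !mulgA -[(x ^+ k * y * _)%g]mulgA yxk mulgA -expgD.
    by case: b' => /=; rewrite ?expg0 ?expg1 ?mulg1 // -mulgA -[(y * y)%g]/(y ^+ 2)%g y2 mulg1.
  rewrite !sE; case: b; case: b' => /=.
  - by rewrite ref_ref; apply: proj_sym; apply: proj_scale erefl; rewrite expf_neq0 ?ii_neq0.
  - by rewrite ref_rot; apply: proj_sym; apply: proj_scale erefl; rewrite expf_neq0 ?ii_neq0.
  - by rewrite rot_ref; apply: (@proj_scale _ _ _ _ _ 1); rewrite ?oner_neq0 ?scale1r.
  - by rewrite rot_rot; apply: (@proj_scale _ _ _ _ _ 1); rewrite ?oner_neq0 ?scale1r.
- move=> a a' _ _ /dm_proj_inj [] // E1 E2.
  rewrite -(Kinv a) -(Kinv a') /=; congr (_ * _)%g; congr (_ ^+ _)%g; first exact: E1.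
  by move: E2; case: (inv a).2 => [[|[|//]] ?]; case: (inv a').2 => [[|[|//]] ?].
move=> sigma /deck_phi_D4 [c [k [b [c0 k4 ->]]]].
exists (x ^+ k * y ^+ b)%g; first by rewrite inE.
by rewrite sE; apply: proj_scale erefl.
Qed.

Lemma card_D4 : #|D4| = 8%N.
Proof. by have := @card_2dihedral 3 isT. Qed.

Lemma galois_phi_D4 : galois_covering 8 (phi_D4 C) D4.
Proof. by split; [exact: curve_phi | exact: deck_D4_isog | exact: card_D4]. Qed.

Lemma CH2 A : A *m A = (A 0 0 + A 1 1) *: A - (A 0 0 * A 1 1 - A 0 1 * A 1 0)%:M.
Proof. by apply/mx2P; rewrite mul2E !mxE /= ?mulr1n ?mulr0n; ring. Qed.

(** The ratio of the eigenvalues of a projectivity of order four is i or -i. *)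
Lemma order4_trace A c : A *m A *m (A *m A) = c%:M -> (forall d, A *m A <> d%:M) ->
  (A 0 0 + A 1 1) ^+ 2 = 2 * (A 0 0 * A 1 1 - A 0 1 * A 1 0) /\ A 0 0 + A 1 1 != 0.
Proof.
set T := A 0 0 + A 1 1; set D := _ - _ => A4 A2.
have CH := CH2 A; rewrite -/T -/D in CH.
have T0 : T != 0.
  by apply/eqP => T0; apply: (A2 (- D)); rewrite CH T0 scale0r sub0r raddfN.
split=> //; apply/eqP; rewrite -subr_eq0; apply/negPn/negP => nz0.
have E i j : (T * A i 0 - D * (i == 0)%:R) * (T * A 0 j - D * (0 == j)%:R)
    + (T * A i 1 - D * (i == 1)%:R) * (T * A 1 j - D * (1 == j)%:R) = c * (i == j)%:R.
  have M (i' j' : 'I_2) : (A *m A) i' j' = T * A i' j' - D * (i' == j')%:R.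
    by rewrite CH !mxE mulr_natr.
  by have := congr1 (fun m : 'M[C]_2 => m i j) A4; rewrite /= mul2E !M => ->; rewrite mxE mulr_natr.
have E01 := E 0 1; have E10 := E 1 0; have E00 := E 0 0; have E11 := E 1 1.
rewrite /= !mulr1 !mulr0 !subr0 in E01 E10 E00 E11.
have nT := mulf_neq0 T0 nz0.
have a01 : A 0 1 = 0.
  apply: (mulfI nT); rewrite mulr0 -[RHS]E01 [in LHS]/T [in LHS]/D /T /D; ring.
have a10 : A 1 0 = 0.
  apply: (mulfI nT); rewrite mulr0 -[RHS]E10 /T /D; ring.
have a00 : A 0 0 = A 1 1.
  apply/eqP; rewrite -subr_eq0; apply/eqP; apply: (mulfI nT).
  by rewrite mulr0 -(subrr c) -{1}E00 -E11 /T /D; ring.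
apply: (A2 (A 1 1 ^+ 2)); apply/mx2P; rewrite mul2E !mxE /= ?a01 ?a10 ?a00 ?mulr0n ?mulr1n; ring.
Qed.

Lemma scalar_neq0 c A : A \in unitmx -> A = c%:M -> c != 0.
Proof. by move=> uA E; apply: contraTneq uA => c0; rewrite unit2 E c0 !mxE /= mul0rn mul0r subrr eqxx. Qed.

(** The eigenvalues of A are l1 = i l2 and l2, and B exchanges the eigenlines,
    because A B A is proportional to B. In a basis v, B v of eigenvectors, suitably
    scaled, both matrices have the standard form. *)
Lemma dihedral_normal A B a b c : A \in unitmx -> B \in unitmx ->
  A *m A *m (A *m A) = a%:M -> (forall d, A *m A <> d%:M) -> B *m B = b%:M ->
  A *m B *m A = c *: B ->
  exists mu r s, [/\ mu \in unitmx, r != 0, s != 0,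
    A *m mu = r *: (mu *m rotm 1) & B *m mu = s *: (mu *m refm 0)].
Proof.
move=> uA uB A4 A2 B2 ABA.
have [TD T0] := order4_trace A4 A2.
set T := A 0 0 + A 1 1 in TD T0; set D := A 0 0 * A 1 1 - A 0 1 * A 1 0 in TD.
(* The eigenvalues: their sum is T and, as T^2 = 2 D, their product is D. *)
pose l1 := (1 + ii) * T / 2; pose l2 := (1 - ii) * T / 2.
have l12 : l1 = ii * l2 
  by rewrite /l1 /l2; transitivity ((ii - ii ^+ 2) * T / 2); [rewrite ii2; field | field].
have lT : l1 + l2 = T by rewrite /l1 /l2; field.
have lD : l1 * l2 = D.
  apply: (mulfI (two_neq0 C)); rewrite -TD /l1 /l2.
  transitivity ((1 - ii ^+ 2) * T ^+ 2 / 2); first by field.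
  by rewrite ii2; field.
have i1 : 1 - ii != 0.
  rewrite subr_eq0; apply/eqP => h.
  by have := @ii_pow_inj 0 1 isT isT; rewrite expr0 expr1 => /(_ h).
have l20 : l2 != 0 by rewrite /l2 !mulf_neq0 ?invr_eq0 ?two_neq0.
have l10 : l1 != 0 by rewrite l12 mulf_neq0 ?ii_neq0.
have ne12 : l1 != l2.
  rewrite l12 -subr_eq0 -{2}[l2]mul1r -mulrBl mulf_neq0 //.
  by rewrite -opprB oppr_eq0.
have CH (v : 'cV[C]_2) : A *m (A *m v) = (l1 + l2) *: (A *m v) - (l1 * l2) *: v.
  by rewrite mulmxA CH2 lT lD mulmxBl -scalemxAl mul_scalar_mx.
have [v1 v10 Av1] : exists2 v1 : 'cV[C]_2, v1 != 0 & A *m v1 = l1 *: v1.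
  have [w w0] : exists w : 'cV[C]_2, A *m w - l2 *: w != 0.
    apply: contrapT => h; apply: (A2 (l2 ^+ 2)).
    have E (w : 'cV[C]_2) : A *m w = l2 *: w.
      by apply/eqP; rewrite -subr_eq0; apply/negPn/negP => w0; apply: h; exists w.
    have -> : A = l2%:M.
      apply/matrixP => i j; have /matrixP/(_ i 0) := E (delta_mx j 0).
      by rewrite -colE !mxE eqxx andbT mulr_natr.
    by rewrite -scalar_mxM -expr2.
  exists (A *m w - l2 *: w) => //.
  rewrite mulmxBr -scalemxAr CH; move: (A *m w) => u.
  by apply/matrixP => i j; rewrite !mxE; ring.
have D0 : D != 0 by rewrite -lD mulf_neq0.
have c2 : c ^+ 2 = D ^+ 2.
  have dB : \det B != 0 by rewrite -unitfE -unitmxE.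
  have := congr1 determinant ABA; rewrite detZ !det_mulmx (det2 A) -/D => h.
  by apply: (mulIf dB); rewrite -h; ring.
pose v2 := B *m v1.
have v20 : v2 != 0.
  by apply: contraNneq v10 => h; rewrite -[v1](mulKmx uB) -/v2 h mulmx0.
have Av2' : A *m v2 = (c / l1) *: v2.
  have := congr1 (fun m : 'M[C]_2 => m *m v1) ABA.
  rewrite /= -!mulmxA Av1 -!scalemxAr -scalemxAl -/v2 => h.
  by rewrite mulrC -scalerA -h scalerA mulVf // scale1r.
have Av2 : A *m v2 = l2 *: v2.
  move/eqP: c2; rewrite eqf_sqr => /orP[/eqP cD|/eqP cD].
    by rewrite Av2' cD -lD mulrAC divff // mul1r.
  have AN : A *m v2 = (- l2) *: v2 by rewrite Av2' cD -lD mulNr mulrAC divff // mul1r.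
  have := CH v2; rewrite AN -scalemxAr AN !scalerA => /eqP.
  rewrite -scalerBl -subr_eq0 -scalerBl scaler_eq0 (negPf v20) orbF => /eqP h.
  case/eqP: (mulf_neq0 (two_neq0 C) (mulf_neq0 l20 T0)); rewrite -lT -[RHS]h; ring.
have b0 : b != 0 by apply: (scalar_neq0 _ B2); rewrite unitmx_mul uB.
have Bv2 : B *m v2 = b *: v1 by rewrite /v2 mulmxA B2 mul_scalar_mx.
have v2E : B *m v1 = v2 by [].
clearbody v2.
(* Rescaling the second eigenvector makes both nonzero entries of B equal. *)
pose r := sqrtC b; have r0 : r != 0 by rewrite sqrtC_eq0.
have r2 : r ^+ 2 = b by rewrite sqrtCK.
pose mu := mk2 (v1 0 0) (v2 0 0 / r) (v1 1 0) (v2 1 0 / r).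
have [Ec1 Ec2] : (forall i, mu i 0 = v1 i 0) /\ (forall i, mu i 1 = v2 i 0 / r).
  by split=> i; case: (ord2P i) => ->; rewrite mk2E.
have mulE (X : 'M[C]_2) (v : 'cV[C]_2) i : X i 0 * v 0 0 + X i 1 * v 1 0 = (X *m v) i 0.
  by rewrite mul2E.
have mu1 (X : 'M[C]_2) i : (X *m mu) i 0 = (X *m v1) i 0 by rewrite mul2E !Ec1 mulE.
have mu2 (X : 'M[C]_2) i : (X *m mu) i 1 = (X *m v2) i 0 / r.
  by rewrite mul2E !Ec2 -mulE; ring.
exists mu, l2, r; split=> //.
- rewrite unit2 !mk2E; apply/eqP => w0.
  have W : v1 0 0 * v2 1 0 = v2 0 0 * v1 1 0.
    apply/eqP; rewrite -subr_eq0; apply/eqP; apply: (mulIf (invr_neq0 r0)).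
    by rewrite mul0r -[RHS]w0; ring.
  have par (i : 'I_2) : v1 i 0 *: v2 = v2 i 0 *: v1.
    apply/matrixP => k l; rewrite ord1 !mxE.
    by case: (ord2P i) => ->; case: (ord2P k) => -> //; rewrite ?W 1?mulrC // -W mulrC.
  have z i : v1 i 0 = 0.
    have := congr1 (mulmx A) (par i); rewrite -!scalemxAr Av1 Av2 => h.
    have /eqP : (l2 - l1) *: (v1 i 0 *: v2) = 0.
      by rewrite scalerBl scalerA mulrC -scalerA h scalerA mulrC -scalerA -par subrr.
    rewrite !scaler_eq0 (negPf v20) orbF subr_eq0 eq_sym (negPf ne12) /=.
    by move/eqP.
  by case/eqP: v10; apply/matrixP => i j; rewrite ord1 z mxE.
- apply/matrixP => i j; rewrite [RHS]mxE; case: (ord2P j) => ->.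
    by rewrite mu1 Av1 mxE mul2E !mk2E Ec1 mulr0 addr0 expr1 l12; ring.
  by rewrite mu2 Av2 mxE mul2E !mk2E Ec2 mulr0 add0r; ring.
apply/matrixP => i j; rewrite [RHS]mxE; case: (ord2P j) => ->.
  by rewrite mu1 v2E mul2E !mk2E Ec2 mulr0 add0r mulr1; field.
by rewrite mu2 Bv2 mul2E !mk2E Ec1 mulr0 addr0 expr0 mulr1 mxE -r2; field.
Qed.

Lemma ev_hform_scale n (c : nat -> C) t x y :
  ev (hform n c) (t * x) y = ev (hform n (fun k => c k * t ^+ k)) x y.
Proof. by rewrite !ev_hform; apply: eq_bigr => i _; rewrite exprMn !mulrA. Qed.

Lemma ev_hform_swap n (c : nat -> C) x y :
  ev (hform n c) y x = ev (hform n (fun k => c (n - k)%N)) x y.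
Proof.
rewrite !ev_hform (reindex_inj rev_ord_inj); apply: eq_bigr => -[i /= ilt] _.
by rewrite subSS (subKn (ilt : (i <= n)%N)) [x ^+ _ * _]mulrC.
Qed.

Lemma ev_hform_lin n (a b : C) (c c' : nat -> C) x y :
  ev (hform n (fun k => a * c k + b * c' k)) x y = a * ev (hform n c) x y + b * ev (hform n c') x y.
Proof.
rewrite !ev_hform !mulr_sumr -big_split; apply: eq_bigr => i _ /=; ring.
Qed.

Lemma mevS n m k (g : 'M[forms C]_(m, k)) t x y : homogm n g ->
  mev g (t * x) (t * y) = t ^+ n *: mev g x y.
Proof. by move=> hg; apply/matrixP => i j; rewrite !mxE (ev_homog _ _ _ (hg i j)). Qed.

Lemma ker2 A : A \notin unitmx -> exists s t, [/\ nz s t,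
  A 0 0 * s + A 0 1 * t = 0 & A 1 0 * s + A 1 1 * t = 0].
Proof.
rewrite unit2 negbK => /eqP d0.
have [h0|h0] := boolP (nz (A 0 0) (A 0 1)).
  exists (- A 0 1), (A 0 0); split; last by rewrite -[RHS]d0; ring.
    by move: h0; rewrite /nz oppr_eq0 orbC.
  by ring.
have [h1|h1] := boolP (nz (A 1 0) (A 1 1)).
  exists (- A 1 1), (A 1 0); split; last by ring.
    by move: h1; rewrite /nz oppr_eq0 orbC.
  by rewrite -[RHS]oppr0 -d0; ring.
move: h0 h1; rewrite !negb_or !negbK => /andP[/eqP -> /eqP ->] /andP[/eqP -> /eqP ->].
by exists 1, 0; rewrite /nz oner_eq0 !mul0r addr0.
Qed.

(** Pencils of forms of degree 8 with the dihedral symmetry: a primitive pair of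
    semi-invariants is invariant, because it does not vanish at the fixed points
    (0,1) and (1,1); this leaves the span of x^8 + y^8 and x^4 y^4. *)
Lemma dihedral_pencil (psi : 'cV[forms C]_2) c c' : is_curve 8 psi ->
  (forall x y, mev psi (ii * x) y = c *: mev psi x y) ->
  (forall x y, mev psi y x = c' *: mev psi x y) ->
  exists2 N, N \in unitmx & psi = const_forms N *m phi_D4 C.
Proof.
move=> /curveP[hpsi npsi] hR hS.
have fixed (v : 'cV[C]_2) d : v != 0 -> v = d *: v -> d = 1.
  move=> v0 E; apply/eqP; rewrite -subr_eq0.
  by have := scaler_eq0 (d - 1) v; rewrite scalerBl -E scale1r subrr eqxx (negPf v0) orbF.
have c1 : c = 1.
  apply: (fixed (mev psi 0 1)); first by rewrite npsi // /nz oner_eq0 orbT.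
  by rewrite -hR mulr0.
have c'1 : c' = 1.
  by apply: (fixed (mev psi 1 1)); [rewrite npsi // /nz oner_eq0 | rewrite -hS].
have main i : exists a b, forall x y, ev (psi i 0) x y = a * - al x y ^+ 2 + b * (x * y) ^+ 4.
  have [d dE] := homog_exists (hpsi i 0).
  have d4 k : (k <= 8)%N -> d k * ii ^+ k - d k = 0.
    move=> k8; have := @hform_coef0 8 (fun k => 1 * (d k * ii ^+ k) + (-1) * d k) _ k k8.
    rewrite mul1r mulN1r; apply=> x y; rewrite ev_hform_lin -ev_hform_scale -dE mul1r mulN1r.
    by have /matrixP/(_ i 0) := hR x y; rewrite c1 scale1r !mxE => ->; rewrite subrr.
  have ds k : (k <= 8)%N -> d (8 - k)%N - d k = 0.
    move=> k8; have := @hform_coef0 8 (fun k => 1 * d (8 - k)%N + (-1) * d k) _ k k8.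
    rewrite mul1r mulN1r; apply=> x y; rewrite ev_hform_lin -ev_hform_swap -dE mul1r mulN1r.
    by have /matrixP/(_ i 0) := hS x y; rewrite c'1 scale1r !mxE => ->; rewrite subrr.
  have d0 k : (k <= 8)%N -> (k %% 4 != 0)%N -> d k = 0.
    move=> k8 k4; have /eqP := d4 k k8; rewrite -{2}[d k]mulr1 -mulrBr mulf_eq0 subr_eq0.
    case/orP => [/eqP //|/eqP]; rewrite ii_mod => h.
    by case/eqP: k4; apply: (ii_pow_inj _ _ (h : _ = ii ^+ 0)); rewrite // ltn_mod.
  exists (- 4 * d 0%N), (2 * d 0%N + d 4%N) => x y; rewrite dE ev_hform !big_ord_recl big_ord0 /=.
  have -> : d (bump 0 (bump 0 (bump 0 (bump 0 (bump 0 (bump 0 (bump 0 (bump 0 0)))))))) = d 0%N.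
    by apply/eqP; rewrite eq_sym -subr_eq0; apply/eqP; exact: (ds 8%N).
  rewrite /bump /= !add1n (d0 1%N) // (d0 2%N) // (d0 3%N) // (d0 5%N) // (d0 6%N) // (d0 7%N) //.
  by rewrite /al; field.
have [a0 [b0 E0]] := main 0; have [a1 [b1 E1]] := main 1.
pose N := mk2 a0 b0 a1 b1.
have psiE : psi = const_forms N *m phi_D4 C.
  apply/matrixP => i j; rewrite ord1; apply: ev_inj => x y.
  rewrite -[RHS]mevP mev_mul mev_const mul2E !mevP phi0E phi1E.
  by case: (ord2P i) => ->; rewrite !mk2E ?E0 ?E1.
exists N => //; apply/negPn/negP => /ker2 [s [t [st h0 h1]]].
have [x [y [xy Es Et]]] := phi_surj_nz st.
case/eqP: (npsi x y xy); apply/matrixP => i j; rewrite ord1 psiE mev_mul mev_const mul2E.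
by rewrite !mevP phi0E phi1E Es Et [RHS]mxE; case: (ord2P i) => ->; [exact: h0 | exact: h1].
Qed.

Lemma mulmx_pt A B x y (i : 'I_2) :
  A i 0 * (B 0 0 * x + B 0 1 * y) + A i 1 * (B 1 0 * x + B 1 1 * y)
  = (A *m B) i 0 * x + (A *m B) i 1 * y.
Proof. by rewrite !mul2E; ring. Qed.

Lemma mev_scalemx n m k (g : 'M[forms C]_(m, k)) r A x y : homogm n g ->
  mev g ((r *: A) 0 0 * x + (r *: A) 0 1 * y) ((r *: A) 1 0 * x + (r *: A) 1 1 * y) =
  r ^+ n *: mev g (A 0 0 * x + A 0 1 * y) (A 1 0 * x + A 1 1 * y).
Proof. by move=> hg; rewrite -(mevS _ _ _ hg) !mxE; congr mev; ring. Qed.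

Lemma symm_conj n m k (g : 'M[forms C]_(m, k)) A B mu r c : homogm n g -> r != 0 ->
  precomp g (moebius A) = c%:MP *: g -> A *m mu = r *: (mu *m B) ->
  forall x y, mev (precomp g (moebius mu)) (B 0 0 * x + B 0 1 * y) (B 1 0 * x + B 1 1 * y) =
    (c / r ^+ n) *: mev (precomp g (moebius mu)) x y.
Proof.
move=> hg r0 E H x y; rewrite !mev_moebius !mulmx_pt.
have := congr1 (fun h => mev h (mu 0 0 * x + mu 0 1 * y) (mu 1 0 * x + mu 1 1 * y)) E.
rewrite /= mev_moebius mevZ evC !mulmx_pt H (mev_scalemx _ _ _ _ hg) => h.
by rewrite [c / _]mulrC -[RHS]scalerA -h scalerA mulVf ?expf_neq0 // scale1r.
Qed.

(** In the coordinates given by mu the components of phi span a pencil with dihedral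
    symmetry. *)
Lemma cover_normal phi A B mu r s : is_curve 8 phi -> mu \in unitmx -> r != 0 -> s != 0 ->
  proj_eq (precomp phi (moebius A)) phi -> proj_eq (precomp phi (moebius B)) phi ->
  A *m mu = r *: (mu *m rotm 1) -> B *m mu = s *: (mu *m refm 0) ->
  exists nu, covering_equiv phi (phi_D4 C) mu nu.
Proof.
move=> cphi umu r0 s0 hA hB EA EB; have [hphi nphi] := (iffLR (curveP _ _) cphi).
have homA X : homogm 8 (precomp phi (moebius X)).
  by rewrite -[8%N]mul1n; apply: homogm_precomp; [exact: hphi | exact: homogm_moebius].
have [a _ Ea] := proj_eq_const (homA A) hphi nphi hA.
have [b _ Eb] := proj_eq_const (homA B) hphi nphi hB.
have [|||N uN NE] := @dihedral_pencil (precomp phi (moebius mu)) (a / r ^+ 8) (b / s ^+ 8).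
- exact: curve_moebius.
- move=> x y; rewrite -(symm_conj hphi r0 Ea EA) !mk2E.
  by rewrite expr1 !mul0r addr0 add0r mul1r.
- move=> x y; rewrite -(symm_conj hphi s0 Eb EB) !mk2E.
  by rewrite expr0 !mul0r addr0 add0r !mul1r.
exists (invmx N); split=> //; first by rewrite unitmx_inv.
apply: (@proj_scale _ _ _ _ _ 1); rewrite ?oner_neq0 // scale1r NE mulmxA.
have -> : const_forms (invmx N) *m const_forms N = 1%:M.
  by rewrite /const_forms -map_mxM mulVmx // map_mx1.
by rewrite mul1mx.
Qed.

End DihedralCovers.

(** * Symmetric normal form of a lift *)

Section LiftSymmetry.

Variable C : numClosedFieldType.
Implicit Types (x y c : C) (A B : 'M[C]_2) (phi : 'cV[forms C]_2).
Implicit Types (F : 'rV[forms C]_7) (g : 'M[forms C]_2).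

Notation ii := ('i : C).

Lemma octa_scale c B : c != 0 -> octa B -> octa (c *: B).
Proof.
move=> c0 [[h1 h2 h3 h4]|[h1 h2 h3 h4]|[h1 h2 h3 h4]]; [apply: Or31|apply: Or32|apply: Or33];
  split; rewrite !mxE ?h1 ?h2 ?mulr0 ?mulf_neq0 ?exprMn ?h1 ?h2 ?h3 ?h4 //.
by rewrite mulrACA h4 mulrACA mulrN.
Qed.

Lemma S4scal_octa B : S4scal B -> octa B.
Proof. by move=> [c [S [c0 hS ->]]]; apply: octa_scale (S4star_octa hS). Qed.

Lemma octa_mul A B : octa A -> octa B -> octa (A *m B).
Proof. by move=> hA hB; apply/S4scal_octa/S4scal_mul; apply: octa_S4scal. Qed.

Lemma octa_inv A : octa A -> octa (invmx A).
Proof.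
move=> /octa_S4scal [c [S [c0 hS ->]]]; rewrite invmxZ; last first.
  by rewrite unitmxZ ?unitfE //; case: (S4star_stab hS).
by apply: octa_scale; rewrite ?invr_neq0 //; apply: S4star_octa; apply: S4star_inv.
Qed.

(** For phi = (p, q), the form t p - s q has a root. *)
Lemma curve_surj d phi s t : is_curve d.+1 phi -> nz s t ->
  exists x y k, [/\ nz x y, k != 0, ev (phi 0 0) x y = k * s & ev (phi 1 0) x y = k * t].
Proof.
move=> /curveP [hphi nphi] st.
have [|x [y [xy h]]] := @homog_root _ d (t *: phi 0 0 - s *: phi 1 0).
  by apply: rpredB; apply: dhomogZ; apply: hphi.
have nn : nz (ev (phi 0 0) x y) (ev (phi 1 0) x y).
  have [i [j]] := noczP (nphi x y xy); rewrite ord1 /nz.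
  by case: (ord2P i) => -> ->; rewrite ?orbT.
rewrite !evE in h.
have [k k0 [h0 h1]] := lform_root st h nn.
by exists x, y, k.
Qed.

Lemma curve_mev_phi d phi s t : is_curve d.+1 phi -> nz s t ->
  exists x y k, [/\ nz x y, k != 0 & forall n m l (h : 'M[forms C]_(m, l)), homogm n h ->
     mev (precomp h phi) x y = k ^+ n *: mev h s t].
Proof.
move=> cphi st; have [x [y [k [xy k0 h0 h1]]]] := curve_surj cphi st.
exists x, y, k; split=> // n m l h hh; rewrite mev_precomp h0 h1; exact: mevS.
Qed.

Lemma nocz_precomp d n m k (h : 'M[forms C]_(m, k)) phi : is_curve d phi -> is_curve n h ->
  nocz (precomp h phi).
Proof.
move=> /curveP [_ nphi] /curveP [_ nh] x y xy; rewrite mev_precomp; apply: nh.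
have [i [j]] := noczP (nphi x y xy); rewrite ord1 /nz.
by case: (ord2P i) => -> ->; rewrite ?orbT.
Qed.

Lemma homogm_f1 n g : homogm n g -> homogm (n * 6) (f1 g).
Proof.
move=> hg i j; apply: homog_of_ev => t x y.
by rewrite -!mevP !mev_f1 (mevS _ _ _ hg) f1Z mxE exprM.
Qed.

Lemma meval_scale n (P : {mpoly C[n]}) d (v : 'rV[C]_n) c : P \is d.-homog ->
  P.@[(c *: v) 0] = c ^+ d * P.@[v 0].
Proof.
move=> hP; rewrite !mevalE mulr_sumr; apply: eq_big_seq => m hm.
have <- := dhomogP _ _ _ hP m hm; rewrite mulrCA; congr (_ * _).
under eq_bigr => i _ do rewrite mxE exprMn.
by rewrite big_split /= prodrXr mdegE.
Qed.

Lemma poly_on_curve (P : {mpoly C[7]}) F :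
  exists Q : forms C, forall x y, ev Q x y = P.@[(mev F x y) 0].
Proof.
exists (mmap (@mpolyC 2 C) (fun i => F 0 i) P) => x y.
rewrite /mmap ev_sum mevalE; apply: eq_bigr => m _; rewrite evM evC; congr (_ * _).
by rewrite /mmap1 ev_prod; apply: eq_bigr => i _; rewrite evX mxE.
Qed.

Lemma moebius_onto A x y : A \in unitmx -> exists x' y',
  A 0 0 * x' + A 0 1 * y' = x /\ A 1 0 * x' + A 1 1 * y' = y.
Proof.
move=> uA; exists (invmx A 0 0 * x + invmx A 0 1 * y), (invmx A 1 0 * x + invmx A 1 1 * y).
by rewrite !mulmx_pt mulmxV // !mxE /= mul1r !mul0r mul1r add0r addr0.
Qed.

Lemma mev_det g x y : \det (mev g x y) = ev (\det g) x y.
Proof. by rewrite !det2 !evE !mevP. Qed.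

Lemma comp_neq0 (f : forms C) A : A \in unitmx -> f != 0 ->
  f \mPo [tuple moebius A i 0 | i < 2] != 0.
Proof.
move=> uA; apply: contraNneq => E; apply/eqP/ev_eq0 => x y.
have [x' [y' [<- <-]]] := moebius_onto x y uA.
by rewrite -!ev_moebius -ev_comp E ev0.
Qed.

Lemma det_precomp g A : \det (precomp g (moebius A)) = \det g \mPo [tuple moebius A i 0 | i < 2].
Proof. by rewrite /precomp det_map_mx. Qed.

Lemma deck_unit phi A : deck phi A -> A \in unitmx. Proof. by case. Qed.

Lemma mul_scal2 (k l : C) A B : (k *: A) *m (l *: B) = (k * l) *: (A *m B).
Proof. by rewrite -scalemxAl -scalemxAr scalerA. Qed.

Lemma deck_generators phi : galois_covering 8 phi D4 -> exists A B a b c,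
  [/\ deck phi A, deck phi B, A *m A *m (A *m A) = a%:M,
      (forall d, A *m A <> d%:M) & B *m B = b%:M /\ A *m B *m A = c *: B].
Proof.
move=> [_ [s [sd sM si _]] _]; have [x [y [x4 y2 yx xx _]]] := D4_generators.
have D a : a \in D4 by rewrite inE.
have sm a b : exists2 k, k != 0 & s (a * b)%g = k *: (s a *m s b).
  exact: proj_field (sM a b (D a) (D b)).
have us a : s a \in unitmx by apply: deck_unit (sd a (D a)).
have [k1 k10 s1] : exists2 k, k != 0 & s 1%g = k%:M.
  have [k k0 E] := sm 1%g 1%g; rewrite mulg1 in E.
  exists k^-1; first by rewrite invr_eq0.
  have : (k *: s 1%g) *m s 1%g = 1%:M *m s 1%g by rewrite mul1mx -scalemxAl -E.
  move/(can_inj (mulmxK (us 1%g))) => F.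
  by rewrite -[s 1%g]scale1r -(mulVf k0) -scalerA F scalemx1.
have [k2 k20 s2] := sm x x; have [k3 k30 s3] := sm y y.
exists (s x), (s y).
have [k4 k40 s4] := sm (x * x)%g (x * x)%g.
have x4' : (x * x * (x * x) = 1)%g by rewrite -x4 !expgS expg0 mulg1 !mulgA.
have y2' : (y * y = 1)%g by rewrite -y2 !expgS expg0 mulg1.
have [k5 k50 s5] := sm x y; have [k6 k60 s6] := sm (x * y)%g x.
have xyx : (x * y * x = y)%g by rewrite -mulgA yx mulgA -expgS x4 mul1g.
rewrite x4' s1 s2 mul_scal2 scalerA in s4.
rewrite y2' s1 in s3; rewrite xyx s5 -scalemxAl scalerA in s6.
exists ((k4 * (k2 * k2))^-1 * k1), (k3^-1 * k1), (k6 * k5)^-1; split.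
- exact: sd.
- exact: sd.
- by rewrite scalar_mxM mul_scalar_mx s4 scalerA mulVf ?scale1r // !mulf_neq0.
- move=> d E; case/eqP: xx; apply: si; rewrite ?D // s2 E s1.
  have d0 : d != 0 by apply: (scalar_neq0 _ E); rewrite unitmx_mul us.
  apply: (@proj_scale _ _ _ _ _ (k2 * d / k1)); first by rewrite !mulf_neq0 ?invr_eq0.
  by rewrite scale_scalar_mx scale_scalar_mx divfK.
split; first by rewrite scalar_mxM mul_scalar_mx s3 scalerA mulVf ?scale1r.
by rewrite [in RHS]s6 scalerA mulVf ?scale1r // mulf_neq0.
Qed.

Lemma octa_order4 B c : octa B -> B *m B *m (B *m B) = c%:M -> (forall d, B *m B <> d%:M) ->
  exists K l, [/\ octa K, l != 0 & B *m K = l *: (K *m rotm C 1)].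
Proof.
move=> oB B4 B2; have [TD T0] := order4_trace B4 B2.
have n2 := two_neq0 C; have i0 := ii_neq0 C.
have i1 : 1 - ii != 0.
  rewrite subr_eq0; apply/eqP => h.
  by have := @ii_pow_inj C 0 1 isT isT; rewrite expr0 expr1 => /(_ h).
case: oB => [[b01 b10 b00 e4]|[b00 b11 _ _]|[b00 e01 e10 e11]].
- have : (B 0 0 - ii * B 1 1) * (B 0 0 + ii * B 1 1) = 0.
    transitivity (B 0 0 ^+ 2 - ii ^+ 2 * B 1 1 ^+ 2); first by ring.
    rewrite ii2; move: TD; rewrite b01 mul0r subr0 => TD.
    by transitivity ((B 0 0 + B 1 1) ^+ 2 - 2 * (B 0 0 * B 1 1)); [ring | rewrite TD subrr].
  have b110 : B 1 1 != 0 by apply: contraNneq b00 => z; move/eqP: e4; rewrite z expr0n expf_eq0.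
  move/eqP; rewrite mulf_eq0 subr_eq0 addr_eq0 => /orP[] /eqP E.
    exists (rotm C 0), (B 1 1); split=> //; first exact: (dm_octa C 0 false).
    by apply/mx2P; rewrite !(mul2E, mxE) /= ?b01 ?b10 ?E ?expr0 ?expr1; ring.
  exists (refm C 0), (B 0 0); split=> //; first exact: (dm_octa C 0 true).
  have E' : B 1 1 = ii * B 0 0 by rewrite E mulrN mulrA -expr2 ii2 mulN1r opprK.
  by apply/mx2P; rewrite !(mul2E, mxE) /= ?b01 ?b10 ?E' ?expr0 ?expr1; ring.
- by move: T0; rewrite b00 b11 addr0 eqxx.
set a := B 0 0 in b00 e01 e10 e11 TD T0.
have ad : B 1 1 = a.
  have : (a - B 1 1) ^+ 2 = 0.
    transitivity ((a + B 1 1) ^+ 2 - 2 * (a * B 1 1 - B 0 1 * B 1 0)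
       - 2 * (a * B 1 1 + B 0 1 * B 1 0)); first by ring.
    by rewrite TD e11; ring.
  by move/eqP; rewrite expf_eq0 subr_eq0 => /eqP.
have [e e4 b01] := eq4P e01.
have e0 : e != 0 by apply: contraNneq (oner_neq0 C) => z; rewrite -e4 z expr0n.
have b10 : B 1 0 = - (a / e).
  apply: (mulfI (mulf_neq0 e0 b00)); apply: oppr_inj.
  by rewrite -b01 -e11 ad b01; field.
(* The columns are eigenvectors of B. *)
exists (mk2 1 1 (ii / e) (- (ii / e))), (a * (1 - ii)); split.
- apply: Or33; rewrite !mk2E; split; rewrite ?oner_neq0 ?expr1n //; last by ring.
  by rewrite exprMn exprVn e4 ii4 invr1 mulr1.
- by rewrite mulf_neq0.
apply/mx2P; rewrite !(mul2E, mxE) /= ?ad ?b10 ?b01 -/a ?expr1.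
- by transitivity (a * (ii - ii ^+ 2)); [rewrite ii2; field | ring].
- by field.
- by transitivity (a / e * (ii ^+ 2 * (1 - ii))); [rewrite ii2; field | field].
by transitivity (- (a / e * (ii - ii ^+ 2))); [rewrite ii2; field | field].
Qed.

(** In the octahedral group the elements inverting a rotation of order four
    interchange its two fixed points. *)
Lemma octa_invert B c : octa B -> rotm C 1 *m B *m rotm C 1 = c *: B ->
  [/\ B 0 0 = 0, B 1 1 = 0, B 0 1 != 0 & B 0 1 ^+ 4 = B 1 0 ^+ 4].
Proof.
move=> oB E; have i2 := ii2 C.
have e00 : - B 0 0 = c * B 0 0.
  by have /matrixP/(_ 0 0) := E; rewrite !(mul2E, mxE) /= expr1 -mulN1r -i2 => <-; ring.
have e11 : B 1 1 = c * B 1 1.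
  by have /matrixP/(_ 1 1) := E; rewrite !(mul2E, mxE) /= => <-; ring.
suff no : B 0 0 != 0 -> B 1 1 != 0 -> False.
  case: oB => [[_ _ h e]|//|[h1 h2 h3 h4]].
    case: (no h); apply: contraNneq h => z; move/eqP: e; rewrite z expr0n expf_eq0 //.
  case: (no h1); apply: contraNneq h1 => z; move/eqP: h4.
  rewrite z mulr0 eq_sym oppr_eq0 mulf_eq0 => /orP[] /eqP z';
    [move/eqP: h2|move/eqP: h3]; by rewrite z' expr0n eq_sym expf_eq0.
move=> h0 h1; have c1 : c = 1 by apply: (mulIf h1); rewrite mul1r -e11.
have cN : c = -1 by apply: (mulIf h0); rewrite mulN1r -e00.
by have := two_neq0 C; rewrite -[2]/(1 + 1) -{1}c1 cN addNr eqxx.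
Qed.

Lemma mev_deck n g A B mu r (R : 'M[C]_2) : homogm n g -> r != 0 ->
  precomp g (moebius A) = g *m const_forms B -> A *m mu = r *: (mu *m R) -> forall x y,
  mev (precomp g (moebius mu)) (R 0 0 * x + R 0 1 * y) (R 1 0 * x + R 1 1 * y) =
    (r ^+ n)^-1 *: (mev (precomp g (moebius mu)) x y *m B).
Proof.
move=> hg r0 E H x y; rewrite !mev_moebius !mulmx_pt.
have := congr1 (fun h => mev h (mu 0 0 * x + mu 0 1 * y) (mu 1 0 * x + mu 1 1 * y)) E.
rewrite /= mev_moebius mev_mul mev_const !mulmx_pt H (mev_scalemx _ _ _ _ hg) => <-.
by rewrite scalerA mulVf ?expf_neq0 // scale1r.
Qed.

Lemma mev_deck_mul n g A A' B B' c (D : 'M[C]_2) : homogm n g ->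
  precomp g (moebius A) = g *m const_forms B -> precomp g (moebius A') = g *m const_forms B' ->
  A *m A' = c *: D -> forall x y,
  c ^+ n *: mev (precomp g (moebius D)) x y = mev g x y *m (B' *m B).
Proof.
move=> hg E E' H x y; rewrite !mev_moebius -(mev_scalemx _ _ _ _ hg) -H -!mulmx_pt.
rewrite -mev_moebius E mev_mul mev_const -mev_moebius E' mev_mul mev_const.
by rewrite mulmxA.
Qed.

Lemma deck_1 phi : is_curve 8 phi -> deck phi 1%:M.
Proof.
move=> _; split; first exact: unitmx1.
apply: (@proj_scale _ _ _ _ _ 1); rewrite ?oner_neq0 // scale1r.
by apply: mev_inj => x y; rewrite mev_moebius !mxE /= mul1r !mul0r mul1r add0r addr0.
Qed.

Lemma deck_mul phi A B : is_curve 8 phi -> deck phi A -> deck phi B -> deck phi (A *m B).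
Proof.
move=> cphi [uA dA] [uB dB]; split; first by rewrite unitmx_mul uA.
have [hphi nphi] := (iffLR (curveP _ _) cphi).
have homA X : homogm 8 (precomp phi (moebius X)).
  by rewrite -[8%N]mul1n; apply: homogm_precomp; [exact: hphi | exact: homogm_moebius].
have [a a0 Ea] := proj_eq_const (homA A) hphi nphi dA.
have [b b0 Eb] := proj_eq_const (homA B) hphi nphi dB.
apply: (@proj_scale _ _ _ _ _ (a * b)%:MP); first by rewrite mpolyC_eq0 mulf_neq0.
apply: mev_inj => x y; rewrite mev_moebius -!mulmx_pt -mev_moebius Ea mevZ evC.
by rewrite -mev_moebius Eb !mevZ !evC scalerA.
Qed.

Section Lift.
Variables (n : nat) (phi : 'cV[forms C]_2) (F : 'rV[forms C]_7) (g : 'M[forms C]_2).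
Hypotheses (cphi : is_curve 8 phi) (cg : is_curve n g) (sF : sextic_curve F).
Hypothesis lift : proj_eq (f1 g) (precomp F phi).

Lemma lift_factor : exists h, [/\ h \is (n * 6 - 8 * 6).-homog, h != 0 & f1 g = h *: precomp F phi].
Proof.
have [hg _] := (iffLR (curveP _ _) cg); have [hp _] := (iffLR (curveP _ _) cphi).
have [cF _ _ _] := sF; have [hF _] := (iffLR (curveP _ _) cF).
by apply: proj_eq_factor lift; [exact: homogm_f1 | exact: homogm_precomp | exact: nocz_precomp cphi cF].
Qed.

(** A degenerate lift would have its image in the closure of the surface orbit. *)
Lemma lift_det_neq0 : \det g != 0.
Proof.
apply/eqP => d0; have [h [_ h0 E]] := lift_factor.
have [cF _ _ [p [p0]]] := sF; apply; rewrite point_ofE => d P hP Pv.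
have [hF _] := (iffLR (curveP _ _) cF).
move: p0; rewrite row_nz => p0.
have [x [y [k [_ k0 Ek]]]] := curve_mev_phi cphi p0.
have [Q QE] := poly_on_curve P (precomp F phi).
have Q0 : Q = 0.
  have : h ^+ d * Q = 0.
    apply: ev_inj => a b; rewrite evM evX ev0 QE -(meval_scale _ _ hP) -mevZ -E mev_f1.
    apply: (closure_f1_det0 _ hP Pv).
    by rewrite mev_det d0 ev0.
  by move/eqP; rewrite mulf_eq0 expf_eq0 (negPf h0) andbF => /eqP.
have := QE x y; rewrite Q0 ev0 (Ek _ _ _ _ hF) (meval_scale _ _ hP) => /esym/eqP.
by rewrite mulf_eq0 !expf_eq0 (negPf k0) !andbF => /eqP.
Qed.

(** The deck transformation leaves phi unchanged, so that g o sigma and g lift the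
    same curve. *)
Lemma deck_octa sigma : deck phi sigma -> exists B, octa B /\
  precomp g (moebius sigma) = g *m const_forms B.
Proof.
move=> [us hs]; have [hg ng] := (iffLR (curveP _ _) cg).
have [hp np] := (iffLR (curveP _ _) cphi).
have [cF _ _ _] := sF; have [hF _] := (iffLR (curveP _ _) cF).
have hps : homogm 8 (precomp phi (moebius sigma)).
  by rewrite -[8%N]mul1n; apply: homogm_precomp; [exact: hp | exact: homogm_moebius].
have [c c0 Ec] := proj_eq_const hps hp np hs.
have [h [_ h0 E]] := lift_factor.
have [h' [h'0 E']] : exists h', h' != 0 /\ f1 (precomp g (moebius sigma)) = h' *: precomp F phi.
  exists ((h \mPo [tuple moebius sigma i 0 | i < 2]) * (c ^+ 6)%:MP); split.
    by rewrite mulf_neq0 ?comp_neq0 // mpolyC_eq0 expf_neq0.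
  apply: mev_inj => x y; rewrite mev_f1 mev_moebius -mev_f1 E !mevZ evM evC ev_comp !ev_moebius.
  rewrite -scalerA; congr (_ *: _); rewrite mev_precomp mev_precomp -(mevS _ _ _ hF).
  have := congr1 (fun m => mev m x y) Ec; rewrite /= mev_moebius mevZ evC => /matrixP Em.
  by rewrite -!mevP !Em !mxE.
have dg := lift_det_neq0.
have [||B oB /proj_eq_const hB] := @same_image_octa _ g (precomp g (moebius sigma)) dg.
- by rewrite det_precomp comp_neq0.
- exists h, h'; split; [exact: h0 | exact: h'0 |].
  rewrite E' E !scalerA (mulrC h h'); reflexivity.
have hgs : homogm n (precomp g (moebius sigma)).
  by rewrite -[n]mul1n; apply: homogm_precomp; [exact: hg | exact: homogm_moebius].
have [k k0 Ek] := hB n hgs (homogm_mulC _ hg) (nocz_mulC (octa_unit oB) ng).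
exists (k *: B); split; first exact: octa_scale.
apply: mev_inj => x y; rewrite Ek mevZ evC !mev_mul !mev_const -scalemxAr //.
Qed.

Lemma mev_cancel (X Y : 'M[C]_2) : (forall x y, mev g x y *m X = mev g x y *m Y) -> X = Y.
Proof.
have [x [y h]] : exists x y, ev (\det g) x y != 0.
  apply: contrapT => nx; move/eqP: lift_det_neq0; apply; apply: ev_eq0 => x y.
  by apply/eqP; apply: contrapT => /negP xy; apply: nx; exists x, y.
move=> /(_ x y) E; apply: (can_inj (mulKmx _)) E.
by rewrite unitmxE mev_det unitfE.
Qed.

(** The deck transformations A and B that generate the dihedral group act on g by
    octahedral matrices BA and BB. By faithfulness BA has order four, so that it is
    conjugate to diag(i,1); then BB is antidiagonal. Its entries have equal squares,
    if B is replaced by A B when necessary, so that a diagonal matrix in the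
    octahedral group makes BB a multiple of the exchange of the columns. *)
Lemma lift_symmetry : galois_covering 8 phi D4 -> galois_lift phi F g ->
  exists mu nu K, [/\ covering_equiv phi (phi_D4 C) mu nu, octa K &
    let g' := precomp g (moebius mu) *m const_forms K in
    exists a b, (forall x y, mev g' (ii * x) y = a *: (mev g' x y *m rotm C 1)) /\
      (forall x y, mev g' y x = b *: (mev g' x y *m refm C 0))].
Proof.
move=> gphi [_ ginj].
have [A [B [a [b [c [dA dB A4 A2 [B2 ABA]]]]]]] := deck_generators gphi.
have [hg _] := (iffLR (curveP _ _) cg).
have [BA [oA EA]] := deck_octa dA; have [BB [oB EB]] := deck_octa dB.
have EM X Y BX BY : precomp g (moebius X) = g *m const_forms BX ->
    precomp g (moebius Y) = g *m const_forms BY ->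
    precomp g (moebius (X *m Y)) = g *m const_forms (BY *m BX).
  move=> EX EY; apply: mev_inj => x y.
  rewrite mev_mul mev_const -(mev_deck_mul hg EX EY (esym (scale1r _))).
  by rewrite expr1n scale1r.
have E1 : precomp g (moebius 1%:M) = g.
  by apply: mev_inj => x y; rewrite mev_moebius !mxE /= mul1r !mul0r mul1r add0r addr0.
have EAA := EM _ _ _ _ EA EA.
have uBA := octa_unit oA.
(* By faithfulness, as A^2 is not the identity. *)
have BA2 d : BA *m BA <> d%:M.
  move=> Ed; have d0 : d != 0 by apply: (scalar_neq0 _ Ed); rewrite unitmx_mul uBA.
  have /proj_field [k _ Ek] : proj_eq (A *m A) 1%:M.
    apply: ginj; [exact: (deck_mul cphi dA dA) | exact: deck_1 |].
    rewrite E1 EAA Ed; apply: (@proj_scale _ _ _ _ _ d%:MP); first by rewrite mpolyC_eq0.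
    rewrite /const_forms map_scalar_mx mul_mx_scalar scalemxAl; congr (_ *m _).
    by rewrite !adj2; apply/mx2P; rewrite !mxE /= ?mulrN; reflexivity.
  by apply: (A2 k); rewrite Ek scalemx1.
have BA4 : BA *m BA *m (BA *m BA) = (a ^+ n)%:M.
  apply: mev_cancel => x y; rewrite -(mev_deck_mul (c := a) (D := 1%:M) hg EAA EAA); last first.
    by rewrite A4 scalemx1.
  by rewrite E1 -mul_mx_scalar.
have EAB := EM _ _ _ _ EA EB.
have BABA : BA *m BB *m BA = c ^+ n *: BB.
  rewrite -mulmxA; apply: mev_cancel => x y; rewrite -(mev_deck_mul hg EAB EA ABA).
  by rewrite EB mev_mul mev_const -scalemxAr.
have [K [l [oK l0 EK]]] := octa_order4 oA BA4 BA2.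
have uK := octa_unit oK.
have KR : rotm C 1 = l^-1 *: (invmx K *m BA *m K).
  by rewrite -mulmxA EK -scalemxAr mulmxA mulVmx // mul1mx scalerA mulVf // scale1r.
have [||B00 B11 B01 B4] := @octa_invert (invmx K *m BB *m K) (l^-1 * l^-1 * c ^+ n).
- by apply: octa_mul => //; apply: octa_mul => //; apply: octa_inv.
- rewrite KR -!scalemxAl -scalemxAr scalerA -[RHS]scalerA; congr (_ *: _).
  by rewrite scalemxAl scalemxAr -BABA !mulmxA !mulmxK.
set Q := invmx K *m BB *m K in B00 B11 B01 B4.
have EQ : BB *m K = K *m mk2 0 (Q 0 1) (Q 1 0) 0.
  have -> : mk2 0 (Q 0 1) (Q 1 0) 0 = Q by apply/mx2P; rewrite !mk2E.
  by rewrite /Q !mulmxA mulmxV // mul1mx.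
have q0 : Q 1 0 != 0 by apply: contraNneq B01 => z; move/eqP: B4; rewrite z expr0n expf_eq0.
clearbody Q.
have [B1 [BB1 [b1 [x [y [[EB1 cB1 B12] AB1A EQ1 y0 xy]]]]]] : exists B1 BB1 b1 x y,
  [/\ [/\ precomp g (moebius B1) = g *m const_forms BB1, deck phi B1 & B1 *m B1 = b1%:M],
      A *m B1 *m A = c *: B1, BB1 *m K = K *m mk2 0 x y 0, y != 0 & x ^+ 2 = y ^+ 2].
  (* The fourth powers agree; if the squares are opposite, B is replaced by A B. *)
  have : (Q 0 1 ^+ 2 - Q 1 0 ^+ 2) * (Q 0 1 ^+ 2 + Q 1 0 ^+ 2) = 0.
    by transitivity (Q 0 1 ^+ 4 - Q 1 0 ^+ 4); [ring | rewrite B4 subrr].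
  move/eqP; rewrite mulf_eq0 subr_eq0 addr_eq0 => /orP[] /eqP sq.
    by exists B, BB, b, (Q 0 1), (Q 1 0).
  exists (A *m B), (BB *m BA), (c * b), (l * Q 0 1), (l * (Q 1 0 * ii)); split.
  - split; [exact: EAB | exact: (deck_mul cphi dA dB) |].
    by rewrite mulmxA ABA -scalemxAl B2 scale_scalar_mx.
  - by rewrite -mulmxA ABA -scalemxAr.
  - rewrite -mulmxA EK -scalemxAr mulmxA EQ -mulmxA scalemxAr; congr (_ *m _).
    by apply/mx2P; rewrite !(mul2E, mxE) /= ?expr1; ring.
  - by rewrite !mulf_neq0 ?ii_neq0.
  by rewrite !exprMn ii2 sq; ring.
have [d d4 d2] : exists2 d : C, d ^+ 4 = 1 & x = y * d ^+ 2.
  move/eqP: xy; rewrite eqf_sqr => /orP[] /eqP ->.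
    by exists 1; rewrite !expr1n ?mulr1.
  by exists ii; rewrite ?ii4 // ii2 mulrN1.
have d0 : d != 0 by apply: contraNneq (oner_neq0 C) => z; rewrite -d4 z expr0n.
have [mu [r [s [umu r0 s0 Emu Emu']]]] :=
  dihedral_normal (deck_unit dA) (deck_unit cB1) A4 A2 B12 AB1A.
have [nu hnu] : exists nu, covering_equiv phi (phi_D4 C) mu nu.
  by apply: cover_normal Emu Emu' => //; [case: dA | case: cB1].
exists mu, nu, (K *m mk2 d 0 0 1); split=> //.
  apply: octa_mul => //; apply: Or31; rewrite !mk2E; split=> //.
  by rewrite expr1n.
exists ((r ^+ n)^-1 * l), ((s ^+ n)^-1 * (y * d)); split=> u v.
  rewrite [LHS]mev_mul [in RHS]mev_mul !mev_const.
  have := mev_deck hg r0 EA Emu u v; rewrite !mk2E expr1 mul0r mul0r addr0 add0r mul1r => ->.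
  rewrite -scalemxAl -[RHS]scalerA; congr (_ *: _); rewrite -!mulmxA scalemxAr; congr (_ *m _).
  rewrite mulmxA EK -scalemxAl; congr (_ *: _); rewrite -mulmxA; congr (_ *m _).
  by apply/mx2P; rewrite !(mul2E, mxE) /=; ring.
rewrite [LHS]mev_mul [in RHS]mev_mul !mev_const.
have := mev_deck hg s0 EB1 Emu' u v; rewrite !mk2E expr0 mul0r mul0r addr0 add0r !mul1r => ->.
rewrite -scalemxAl -[RHS]scalerA; congr (_ *: _); rewrite -!mulmxA scalemxAr; congr (_ *m _).
rewrite mulmxA EQ1 -mulmxA scalemxAr; congr (_ *m _).
by apply/mx2P; rewrite !(mul2E, mxE) /= ?d2; ring.
Qed.

End Lift.

End LiftSymmetry.

(** * Degree and monomials of a symmetric lift *)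

Section MonomialForm.

Variable C : numClosedFieldType.
Implicit Types (x y c : C) (M : 'M[C]_(2, 3)) (g : 'M[forms C]_2).

Notation ii := ('i : C).

Lemma ii_pow_eq j k : ii ^+ j = ii ^+ k -> j = k %[mod 4].
Proof. by rewrite (ii_mod _ j) (ii_mod _ k); apply: ii_pow_inj; rewrite ltn_mod. Qed.

(** Comparing the effect of x |-> i x on the two columns shows that the exponents
    are constant modulo 4. As g does not vanish at (1,0), the exponent n or 0
    occurs, which determines n modulo 4. *)
Lemma symmetric_coefs n g a : homogm n g -> nocz g ->
  (forall x y, mev g (ii * x) y = a *: (mev g x y *m rotm C 1)) ->
  (forall x y, mev g y x = mev g x y *m refm C 0) ->
  exists c : 'I_2 -> nat -> C, [/\ forall r x y, mev g x y r 0 = ev (hform n (c r)) x y,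
     forall r x y, mev g x y r 1 = ev (hform n (c r)) y x &
     ((n %% 4 = 1)%N /\ forall r k, (k <= n)%N -> (k %% 4 != 1)%N -> c r k = 0) \/
     ((n %% 4 = 3)%N /\ forall r k, (k <= n)%N -> (k %% 4 != 0)%N -> c r k = 0)].
Proof.
move=> hg ng hR hS.
have [c cE] : exists c : 'I_2 -> nat -> C, forall r, g r 0 = hform n (c r).
  have [c0 E0] := homog_exists (hg 0 0); have [c1 E1] := homog_exists (hg 1 0).
  by exists (fun r => if r == 0 then c0 else c1) => r; case: (ord2P r) => ->.
have c1E r x y : mev g x y r 1 = ev (hform n (c r)) y x.
  have /matrixP/(_ r 0) := hS x y; rewrite mul2E !mk2E mulr0 add0r mulr1 => <-.
  by rewrite mevP cE.
have c0E r x y : mev g x y r 0 = ev (hform n (c r)) x y by rewrite mevP cE.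
have hR0 r x y : mev g (ii * x) y r 0 = a * ii * mev g x y r 0.
  by have /matrixP/(_ r 0) := hR x y; rewrite [RHS]mxE mul2E !mk2E mulr0 addr0 expr1 => ->; ring.
have hR1 r x y : mev g (ii * x) y r 1 = a * mev g x y r 1.
  by have /matrixP/(_ r 1) := hR x y; rewrite [RHS]mxE mul2E !mk2E mulr0 add0r mulr1.
have scal (d : nat -> C) b k : (forall x y, ev (hform n d) (ii * x) y = b * ev (hform n d) x y) ->
    (k <= n)%N -> d k != 0 -> ii ^+ k = b.
  move=> hd kn dk; have := @hform_coef0 C n (fun k => 1 * (d k * ii ^+ k) + (- b) * d k) _ k kn.
  rewrite mul1r mulNr [b * _]mulrC -mulrBr => h.
  apply/eqP; rewrite -subr_eq0; apply/eqP; apply: (mulfI dk); rewrite mulr0; apply: h => x y.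
  by rewrite ev_hform_lin -ev_hform_scale hd mul1r mulNr subrr.
have R0 r k : (k <= n)%N -> c r k != 0 -> ii ^+ k = a * ii.
  by apply: scal => x y; rewrite -!c0E hR0.
have R1 r k : (k <= n)%N -> c r k != 0 -> ii ^+ (n - k) = a.
  move=> kn ck; apply: (scal (fun k => c r (n - k)%N)); rewrite ?leq_subr ?subKn // => x y.
  by rewrite -!ev_hform_swap -!c1E hR1.
exists c; split=> //.
have [i [j]] : exists i j, ev (g i j) 1 0 != 0 by apply/noczP/ng; rewrite /nz oner_neq0.
have low r k e : (k <= n)%N -> (k %% 4 != e %% 4)%N -> a * ii = ii ^+ e -> c r k = 0.
  move=> kn ke ae; apply/eqP; apply: contraNT ke => ck; apply/eqP/ii_pow_eq.
  by rewrite (R0 r k kn ck).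
rewrite -mevP; case: (ord2P j) => ->; rewrite ?c0E ?c1E ev_hform.
  rewrite big_ord_recr big1 /=; last first.
    by move=> k _; rewrite expr0n subn_eq0 leqNgt ltn_ord /= !mulr0.
  rewrite add0r subnn expr1n mulr1 mulr1 => cn; left.
  have a1 := R1 i n (leqnn n) cn; rewrite subnn expr0 in a1.
  have := R0 i n (leqnn n) cn; rewrite -a1 mul1r -[ii in RHS]expr1 => /ii_pow_eq n1.
  by split=> [|r k kn k4]; [rewrite n1 | apply: (low r k 1%N)]; rewrite // -a1 mul1r expr1.
rewrite big_ord_recl big1 /=; last by move=> k _; rewrite expr0n /= mul0r mulr0.
rewrite addr0 expr0 subn0 expr1n mulr1 mulr1 => cn; right.
have a1 := R0 i 0%N (leq0n n) cn; rewrite expr0 in a1.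
have := R1 i 0%N (leq0n n) cn; rewrite subn0.
have -> : a = ii ^+ 3 by apply: (mulIf (ii_neq0 C)); rewrite -a1 -exprSr ii4.
move/ii_pow_eq => n1.
by split=> [|r k kn k4]; [rewrite n1 | apply: (low r k 0%N)]; rewrite // expr0.
Qed.

Lemma symmetric_families n g a : homogm n g -> nocz g ->
  (forall x y, mev g (ii * x) y = a *: (mev g x y *m rotm C 1)) ->
  (forall x y, mev g y x = mev g x y *m refm C 0) ->
  [/\ (n %% 4 = 1 \/ n %% 4 = 3)%N, n = 9%N -> exists M, g = g9 M &
      n = 11%N -> exists M, g = g11 M].
Proof.
move=> hg ng hR hS; have [c [E0 E1 h]] := symmetric_coefs hg ng hR hS.
split; first by case: h => -[]; [left | right].
- move=> n9; move: h; rewrite n9 => -[[_ h]|[e _]]; last by move: e.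
  (* The solution for the coefficients of x y^8, x^5 y^4 and x^9 in the first column. *)
  exists (\matrix_(i, j) nth 0 [:: 4 * c i 9%N; c i 5%N + c i 9%N + c i 1%N; c i 1%N - c i 9%N] j).
  apply: mev_inj => x y; apply/matrixP => i j.
  by case: (ord2P j) => ->; rewrite !g9E !mxE /=; [rewrite -[LHS]mevP E0 | rewrite -[LHS]mevP E1];
  rewrite n9 ev_hform !big_ord_recl big_ord0 /= /bump /=;
  rewrite !(add1n, add0n) !(h i 0%N, h i 2%N, h i 3%N, h i 4%N, h i 6%N, h i 7%N, h i 8%N) //= /al; field.
move=> n11; move: h; rewrite n11 => -[[e _]|[_ h]]; first by move: e.
(* The solution for the coefficients of y^11, x^4 y^7 and x^8 y^3. *)
exists (\matrix_(i, j) nth 0 [:: c i 4%N - c i 8%N - c i 0%N; c i 4%N + c i 8%N + c i 0%N; 2 * c i 0%N] j).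
apply: mev_inj => x y; apply/matrixP => i j.
by case: (ord2P j) => ->; rewrite !g11E !mxE /=; [rewrite -[LHS]mevP E0 | rewrite -[LHS]mevP E1];
rewrite n11 ev_hform !big_ord_recl big_ord0 /= /bump /=;
rewrite !(add1n, add0n) !(h i 1%N, h i 2%N, h i 3%N, h i 5%N, h i 6%N, h i 7%N, h i 9%N, h i 10%N, h i 11%N) //= /al /be; field.
Qed.

Lemma ord3P (j : 'I_3) : [\/ j = 0, j = 1 | j = 2].
Proof.
by case: j => [[|[|[|//]]] h]; [apply: Or31|apply: Or32|apply: Or33]; apply: val_inj.
Qed.

Lemma rank2_minors M : \rank M = 2%N <-> [\/ m01 M != 0, m02 M != 0 | m12 M != 0].
Proof.
have rowf B : M *m B = 1%:M -> \rank M = 2%N.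
  by move=> E; apply/eqP; rewrite -[_ == _]/(row_free M); apply/row_freeP; exists B.
split=> [/eqP|].
  move/(row_freeP (A := M)) => [B E].
  have [z0|?] := eqVneq (m01 M) 0; last by apply: Or31.
  have [z1|?] := eqVneq (m02 M) 0; last by apply: Or32.
  have [z2|?] := eqVneq (m12 M) 0; last by apply: Or33.
  case/eqP: (oner_neq0 C); rewrite -(det1 _ 2) -E det2 !mul3E.
  transitivity (m01 M * (B 0 0 * B 1 1 - B 0 1 * B 1 0) + m02 M * (B 0 0 * B 2 1 - B 0 1 * B 2 0)
     + m12 M * (B 1 0 * B 2 1 - B 1 1 * B 2 0)); first by rewrite /m01 /m02 /m12; ring.
  by rewrite z0 z1 z2 !mul0r !addr0.
pose B (c00 c01 c10 c11 c20 c21 : C) : 'M[C]_(3, 2) := \matrix_(i, j)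
  nth 0 (if j == 0 then [:: c00; c10; c20] else [:: c01; c11; c21]) i.
have minor B' m : m != 0 -> M *m B' = m%:M -> \rank M = 2%N.
  by move=> m0 E; apply: (rowf (m^-1 *: B')); rewrite -scalemxAr E scale_scalar_mx mulVf.
case=> m0.
- apply: (minor (B (M 1 1) (- M 0 1) (- M 1 0) (M 0 0) 0 0) _ m0).
  by apply/mx2P; rewrite mul3E !mxE /= ?mulr1n ?mulr0n /m01; ring.
- apply: (minor (B (M 1 2) (- M 0 2) 0 0 (- M 1 0) (M 0 0)) _ m0).
  by apply/mx2P; rewrite mul3E !mxE /= ?mulr1n ?mulr0n /m02; ring.
apply: (minor (B 0 0 (M 1 2) (- M 0 2) (- M 1 1) (M 0 1)) _ m0).
by apply/mx2P; rewrite mul3E !mxE /= ?mulr1n ?mulr0n /m12; ring.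
Qed.

End MonomialForm.

(** * Contents of a lift at the vertices of the octahedron *)

Section Vertices.

Variable C : numClosedFieldType.
Notation ii := ('i : C).

(** The roots (0,1), (1,0) and (i^l,1) of the sextic uv(u^4 - v^4). *)
Definition vtx (i : nat) : 'cV[C]_2 := \col_j
  (if j == 0 then if i is k.+1 then if k is l.+1 then ii ^+ l else 1 else 0
   else if i == 1%N then 0 else 1).

Definition lin (K : comNzRingType) (r : 'cV[K]_2) (u w : K) : K := r 1 0 * u - r 0 0 * w.

(** The sextic with prescribed roots. *)
Definition psx (K : comNzRingType) (r : 'I_6 -> 'cV[K]_2) : 'rV[K]_7 :=
  coefs6 (\prod_(i < 6) (r i 1 0 *: X0 - r i 0 0 *: X1)).

Lemma sx_psx (K : comNzRingType) (r : 'I_6 -> 'cV[K]_2) u w :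
  sx (psx r) u w = \prod_i lin (r i) u w.
Proof.
rewrite /psx sx_coefs6; last first.
  rewrite -[6%N]/(0 + 1 + 1 + 1 + 1 + 1 + 1)%N.
  have h i : (r i 1 0 *: X0 - r i 0 0 *: X1 : forms K) \is 1.-homog.
    by apply: rpredB; apply: dhomogZ; [exact: homog_X0 | exact: homog_X1].
  by rewrite !big_ord_recr big_ord0; do 6![apply: dhomogM; last exact: h]; rewrite dhomog1.
by rewrite ev_prod; apply: eq_bigr => i _; rewrite !evE.
Qed.

Lemma mev_psx (r : 'I_6 -> 'cV[forms C]_2) x y :
  mev (psx r) x y = psx (fun i => mev (r i) x y).
Proof.
apply: sx_inj => u w; rewrite -ev_sxf /sxf !sx_psx ev_prod.
by apply: eq_bigr => i _; rewrite /lin !evE !mevP.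
Qed.

Lemma lin_mul (K : comNzRingType) (c : K) (r : 'cV[K]_2) u w : lin (c *: r) u w = c * lin r u w.
Proof. by rewrite /lin !mxE; ring. Qed.

Lemma vtx_det i j : (i < 6)%N -> (j < 6)%N -> i != j ->
  vtx i 0 0 * vtx j 1 0 - vtx i 1 0 * vtx j 0 0 != 0.
Proof.
rewrite !mxE /=; case: i => [|[|i]]; case: j => [|[|j]] //= hi hj ij;
  rewrite ?mulr0 ?mul0r ?mulr1 ?mul1r ?subr0 ?sub0r ?oppr_eq0 ?oner_neq0 ?expf_neq0 ?ii_neq0 //.
rewrite subr_eq0; apply: contra ij => /eqP /ii_pow_inj -> //.
Qed.

Lemma f1_vertices (N : 'M[C]_2) u w :
  sx (f1 N) u w = - \prod_(i < 6) lin (N *m vtx i) u w.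
Proof.
rewrite sx_f1 !big_ord_recl big_ord0 /lin !mul2E !mxE /= /f0.
have e3 : ii ^+ 3 = - ii by rewrite exprS ii2 mulrN1.
rewrite /bump /= !expr1 ?expr0 ?ii2 ?e3.
set p := N 1 1; set q := N 0 1; set r := N 0 0; set s := N 1 0; clearbody p q r s.
have -> X Y : X ^+ 4 - Y ^+ 4 = (X ^+ 2 - Y ^+ 2) * (X ^+ 2 - ii ^+ 2 * Y ^+ 2) by rewrite ii2; ring.
ring.
Qed.

Lemma nocz_psx (r : 'I_6 -> 'cV[forms C]_2) : (forall i, nocz (r i)) -> nocz (psx r).
Proof.
move=> nr x y xy; rewrite mev_psx; set s := fun i => mev (r i) x y.
have : \prod_(i < 6) (s i 1 0 *: X0 - s i 0 0 *: X1) != 0 :> forms C.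
  apply/prodf_neq0 => i _; rewrite -[_ - _]/(lform (s i 0 0) (s i 1 0)); apply: lform_neq0.
  have [k [j]] := noczP (nr i x y xy); rewrite ord1 /nz /s !mevP.
  by case: (ord2P k) => -> ->; rewrite ?orbT.
apply: contraNneq => E; apply/eqP/ev_eq0 => u w; rewrite ev_prod.
have := sx_psx s u w; rewrite E sx0 => ->.
by apply: eq_bigr => i _; rewrite /lin !evE.
Qed.

Lemma homogm_psx (r : 'I_6 -> 'cV[forms C]_2) d : (forall i, homogm (d i) (r i)) ->
  homogm (\sum_i d i) (psx r).
Proof.
move=> hr i j; apply: homog_of_ev => t x y; rewrite -!mevP.
suff -> : mev (psx r) (t * x) (t * y) = t ^+ (\sum_i d i) *: mev (psx r) x y by rewrite mxE.
apply: sx_inj => u w; rewrite sxZ !mev_psx !sx_psx -prodrXr -big_split.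
by apply: eq_bigr => k _; rewrite /= (mevS _ _ _ (hr k)) lin_mul.
Qed.

(** By gauss_div, dividing by one of the pairwise coprime factors keeps the
    divisibility by the next ones. *)
Lemma dvd_prod_coprime n (D : forms C) (m : nat) (d : nat -> nat) (c : nat -> forms C) :
  D \is n.-homog -> (forall i, (i < m)%N -> c i \is (d i).-homog /\ c i != 0) ->
  (forall i, (i < m)%N -> exists k, D = c i * k) ->
  (forall i j, (i < j)%N -> (j < m)%N -> forall x y, nz x y -> ev (c i) x y = 0 -> ev (c j) x y <> 0) ->
  exists2 k, k \is (n - \sum_(i < m) d i).-homog & D = k * \prod_(i < m) c i.
Proof.
elim: m => [|m IH] hD hc dv cp.
  by exists D; rewrite !big_ord0 ?subn0 ?mulr1.
have [|||k hk Dk] := IH hD.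
- by move=> i im; apply: hc; apply: ltnW.
- by move=> i im; apply: dv; apply: ltnW.
- by move=> i j ij jm; apply: cp; rewrite ?ltnS // ltnW.
have [hm m0] := hc m (ltnSn m).
have [|j|q hq kq] := @gauss_div C bool (fun b => if b then c m else \prod_(i < m) c i) _ _ _ k hm m0 hk.
- move=> x y xy; have [z|nz0] := eqVneq (ev (c m) x y) 0; last by exists true.
  exists false; rewrite ev_prod; apply/prodf_neq0 => i _; apply/eqP => zi.
  by apply: (cp i m _ _ x y xy zi z).
- case: j; first by exists k; rewrite mulrC.
  by have [k' Dk'] := dv m (ltnSn m); exists k'; rewrite -Dk -Dk'.
exists q; first by rewrite big_ord_recr /= subnDA.
by rewrite big_ord_recr /= Dk kq; ring.
Qed.

End Vertices.

Section Contents.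

Variables (C : numClosedFieldType) (n : nat) (g : 'M[forms C]_2).
Hypotheses (hg : homogm n g) (ng : nocz g) (dg : \det g != 0).

Lemma vertex_contents : exists (d : nat -> nat) (c : nat -> forms C) (r : nat -> 'cV[forms C]_2),
  forall i, [/\ (d i <= n)%N, c i \is (d i).-homog, homogm (n - d i) (r i), nocz (r i) &
    g *m const_forms (vtx C i) = c i *: r i].
Proof.
have P i : exists z : nat * forms C * 'cV[forms C]_2,
    [/\ (z.1.1 <= n)%N, z.1.2 \is (z.1.1).-homog, homogm (n - z.1.1) z.2, nocz z.2 &
    g *m const_forms (vtx C i) = z.1.2 *: z.2].
  have [||d [c [r [dn hc hr nr E]]]] := @primitive_part C n 2 1 (g *m const_forms (vtx C i)).
  - exact: homogm_mulC.
  - have [x [y h]] : exists x y, ev (\det g) x y != 0.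
      apply: contrapT => nx; move/eqP: dg; apply; apply: ev_eq0 => x y.
      by apply/eqP; apply: contrapT => /negP xy; apply: nx; exists x, y.
    have ug : mev g x y \in unitmx by rewrite unitmxE mev_det unitfE.
    apply/eqP => /(congr1 (fun m => mev m x y)); rewrite mev_mul mev_const mev0 => E.
    have : vtx C i = 0 by rewrite -[vtx C i](mulKmx ug) E mulmx0.
    move/matrixP => V; have := V 0 0; have := V 1 0; rewrite !mxE /=.
    by case: i {E V} => [|[|i]] /= /eqP; rewrite ?oner_eq0 // => _ /eqP; rewrite oner_eq0.
  by exists (d, c, r).
have [f fP] := boolp.choice P.
by exists (fun i => (f i).1.1), (fun i => (f i).1.2), (fun i => (f i).2).
Qed.

Variables (d : nat -> nat) (c : nat -> forms C) (r : nat -> 'cV[forms C]_2).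
Hypothesis dcr : forall i, [/\ (d i <= n)%N, c i \is (d i).-homog, homogm (n - d i) (r i), nocz (r i) &
    g *m const_forms (vtx C i) = c i *: r i].

Let gv i x y : mev g x y *m vtx C i = ev (c i) x y *: mev (r i) x y.
Proof. by have [_ _ _ _ E] := dcr i; rewrite -mevZ -E mev_mul mev_const. Qed.

Lemma f1_contents : f1 g = (- \prod_(i < 6) c i) *: psx (fun i => r i).
Proof.
apply: mev_inj => x y; apply: sx_inj => u w.
rewrite mev_f1 f1_vertices mevZ evN sxZ mulNr mev_psx sx_psx ev_prod -big_split.
by congr (- _); apply: eq_bigr => i _; rewrite gv lin_mul.
Qed.

Let cross i j x y : \det (mev g x y) * (vtx C i 0 0 * vtx C j 1 0 - vtx C i 1 0 * vtx C j 0 0) =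
  (mev g x y *m vtx C i) 0 0 * (mev g x y *m vtx C j) 1 0 -
  (mev g x y *m vtx C i) 1 0 * (mev g x y *m vtx C j) 0 0.
Proof. by rewrite det2 !mul2E; ring. Qed.

Lemma contents_neq0 i : (i < 6)%N -> c i != 0.
Proof.
move=> i6; pose j := if i == 0%N then 1%N else 0%N.
have jv := @vtx_det C i j i6 _ _.
apply: contraNneq dg => z; apply/eqP/ev_eq0 => x y.
have v0 : vtx C i 0 0 * vtx C j 1 0 - vtx C i 1 0 * vtx C j 0 0 != 0.
  by apply: jv; rewrite /j; case: (i) i6 => [|[]].
by apply: (mulIf v0); rewrite -mev_det cross gv z ev0 scale0r !mxE !mul0r subrr.
Qed.

(** Otherwise g would annihilate two independent vectors at the point, hence be zero
    there. *)
Lemma contents_coprime i j x y : (i < 6)%N -> (j < 6)%N -> i != j -> nz x y ->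
  ev (c i) x y = 0 -> ev (c j) x y <> 0.
Proof.
move=> i6 j6 ij xy zi zj; case/eqP: (ng xy).
have v0 := @vtx_det C i j i6 j6 ij.
have E a i' : ev (c i') x y = 0 -> mev g x y a 0 * vtx C i' 0 0 + mev g x y a 1 * vtx C i' 1 0 = 0.
  by move=> z; rewrite -mul2E gv z scale0r mxE.
have Ea a := E a i zi; have Eb a := E a j zj.
apply/matrixP => a b; rewrite [RHS]mxE; apply: (mulIf v0); rewrite mul0r.
case: (ord2P b) => ->.
  transitivity (vtx C j 1 0 * (mev g x y a 0 * vtx C i 0 0 + mev g x y a 1 * vtx C i 1 0)
     - vtx C i 1 0 * (mev g x y a 0 * vtx C j 0 0 + mev g x y a 1 * vtx C j 1 0)); first by ring.
  by rewrite Ea Eb !mulr0 subrr.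
transitivity (vtx C i 0 0 * (mev g x y a 0 * vtx C j 0 0 + mev g x y a 1 * vtx C j 1 0)
     - vtx C j 0 0 * (mev g x y a 0 * vtx C i 0 0 + mev g x y a 1 * vtx C i 1 0)); first by ring.
by rewrite Ea Eb !mulr0 subrr.
Qed.

Lemma contents_cross i j : \det g * (vtx C i 0 0 * vtx C j 1 0 - vtx C i 1 0 * vtx C j 0 0)%:MP =
  c i * c j * (r i 0 0 * r j 1 0 - r i 1 0 * r j 0 0).
Proof.
apply: ev_inj => x y; rewrite evM evC -mev_det cross !gv.
have scE l a : (ev (c l) x y *: mev (r l) x y) a 0 = ev (c l) x y * ev (r l a 0) x y.
  by rewrite mxE mevP.
by rewrite !scE evM !evM evB !evM; ring.
Qed.

(** Up to a constant, det g is the determinant of the images under g of any two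
    vertices; this gives the divisibility by each content. *)
Lemma det_contents : exists2 k, k \is (n + n - \sum_(i < 6) d i).-homog &
  \det g = k * \prod_(i < 6) c i.
Proof.
apply: dvd_prod_coprime.
- apply: homog_of_ev => t x y; rewrite -!mev_det (mevS _ _ _ hg) detZ.
  by rewrite exprD expr2.
- by move=> i i6; split; [case: (dcr i) | apply: contents_neq0].
- move=> i i6; pose j := if i == 0%N then 1%N else 0%N.
  have v0 : vtx C i 0 0 * vtx C j 1 0 - vtx C i 1 0 * vtx C j 0 0 != 0.
    by apply: vtx_det => //; rewrite /j; case: (i) i6 => [|[]].
  pose s := g *m const_forms (vtx C j).
  exists ((vtx C i 0 0 * vtx C j 1 0 - vtx C i 1 0 * vtx C j 0 0)^-1 *: (r i 0 0 * s 1 0 - r i 1 0 * s 0 0)).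
  apply: ev_inj => x y; rewrite evM evZ evB !evM -!mevP /s !mev_mul !mev_const.
  have scE a : (ev (c i) x y *: mev (r i) x y) a 0 = ev (c i) x y * mev (r i) x y a 0.
    by rewrite mxE.
  rewrite -mev_det; apply: (mulIf v0); rewrite cross gv !scE.
  by move: v0; set v := _ - _ => v0; field.
move=> i j ij j6 x y xy zi; apply: contents_coprime xy zi => //; [exact: ltn_trans ij j6 | by rewrite neq_ltn ij].
Qed.

Section WithSextic.
Variables (phi : 'cV[forms C]_2) (F : 'rV[forms C]_7).
Hypotheses (cphi : is_curve 8 phi) (cF : is_curve 6 F).
Hypothesis lift : proj_eq (f1 g) (precomp F phi).

Let hpsi : homogm (\sum_(i < 6) (n - d i)) (psx (fun i => r i)).
Proof. by apply: (@homogm_psx C (fun i : 'I_6 => r i)) => i; case: (dcr i). Qed.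

Let npsi : nocz (psx (fun i => r i)).
Proof. by apply: nocz_psx => i; case: (dcr i). Qed.

Let psi_proj : proj_eq (psx (fun i => r i)) (precomp F phi).
Proof.
have [p [q [p0 q0]]] := lift; rewrite f1_contents scalerA => E.
exists (p * - \prod_(i < 6) c i), q; split; [|exact: q0 | exact: E].
rewrite mulf_neq0 ?oppr_eq0 //; apply/prodf_neq0 => i _; exact: contents_neq0.
Qed.

Let hFphi : homogm (8 * 6) (precomp F phi).
Proof.
have [hF _] := (iffLR (curveP _ _) cF); have [hp _] := (iffLR (curveP _ _) cphi).
exact: homogm_precomp.
Qed.

Let nFphi : nocz (precomp F phi). Proof. exact: nocz_precomp cphi cF. Qed.

(** Two proportional curves without common zeros have the same degree. *)
Lemma degree_contents : (\sum_(i < 6) (n - d i) = 48)%N.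
Proof. exact: proj_eq_degree hpsi hFphi npsi nFphi psi_proj. Qed.

Lemma sextic_contents : exists2 k, k != 0 & psx (fun i => r i) = k%:MP *: precomp F phi.
Proof.
have h := hpsi; rewrite degree_contents in h; exact: proj_eq_const h hFphi nFphi psi_proj.
Qed.

(** The contents have total degree 6 n - 48, at most the degree 2 n of the
    determinant. *)
Lemma degree_bounds : (8 <= n <= 12)%N /\ (\sum_(i < 6) d i + 48 = 6 * n)%N.
Proof.
have E : (\sum_(i < 6) d i + 48 = 6 * n)%N.
  rewrite -degree_contents -big_split /=.
  rewrite (eq_bigr (fun _ => n)); first by rewrite sum_nat_const card_ord.
  by move=> i _; rewrite subnKC //; case: (dcr i).
split; last exact: E.
have [k hk Ek] := det_contents.
have le : (\sum_(i < 6) d i <= n + n)%N.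
  have hc : \prod_(i < 6) c i \is (\sum_(i < 6) d i).-homog.
    apply: homog_of_ev => t x y; rewrite !ev_prod -prodrXr -big_split; apply: eq_bigr => i _.
    by rewrite /=; apply: ev_homog; case: (dcr i).
  have hd : \det g \is (n + n).-homog.
    by apply: homog_of_ev => t x y; rewrite -!mev_det (mevS _ _ _ hg) detZ exprD expr2.
  have := dhomogM hk hc; rewrite -Ek => hd'.
  have := dhomog_uniq dg hd hd'; lia.
by lia.
Qed.

End WithSextic.

End Contents.

(** * Tangent lines *)

Section TangentLines.

Variable C : numClosedFieldType.
Implicit Types (F : 'rV[forms C]_7) (a b e f u w : C).

(** The expansion of F along the line from (a,b) in the direction (a',b'). *)
Definition sxl F a b a' b' u w : {poly C} := sx (map_mx (line a b a' b') F) u%:P w%:P.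

Lemma horner_sxl F a b a' b' u w t :
  (sxl F a b a' b' u w).[t] = sx (mev F (a + a' * t) (b + b' * t)) u w.
Proof.
rewrite /sxl !sxE horner_sum; apply: eq_bigr => i _.
by rewrite !hornerE !mxE horner_line.
Qed.

Lemma sxl_eq F a b a' b' u w (P : {poly C}) :
  (forall t, P.[t] = sx (mev F (a + a' * t) (b + b' * t)) u w) -> sxl F a b a' b' u w = P.
Proof.
move=> h; apply/eqP; rewrite -subr_eq0; apply/eqP/poly_eq0_fun => t.
by rewrite hornerD hornerN horner_sxl h subrr.
Qed.

Lemma sxl0 F a b a' b' u w : (sxl F a b a' b' u w)`_0 = sx (mev F a b) u w.
Proof. by rewrite -horner_coef0 horner_sxl !mulr0 !addr0. Qed.

Lemma sxl1 F (p : 'rV[C]_2) a' b' u w : (sxl F (p 0 0) (p 0 1) a' b' u w)`_1 =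
  sx (a' *: row 0 (tangent_line F p) + b' *: row 1 (tangent_line F p)) u w.
Proof.
rewrite /sxl !sxE coef_sum; apply: eq_bigr => i _.
rewrite -!polyC_exp -polyCM coefMC; congr (_ * _); rewrite !mxE line1.
have E j : ev (F 0 i)^`M(j) (p 0 0) (p 0 1) = (F 0 i)^`M(j).@[p 0].
  by rewrite meval_row.
by rewrite !E.
Qed.

Lemma sx_rational_normal e f u w :
  sx (mev (rational_normal6 C) e f) u w = (e * u + f * w) ^+ 6.
Proof.
rewrite -ev_sxf /sxf /rational_normal6 sx_coefs6; first by rewrite !evE.
rewrite -[6%N]mul1n; apply: dhomogMn.
by apply: rpredD; apply: dhomogZ; [exact: homog_X0 | exact: homog_X1].
Qed.

Lemma coef1_pow6 (l m : C) : ((l%:P + m *: 'X) ^+ 6)`_1 = l ^+ 5 * (6 * m).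
Proof.
have -> : (l%:P + m *: 'X) ^+ 6 = (l ^+ 6)%:P + (l ^+ 5 * (6 * m))%:P * 'X +
   (15 * l%:P ^+ 4 * m%:P ^+ 2 + 20 * l%:P ^+ 3 * m%:P ^+ 3 * 'X + 15 * l%:P ^+ 2 * m%:P ^+ 4 * 'X^2
    + 6 * l%:P * m%:P ^+ 5 * 'X^3 + m%:P ^+ 6 * 'X^4) * 'X^2.
  by rewrite -mul_polyC; ring.
by rewrite !coefD coefC coefMX coefC coefMXn /= add0r addr0.
Qed.

Lemma ev_neq0 (f : forms C) : f != 0 -> exists x y, ev f x y != 0.
Proof.
move=> f0; apply: contrapT => nx; move/eqP: f0; apply; apply: ev_eq0 => x y.
by apply/eqP; apply: contrapT => /negP xy; apply: nx; exists x, y.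
Qed.

Lemma sxl_rational_normal e f a' b' u w : (sxl (rational_normal6 C) e f a' b' u w)`_1 =
  (e * u + f * w) ^+ 5 * (6 * (a' * u + b' * w)).
Proof.
rewrite (sxl_eq (P := ((e * u + f * w)%:P + (a' * u + b' * w) *: 'X) ^+ 6)); last first.
  by move=> t; rewrite sx_rational_normal !hornerE; ring.
exact: coef1_pow6.
Qed.

Lemma tangent_row F a b a' b' u w : (sxl F a b a' b' u w)`_1 =
  sx (a' *: row 0 (tangent_line F (rv2 a b)) + b' *: row 1 (tangent_line F (rv2 a b))) u w.
Proof. by rewrite -sxl1 rv2_0 rv2_1. Qed.

(** Fullness is the invertibility of the matrix of coefficients, of size 7. *)
Lemma full_surj F (f : forms C) : homogm 6 F -> linearly_full F -> f \is 6.-homog ->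
  exists c : 'cV[C]_7, forall x y, \sum_j ev (F 0 j) x y * c j 0 = ev f x y.
Proof.
move=> hF fF hf; pose A := \matrix_(k < 7, j < 7) (F 0 j)@_(mon2 k (6 - k)).
have FA x y (c : 'cV[C]_7) : \sum_j ev (F 0 j) x y * c j 0 =
    \sum_(k < 7) (A *m c) k 0 * (x ^+ k * y ^+ (6 - k)).
  under [RHS]eq_bigr => k _ do rewrite mxE mulr_suml.
  rewrite exchange_big; apply: eq_bigr => j _ /=.
  rewrite {1}(homog_hformE (hF 0 j)) ev_hform mulr_suml; apply: eq_bigr => k _.
  by rewrite mxE; ring.
have uA : A \in unitmx.
  apply/negPn/negP => nA; have : kermx A^T != 0.
    by rewrite kermx_eq0 -row_leq_rank -mxrank_tr trmxK row_leq_rank row_free_unit.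
  case/rowV0Pn => v /sub_kermxP vA v0; case/eqP: v0; apply: trmx_inj; rewrite trmx0; apply: fF.
  apply: mev_inj => x y; apply/matrixP => i j; rewrite mev_mul mev_const mev0 !mxE.
  transitivity (\sum_j0 ev (F 0 j0) x y * v^T j0 0).
    by apply: eq_bigr => k _; rewrite !ord1 mevP.
  have := congr1 trmx vA; rewrite trmx_mul trmxK trmx0 => E.
  by rewrite FA E big1 // => k _; rewrite mxE mul0r.
pose c := invmx A *m \col_k f@_(mon2 k (6 - k)).
exists c => x y; rewrite FA /c mulmxA mulmxV // mul1mx {2}(homog_hformE hf) ev_hform.
by apply: eq_bigr => k _; rewrite mxE.
Qed.

(** By full_surj some linear projection of F is the sixth power of a linear form
    that neither vanishes at the point nor is constant in a given direction. Its
    derivative in this direction is not zero, so the corresponding combination of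
    tangent vectors is not zero either. *)
Lemma full_tangent_rank F a b : homogm 6 F -> linearly_full F -> nz a b ->
  \rank (tangent_line F (rv2 a b)) = 2%N.
Proof.
move=> hF fF ab; apply/eqP; rewrite -[_ == _]/(row_free _) -kermx_eq0.
apply/negPn/negP => /rowV0Pn [v /sub_kermxP vT v0].
have [al [be' [h1 h2]]] : exists al be', al * a + be' * b != 0 /\ al * v 0 0 + be' * v 0 1 != 0.
  have nv : nz (v 0 0) (v 0 1) by rewrite -row_nz.
  have [x [y]] := ev_neq0 (mulf_neq0 (lform_neq0 ab) (lform_neq0 nv)).
  rewrite evM !ev_lform mulf_eq0 negb_or => /andP[h1 h2].
  by exists (- y), x; split; [move: h1 | move: h2]; apply: contra => /eqP <-; apply/eqP; ring.
have [|c cE] := @full_surj F ((al *: X0 + be' *: X1) ^+ 6) hF fF.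
  rewrite -[6%N]mul1n; apply: dhomogMn.
  by apply: rpredD; apply: dhomogZ; [exact: homog_X0 | exact: homog_X1].
set l := al * a + be' * b in h1; set m := al * v 0 0 + be' * v 0 1 in h2.
have E : \sum_j line a b (v 0 0) (v 0 1) (F 0 j) * (c j 0)%:P = (l%:P + m *: 'X) ^+ 6.
  apply/eqP; rewrite -subr_eq0; apply/eqP/poly_eq0_fun => t.
  rewrite hornerD hornerN horner_sum.
  under eq_bigr => j _ do rewrite hornerM hornerC horner_line.
  rewrite cE !evE horner_exp hornerD hornerC hornerZ hornerX /l /m.
  ring.
move/(congr1 (fun p : {poly C} => p`_1)): E; rewrite coef1_pow6 coef_sum big1 => [/eqP|j _].
  by apply/negP; rewrite eq_sym mulf_neq0 ?expf_neq0 ?(mulf_neq0 _ h2) ?pnatr_eq0.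
rewrite coefMC line1; move/matrixP/(_ 0 j): vT; rewrite mul2E !mxE !meval_row rv2_0 rv2_1 => ->.
by rewrite mul0r.
Qed.

(** In terms of sextic polynomials: F meets the orbit of sixth powers at l^6 and
    all first order variations of F there are divisible by l^5. *)
Definition ramified_at F a b e f := [/\ nz a b, nz e f,
  exists2 c, c != 0 & forall u w, sx (mev F a b) u w = c * (e * u + f * w) ^+ 6 &
  forall a' b', exists l0 l1, forall u w,
    (sxl F a b a' b' u w)`_1 = (e * u + f * w) ^+ 5 * (l0 * u + l1 * w)].

(** One of the tangent lines contains the other, and both have rank two. *)
Lemma ramified_intro F a b e f : homogm 6 F -> linearly_full F -> ramified_at F a b e f ->
  generally_ramified F.
Proof.
move=> hF fF [ab ef [c c0 E] T]; exists (rv2 a b), (rv2 e f); rewrite !row_nz !rv2_0 !rv2_1.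
have Ep : point_of F (rv2 a b) = c *: point_of (rational_normal6 C) (rv2 e f).
  by rewrite !point_ofE !rv2_0 !rv2_1; apply: sx_inj => u w; rewrite sxZ sx_rational_normal.
split=> //.
- by apply: (orbit_u6 c0 ef) => u w; rewrite point_ofE rv2_0 rv2_1.
- exact: proj_scale Ep.
have six : 6 != 0 :> C by rewrite pnatr_eq0.
have sub : (tangent_line F (rv2 a b) <= tangent_line (rational_normal6 C) (rv2 e f))%MS.
  apply/row_subP => i; have [l0 [l1 lE]] := T (i == 0)%:R (i == 1)%:R.
  have -> : row i (tangent_line F (rv2 a b)) = rv2 (l0 / 6) (l1 / 6) *m tangent_line (rational_normal6 C) (rv2 e f).
    have -> : row i (tangent_line F (rv2 a b)) = (i == 0)%:R *: row 0 (tangent_line F (rv2 a b))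
        + (i == 1)%:R *: row 1 (tangent_line F (rv2 a b)).
      by case: (ord2P i) => ->; rewrite /= scale1r scale0r ?addr0 ?add0r.
    have -> : rv2 (l0 / 6) (l1 / 6) *m tangent_line (rational_normal6 C) (rv2 e f) =
       (l0 / 6) *: row 0 (tangent_line (rational_normal6 C) (rv2 e f)) +
       (l1 / 6) *: row 1 (tangent_line (rational_normal6 C) (rv2 e f)).
      by apply/matrixP => i' j; rewrite ord1 mul2E rv2_0 rv2_1 !mxE.
    apply: sx_inj => u w; rewrite -!tangent_row lE sxl_rational_normal; by field.
  exact: submxMl.
rewrite sub /=; have rk := full_tangent_rank hF fF ab.
by have := (mxrank_leqif_sup sub).2; rewrite rk => <-; rewrite eqn_leq -{1}rk mxrankS // rank_leq_row.
Qed.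

Lemma ramified_elim F : generally_ramified F -> exists a b e f, ramified_at F a b e f.
Proof.
move=> [p [q [p0 q0 _ /proj_field [c c0 E] /andP[sub _]]]].
exists (p 0 0), (p 0 1), (q 0 0), (q 0 1); split; rewrite -?row_nz //.
  by exists c => // u w; rewrite -point_ofE E point_ofE sxZ sx_rational_normal.
move=> a' b'; have : ((a' *: row 0 (tangent_line F p) + b' *: row 1 (tangent_line F p))%R
     <= tangent_line (rational_normal6 C) q)%MS.
  by rewrite addmx_sub // scalemx_sub // (submx_trans (row_sub _ _)).
move=> /submxP [D ED]; exists (6 * D 0 0), (6 * D 0 1) => u w.
rewrite sxl1 ED.
have -> : D *m tangent_line (rational_normal6 C) q = D 0 0 *: row 0 (tangent_line (rational_normal6 C) q)
    + D 0 1 *: row 1 (tangent_line (rational_normal6 C) q).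
  by apply/matrixP => i' j; rewrite ord1 mul2E !mxE.
by rewrite -sxl1 sxl_rational_normal; ring.
Qed.

Lemma sxl_moebius F A a b a' b' u w : sxl (precomp F (moebius A)) a b a' b' u w =
  sxl F (A 0 0 * a + A 0 1 * b) (A 1 0 * a + A 1 1 * b)
        (A 0 0 * a' + A 0 1 * b') (A 1 0 * a' + A 1 1 * b') u w.
Proof.
by apply: sxl_eq => t; rewrite horner_sxl mev_moebius; congr (sx (mev F _ _) u w); ring.
Qed.

Lemma ramified_moebius F A : A \in unitmx -> homogm 6 F -> linearly_full F ->
  generally_ramified (precomp F (moebius A)) -> generally_ramified F.
Proof.
move=> uA hF fF /ramified_elim [a [b [e [f [ab ef [c c0 E] T]]]]].
apply: (@ramified_intro F (A 0 0 * a + A 0 1 * b) (A 1 0 * a + A 1 1 * b) e f) => //.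
split=> //; first exact: moebius_nz.
  by exists c => // u w; rewrite -mev_moebius E.
move=> a' b'; have [x [y [<- <-]]] := moebius_onto a' b' uA.
by have [l0 [l1 lE]] := T x y; exists l0, l1 => u w; rewrite -sxl_moebius lE.
Qed.

End TangentLines.

(** * Normal form of a lift *)

Section NormalForm.

Variable C : numClosedFieldType.
Implicit Types (M : 'M[C]_(2, 3)) (g : 'M[forms C]_2) (F : 'rV[forms C]_7).
Notation ii := ('i : C).

Lemma f1_octa (K : 'M[C]_2) : octa K -> exists2 c, c != 0 & forall N, f1 (N *m K) = c *: f1 N.
Proof.
move=> oK; have uK := octa_unit oK.
have oA : octa (\adj K).
  have -> : \adj K = \det K *: invmx K by rewrite /invmx uK scalerA divff ?scale1r // -unitfE -unitmxE.
  by apply: octa_scale (octa_inv oK); rewrite -unitfE -unitmxE.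
have [k [S [k0 hS E]]] := octa_S4scal oA; have [_ [c c0 cE]] := S4star_stab hS.
exists (k ^+ 6 * c); first by rewrite mulf_neq0 ?expf_neq0.
move=> N; apply: sx_inj => u w; rewrite sxZ !sx_f1.
set X := N 1 1 * u - N 0 1 * w; set Y := N 0 0 * w - N 1 0 * u.
rewrite -mulrA -cE; have f0k x y : k ^+ 6 * f0 x y = f0 (k * x) (k * y) by rewrite /f0; ring.
have aE i j : k * S i j = (\adj K) i j by rewrite E mxE.
rewrite f0k !mulrDr !mulrA !aE adj2 !mk2E !mul2E /X /Y.
by congr f0; ring.
Qed.

Lemma full_moebius F (A : 'M[C]_2) : A \in unitmx -> linearly_full F ->
  linearly_full (precomp F (moebius A)).
Proof.
move=> uA fF c E; apply: fF; apply: mev_inj => x y.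
have [x' [y' [<- <-]]] := moebius_onto x y uA.
by rewrite mev_mul -mev_moebius mev_const -[c in LHS](mev_const _ x' y') -mev_mul E !mev0.
Qed.

(** The exchange of x and y is an involution, so b is a sign, which diag(1,-1)
    changes. *)
Lemma swap_sign n g a b : homogm n g -> nocz g ->
  (forall x y, mev g (ii * x) y = a *: (mev g x y *m rotm C 1)) ->
  (forall x y, mev g y x = b *: (mev g x y *m refm C 0)) ->
  exists D, [/\ octa D, forall x y, mev (g *m const_forms D) (ii * x) y =
      a *: (mev (g *m const_forms D) x y *m rotm C 1) &
      forall x y, mev (g *m const_forms D) y x = mev (g *m const_forms D) x y *m refm C 0].
Proof.
move=> hg ng hR hS.
have SS : refm C 0 *m refm C 0 = 1%:M.
  by apply/mx2P; rewrite mul2E !mxE /= ?mulr1n ?mulr0n ?expr0; ring.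
have b2 : b ^+ 2 = 1.
  have [i [j]] : exists i j, ev (g i j) 1 0 != 0 by apply/noczP/ng; rewrite /nz oner_neq0.
  rewrite -mevP => h; apply: (mulIf h); rewrite mul1r.
  by rewrite [in RHS](hS 0 1) [in RHS](hS 1 0) -scalemxAl scalerA -mulmxA SS mulmx1 [RHS]mxE -expr2.
have oD e : e ^+ 4 = 1 -> octa (mk2 1 0 0 e).
  by move=> e4; apply: Or31; rewrite !mk2E oner_neq0 expr1n e4.
move/eqP: b2; rewrite -[1 in X in X -> _](expr1n _ 2) eqf_sqr => /orP[] /eqP bE.
  exists (mk2 1 0 0 1); split=> [|x y|x y]; first by apply: oD; rewrite expr1n.
    rewrite !mev_mul !mev_const hR -scalemxAl -!mulmxA; congr (_ *: (_ *m _)).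
    by apply/mx2P; rewrite !mul2E !mxE /=; ring.
  rewrite !mev_mul !mev_const hS bE scale1r -!mulmxA; congr (_ *m _).
  by apply/mx2P; rewrite !mul2E !mxE /=; ring.
exists (mk2 1 0 0 (-1)); split=> [|x y|x y]; first by apply: oD; ring.
  rewrite !mev_mul !mev_const hR -scalemxAl -!mulmxA; congr (_ *: (_ *m _)).
  by apply/mx2P; rewrite !mul2E !mxE /=; ring.
rewrite !mev_mul !mev_const hS bE -scalemxAl -!mulmxA scalemxAr; congr (_ *m _).
by apply/mx2P; rewrite !(mul2E, mxE) /=; ring.
Qed.

(** Transport of the symmetric normal form to the standard covering; F moves along
    with the target of the covering. *)
Lemma lift_normal n phi F g : galois_covering 8 phi D4 -> is_curve n g -> sextic_curve F ->
  galois_lift phi F g -> exists mu nu K,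
  let g' := precomp g (moebius mu) *m const_forms K in
  let F' := precomp F (moebius (invmx nu)) in
  [/\ covering_equiv phi (phi_D4 C) mu nu /\ octa K,
      is_curve n g' /\ \det g' != 0, proj_eq (f1 g') (precomp F' (phi_D4 C)),
      (n %% 4 = 1 \/ n %% 4 = 3)%N &
      (n = 9%N -> exists M, g' = g9 M) /\ (n = 11%N -> exists M, g' = g11 M)].
Proof.
move=> gphi cg sF lift; have [cphi _ _] := gphi; have [lift1 _] := lift.
have [cF _ _ _] := sF; have [hF _] := (iffLR (curveP _ _) cF).
have [mu [nu [K [heq oK [a [b [hR hS]]]]]]] := lift_symmetry cphi cg sF lift1 gphi lift.
have [umu unu hnu] := heq.
have [hg ng] := (iffLR (curveP _ _) (curve_moebius umu cg)).
have [D [oD hR' hS']] := swap_sign (homogm_mulC K hg) (nocz_mulC (octa_unit oK) ng) hR hS.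
have KD : precomp g (moebius mu) *m const_forms K *m const_forms D =
    precomp g (moebius mu) *m const_forms (K *m D).
  by rewrite -mulmxA /const_forms map_mxM.
rewrite KD in hR' hS'; exists mu, nu, (K *m D).
have oKD := octa_mul oK oD; have uKD := octa_unit oKD.
have hg' := homogm_mulC (K *m D) hg; have ng' := nocz_mulC uKD ng.
have [n4 E9 E11] := symmetric_families hg' ng' hR' hS'.
split; [by split | split | | exact: n4 | by split].
- by apply/curveP.
- rewrite det_mulmx mulf_neq0 //; first by rewrite det_precomp comp_neq0 // (lift_det_neq0 cphi cg sF lift1).
  by rewrite /const_forms det_map_mx mpolyC_eq0 -unitfE -unitmxE.
have [c c0 cE] := f1_octa oKD.
have [h [_ h0 hE]] := lift_factor cphi cg sF lift1.
have [hphi nphi] := (iffLR (curveP _ _) (curve_moebius umu cphi)).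
have [hp _] := (iffLR (curveP _ _) (curve_phi C)).
have [k k0 kE] := proj_eq_const hp (homogm_Cmul nu hphi) (nocz_Cmul unu nphi) hnu.
exists 1, (c%:MP * (h \mPo [tuple moebius mu i 0 | i < 2]) * (k ^- 6)%:MP); split.
- exact: oner_neq0.
- by rewrite !mulf_neq0 ?comp_neq0 // mpolyC_eq0 // invr_eq0 expf_neq0.
rewrite scale1r; apply: mev_inj => x y.
rewrite mev_f1 mev_mul mev_const cE -mev_f1 mevZ !evM !evC -!scalerA; congr (_ *: _).
rewrite mev_f1 mev_moebius -mev_f1 hE mevZ ev_comp !ev_moebius; congr (_ *: _).
set v := mev (precomp phi (moebius mu)) x y.
have vE i : ev (phi i 0) (mu 0 0 * x + mu 0 1 * y) (mu 1 0 * x + mu 1 1 * y) = v i 0.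
  by rewrite /v mev_moebius mevP.
have pE i : ev (phi_D4 C i 0) x y = (k *: (nu *m v)) i 0.
  by rewrite -mevP kE mevZ evC mev_mul mev_const.
rewrite mev_precomp !vE mev_precomp mev_moebius !pE -!mul2E -scalemxAr mulmxA mulVmx // mul1mx.
have sE i : (k *: v) i 0 = k * v i 0 by rewrite mxE.
by rewrite !sE (mevS _ _ _ hF) scalerA mulVf ?expf_neq0 // scale1r.
Qed.

Lemma lift_equiv_octa phi g mu nu (K : 'M[C]_2) : covering_equiv phi (phi_D4 C) mu nu -> octa K ->
  lift_equiv phi g (phi_D4 C) (precomp g (moebius mu) *m const_forms K).
Proof.
move=> h oK; exists mu, nu; split; first exact: h.
have [c [S [c0 hS E]]] := octa_S4scal (octa_tr oK).
exists 1%:M, S; split; [by rewrite det1 | exact: hS |].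
apply: (@proj_scale _ _ _ _ _ c%:MP); first by rewrite mpolyC_eq0.
apply: mev_inj => x y; rewrite mevZ evC !mev_mul mev_tr !mev_const mul1mx scalemxAr; congr (_ *m _).
by rewrite -[K]trmxK E linearZ.
Qed.

(** The covering is onto, so that proportionality may be tested after composition
    with it. *)
Lemma descend n d G F : homogm n G -> homogm d F -> nocz F ->
  proj_eq (precomp G (phi_D4 C)) (precomp F (phi_D4 C)) ->
  exists q, [/\ q \is (n - d).-homog, q != 0 & G = q *: F].
Proof.
move=> hG hF nF E; apply: proj_eq_factor => //; apply: proj_of_cross.
- have [p [q [p0 q0 e]]] := E; apply: contraNneq (nocz_neq0 nF) => G0; apply/eqP.
  apply: mev_inj => s t; have [x [y [Es Et]]] := phi_surj s t.
  have : precomp F (phi_D4 C) = 0.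
    have : q *: precomp F (phi_D4 C) = 0.
      by rewrite -e G0; apply: mev_inj => a b; rewrite mevZ mev_precomp !mev0 scaler0.
    by move=> h; apply/matrixP => i j; move/matrixP/(_ i j): h; rewrite !mxE => /eqP;
      rewrite mulf_eq0 (negPf q0) => /eqP.
  by move/(congr1 (fun m => mev m x y)); rewrite mev_precomp phi0E phi1E Es Et !mev0.
- exact: nocz_neq0 nF.
move=> i j i' j'; apply: ev_inj => s t; have [x [y [Es Et]]] := phi_surj s t.
have := congr1 (fun f => ev f x y) (proj_cross E i j i' j').
have e H a b : ev (precomp H (phi_D4 C) a b) x y = ev (H a b) s t.
  by rewrite -mevP mev_precomp phi0E phi1E Es Et mevP.
by rewrite !evM !e.
Qed.

Lemma full_scale F q F' : F = q *: F' -> linearly_full F' -> q != 0 -> linearly_full F.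
Proof.
move=> -> fF q0 c; rewrite -scalemxAl => E; apply: fF.
apply/matrixP => i j; have /matrixP/(_ i j) := E; rewrite !mxE => /eqP.
by rewrite mulf_eq0 (negPf q0) => /eqP.
Qed.

End NormalForm.

Section FirstOrder.

Variable C : numClosedFieldType.
Implicit Types (p q : {poly C}) (c : C).

Lemma c0M p q : (p * q)`_0 = p`_0 * q`_0. Proof. exact: coef0M. Qed.
Lemma c1M p q : (p * q)`_1 = p`_0 * q`_1 + p`_1 * q`_0.
Proof. by rewrite coefM big_ord_recl big_ord1. Qed.
Lemma c0n k : (k%:R : {poly C})`_0 = k%:R. Proof. by rewrite coefMn coef1. Qed.
Lemma c1n k : (k%:R : {poly C})`_1 = 0. Proof. by rewrite coefMn coef1 mul0rn. Qed.
Lemma c01 : (1 : {poly C})`_0 = 1. Proof. by rewrite coef1. Qed.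
Lemma c11 : (1 : {poly C})`_1 = 0. Proof. by rewrite coef1. Qed.
Lemma c0C c : c%:P`_0 = c. Proof. by rewrite coefC. Qed.
Lemma c1C c : c%:P`_1 = 0. Proof. by rewrite coefC. Qed.
Lemma c0L c d : (c%:P + d *: 'X)`_0 = c. Proof. by rewrite coefD coefC coefZ coefX mulr0 addr0. Qed.
Lemma c1L c d : (c%:P + d *: 'X)`_1 = d. Proof. by rewrite coefD coefC coefZ coefX mulr1 add0r. Qed.

Lemma c1q6 (a c E G : {poly C}) a0 a1 c0 c1 E0 E1 G0 G1 :
  a`_0 = a0 -> a`_1 = a1 -> c`_0 = c0 -> c`_1 = c1 -> E`_0 = E0 -> E`_1 = E1 ->
  G`_0 = G0 -> G`_1 = G1 -> (q6 a c E G)`_1 =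
  (2 * E0 * E1 - G1) * (a0 * (E0 ^+ 4 + 6 * E0 ^+ 2 * G0 + G0 ^+ 2) + c0 * E0 * (E0 ^+ 2 + G0))
  + (E0 ^+ 2 - G0) * (a1 * (E0 ^+ 4 + 6 * E0 ^+ 2 * G0 + G0 ^+ 2)
     + a0 * (4 * E0 ^+ 3 * E1 + 12 * E0 * E1 * G0 + 6 * E0 ^+ 2 * G1 + 2 * G0 * G1)
     + c1 * E0 * (E0 ^+ 2 + G0) + c0 * E1 * (E0 ^+ 2 + G0) + c0 * E0 * (2 * E0 * E1 + G1)).
Proof.
move=> <- <- <- <- <- <- <- <-.
have h (p : {poly C}) : p`_0 = horner_eval 0 p by rewrite /horner_eval horner_coef0.
have h1 (p : {poly C}) : p`_1 = horner_eval 0 p^`() by rewrite /horner_eval horner_coef0 coef_deriv mulr1n.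
have dn k : (k%:R : {poly C})^`() = 0 by rewrite -polyC_natr derivC.
have d1 : (1 : {poly C})^`() = 0 by rewrite -polyC1 derivC.
by rewrite !h1 !h /q6 !(derivM, derivB, derivD, deriv_exp, dn, d1); ring.
Qed.

Definition c01E := (c0L, c1L, c0C, c1C, c0n, c1n, c01, c11, c0M, c1M, coefD, coefB, coefN).

End FirstOrder.

(** * The curves of degree nine *)

Section NinthDegree.

Variable C : numClosedFieldType.
Implicit Types (M : 'M[C]_(2, 3)) (g : 'M[forms C]_2) (F : 'rV[forms C]_7).

Lemma sxl_F9 M a b a' b' u w : sxl (F9 M) a b a' b' u w =
  phi9 (a%:P + a' *: 'X) (b%:P + b' *: 'X) (cf M 0 u w)%:P (cf M 1 u w)%:P (cf M 2 u w)%:P.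
Proof.
apply: sxl_eq => t; rewrite sx_F9 -[LHS]/(horner_eval t _) phi9_map /= /horner_eval.
by rewrite !hornerD !hornerZ !hornerX !hornerC.
Qed.

(** At s = m12 and t = m02 one has t Z - s X = m01 N, so that F9 M is a multiple of
    N^6 there, and each term of its first order expansion is divisible by N^5. *)
Lemma ramified_F9 M : nocz (F9 M) -> nz (m02 M) (m12 M) ->
  exists a b e f, ramified_at (F9 M) a b e f.
Proof.
move=> nF hm; pose s := m12 M; pose t := m02 M; pose e := M 1 2; pose f := - M 0 2.
have ef : nz e f.
  apply: contraTT hm; rewrite /nz /f oppr_eq0 !negb_or !negbK => /andP[/eqP e0 /eqP f0].
  by rewrite /m02 /m12 -/e e0 f0 !mulr0 !mul0r subrr eqxx.
pose l := m01 M.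
have lE u w : t * cf M 1 u w - s * cf M 0 u w = l * cf M 2 u w.
  by rewrite /cf /t /s /l /m01 /m02 /m12; ring.
have NE u w : cf M 2 u w = e * u + f * w by rewrite /cf /e /f; ring.
exists s, t, e, f; split.
- by rewrite /nz orbC.
- exact: ef.
- pose k := q6 1 (- (8 * (t - s))) (l - 2 * s) (- (4 * (s * (t - s)))).
  have E u w : sx (mev (F9 M) s t) u w = k * (e * u + f * w) ^+ 6.
    by rewrite sx_F9 -NE /phi9 lE /k /q6; ring.
  exists k => //; apply/eqP => k0; have st : nz s t by rewrite /nz orbC.
  by case/eqP: (nF s t st); apply: sx_inj => u w; rewrite E k0 mul0r sx0.
move=> a' b'.
(* The first order term is N^5 times a linear form, in which fE, fb and fs are the partial derivatives with respect to E, t - s and s. *)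
pose b0 := t - s; pose b1 := b' - a'; pose E := l - 2 * s.
pose r := E ^+ 4 - 24 * s * b0 * E ^+ 2 + 16 * s ^+ 2 * b0 ^+ 2 - 8 * b0 * E ^+ 3 + 32 * s * b0 ^+ 2 * E.
pose fE := 2 * E * r + (E ^+ 2 + 4 * s * b0) * (4 * E ^+ 3 - 48 * s * b0 * E - 24 * b0 * E ^+ 2 + 32 * s * b0 ^+ 2).
pose fb := 4 * s * r + (E ^+ 2 + 4 * s * b0) * (- 24 * s * E ^+ 2 + 32 * s ^+ 2 * b0 - 8 * E ^+ 3 + 64 * s * b0 * E).
pose fs := 4 * b0 * r + (E ^+ 2 + 4 * s * b0) * (- 24 * b0 * E ^+ 2 + 32 * s * b0 ^+ 2 + 32 * b0 ^+ 2 * E).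
pose V u w := b' * cf M 1 u w - a' * cf M 0 u w - 2 * a' * cf M 2 u w.
pose L u w := fE * V u w + (fb * b1 + fs * a') * cf M 2 u w.
exists (L 1 0), (L 0 1) => u w.
have -> : L 1 0 * u + L 0 1 * w = L u w by rewrite /L /V /cf; ring.
move: (lE u w); rewrite sxl_F9 -NE /L /V.
set X := cf M 0 u w; set Z := cf M 1 u w; set N := cf M 2 u w => h; clearbody X Z N.
rewrite /phi9 -polyC_exp.
have := c0L s a'; have := c1L s a'; have := c0L t b'; have := c1L t b'.
move: (s%:P + _) (t%:P + _) => S T T1 T0 S1 S0; have c01 := (c01E C, T1, T0, S1, S0).
rewrite (@c1q6 _ _ _ _ _ 1 0 (- (8 * (t - s) * N)) (- (8 * (b' - a') * N)) (l * N - 2 * s * N)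
   (b' * Z - a' * X - 2 * a' * N) (- (4 * s * (t - s) * N ^+ 2))
   (- (4 * (a' * (t - s) + s * (b' - a')) * N ^+ 2))); [ | by rewrite !c01 | by rewrite !c01 | by rewrite !c01; ring | by rewrite !c01; ring | by rewrite !c01 -h; ring | by rewrite !c01; ring | by rewrite !c01; ring | by rewrite !c01; ring].
rewrite /fE /fb /fs /r /E /b0 /b1; ring.
Qed.

Lemma precomp_proj_g9 M F' : homogm 6 F' -> nocz F' -> \det (g9 M) != 0 ->
  proj_eq (f1 (g9 M)) (precomp F' (phi_D4 C)) ->
  exists2 c, c != 0 & F9 M = c%:MP *: F'.
Proof.
move=> hF nF dM E.
have [q [hq q0 qE]] : exists q, [/\ q \is (6 - 6).-homog, q != 0 & F9 M = q *: F'].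
  apply: descend (homogm_F9 M) hF nF _; apply: proj_trans E.
  apply: proj_sym; apply: (@proj_scale _ _ _ _ _ (2 *: (alpha4 C * gamma C))).
    have [x [y]] := ev_neq0 dM; rewrite -mev_det det_g9 => h.
    apply: contraNneq h => /(congr1 (fun f => ev f x y)).
    rewrite evZ evM ev_alpha ev_gamma ev0 => z.
    have n2 := two_neq0 C; have {}z : al x y * (x * y) = 0 by apply: (mulfI n2); rewrite z mulr0.
    by apply/eqP; transitivity (4 * (al x y * (x * y)) * be x y * (m02 M * al x y ^+ 2 + m12 M * (x * y) ^+ 4));
      [ring | rewrite z; ring].
  apply: mev_inj => x y; rewrite mev_f1 f1_g9 mevZ evZ evM ev_alpha ev_gamma mev_precomp.
  by rewrite phi0E phi1E; congr (_ *: _); ring.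
have [c cE] := homog0E hq; exists c; first by rewrite cE mpolyC_eq0 in q0.
by rewrite qE cE.
Qed.

Lemma ramified_scale F c F' a b e f : c != 0 -> F = c%:MP *: F' -> ramified_at F a b e f ->
  ramified_at F' a b e f.
Proof.
move=> c0 FE [ab ef [k k0 E] T].
have E' x y u w : sx (mev F x y) u w = c * sx (mev F' x y) u w by rewrite FE mevZ evC sxZ.
split=> //.
  exists (c^-1 * k); first by rewrite mulf_neq0 ?invr_eq0.
  by move=> u w; apply: (mulfI c0); rewrite -E' E; field.
move=> a' b'; have [l0 [l1 lE]] := T a' b'; exists (c^-1 * l0), (c^-1 * l1) => u w.
have S : sxl F a b a' b' u w = c *: sxl F' a b a' b' u w.
  by apply: sxl_eq => t; rewrite hornerZ horner_sxl E'.
by apply: (mulfI c0); rewrite -coefZ -S lE; field.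
Qed.

Lemma det_g9_minors M : \det (g9 M) != 0 -> nz (m02 M) (m12 M).
Proof.
move=> /ev_neq0 [x [y]]; rewrite -mev_det det_g9; apply: contraNT.
by rewrite negb_or !negbK => /andP[/eqP -> /eqP ->]; rewrite !mul0r addr0 mulr0.
Qed.

Lemma nine_ramified F nu M : sextic_curve F -> nu \in unitmx -> \det (g9 M) != 0 ->
  proj_eq (f1 (g9 M)) (precomp (precomp F (moebius (invmx nu))) (phi_D4 C)) ->
  generally_ramified F.
Proof.
move=> [cF _ fF _] unu dM E.
have uV : invmx nu \in unitmx by rewrite unitmx_inv.
have [hF' nF'] := (iffLR (curveP _ _) (curve_moebius uV cF)).
have [hF _] := (iffLR (curveP _ _) cF).
have [c c0 cE] := precomp_proj_g9 hF' nF' dM E.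
have [|a [b [e [f R]]]] := @ramified_F9 M _ (det_g9_minors dM).
  move=> s t st; rewrite cE mevZ evC scaler_eq0 (negPf c0) /=; exact: nF'.
apply: (ramified_moebius uV hF fF); apply: (ramified_intro hF' (full_moebius uV fF)).
exact: ramified_scale c0 cE R.
Qed.

End NinthDegree.

(** * The curves of degree eleven *)

Section EleventhDegree.

Variables (C : numClosedFieldType) (M : 'M[C]_(2, 3)) (F : 'rV[forms C]_7).
Hypotheses (hF : homogm 6 F) (nF : nocz F) (fF : linearly_full F).
Hypotheses (dM : \det (g11 M) != 0) (nM : nocz (g11 M)).
Hypothesis lift : proj_eq (f1 (g11 M)) (precomp F (phi_D4 C)).

Implicit Types (s t u w x y : C).

Notation X := (cf M 0). Notation Z := (cf M 1). Notation N := (cf M 2).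

Lemma sxl_F11 a b a' b' u w : sxl (F11 M) a b a' b' u w =
  psi11 (a%:P + a' *: 'X) (b%:P + b' *: 'X) (X u w)%:P (Z u w)%:P (N u w)%:P.
Proof.
apply: sxl_eq => t; rewrite sx_F11 -[LHS]/(horner_eval t _) psi11_map /= /horner_eval.
by rewrite !hornerD !hornerZ !hornerX !hornerC.
Qed.

Lemma f1_g11_form : f1 (g11 M) = (- 2 *: (alpha4 C * gamma C ^+ 3)) *: precomp (F11 M) (phi_D4 C).
Proof.
apply: mev_inj => x y; rewrite mev_f1 f1_g11 mevZ evZ evM evX ev_alpha ev_gamma mev_precomp.
by rewrite phi0E phi1E; congr (_ *: _); ring.
Qed.

Lemma alga_neq0 : - 2 *: (alpha4 C * gamma C ^+ 3) != 0 :> forms C.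
Proof.
have [x [y]] := ev_neq0 dM; rewrite -mev_det det_g11 => h.
have n2 := two_neq0 C.
have z : al x y * (x * y) ^+ 3 != 0.
  apply: contraNneq h => z; apply/eqP.
  transitivity (al x y * (x * y) ^+ 3 * (be x y *
     (- 2 * m01 M * (x * y) ^+ 4 - 4 * m02 M * al x y ^+ 2 + 4 * m12 M * be x y ^+ 2))); first by ring.
  by rewrite z mul0r.
apply: contraNneq z => /(congr1 (fun f => ev f x y)).
rewrite evZ evM evX ev_alpha ev_gamma ev0 => z; apply/eqP/(mulfI n2); rewrite mulr0 -[RHS]oppr0 -z.
ring.
Qed.

(** The degrees are 7 and 6. *)
Lemma F11_factor : exists L, [/\ L \is 1.-homog, L != 0 & F11 M = L *: F].
Proof.
apply: (@descend C 7 6 (F11 M) F (homogm_F11 M) hF nF); apply: proj_trans lift.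
by apply: proj_sym; apply: (proj_scale alga_neq0 f1_g11_form).
Qed.

Variable L : forms C.
Hypotheses (hL : L \is 1.-homog) (L0 : L != 0) (LE : F11 M = L *: F).

Lemma L_lin : exists c0 c1, forall s t, ev L s t = c0 * s + c1 * t.
Proof.
have [c ->] := homog_exists hL; exists (c 1%N), (c 0%N) => s t.
by rewrite ev_hform !big_ord_recl big_ord0 /= /bump /= ?expr0 ?expr1; ring.
Qed.

Lemma sx_LF s t u w : psi11 s t (X u w) (Z u w) (N u w) = ev L s t * sx (mev F s t) u w.
Proof. by rewrite -sx_F11 LE mevZ sxZ. Qed.

Lemma sxl_LF a b a' b' u w : (sxl (F11 M) a b a' b' u w)`_1 =
  ev L a b * (sxl F a b a' b' u w)`_1 + ev L a' b' * sx (mev F a b) u w.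
Proof.
have [c0 [c1 E]] := L_lin.
rewrite (_ : sxl _ _ _ _ _ _ _ = ((ev L a b)%:P + ev L a' b' *: 'X) * sxl F a b a' b' u w).
  by rewrite c1M c0L c1L sxl0.
apply: sxl_eq => t; rewrite hornerM hornerD hornerZ hornerX hornerC horner_sxl LE mevZ sxZ.
by congr (_ * _); rewrite !E; ring.
Qed.

Lemma sxF_neq0 s t : nz s t -> exists u w, sx (mev F s t) u w != 0.
Proof. by move=> st; apply: sx_neq0; apply: nF. Qed.

(** The zero of F11 M = L F at the root of L is simple, because F vanishes nowhere. *)
Lemma simple_zero a b a' b' : nz a b -> a * b' != b * a' ->
  (forall u w, psi11 a b (X u w) (Z u w) (N u w) = 0) ->
  (forall u w, (sxl (F11 M) a b a' b' u w)`_1 = 0) -> False.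
Proof.
move=> ab ind h0 h1; have [u [w F0]] := sxF_neq0 ab; have [c0 [c1 E]] := L_lin.
have La : ev L a b = 0 by have /eqP := h0 u w; rewrite sx_LF mulf_eq0 (negPf F0) orbF => /eqP.
have La' : ev L a' b' = 0.
  by have /eqP := h1 u w; rewrite sxl_LF La mul0r add0r mulf_eq0 (negPf F0) orbF => /eqP.
rewrite !E in La La'.
have D0 : a * b' - b * a' != 0 by rewrite subr_eq0.
case/eqP: L0; apply: ev_eq0 => s t; rewrite E.
have -> : c0 = 0.
  apply: (mulfI D0); rewrite mulr0.
  transitivity (b' * (c0 * a + c1 * b) - b * (c0 * a' + c1 * b')); first by ring.
  by rewrite La La'; ring.
have -> : c1 = 0.
  apply: (mulfI D0); rewrite mulr0.
  transitivity (a * (c0 * a' + c1 * b') - a' * (c0 * a + c1 * b)); first by ring.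
  by rewrite La La'; ring.
by ring.
Qed.

Lemma coef1_at11 u w : (sxl (F11 M) 1 1 (-1) 0 u w)`_1 =
  5 * X u w ^+ 4 * (X u w - Z u w + 2 * N u w) ^+ 2
  + X u w ^+ 5 * (4 * X u w - 6 * (Z u w - X u w) - 12 * (X u w - Z u w + 2 * N u w)).
Proof.
rewrite sxl_F11; move: (X u w) (Z u w) (N u w) => P Q R; rewrite /psi11.
rewrite (_ : P%:P - Q%:P + 2 * R%:P = (P - Q + 2 * R)%:P); last by ring.
rewrite -polyC_exp; set H := P - Q + 2 * R.
have := c0L (1 : C) (-1); have := c1L (1 : C) (-1); have := c0L (1 : C) 0; have := c1L (1 : C) 0.
move: ((1 : C)%:P + _) ((1 : C)%:P + _) => S T T1 T0 S1 S0; have c01 := (c01E C, T1, T0, S1, S0).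
rewrite (@c1q6 _ _ _ _ _ (-1) 4 0 (- (12 * H)) P (Q - P) 0 (- H ^+ 2)); try by rewrite !c01; ring.
by rewrite /H; ring.
Qed.

(** If X were zero, F11 M would have a double zero at s = t. *)
Lemma X_neq0 : ~ (forall u w, X u w = 0).
Proof.
move=> X0; apply: (@simple_zero 1 1 (-1) 0).
- by rewrite /nz oner_neq0.
- by rewrite mulr0 mul1r eq_sym oppr_eq0 oner_neq0.
- by move=> u w; rewrite X0 /psi11 /q6; ring.
by move=> u w; rewrite coef1_at11 X0; ring.
Qed.

(** If Z were zero, F11 M would have a double zero at s = 0. *)
Lemma Z_neq0 : ~ (forall u w, Z u w = 0).
Proof.
move=> Z0; apply: (@simple_zero 0 1 1 0).
- by rewrite /nz oner_neq0 orbT.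
- by rewrite mulr0 mul1r eq_sym oner_neq0.
- by move=> u w; rewrite Z0 /psi11 /q6; ring.
move=> u w; rewrite sxl_F11 Z0; move: (X u w) (N u w) => P R; rewrite /psi11.
rewrite (_ : P%:P - 0%:P + 2 * R%:P = (P + 2 * R)%:P); last by rewrite polyC0; ring.
rewrite -polyC_exp; set H := P + 2 * R.
have := c0L (0 : C) 1; have := c1L (0 : C) 1; have := c0L (1 : C) 0; have := c1L (1 : C) 0.
move: ((0 : C)%:P + _) ((1 : C)%:P + _) => S T T1 T0 S1 S0; have c01 := (c01E C, T1, T0, S1, S0).
rewrite (@c1q6 _ _ _ _ _ 3 (-4) (4 * H) (- (20 * H)) 0 P 0 (- H ^+ 2)); try by rewrite !c01; ring.
by ring.
Qed.

(** If L1 or L2 vanishes identically at some point, then F11 M has no middle term in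
    the coordinates b P = X and a R = Z, against fullness. *)
Lemma not_degenerate a b : a != 0 -> b != 0 ->
  ~ (forall u w, a * b * (X u w - Z u w + 2 * N u w) = a ^+ 2 * X u w - b ^+ 2 * Z u w).
Proof.
move=> a0 b0 rel; have n2 := two_neq0 C.
have n2ab : 2 * a * b != 0 by rewrite !mulf_neq0.
have relN u w : N u w = - ((b - a) * (a * X u w + b * Z u w)) / (2 * a * b).
  apply: (mulfI n2ab); rewrite [RHS]mulrC divfK //.
  transitivity (a * b * (X u w - Z u w + 2 * N u w) - a * b * X u w + a * b * Z u w); first by ring.
  by rewrite rel; ring.
have m0 : m01 M != 0.
  apply: contraNneq dM => m0.
  have r0 : M 0 2 = - ((b - a) * (a * M 0 0 + b * M 0 1)) / (2 * a * b).
    have := relN 0 (-1); rewrite /cf !mulr0 !mulrN1 !sub0r !opprK => ->; ring.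
  have r1 : M 1 2 = - ((b - a) * (a * M 1 0 + b * M 1 1)) / (2 * a * b).
    have := relN 1 0; rewrite /cf !mulr1 !mulr0 !subr0 => ->; ring.
  have m2 : m02 M = 0.
    transitivity (- ((b - a) / (2 * a)) * m01 M); last by rewrite m0 mulr0.
    by rewrite /m02 r0 r1 /m01; field; rewrite a0 b0.
  have m1 : m12 M = 0.
    transitivity ((b - a) / (2 * b) * m01 M); last by rewrite m0 mulr0.
    by rewrite /m12 r0 r1 /m01; field; rewrite a0 b0.
  apply/eqP/ev_eq0 => x y; rewrite -mev_det det_g11 m0 m1 m2; ring.
pose A := mk2 (- M 0 1 * b / m01 M) (M 0 0 * a / m01 M) (- M 1 1 * b / m01 M) (M 1 0 * a / m01 M).
have uA : A \in unitmx.
  rewrite unit2 !mk2E.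
  have -> : - M 0 1 * b / m01 M * (M 1 0 * a / m01 M) - M 0 0 * a / m01 M * (- M 1 1 * b / m01 M)
     = a * b / m01 M by move: m0; rewrite /m01 => m0; field.
  by rewrite !mulf_neq0 ?invr_eq0.
have XA P R : X (A 0 0 * P + A 0 1 * R) (A 1 0 * P + A 1 1 * R) = b * P.
  by rewrite /cf !mk2E; move: m0; rewrite /m01 => m0; field.
have ZA P R : Z (A 0 0 * P + A 0 1 * R) (A 1 0 * P + A 1 1 * R) = a * R.
  by rewrite /cf !mk2E; move: m0; rewrite /m01 => m0; field.
have NA P R : N (A 0 0 * P + A 0 1 * R) (A 1 0 * P + A 1 1 * R) = - ((b - a) * (P + R)) / 2.
  by rewrite relN XA ZA; field; rewrite a0 b0.
clearbody A.
have key s t : (mev (F11 M) s t *m act6 A) 0 (inord 3) = 0.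
  pose B := t - s; pose T := s * b ^+ 2 + B * a ^+ 2; pose D := B * a ^+ 2 - s * b ^+ 2; pose m := a * b.
  (* In the coordinates P and R there is no term in P^3 R^3. *)
  pose k0 := (3 * B - s) * (T ^+ 2 * s ^+ 2 - 8 * s * B * s ^+ 2 * m ^+ 2) - 4 * B * (B - 3 * s) * s ^+ 2 * m * D.
  pose k1 := (3 * B - s) * (- 16 * s ^+ 2 * B * m * D) + 4 * B * (B - 3 * s) * s * (4 * s * B * m ^+ 2 - D ^+ 2).
  pose k2 := (3 * B - s) * (2 * s * B * T ^+ 2 - 8 * s * B * (D ^+ 2 - 2 * s * B * m ^+ 2))
     + 24 * B * (B - 3 * s) * s * B * m * D.
  pose k3 := (3 * B - s) * (16 * s * B ^+ 2 * m * D) + 4 * B ^+ 2 * (B - 3 * s) * (D ^+ 2 - 4 * s * B * m ^+ 2).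
  pose k4 := (3 * B - s) * (T ^+ 2 * B ^+ 2 - 8 * s * B ^+ 3 * m ^+ 2) - 4 * B * (B - 3 * s) * B ^+ 2 * m * D.
  pose V : 'rV[C]_7 := \row_i nth 0 [:: T * s * k0; T * s * k1; T * (s * k2 + B * k0); 0;
     T * (s * k4 + B * k2); T * B * k3; T * B * k4] i.
  have -> : mev (F11 M) s t *m act6 A = V.
    apply: sx_inj => P R; rewrite sx_act6 sx_F11 XA ZA NA.
    rewrite sxE !big_ord_recl big_ord0 /V !mxE /= /bump /= ?expr0 /k0 /k1 /k2 /k3 /k4 /T /D /B /m.
    by rewrite /psi11 /q6; field.
  by rewrite mxE inordK.
pose c := act6 A *m delta_mx (inord 3) 0 : 'cV[C]_7.
have c0 : c = 0.
  apply: (full_scale LE fF L0); apply: mev_inj => s t; rewrite mev_mul mev_const mev0 mulmxA.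
  by apply/matrixP => i j; rewrite -colE mxE [RHS]mxE !ord1 key.
have /matrixP/(_ (inord 3) 0) : delta_mx (inord 3) 0 = 0 :> 'cV[C]_7.
  by rewrite -[LHS](mulKmx (act6_unit uA)) -/c c0 mulmx0.
by rewrite !mxE !eqxx => /eqP; rewrite oner_eq0.
Qed.

(** When a product of linear forms vanishes identically, so does one of the factors. *)
Lemma vertex_cases x y : al x y != 0 ->
  (forall u w, psi11 (- al x y ^+ 2) ((x * y) ^+ 4) (X u w) (Z u w) (N u w) = 0) ->
  [\/ forall u w, L1 M x y u w = 0, forall u w, L2 M x y u w = 0 |
      exists2 e, e ^+ 4 = 1 & forall u w, x ^+ 3 * L1 M x y u w = e * (y ^+ 3 * L2 M x y u w)].
Proof.
move=> a0 h; pose a := al x y; pose b := be x y.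
pose H : forms C := cform M 0 - cform M 1 + 2%:MP * cform M 2.
pose l1 := b ^+ 2 *: cform M 1 - a ^+ 2 *: cform M 0 + (a * b) *: H.
pose l2 := - (b ^+ 2 *: cform M 1 - a ^+ 2 *: cform M 0 - (a * b) *: H).
have E1 u w : ev l1 u w = L1 M x y u w by rewrite /l1 /H !(ev_cform, evE).
have E2 u w : ev l2 u w = L2 M x y u w by rewrite /l2 /H !(ev_cform, evE).
clearbody l1 l2.
pose A := x ^+ 3 *: l1; pose B := y ^+ 3 *: l2; pose ii : C := 'i.
have P0 : l1 * (l2 * ((A - 1 *: B) * ((A - ii *: B) * ((A - (-1) *: B) * (A - (- ii) *: B))))) = 0.
  apply: ev_inj => u w; rewrite ev0 /A /B !evE !E1 !E2.
  transitivity (L1 M x y u w * L2 M x y u w * ((x ^+ 3 * L1 M x y u w) ^+ 4 + (ii ^+ 2 - ii ^+ 2 - 1)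
     * (y ^+ 3 * L2 M x y u w) ^+ 4)); last first.
    rewrite subrr sub0r mulN1r -[RHS](mulr0 (- 2 * al x y)) -(h u w) psi11_factor; ring.
  have i2 : ii ^+ 2 = -1 by exact: ii2.
  transitivity (L1 M x y u w * L2 M x y u w * (((x ^+ 3 * L1 M x y u w) ^+ 2 - (y ^+ 3 * L2 M x y u w) ^+ 2) *
     ((x ^+ 3 * L1 M x y u w) ^+ 2 - ii ^+ 2 * (y ^+ 3 * L2 M x y u w) ^+ 2))); first by ring.
  by rewrite i2; ring.
have third e : e ^+ 4 = 1 -> A - e *: B = 0 ->
    exists2 e, e ^+ 4 = 1 & forall u w, x ^+ 3 * L1 M x y u w = e * (y ^+ 3 * L2 M x y u w).
  move=> e4 E; exists e => // u w; apply/eqP; rewrite -subr_eq0 -E1 -E2 -!evZ.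
  by rewrite -evB -/A -/B E ev0.
move/eqP: P0; rewrite !mulf_eq0 => /or4P[|||/or3P[]] /eqP z.
- by apply: Or31 => u w; rewrite -E1 z ev0.
- by apply: Or32 => u w; rewrite -E2 z ev0.
- by apply: Or33; apply: third z; rewrite expr1n.
- by apply: Or33; apply: third z; apply: ii4.
- by apply: Or33; apply: third z; ring.
by apply: Or33; apply: third z; rewrite exprNn ii4; ring.
Qed.

Lemma perp_of_relation (v : 'rV[C]_3) c : c != 0 ->
  (forall u w, c * (v 0 0 * X u w + v 0 1 * Z u w + v 0 2 * N u w) = 0) -> M *m v^T = 0.
Proof.
move=> c0 h; apply/matrixP => r j; rewrite ord1 mul3E !mxE.
have := h 1 0; have := h 0 (-1); rewrite /cf !mulr0 !mulr1 !mulrN1 !subr0 !sub0r !opprK.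
by case: (ord2P r) => -> h0 h1; apply: (mulfI c0); rewrite mulr0; [rewrite -[RHS]h0 | rewrite -[RHS]h1]; ring.
Qed.

Lemma normal11E t : ((normal11 t 0 0 = (- ((t + 1) ^+ 2 * (t ^+ 2 + 1) * t ^+ 3))%R) *
  (normal11 t 0 1 = ((t ^+ 4 + 1) * t ^+ 3)%R) *
  (normal11 t 0 2 = (- ((t ^+ 3 + 1) * (t ^+ 4 + 1) * (t ^+ 3 + t ^+ 2 + t + 1)))%R))%type.
Proof. by rewrite !mxE. Qed.

(** At the root of L one of the linear factors of f1 (g11 M) vanishes. If it is not
    L1 or L2, this is a linear relation between X, Z and N, whose coefficients
    depend on the position of the root only. *)
Lemma normal_exists : exists t, M *m (normal11 t)^T = 0.
Proof.
have [s [t [st Lst]]] := homog_root hL.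
have h u w : psi11 s t (X u w) (Z u w) (N u w) = 0 by rewrite sx_LF Lst mul0r.
have [x [y [xy Es Et]]] := phi_surj_nz st.
rewrite -Es -Et in h.
have [a0|a0] := eqVneq (al x y) 0.
  have xy0 : x * y != 0.
    have := phi_nz xy; rewrite a0 expr0n oppr0 /nz eqxx /=.
    by apply: contraNneq => ->; rewrite expr0n.
  (* Here psi11 is a multiple of Z^5 W, and W = 0 is the relation for t = 1. *)
  pose W : forms C := 4%:MP * cform M 0 - cform M 1 + 8%:MP * cform M 2.
  have P0 : cform M 1 ^+ 5 * W = 0.
    apply: ev_inj => u w; rewrite ev0 /W !(ev_cform, evE).
    have := h u w; rewrite a0 /psi11 /q6 => e.
    have c0 : ((x * y) ^+ 4) ^+ 7 != 0 by rewrite !expf_neq0.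
    by apply: (mulfI c0); rewrite mulr0 -[RHS]e; ring.
  move/eqP: P0; rewrite mulf_eq0 expf_eq0 /= => /orP[] /eqP z.
    by case: Z_neq0 => u w; rewrite -ev_cform z ev0.
  exists 1; apply: (@perp_of_relation _ (-1)); first by rewrite oppr_eq0 oner_neq0.
  move=> u w; rewrite !normal11E -[RHS](mulr0 2) -[in RHS](ev0 u w) -z /W !(ev_cform, evE); ring.
have [b0|b0] := eqVneq (be x y) 0.
  case: X_neq0 => u w; have a2 : - al x y ^+ 2 != 0 by rewrite oppr_eq0 expf_neq0.
  have E : ev (cform M 0 ^+ 6) u w = 0.
    have B0 : (x * y) ^+ 4 - - al x y ^+ 2 = 0 by rewrite opprK addrC -albe b0 expr0n.
    have t0 : (x * y) ^+ 4 = - al x y ^+ 2 by apply/eqP; rewrite -subr_eq0 B0.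
    have := h u w; rewrite t0 /psi11 /q6 evX ev_cform => e.
    have c0 : - (- al x y ^+ 2) ^+ 7 != 0 by rewrite oppr_eq0 expf_neq0.
    by apply: (mulfI c0); rewrite mulr0 -[RHS]e; ring.
  by apply/eqP; move/eqP: E; rewrite evX expf_eq0 ev_cform.
case: (vertex_cases a0 h) => [l|l|[e e4 l]].
- case: (not_degenerate a0 b0) => u w; move: (l u w); rewrite /L1 => E.
  by apply/eqP; rewrite -subr_eq0 -E; apply/eqP; ring.
- have Na0 : - al x y != 0 by rewrite oppr_eq0.
  case: (not_degenerate Na0 b0) => u w; move: (l u w); rewrite /L2 => E.
  by apply/eqP; rewrite -subr_eq0 -oppr_eq0 -E; apply/eqP; ring.
have e0 : e != 0 by apply: contraNneq (oner_neq0 C) => z; rewrite -e4 z expr0n.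
have y0 : y != 0.
  apply/eqP => y0; move: xy; rewrite /nz y0 eqxx orbF => x0.
  have x3 : x ^+ 3 != 0 by rewrite expf_neq0.
  case: (not_degenerate a0 b0) => u w; move: (l u w); rewrite y0 expr0n /= mul0r mulr0 => E.
  have {}E : L1 M x y u w = 0 by apply: (mulfI x3); rewrite mulr0 y0.
  by apply/eqP; rewrite -subr_eq0; apply/eqP; rewrite -[RHS]E /L1 y0; ring.
(* The parameter of the plane. *)
pose T := - e * x / y; have xE : x = - e ^+ 3 * T * y.
  by rewrite /T; transitivity (e ^+ 4 * x); [rewrite e4 mul1r | field].
have aE : al x y = (T ^+ 4 - 1) * (y ^+ 4 / 2).
  rewrite /al {1}xE; transitivity ((e ^+ 4 * e ^+ 4 * e ^+ 4 * T ^+ 4 - 1) * (y ^+ 4 / 2)); first by ring.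
  by rewrite e4 !mul1r.
have bE : be x y = (T ^+ 4 + 1) * (y ^+ 4 / 2).
  rewrite /be {1}xE; transitivity ((e ^+ 4 * e ^+ 4 * e ^+ 4 * T ^+ 4 + 1) * (y ^+ 4 / 2)); first by ring.
  by rewrite e4 !mul1r.
have k0 : y ^+ 4 / 2 != 0 by rewrite mulf_neq0 ?expf_neq0 ?invr_eq0 ?two_neq0.
set k := y ^+ 4 / 2 in aE bE k0.
have T1 : T - 1 != 0.
  apply: contraNneq a0 => z; rewrite aE; apply/eqP.
  by transitivity ((T - 1) * ((T + 1) * (T ^+ 2 + 1) * k)); [ring | rewrite z mul0r].
have x3 : x ^+ 3 = - (e * T ^+ 3 * y ^+ 3).
  rewrite xE; transitivity (- (e ^+ 4 * e ^+ 4 * e * T ^+ 3 * y ^+ 3)); first by ring.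
  by rewrite e4 !mul1r.
exists T; apply: (@perp_of_relation _ (- 2 * (T - 1) * k ^+ 2)).
  by rewrite mulf_neq0 ?(mulf_neq0 _ T1) ?oppr_eq0 ?two_neq0 // expf_neq0.
move=> u w; rewrite !normal11E.
have c0 : e * y ^+ 3 != 0 by rewrite mulf_neq0 ?expf_neq0.
apply: (mulfI c0); rewrite mulr0; apply/eqP; rewrite -subr_eq0; apply/eqP.
transitivity (e * (y ^+ 3 * L2 M x y u w) - x ^+ 3 * L1 M x y u w); last by rewrite l subrr.
rewrite x3 /L1 /L2 aE bE; move: (X u w) (Z u w) (N u w) => P Q R; clearbody T k; ring.
Qed.

Lemma F11_at11 u w : psi11 1 1 (X u w) (Z u w) (N u w) = - X u w ^+ 6.
Proof. by rewrite /psi11 /q6; ring. Qed.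

Lemma L11_neq0 : ev L 1 1 != 0.
Proof.
apply/eqP => L11; apply: X_neq0 => u w; apply/eqP; rewrite -[_ == 0]orbF.
have := sx_LF 1 1 u w; rewrite F11_at11 L11 mul0r => /eqP.
by rewrite oppr_eq0 expf_eq0 orbF.
Qed.

Section Contents11.

Variables (d : nat -> nat) (c : nat -> forms C) (r : nat -> 'cV[forms C]_2) (k : C) (ka : forms C).
Hypothesis dcr : forall i, [/\ (d i <= 11)%N, c i \is (d i).-homog, homogm (11 - d i) (r i), nocz (r i) &
    g11 M *m const_forms (vtx C i) = c i *: r i].
Hypotheses (k0 : k != 0) (psiE : psx (fun i => r i) = k%:MP *: precomp F (phi_D4 C)).
Hypotheses (hka : ka \is 4.-homog) (kaE : \det (g11 M) = ka * \prod_(i < 6) c i).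

Let Q : forms C := (- 2 * m01 M)%:MP * gamma C ^+ 4 - (4 * m02 M)%:MP * alpha4 C ^+ 2
  + (4 * m12 M)%:MP * beta4 C ^+ 2.

Let Lphi : forms C := L \mPo [tuple phi_D4 C i 0 | i < 2].

Let evLphi x y : ev Lphi x y = ev L (- al x y ^+ 2) ((x * y) ^+ 4).
Proof. by rewrite ev_comp phi0E phi1E. Qed.

Let prodE : k%:MP * \prod_(i < 6) c i = 2%:MP * (alpha4 C * gamma C ^+ 3) * Lphi.
Proof.
have nz10 : nz (1 : C) 0 by rewrite /nz oner_neq0.
have [u [w F0]] := sxF_neq0 nz10.
pose G := sxf (precomp F (phi_D4 C)) u w.
have G0 : G != 0.
  have [x [y [_ Es Et]]] := phi_surj_nz nz10.
  apply: contraNneq F0 => z; apply/eqP.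
  by rewrite -[RHS](ev0 x y) -z /G ev_sxf mev_precomp phi0E phi1E Es Et.
apply: (mulIf G0); apply: ev_inj => x y.
have E1 : sx (mev (f1 (g11 M)) x y) u w = - 2 * (al x y * (x * y) ^+ 3) * (ev Lphi x y * ev G x y).
  rewrite f1_g11_form mevZ sxZ evZ evM evX ev_alpha ev_gamma mev_precomp LE mevZ sxZ.
  by rewrite evLphi phi0E phi1E /G ev_sxf mev_precomp phi0E phi1E.
have E2 : sx (mev (f1 (g11 M)) x y) u w = - ev (\prod_(i < 6) c i) x y * (k * ev G x y).
  by rewrite (f1_contents dcr) mevZ sxZ evN psiE mevZ evC sxZ /G ev_sxf.
rewrite !(ev_alpha, ev_gamma, evX, evM, evC); apply: oppr_inj.
by transitivity (- ev (\prod_(i < 6) c i) x y * (k * ev G x y)); [ring | rewrite -E2 E1; ring].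
Qed.

Let detE : \det (g11 M) = alpha4 C * beta4 C * gamma C ^+ 3 * Q.
Proof.
apply: ev_inj => x y; rewrite -mev_det det_g11 /Q !(ev_alpha, ev_beta, ev_gamma, evE); ring.
Qed.

(** Comparison of two factorizations of det (g11 M). *)
Let kaQ : k%:MP * (beta4 C * Q) = 2%:MP * ka * Lphi.
Proof.
have a0 : alpha4 C * gamma C ^+ 3 != 0 by apply: contraNneq alga_neq0 => ->; rewrite scaler0.
apply: (mulfI a0); transitivity (k%:MP * \det (g11 M)); first by rewrite detE; ring.
rewrite kaE mulrCA prodE; ring.
Qed.

(** The zeros of beta lie over s = t, where F11 M = - X^6 does not vanish, hence
    neither does L. *)
Let at_beta x y : nz x y -> be x y = 0 -> ev Lphi x y != 0.
Proof.
move=> xy b0; have t : - al x y ^+ 2 = (x * y) ^+ 4.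
  by apply/eqP; rewrite eq_sym -subr_eq0 opprK addrC -albe b0 expr0n.
have := phi_nz xy; rewrite evLphi t /nz orbb => h.
have [c0 [c1 E]] := L_lin; rewrite E -mulrDl mulf_neq0 //.
by have := L11_neq0; rewrite E !mulr1.
Qed.

Let homog_beta : beta4 C \is 4.-homog.
Proof. by apply: homog_of_ev => t x y; rewrite !ev_beta /be; field. Qed.

(** beta divides the product of ka and Lphi, and has no zero in common with Lphi. *)
Let ka_beta : exists2 q, q != 0 & ka = q%:MP * beta4 C.
Proof.
have b0 : beta4 C != 0.
  apply: contraNneq dM => z; rewrite detE z; apply/eqP; ring.
have [||q hq qE] := @gauss_div C bool (fun b => if b then Lphi else beta4 C) _ _ _ ka homog_beta b0 hka.
- move=> x y xy; have [z|z] := eqVneq (be x y) 0; first by exists true; apply: at_beta.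
  by exists false; rewrite ev_beta.
- case; last by exists ka; rewrite mulrC.
  exists ((k / 2)%:MP * Q); have n2 : (2 : C)%:MP != 0 :> forms C by rewrite mpolyC_eq0 two_neq0.
  apply: (mulfI n2); rewrite [LHS]mulrA -kaQ.
  have -> : k%:MP = 2%:MP * (k / 2)%:MP :> forms C by rewrite -mpolyCM mulrC divfK ?two_neq0.
  ring.
have [c0 cE] := homog0E hq; exists c0; last by rewrite qE cE mulrC.
apply: contraNneq dM => z; rewrite kaE qE cE z; apply/eqP.
by rewrite (_ : 0%:MP = 0) ?mulr0 ?mul0r //; apply: mpolyC0.
Qed.

(** Otherwise Q would vanish at the zeros of beta, hence Lphi too. *)
Lemma m01_m02 : m01 M != 2 * m02 M.
Proof.
apply/eqP => m.
have [q q0 qE] := ka_beta.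
have b0 : beta4 C != 0 by apply: contraNneq dM => z; rewrite detE z; apply/eqP; ring.
have E : k%:MP * Q = (2 * q)%:MP * Lphi.
  apply: (mulfI b0); transitivity (k%:MP * (beta4 C * Q)); first by ring.
  by rewrite kaQ qE mpolyCM; ring.
have [x [y [xy bxy]]] := homog_root homog_beta; rewrite ev_beta in bxy.
have := congr1 (fun f => ev f x y) E; rewrite !evM !evC => /eqP.
have -> : ev Q x y = 0.
  rewrite /Q !(ev_alpha, ev_beta, ev_gamma, evE) m bxy.
  transitivity (- 4 * m02 M * (al x y ^+ 2 + (x * y) ^+ 4)); first by ring.
  by rewrite -albe bxy; ring.
by rewrite mulr0 eq_sym; apply/negP; rewrite !mulf_neq0 ?two_neq0 ?at_beta.
Qed.

(** The expansion of F11 M at s = t starts with - X^6. Up to multiples of X^5, its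
    first order term is 5 X^4 H^2 for H = X - Z + 2 N, and H is not a multiple of X. *)
Let not_ramified_diag e f a : ~ ramified_at F a a e f.
Proof.
move=> [aa ef [c' c'0 E] T].
have a0 : a != 0 by move: aa; rewrite /nz orbb.
have a6 : a ^+ 6 != 0 by rewrite expf_neq0.
have [l0 [l1 lE]] := T (- a) 0; have L11 := L11_neq0.
have E' u w : sx (mev F 1 1) u w = c' / a ^+ 6 * (e * u + f * w) ^+ 6.
  have h : sx (mev F a a) u w = a ^+ 6 * sx (mev F 1 1) u w.
    by rewrite -[a in LHS]mulr1 (mevS _ _ _ hF) sxZ.
  by apply: (mulfI a6); rewrite -h E; field.
have lE' u w : (sxl F 1 1 (-1) 0 u w)`_1 = (e * u + f * w) ^+ 5 * (l0 * u + l1 * w) / a ^+ 6.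
  apply: (mulfI a6); rewrite -coefZ (_ : _ *: _ = sxl F a a (- a) 0 u w); first by rewrite lE; field.
  symmetry; apply: sxl_eq => t; rewrite hornerZ horner_sxl -sxZ -(mevS _ _ _ hF).
  by congr (sx (mev F _ _) u w); ring.
have X6 u w : X u w ^+ 6 = - (ev L 1 1 * (c' / a ^+ 6)) * (e * u + f * w) ^+ 6.
  by have := sx_LF 1 1 u w; rewrite F11_at11 E' => h; rewrite -[LHS]opprK h; ring.
have root : M 1 0 * f + M 0 0 * e = 0.
  have := X6 f (- e); rewrite (_ : e * f + f * - e = 0); last by ring.
  rewrite expr0n mulr0 /cf => /eqP; rewrite expf_eq0 => /andP[_ /eqP <-]; ring.
have [mu muE] : exists mu, forall u w, X u w = mu * (e * u + f * w).
  have [e0|e0] := eqVneq e 0.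
    have f0 : f != 0 by move: ef; rewrite /nz e0 eqxx.
    have M1 : M 1 0 = 0 by apply: (mulIf f0); rewrite mul0r -root e0 mulr0 addr0.
    by exists (- M 0 0 / f) => u w; rewrite /cf M1 e0; field.
  exists (M 1 0 / e) => u w; have M0 : M 0 0 = - (M 1 0 * f) / e.
    by apply: (mulIf e0); rewrite divfK //; apply/eqP; rewrite -addr_eq0 addrC root.
  by rewrite /cf M0; field.
have mu0 : mu != 0 by apply/eqP => z; apply: X_neq0 => u w; rewrite muE z mul0r.
pose H : forms C := cform M 0 - cform M 1 + 2%:MP * cform M 2.
have HE u w : ev H u w = X u w - Z u w + 2 * N u w by rewrite /H !(ev_cform, evE).
pose l : forms C := lform (- f) e.
have l_E u w : ev l u w = e * u + f * w by rewrite /l ev_lform; ring.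
have ln0 : l != 0 by apply: lform_neq0; rewrite /nz oppr_eq0 orbC.
have ZE u w : ev (cform M 1) u w = Z u w by rewrite ev_cform.
pose m : forms C := l0 *: X0 + l1 *: X1.
have mE u w : ev m u w = l0 * u + l1 * w by rewrite /m !evE; ring.
move: (cform M 1) ZE => Zf ZE; clearbody H l m.
have G0 : 5%:MP * H ^+ 2 * (mu ^+ 4)%:MP + l * ((mu ^+ 5)%:MP * (4%:MP * mu%:MP * l - 6%:MP * (Zf - mu%:MP * l) - 12%:MP * H)
    - (ev L 1 1 / a ^+ 6)%:MP * m - (ev L (-1) 0 * (c' / a ^+ 6))%:MP * l) = 0.
  have l4 : l ^+ 4 != 0 by rewrite expf_neq0.
  apply: (mulfI l4); apply: ev_inj => u w; rewrite mulr0 !(evE, HE, l_E, ZE, mE).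
  have := sxl_LF 1 1 (-1) 0 u w; rewrite coef1_at11 E' lE' !muE => /eqP.
  by rewrite -subr_eq0 => /eqP h; rewrite -[RHS]h; ring.
have := congr1 (fun g => ev g f (- e)) G0.
rewrite !(evE, HE, l_E, ZE, mE) (_ : e * f + f * - e = 0); last by ring.
rewrite mul0r addr0 => /eqP; rewrite mulf_eq0 mulf_eq0 !expf_eq0 (negPf mu0) pnatr_eq0 orbF /= muE.
rewrite (_ : e * f + f * - e = 0); last by ring.
rewrite mulf_eq0 orbb mulr0 sub0r /cf => /eqP h; move/eqP: m01_m02; apply.
have M1 : M 1 0 = mu * e by have := muE 1 0; rewrite /cf !mulr1 !mulr0 !subr0 addr0.
have M0 : M 0 0 = - (mu * f) by have := muE 0 1; rewrite /cf !mulr1 !mulr0 !sub0r add0r => <-; rewrite opprK.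
apply/eqP; rewrite -subr_eq0 /m01 /m02 M1 M0; apply/eqP.
by rewrite -[RHS](mulr0 mu) -h; ring.
Qed.

Let c_neq0 i : (i < 6)%N -> c i != 0.
Proof. by move=> i6; apply: (contents_neq0 dM dcr). Qed.

(** If F is a sixth power over (x,y), the six curves r i agree at (x,y), so that
    their mutual determinants vanish there. Up to a constant the determinant of r i
    and r j is ka times the product of the other four contents. For s <> t neither
    beta nor ka vanishes, so that at least two contents do, a contradiction. *)
Lemma not_ramified11 a b e f : ~ ramified_at F a b e f.
Proof.
have [<-|ab] := eqVneq a b; first exact: not_ramified_diag.
move=> [nab ef [c' c'0 E] _].
have [x [y [xy Ea Eb]]] := phi_surj_nz nab.
have b0 : be x y != 0.
  apply: contraNneq ab => z; rewrite -Ea -Eb; apply/eqP.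
  by apply/eqP; rewrite eq_sym -subr_eq0 opprK addrC -albe z expr0n.
have ka0 : ev ka x y != 0.
  by have [q q0 ->] := ka_beta; rewrite evM evC ev_beta mulf_neq0.
have on_line (i : 'I_6) : e * ev (r i 0 0) x y + f * ev (r i 1 0) x y = 0.
  have := congr1 (fun m => sx (mev m x y) (ev (r i 0 0) x y) (ev (r i 1 0) x y)) psiE.
  rewrite /= mevZ evC sxZ mev_precomp phi0E phi1E Ea Eb E mev_psx sx_psx (bigD1 i) //=.
  rewrite {1}/lin !mevP [X in (X - _) * _]mulrC subrr mul0r => /esym/eqP.
  by rewrite mulf_eq0 (negPf k0) mulf_eq0 (negPf c'0) expf_eq0 /= => /eqP.
have cross i j : (i < 6)%N -> (j < 6)%N ->
    ev (r i 0 0) x y * ev (r j 1 0) x y - ev (r i 1 0) x y * ev (r j 0 0) x y = 0.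
  move=> i6 j6; have := on_line (Ordinal i6); have := on_line (Ordinal j6) => /= h2 h1.
  move: ef => /orP[] h0; apply: (mulfI h0); rewrite mulr0.
    transitivity (ev (r j 1 0) x y * (e * ev (r i 0 0) x y + f * ev (r i 1 0) x y)
      - ev (r i 1 0) x y * (e * ev (r j 0 0) x y + f * ev (r j 1 0) x y)); first by ring.
    by rewrite h1 h2 !mulr0 subrr.
  transitivity (ev (r i 0 0) x y * (e * ev (r j 0 0) x y + f * ev (r j 1 0) x y)
      - ev (r j 0 0) x y * (e * ev (r i 0 0) x y + f * ev (r i 1 0) x y)); first by ring.
  by rewrite h1 h2 !mulr0 subrr.
have other (i j : 'I_6) : i != j -> exists l : 'I_6, [/\ l != i, l != j & ev (c l) x y = 0].
  move=> ij.
  have v0 := @vtx_det C i j (ltn_ord i) (ltn_ord j) ij.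
  have := contents_cross dcr i j; rewrite kaE (bigD1 i) //= (bigD1 j) 1?eq_sym //=.
  set P := \prod_(l < 6 | _) _ => E6.
  have {}E6 : ka * P * (vtx C i 0 0 * vtx C j 1 0 - vtx C i 1 0 * vtx C j 0 0)%:MP =
      r i 0 0 * r j 1 0 - r i 1 0 * r j 0 0.
    apply: (mulfI (mulf_neq0 (c_neq0 (ltn_ord i)) (c_neq0 (ltn_ord j)))).
    by rewrite -E6; ring.
  have := congr1 (fun g => ev g x y) E6.
  rewrite !(evB, evM, evC) cross // => /eqP; rewrite !mulf_eq0 (negPf ka0) (negPf v0) orbF /= /P ev_prod.
  move=> /prodf_eq0 [l /andP[li lj] /eqP lz]; by exists l.
have ne01 : (inord 0 : 'I_6) != inord 1 by rewrite -val_eqE /= !inordK.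
have [l [l0 l1 lz]] := other _ _ ne01.
have [l' [l'0 _ l'z]] := other _ _ l0.
by case: (contents_coprime nM dcr (ltn_ord l) (ltn_ord l') _ xy lz l'z); rewrite eq_sym.
Qed.

End Contents11.

End EleventhDegree.

Section Classification.

Variable C : numClosedFieldType.
Implicit Types (M : 'M[C]_(2, 3)) (g : 'M[forms C]_2) (F : 'rV[forms C]_7).

Lemma eleven_classify F nu M : sextic_curve F -> nu \in unitmx -> nocz (g11 M) ->
  \det (g11 M) != 0 -> proj_eq (f1 (g11 M)) (precomp (precomp F (moebius (invmx nu))) (phi_D4 C)) ->
  (exists t, M *m (normal11 t)^T = 0) /\ exceptional_transversal F.
Proof.
move=> [cF _ fF _] unu nM dM E.
have uV : invmx nu \in unitmx by rewrite unitmx_inv.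
set F' := precomp F (moebius (invmx nu)) in E.
have cF' : is_curve 6 F' := curve_moebius uV cF.
have [hF' nF'] := (iffLR (curveP _ _) cF').
have fF' : linearly_full F' := full_moebius uV fF.
have [L [hL L0 LE]] := F11_factor hF' nF' dM E.
split; first exact: (normal_exists nF' fF' dM hL L0 LE).
move=> R; have R' : generally_ramified F'.
  apply: (ramified_moebius unu hF' fF').
  have -> : precomp F' (moebius nu) = F.
    apply: mev_inj => x y; rewrite mev_moebius mev_moebius !mulmx_pt mulVmx // !mxE /=.
    by rewrite mul1r !mul0r mul1r add0r addr0.
  exact: R.
have [a [b [e [f]]]] := ramified_elim R'.
have hg := homog_g11 M.
have [d [c [r dcr]]] := vertex_contents hg dM.
have cphi := curve_phi C.
have [k k0 kE] := sextic_contents dM dcr cphi cF' E.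
have [_ dS] := degree_bounds hg nM dM dcr cphi cF' E.
have [ka hka kaE] := det_contents hg nM dM dcr.
have dS' : (\sum_(i < 6) d i = 18)%N by lia.
rewrite dS' in hka.
exact: (not_ramified11 hF' nF' dM nM hL L0 LE dcr k0 kE hka kaE).
Qed.

Lemma normal11_neq0 (t : C) : normal11 t != 0.
Proof.
apply/eqP => E; have := congr1 (fun v : 'rV[C]_3 => v 0 0) E; have := congr1 (fun v : 'rV[C]_3 => v 0 1) E;
  have := congr1 (fun v : 'rV[C]_3 => v 0 2) E; rewrite !normal11E !mxE => E2 E1 E0.
have t0 : t != 0.
  apply/eqP => t0; move/eqP: E2; rewrite t0 !expr0n /= !add0r !mulr1 oppr_eq0.
  by rewrite oner_eq0.
have t4 : t ^+ 4 = -1.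
  by move/eqP: E1; rewrite mulf_eq0 expf_eq0 (negPf t0) andbF orbF addr_eq0 => /eqP.
move/eqP: E0; rewrite oppr_eq0 mulf_eq0 expf_eq0 (negPf t0) andbF orbF mulf_eq0 expf_eq0 /=.
have n2 := two_neq0 C; case/orP; rewrite addr_eq0 => /eqP h.
  by move/eqP: t4; rewrite h -addr_eq0 => /eqP e; case/eqP: n2; rewrite -e; ring.
move/eqP: t4; rewrite (_ : t ^+ 4 = (t ^+ 2) ^+ 2); last by ring.
by rewrite h -addr_eq0 => /eqP e; case/eqP: n2; rewrite -e; ring.
Qed.

Lemma perp_unique (w : 'rV[C]_3) M : w != 0 -> \rank M = 2%N -> M *m w^T = 0 -> unique_perp_plane w M.
Proof.
move=> w0 rM Mw; split; first by split.
have rk : \rank (kermx w^T) = 2%N.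
  rewrite mxrank_ker mxrank_tr; have -> // : \rank w = 1%N.
  by apply/eqP; rewrite eqn_leq rank_leq_row lt0n mxrank_eq0.
have eqk M' : perp_plane w M' -> (M' :=: kermx w^T)%MS.
  move=> [rM' Mw']; apply/eqmxP.
  have sub : (M' <= kermx w^T)%MS by apply/sub_kermxP.
  by rewrite sub /= -(mxrank_leqif_sup sub).2 rk rM'.
move=> M' hM'; have e1 := eqk M' hM'; have e2 := eqk M (conj rM Mw).
by apply/eqmxP; apply: (eqmx_trans e1); apply: eqmx_sym.
Qed.

Lemma lift_classification n phi F g : galois_covering 8 phi D4 -> is_curve n g ->
  sextic_curve F -> galois_lift phi F g ->
  [/\ (n = 9 \/ n = 11)%N,
      n = 9%N -> (exists M : 'M[C]_(2, 3), \rank M = 2%N /\ lift_equiv phi g (phi_D4 C) (g9 M)) /\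
        generally_ramified F &
      n = 11%N -> (exists (t : C) (M : 'M[C]_(2, 3)), unique_perp_plane (normal11 t) M /\
          lift_equiv phi g (phi_D4 C) (g11 M)) /\ exceptional_transversal F].
Proof.
move=> gphi cg sF lift.
have [mu [nu [K [[heq oK] [cg' dg'] E n4 [E9 E11]]]]] := lift_normal gphi cg sF lift.
have [_ unu _] := heq; have leq := lift_equiv_octa g heq oK.
set g' := precomp g (moebius mu) *m const_forms K in cg' dg' E E9 E11 leq.
have [hg' ng'] := (iffLR (curveP _ _) cg').
have cF' : is_curve 6 (precomp F (moebius (invmx nu))).
  by apply: curve_moebius; rewrite ?unitmx_inv //; case: sF.
have [d [c [r dcr]]] := vertex_contents hg' dg'.
have [n8 _] := degree_bounds hg' ng' dg' dcr (curve_phi C) cF' E.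
clearbody g'; split.
- by have : (n = 9 \/ n = 11)%N by lia.
- move=> /E9 [M gM]; rewrite gM in leq dg' E; split; last exact: nine_ramified sF unu dg' E.
  exists M; split; last exact: leq.
  by apply/rank2_minors; case/orP: (det_g9_minors dg'); [apply: Or32 | apply: Or33].
move=> /E11 [M gM]; rewrite gM in leq dg' E ng'.
have [[t Mt] ex] := eleven_classify sF unu ng' dg' E; split; last exact: ex.
exists t, M; split; last exact: leq.
apply: perp_unique (normal11_neq0 t) _ Mt; apply/rank2_minors.
have [z0|?] := eqVneq (m01 M) 0; last by apply: Or31.
have [z1|?] := eqVneq (m02 M) 0; last by apply: Or32.
have [z2|?] := eqVneq (m12 M) 0; last by apply: Or33.
by case/eqP: dg'; apply: ev_eq0 => x y; rewrite -mev_det det_g11 z0 z1 z2; ring.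
Qed.

End Classification.

(** * Constructing sextic curves *)

Section Construction.

Variable C : numClosedFieldType.
Implicit Types (M : 'M[C]_(2, 3)) (g : 'M[forms C]_2) (F G : 'rV[forms C]_7).
Notation ii := ('i : C).

Lemma dihedral_covers (phi : 'cV[forms C]_2) : galois_covering 8 phi D4 ->
  exists mu nu, covering_equiv phi (phi_D4 C) mu nu.
Proof.
move=> gphi; have [cphi _ _] := gphi.
have [A [B [a [b [c [dA dB A4 A2 [B2 ABA]]]]]]] := deck_generators gphi.
have [mu [r [s [umu r0 s0 EA EB]]]] := dihedral_normal (deck_unit dA) (deck_unit dB) A4 A2 B2 ABA.
have [nu h] : exists nu, covering_equiv phi (phi_D4 C) mu nu.
  by apply: cover_normal EA EB; [exact: cphi | exact: umu | exact: r0 | exact: s0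
     | exact: (proj2 dA) | exact: (proj2 dB)].
by exists mu, nu.
Qed.

(** Sixth powers of linear forms are linear projections of G, so that G vanishes
    nowhere. *)
Lemma full_nocz G : homogm 6 G -> linearly_full G -> nocz G.
Proof.
move=> hG fG a b ab; have [x [y h]] := ev_neq0 (lform_neq0 ab).
pose l : forms C := - y *: X0 + x *: X1.
have hl : l ^+ 6 \is 6.-homog.
  rewrite -[6%N]mul1n; apply: dhomogMn.
  by apply: rpredD; apply: dhomogZ; [exact: homog_X0 | exact: homog_X1].
have [c cE] := full_surj hG fG hl.
apply: contraNneq h => E; have := cE a b; rewrite big1 => [/esym/eqP|j _]; last first.
  by rewrite -mevP E !mxE mul0r.
rewrite evX expf_eq0 => /andP[_ /eqP z]; rewrite ev_lform; apply/eqP; rewrite -[RHS]z /l !evE; ring.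
Qed.

(** The points f1 N with det N nonzero lie in the open orbit, where the quadratic
    invariant does not vanish. As the covering is onto, polynomial conditions pass
    from f1 g to G. *)
Lemma sextic_of_lift g G h : homogm 6 G -> linearly_full G -> \det g != 0 -> h != 0 ->
  f1 g = h *: precomp G (phi_D4 C) -> sextic_curve G.
Proof.
move=> hG fG dg h0 E; have nG := full_nocz hG fG; split.
- by apply/curveP.
- move=> p p0; rewrite point_ofE => d P hP PS.
  have [x [y [Es Et]]] := phi_surj (p 0 0) (p 0 1).
  have [Q QE] := poly_on_curve P (f1 g).
  have [Q' QE'] := poly_on_curve P (precomp G (phi_D4 C)).
  have Q0 : Q = 0.
    have : Q * \det g = 0.
      apply: ev_inj => a b; rewrite evM ev0 QE mev_f1 -mev_det.
      (* Multiplication by det g takes care of the degenerate points of g. *)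
      have [->|db] := eqVneq (\det (mev g a b)) 0; first by rewrite mulr0.
      by rewrite PS ?mul0r //; apply: orbit_f1.
    by move/eqP; rewrite mulf_eq0 (negPf dg) orbF => /eqP.
  have Q'0 : Q' = 0.
    have : h ^+ d * Q' = 0.
      apply: ev_inj => a b; rewrite evM evX ev0 QE' -(meval_scale _ _ hP) -mevZ -E.
      by rewrite -QE Q0 ev0.
    by move/eqP; rewrite mulf_eq0 expf_eq0 (negPf h0) andbF => /eqP.
  by have := QE' x y; rewrite Q'0 ev0 mev_precomp phi0E phi1E Es Et => <-.
- exact: fG.
have [x [y dxy]] := ev_neq0 dg; rewrite -mev_det in dxy.
pose p := rv2 (- al x y ^+ 2) ((x * y) ^+ 4).
have q0 : (quad6 C).@[(point_of G p) 0] != 0.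
  have : (quad6 C).@[(f1 (mev g x y)) 0] != 0 by rewrite quad6_f1 mulf_neq0 ?expf_neq0 ?pnatr_eq0.
  rewrite -mev_f1 E mevZ (meval_scale _ _ (quad6_homog C)) mev_precomp phi0E phi1E.
  by rewrite point_ofE /p rv2_0 rv2_1 mulf_eq0 negb_or => /andP[].
exists p; split; last by move=> /quad6_closure z; rewrite z eqxx in q0.
apply: contraNneq q0 => z; rewrite point_ofE z !mxE.
have -> : mev G 0 0 = 0 by rewrite -(mulr0 0) (mevS _ _ _ hG) expr0n scale0r.
by rewrite -(scale0r (0 : 'rV[C]_7)) (meval_scale _ _ (quad6_homog C)) expr0n mul0r.
Qed.

Lemma deck_symmetric n g a sigma : homogm n g -> a != 0 ->
  (forall x y, mev g (ii * x) y = a *: (mev g x y *m rotm C 1)) ->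
  (forall x y, mev g y x = mev g x y *m refm C 0) -> deck (phi_D4 C) sigma ->
  exists2 l, l != 0 & precomp g (moebius sigma) = g *m const_forms (l *: sigma^T).
Proof.
move=> hg a0 hR hS /deck_phi_D4 [c [k [b [c0 _ ->]]]].
have R j x y : mev g (ii ^+ j * x) y = a ^+ j *: (mev g x y *m rotm C j).
  elim: j => [|j IH] in x y *.
    have -> : rotm C 0 = 1%:M by apply/mx2P; rewrite !mxE.
    by rewrite !expr0 mul1r scale1r mulmx1.
  by rewrite exprSr -mulrA IH hR -scalemxAl scalerA -exprSr -mulmxA rot_rot add1n.
exists (c ^+ n * a ^+ k / c); first by rewrite !mulf_neq0 ?invr_eq0 ?expf_neq0.
apply: mev_inj => x y; rewrite mev_moebius (mev_scalemx _ _ _ _ hg) mev_mul mev_const.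
rewrite [(c *: _)^T]linearZ scalerA divfK // -scalemxAr -scalerA; congr (_ *: _).
case: b; rewrite !mk2E !mul0r !mul1r ?addr0 ?add0r R; last first.
  by congr (_ *: (_ *m _)); apply/mx2P; rewrite !mxE.
rewrite [mev g y x]hS -mulmxA; congr (_ *: (_ *m _)).
by apply/mx2P; rewrite !(mul2E, mxE) /=; ring.
Qed.

(** The deck transformation sigma acts on g by a multiple of its own transpose,
    which determines sigma. *)
Lemma symmetric_galois_lift n g G a h : homogm n g -> \det g != 0 -> a != 0 -> h != 0 ->
  (forall x y, mev g (ii * x) y = a *: (mev g x y *m rotm C 1)) ->
  (forall x y, mev g y x = mev g x y *m refm C 0) ->
  f1 g = h *: precomp G (phi_D4 C) -> galois_lift (phi_D4 C) G g.
Proof.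
move=> hg dg a0 h0 hR hS E; split; first exact: proj_scale E.
move=> s t ds dt.
have [l l0 ->] := deck_symmetric hg a0 hR hS ds; have [m m0 ->] := deck_symmetric hg a0 hR hS dt.
move uE : (l *: s^T) => u; move vE : (m *: t^T) => v.
have adjE (S : 'M[C]_2) : \adj (g *m const_forms S) *m g = \det g *: const_forms (\adj S).
  apply: mev_inj => x y; rewrite mev_mul mevZ mev_const -mev_det.
  have -> : mev (\adj (g *m const_forms S)) x y = \adj (mev g x y *m S).
    by rewrite -[LHS]/(map_mx (meval (pt2 x y)) _) map_mx_adj -[map_mx _ _]/(mev _ x y) mev_mul mev_const.
  by move: (mev g x y) => A; rewrite !adj2 det2; apply/mx2P; rewrite !(mul2E, mk2E, mxE) /=; ring.
move=> PE.
have {}PE := eq_ind _ (fun Y => proj_eq (\adj (g *m const_forms u) *m g) Y) PE _ (adjE v).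
have {}PE := eq_ind _ (fun Y => proj_eq Y (\det g *: const_forms (\adj v))) PE _ (adjE u).
have X := @proj_cross _ _ _ _ _ PE.
have uu : u \in unitmx by rewrite -uE unitmxZ ?unitfE // unitmx_tr; case: ds.
have uv : v \in unitmx by rewrite -vE unitmxZ ?unitfE // unitmx_tr; case: dt.
have adj0 (w : 'M[C]_2) : w \in unitmx -> \adj w != 0.
  rewrite unit2; apply: contraNneq => z; have := congr1 (fun m : 'M[C]_2 => m 0 0) z.
  have := congr1 (fun m : 'M[C]_2 => m 0 1) z; rewrite adj2 !mxE /= => /eqP; rewrite oppr_eq0 => /eqP -> ->.
  by rewrite mul0r mulr0 subrr.
have [x [y dxy]] := ev_neq0 dg.
have [c c0 cE] : exists2 c, c != 0 & \adj u = c *: \adj v.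
  apply: proj_field; apply: proj_of_cross; rewrite ?adj0 // => i j i' j'.
  have eE (S : 'M[C]_2) a' b' : ev ((\det g *: const_forms S) a' b') x y = ev (\det g) x y * S a' b'.
    by rewrite mxE evM mxE evC.
  have hh : ev (\det g) x y * (\adj u) i j * (ev (\det g) x y * (\adj v) i' j') =
      ev (\det g) x y * (\adj u) i' j' * (ev (\det g) x y * (\adj v) i j).
    by rewrite -!eE -!evM (X i j i' j').
  apply: (mulfI dxy); apply: (mulfI dxy); transitivity (ev (\det g) x y * (\adj u) i j * (ev (\det g) x y * (\adj v) i' j')).
    by ring.
  by rewrite hh; ring.
have uvE : u = c *: v.
  have e i j := congr1 (fun m : 'M[C]_2 => m i j) cE.
  have := e 0 0; have := e 0 1; have := e 1 0; have := e 1 1; rewrite !adj2 !mxE /= => h1 h2 h3 h4.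
  by apply/mx2P; rewrite [RHS]mxE //; apply: oppr_inj; rewrite ?h2 ?h3 mulrN.
apply: (@proj_scale _ _ _ _ _ (l^-1 * (c * m))); first by rewrite !mulf_neq0 ?invr_eq0.
apply: trmx_inj; rewrite -[LHS]scale1r -(mulVf l0) -scalerA uE uvE -vE scalerA.
by rewrite [RHS]linearZ /= -!scalerA.
Qed.

End Construction.

(** * The two-parameter family of degree nine *)

Section GenericNine.

Variable C : numClosedFieldType.
Implicit Types (M : 'M[C]_(2, 3)) (g : 'M[forms C]_2).
Notation ii := ('i : C).

Lemma i_scale4 x : (ii * x) ^+ 4 = x ^+ 4 :> C.
Proof. by rewrite exprMn ii4 mul1r. Qed.

Lemma al_rot x y : al (ii * x) y = al x y :> C. Proof. by rewrite /al i_scale4. Qed.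
Lemma be_rot x y : be (ii * x) y = be x y :> C. Proof. by rewrite /be i_scale4. Qed.
Lemma al_swap x y : al y x = - al x y :> C. Proof. by rewrite /al; field. Qed.
Lemma be_swap x y : be y x = be x y :> C. Proof. by rewrite /be addrC. Qed.

Lemma g9_rot M x y : mev (g9 M) (ii * x) y = 1 *: (mev (g9 M) x y *m rotm C 1).
Proof.
have i2 := ii2 C; rewrite scale1r; apply/matrixP => i j; rewrite mul2E.
by case: (ord2P j) => ->; rewrite !g9E !mk2E al_rot ?expr1; ring: i2.
Qed.

Lemma g9_swap M x y : mev (g9 M) y x = mev (g9 M) x y *m refm C 0.
Proof.
apply/matrixP => i j; rewrite mul2E.
by case: (ord2P j) => ->; rewrite !g9E !mk2E al_swap ?expr0; ring.
Qed.

Lemma g11_rot M x y : mev (g11 M) (ii * x) y = (- ii) *: (mev (g11 M) x y *m rotm C 1).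
Proof.
have i2 := ii2 C; apply/matrixP => i j; rewrite [RHS]mxE mul2E.
by case: (ord2P j) => ->; rewrite !g11E !mk2E al_rot be_rot ?expr1; ring: i2.
Qed.

Lemma g11_swap M x y : mev (g11 M) y x = mev (g11 M) x y *m refm C 0.
Proof.
apply/matrixP => i j; rewrite mul2E.
by case: (ord2P j) => ->; rewrite !g11E !mk2E al_swap be_swap ?expr0; ring.
Qed.

(** The lowest power of the variable isolates the first nonzero coefficient. *)
Lemma triangular_free n (a : nat -> {poly C}) (c : nat -> C) :
  (forall k, (k < n)%N -> (a k)`_0 != 0) -> \sum_(k < n) c k *: ('X^k * a k) = 0 ->
  forall k, (k < n)%N -> c k = 0.
Proof.
move=> ha E k; elim/ltn_ind: k => k IH kn.
have := congr1 (fun p : {poly C} => p`_k) E; rewrite coef_sum coef0 (bigD1 (Ordinal kn)) //=.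
rewrite coefZ coefXnM ltnn subnn big1 ?addr0 => [|j /= jk].
  by move/eqP; rewrite mulf_eq0 (negPf (ha k kn)) orbF => /eqP.
have [jlt|jgt] := ltnP j k; first by rewrite IH ?scale0r ?coef0.
have jk' : (j : nat) != k by apply: contra jk => /eqP jk; apply/eqP/val_inj.
by rewrite coefZ coefXnM ltn_neqAle eq_sym jk' jgt mulr0.
Qed.

(** The coefficients of F9 in the coordinates Z and N. For s = 1, B = t - 1 and t Z
    - X - 2 N = e N + T Z, the coefficient of Z^k N^(6-k) is T^k fE9 1 e B k; the
    variable w makes it homogeneous. *)
Definition fE9 (K : comNzRingType) (w e B : K) (k : nat) : K := nth 1
  [:: e ^+ 6 - 8 * B * e ^+ 5 - 20 * w * B * e ^+ 4 - 80 * w ^+ 2 * B ^+ 2 * e ^+ 2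
        + 128 * w ^+ 2 * B ^+ 3 * e + 64 * w ^+ 3 * B ^+ 3;
      6 * e ^+ 5 - 40 * B * e ^+ 4 - 80 * w * B * e ^+ 3 - 160 * w ^+ 2 * B ^+ 2 * e + 128 * w ^+ 2 * B ^+ 3;
      15 * e ^+ 4 - 80 * B * e ^+ 3 - 120 * w * B * e ^+ 2 - 80 * w ^+ 2 * B ^+ 2;
      20 * e ^+ 3 - 80 * B * e ^+ 2 - 80 * w * B * e;
      15 * e ^+ 2 - 40 * B * e - 20 * w * B;
      6 * e - 8 * B] k.

Lemma fE9_map (K L : comNzRingType) (f : {rmorphism K -> L}) w e B k :
  f (fE9 w e B k) = fE9 (f w) (f e) (f B) k.
Proof. by rewrite /fE9; do 6?[case: k => [|k] /=; first by ring]; case: k => [|k] /=; rewrite rmorph1. Qed.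

(** In the coordinates Z and N the coefficient of Z^k N^(6-k) has a zero of order
    exactly k at T = 0, so that the coefficients are linearly independent functions. *)
Lemma full_F9 M : m12 M != 0 ->
  (forall k, (k < 7)%N -> fE9 1 (m01 M / m12 M - 2) (m02 M / m12 M - 1) k != 0) ->
  linearly_full (F9 M).
Proof.
move=> m0 hk; set e := m01 M / m12 M - 2; set mu := m02 M / m12 M - 1.
pose A := mk2 (- M 0 2 / m12 M) (M 0 1 / m12 M) (- M 1 2 / m12 M) (M 1 1 / m12 M).
have uA : A \in unitmx.
  rewrite unit2 !mk2E (_ : _ - _ = (m12 M)^-1); first by rewrite invr_eq0.
  by move: m0; rewrite /m12 => m0; field.
have ZA P R : cf M 1 (A 0 0 * P + A 0 1 * R) (A 1 0 * P + A 1 1 * R) = P.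
  by rewrite /cf !mk2E; move: m0; rewrite /m12 => m0; field.
have NA P R : cf M 2 (A 0 0 * P + A 0 1 * R) (A 1 0 * P + A 1 1 * R) = R.
  by rewrite /cf !mk2E; move: m0; rewrite /m12 => m0; field.
have XA P R : cf M 0 (A 0 0 * P + A 0 1 * R) (A 1 0 * P + A 1 1 * R) = (mu + 1) * P - (e + 2) * R.
  by rewrite /cf !mk2E /mu /e; move: m0; rewrite /m12 /m01 /m02 => m0; field.
clearbody A.
have coefs T : mev (F9 M) 1 (mu + 1 + T) *m act6 A = \row_i (T ^+ (6 - i) * fE9 1 e (mu + T) (6 - i)).
  apply: sx_inj => P R; rewrite sx_act6 sx_F9 XA ZA NA sxE !big_ord_recl big_ord0 !mxE /=.
  rewrite /bump /= !add1n !subSS ?subn0 ?expr0 /fE9 /= /phi9 /q6; ring.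
move=> c Ec; pose d := invmx (act6 A) *m c.
have E T : \sum_(i < 7) d i 0 * (T ^+ (6 - i) * fE9 1 e (mu + T) (6 - i)) = 0.
  have := congr1 (fun h => mev h 1 (mu + 1 + T) 0 0) Ec; rewrite /= mev_mul mev_const mev0 !mxE => h.
  have : (mev (F9 M) 1 (mu + 1 + T) *m act6 A *m d) 0 0 = 0.
    by rewrite /d mulmxA mulmxK ?act6_unit // -[RHS]h !mxE.
  by rewrite coefs mxE => h'; rewrite -[RHS]h'; apply: eq_bigr => i _; rewrite mxE mulrC.
pose a k : {poly C} := fE9 1 e%:P (mu%:P + 'X) k.
have fE k T : (a k).[T] = fE9 1 e (mu + T) k.
  rewrite -[LHS]/(horner_eval T (a k)) /a fE9_map rmorph1 /= /horner_eval.
  by rewrite hornerD !hornerC hornerX.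
have d0 : forall k, (k < 7)%N -> d (inord (6 - k)) 0 = 0.
  apply: (@triangular_free 7 a).
    move=> k k7; rewrite -horner_coef0; have := hk k k7; rewrite -/e -/mu.
    by rewrite fE addr0.
  apply: poly_eq0_fun => T; rewrite horner_sum -[RHS](E T) [RHS](reindex_inj rev_ord_inj).
  apply: eq_bigr => -[i /= i7] _; rewrite hornerZ hornerM hornerXn fE.
  have -> : inord (6 - i) = rev_ord (Ordinal i7) by apply: val_inj; rewrite /= inordK ?subSS // ltnS leq_subr.
  by rewrite subSS subKn // -ltnS.
have : d = 0.
  apply/matrixP => i j; rewrite ord1 [RHS]mxE -(d0 (6 - i)%N) ?ltnS ?leq_subr //.
  by congr (d _ _); apply: val_inj; rewrite /= subKn ?inordK // -ltnS.
by move=> dz; rewrite -[c](mulKVmx (act6_unit uA)) -/d dz mulmx0.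
Qed.

Lemma det_g9_neq0 M : m12 M != 0 -> \det (g9 M) != 0.
Proof.
move=> m0; have -> : \det (g9 M) = 4%:MP * alpha4 C * beta4 C * gamma C *
    (m02 M *: alpha4 C ^+ 2 + m12 M *: gamma C ^+ 4).
  apply: ev_inj => x y; rewrite -mev_det det_g9 !(ev_alpha, ev_beta, ev_gamma, evE); ring.
have n2 := two_neq0 C.
have nzev (f : forms C) x y : ev f x y != 0 -> f != 0 by apply: contraNneq => ->; rewrite ev0.
have n4 : 4%:MP != 0 :> forms C by rewrite mpolyC_eq0 pnatr_eq0.
have a0 : alpha4 C != 0.
  by apply: (nzev _ 1 0); rewrite ev_alpha /al expr0n expr1n subr0 mul1r invr_eq0.
have b0 : beta4 C != 0.
  by apply: (nzev _ 1 0); rewrite ev_beta /be expr0n expr1n addr0 mul1r invr_eq0.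
have g0 : gamma C != 0 by apply: (nzev _ 1 1); rewrite ev_gamma mulr1 oner_neq0.
have q0 : m02 M *: alpha4 C ^+ 2 + m12 M *: gamma C ^+ 4 != 0.
  apply: (nzev _ 1 1); rewrite !(ev_alpha, ev_gamma, evE) /al.
  by apply: contraNneq m0 => z; apply/eqP; rewrite -[RHS]z; field.
exact: (mulf_neq0 (mulf_neq0 (mulf_neq0 (mulf_neq0 n4 a0) b0) g0) q0).
Qed.

Lemma f1_g9_form M : f1 (g9 M) = (2 *: (alpha4 C * gamma C)) *: precomp (F9 M) (phi_D4 C).
Proof.
apply: mev_inj => x y; rewrite mev_f1 f1_g9 mevZ evZ evM ev_alpha ev_gamma mev_precomp.
by rewrite phi0E phi1E; congr (_ *: _); ring.
Qed.

(** A common zero of the entries of g9 M would be a zero of F9 M. *)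
Lemma nocz_g9 M : nocz (F9 M) -> nocz (g9 M).
Proof.
move=> nF x y xy; apply/eqP => E; case/eqP: (nF _ _ (phi_nz xy)); apply: sx_inj => u w.
rewrite sx_F9 sx0; set X := cf M 0 u w; set Z := cf M 1 u w; set N := cf M 2 u w.
have e i j : mev (g9 M) x y i j = 0 by rewrite E mxE.
have h1 : y * (al x y ^+ 2 * X + (x * y) ^+ 4 * Z + 2 * al x y * x ^+ 4 * N) = 0.
  have h : u * mev (g9 M) x y 1 1 - w * mev (g9 M) x y 0 1 = 0 by rewrite !e !mulr0 subrr.
  by rewrite -[RHS]h !g9E /X /Z /N /cf; ring.
have h0 : x * (al x y ^+ 2 * X + (x * y) ^+ 4 * Z - 2 * al x y * y ^+ 4 * N) = 0.
  have h : u * mev (g9 M) x y 1 0 - w * mev (g9 M) x y 0 0 = 0 by rewrite !e !mulr0 subrr.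
  by rewrite -[RHS]h !g9E /X /Z /N /cf; ring.
clearbody X Z N.
pose P := al x y ^+ 2 * X + (x * y) ^+ 4 * Z + 2 * al x y * x ^+ 4 * N.
pose Q := al x y ^+ 2 * X + (x * y) ^+ 4 * Z - 2 * al x y * y ^+ 4 * N.
have PQ : P * Q = 0.
  case/orP: xy => xy; last by rewrite /P (mulfI xy (etrans h1 (esym (mulr0 y)))) mul0r.
  by rewrite /Q (mulfI xy (etrans h0 (esym (mulr0 x)))) mulr0.
have n2 := two_neq0 C.
rewrite /phi9 /q6 (_ : _ ^+ 2 - - _ = P * Q); first by rewrite PQ mul0r.
by rewrite /P /Q /al; field.
Qed.

Lemma generic_nine M : m12 M != 0 ->
  (forall k, (k < 7)%N -> fE9 1 (m01 M / m12 M - 2) (m02 M / m12 M - 1) k != 0) ->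
  lift_of_sextic 9 (phi_D4 C) (g9 M).
Proof.
move=> m0 hk; have fF := full_F9 m0 hk; have hF := homogm_F9 M.
have dg := det_g9_neq0 m0; have nF := full_nocz hF fF.
have h0 : 2 *: (alpha4 C * gamma C) != 0 :> forms C.
  have := dg; apply: contraNneq => z; apply/eqP.
  have : 2%:MP * (alpha4 C * gamma C) = 0 by rewrite -z; apply: ev_inj => x y; rewrite !evE.
  move=> {}z; transitivity (2%:MP * (2%:MP * (alpha4 C * gamma C)) * beta4 C *
      (m02 M *: alpha4 C ^+ 2 + m12 M *: gamma C ^+ 4)).
    by apply: ev_inj => x y; rewrite -mev_det det_g9 !(ev_alpha, ev_beta, ev_gamma, evE); ring.
  by rewrite z; ring.
split; first by apply/curveP; split; [exact: homog_g9 | exact: nocz_g9].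
exists (F9 M); split; first exact: sextic_of_lift hF fF dg h0 (f1_g9_form M).
exact: symmetric_galois_lift (homog_g9 M) dg (oner_neq0 C) h0 (g9_rot M) (g9_swap M) (f1_g9_form M).
Qed.

Lemma plueckerE M : [/\ pluecker M 0 = m12 M, pluecker M 1 = m02 M & pluecker M 2 = m01 M].
Proof.
have lE (i : 'I_3) (k : 'I_2) (j : 'I_3) : bump i k = j :> nat -> lift i k = j by move=> h; apply: val_inj.
have cE i k j l : lift i k = j -> col' i M l k = M l j by move=> <-; rewrite mxE.
split; rewrite /pluecker det2.
- by rewrite (cE _ _ 1 0 (lE 0 0 1 erefl)) (cE _ _ 1 1 (lE 0 0 1 erefl)) (cE _ _ 2 0 (lE 0 1 2 erefl)) (cE _ _ 2 1 (lE 0 1 2 erefl)).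
- by rewrite (cE _ _ 0 0 (lE 1 0 0 erefl)) (cE _ _ 0 1 (lE 1 0 0 erefl)) (cE _ _ 2 0 (lE 1 1 2 erefl)) (cE _ _ 2 1 (lE 1 1 2 erefl)).
by rewrite (cE _ _ 0 0 (lE 2 0 0 erefl)) (cE _ _ 0 1 (lE 2 0 0 erefl)) (cE _ _ 1 0 (lE 2 1 1 erefl)) (cE _ _ 1 1 (lE 2 1 1 erefl)).
Qed.

Lemma homog_fE9 n (w e B : {mpoly C[n]}) k : w \is 1.-homog -> e \is 1.-homog -> B \is 1.-homog ->
  (k < 6)%N -> fE9 w e B k \is (6 - k).-homog.
Proof.
move=> hw he hB.
have hn d (f : {mpoly C[n]}) j : f \is d.-homog -> j%:R * f \is d.-homog.
  by move=> hf; rewrite mulr_natl; apply: rpredMn.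
have hm d i j l a : d = (i + j + l)%N -> a%:R * (w ^+ i * B ^+ j * e ^+ l) \is d.-homog.
  move=> ->; apply: hn; have hp (f : {mpoly C[n]}) m : f \is 1.-homog -> f ^+ m \is m.-homog.
    by move=> hf; have := dhomogMn m hf; rewrite mul1n.
  by do 2?apply: dhomogM; apply: hp.
have hs d (f f' : {mpoly C[n]}) : f = f' -> f' \is d.-homog -> f \is d.-homog by move->.
case: k => [|[|[|[|[|[|//]]]]]] _; rewrite /fE9 /=.
- apply: (hs _ _ (1%:R * (w ^+ 0 * B ^+ 0 * e ^+ 6) - 8 * (w ^+ 0 * B ^+ 1 * e ^+ 5) - 20 * (w ^+ 1 * B ^+ 1 * e ^+ 4)
     - 80 * (w ^+ 2 * B ^+ 2 * e ^+ 2) + 128 * (w ^+ 2 * B ^+ 3 * e ^+ 1) + 64 * (w ^+ 3 * B ^+ 3 * e ^+ 0))); first by ring.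
  by apply: rpredD; [apply: rpredD; [apply: rpredB; [apply: rpredB; [apply: rpredB | ] | ] | ] | ]; apply: hm.
- apply: (hs _ _ (6 * (w ^+ 0 * B ^+ 0 * e ^+ 5) - 40 * (w ^+ 0 * B ^+ 1 * e ^+ 4) - 80 * (w ^+ 1 * B ^+ 1 * e ^+ 3)
     - 160 * (w ^+ 2 * B ^+ 2 * e ^+ 1) + 128 * (w ^+ 2 * B ^+ 3 * e ^+ 0))); first by ring.
  by apply: rpredD; [apply: rpredB; [apply: rpredB; [apply: rpredB | ] | ] | ]; apply: hm.
- apply: (hs _ _ (15 * (w ^+ 0 * B ^+ 0 * e ^+ 4) - 80 * (w ^+ 0 * B ^+ 1 * e ^+ 3) - 120 * (w ^+ 1 * B ^+ 1 * e ^+ 2)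
     - 80 * (w ^+ 2 * B ^+ 2 * e ^+ 0))); first by ring.
  by apply: rpredB; [apply: rpredB; [apply: rpredB | ] | ]; apply: hm.
- apply: (hs _ _ (20 * (w ^+ 0 * B ^+ 0 * e ^+ 3) - 80 * (w ^+ 0 * B ^+ 1 * e ^+ 2) - 80 * (w ^+ 1 * B ^+ 1 * e ^+ 1))); first by ring.
  by apply: rpredB; [apply: rpredB | ]; apply: hm.
- apply: (hs _ _ (15 * (w ^+ 0 * B ^+ 0 * e ^+ 2) - 40 * (w ^+ 0 * B ^+ 1 * e ^+ 1) - 20 * (w ^+ 1 * B ^+ 1 * e ^+ 0))); first by ring.
  by apply: rpredB; [apply: rpredB | ]; apply: hm.
apply: (hs _ _ (6 * (w ^+ 0 * B ^+ 0 * e ^+ 1) - 8 * (w ^+ 0 * B ^+ 1 * e ^+ 0))); first by ring.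
by apply: rpredB; apply: hm.
Qed.

(** The conditions of generic_nine, made homogeneous in the Pluecker coordinates. *)
Lemma generic_poly9 : exists (d : nat) (P : {mpoly C[3]}), [/\ P \is d.-homog, P != 0 &
   forall M, \rank M = 2%N -> P.@[pluecker M] != 0 -> lift_of_sextic 9 (phi_D4 C) (g9 M)].
Proof.
pose w : {mpoly C[3]} := 'X_0; pose e : {mpoly C[3]} := 'X_2 - 2 *: 'X_0; pose B : {mpoly C[3]} := 'X_1 - 'X_0.
have [hw he hB] : [/\ w \is 1.-homog, e \is 1.-homog & B \is 1.-homog].
  have hX i : ('X_i : {mpoly C[3]}) \is 1.-homog by rewrite dhomogX; apply/eqP/mdeg1.
  by split; [exact: hX | apply: rpredB; [exact: hX | apply: dhomogZ; exact: hX] | apply: rpredB; exact: hX].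
have hc k d : (k < 6)%N -> d = (6 - k)%N -> fE9 w e B k \is d.-homog.
  by move=> k6 ->; apply: homog_fE9.
have [p0 p1 p2] : [/\ forall M, pluecker M 0 = m12 M, forall M, pluecker M 1 = m02 M
    & forall M, pluecker M 2 = m01 M].
  by split=> M; have [p0 p1 p2] := plueckerE M.
have PE v : (w * \prod_(k < 6) fE9 w e B k).@[v] =
    v 0 * \prod_(k < 6) fE9 (v 0) (v 2 - 2 * v 0) (v 1 - v 0) k.
  rewrite mevalM mevalXU rmorph_prod; congr (_ * _); apply: eq_bigr => k _.
  by rewrite fE9_map /w /e /B !rmorphB /= mevalZ !mevalXU.
exists 22%N, (w * \prod_(k < 6) fE9 w e B k); split.
- have hprod n : (n <= 6)%N -> \prod_(k < n) fE9 w e B k \is (\sum_(k < n) (6 - k)).-homog.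
    elim: n => [|n IH] n6; first by rewrite !big_ord0 dhomog1.
    by rewrite !big_ord_recr /=; apply: dhomogM; [apply: IH; apply: ltnW | apply: hc].
  have -> : 22%N = (1 + \sum_(k < 6) (6 - k))%N by rewrite !big_ord_recr big_ord0.
  by apply: dhomogM; [exact: hw | exact: hprod].
  (* At this point w = e = 1 and B = 0. *)
- pose v (i : 'I_3) : C := if i == 2 then 3 else 1.
  suff : (w * \prod_(k < 6) fE9 w e B k).@[v] != 0 by apply: contraNneq => ->; rewrite meval0.
  rewrite PE /v /= mul1r; apply/prodf_neq0 => k _.
  rewrite mulr1 (_ : 3 - 2 = 1) ?subrr; last by ring.
  by case: k => -[|[|[|[|[|[|//]]]]]] ? /=; rewrite /fE9 /= !(expr1n, mulr0, mul0r, subr0, addr0, expr0n, mulr1) ?oner_neq0 ?pnatr_eq0.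
move=> M _; rewrite PE p0 p1 p2 mulf_eq0 negb_or => /andP[m0 /prodf_neq0 hk].
apply: (generic_nine m0) => k k7.
have [k6|k6] := ltnP k 6; last first.
  by rewrite (_ : k = 6%N) ?oner_neq0 //; apply/eqP; rewrite eqn_leq k6 -ltnS k7.
have := hk (Ordinal k6) isT; apply: contraNneq => /= z; apply/eqP.
transitivity (m12 M ^+ (6 - k) * fE9 1 (m01 M / m12 M - 2) (m02 M / m12 M - 1) k); last by rewrite z mulr0.
by case: k k6 {k7 z} => [|[|[|[|[|[|//]]]]]] _; rewrite /fE9 /=; field.
Qed.

End GenericNine.

(** * The one-parameter family of degree eleven *)

Section Spanning.

Variables (C : numClosedFieldType) (n : nat) (I : Type) (v : I -> 'rV[C]_n).

(** A maximal independent subfamily is a basis, since a vector outside its span is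
    separated from it by a functional. *)
Lemma spanning_basis : (forall c : 'cV[C]_n, (forall i, v i *m c = 0) -> c = 0) ->
  exists f : 'I_n -> I, \det (\matrix_i v (f i)) != 0.
Proof.
move=> span; suff h k : (k <= n)%N -> exists f : 'I_k -> I, row_free (\matrix_i v (f i)).
  have [f] := h n (leqnn n); rewrite row_free_unit unitmxE unitfE => d.
  by exists f.
elim: k => [|k IH] kn.
  by exists (fun i => match i with Ordinal m h => False_rect I (notF (h : (m < 0)%N)) end);
     rewrite /row_free -leqn0 rank_leq_row.
have [f ff] := IH (ltnW kn).
set A := \matrix_i v (f i) in ff.
have : kermx A^T != 0.
  rewrite kermx_eq0 /row_free mxrank_tr (eqP ff : \rank A = k); apply: contraTneq kn => ->.
  by rewrite ltnn.
case/rowV0Pn => c /sub_kermxP cA c0.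
have Ac : A *m c^T = 0 by rewrite -[A]trmxK -trmx_mul cA trmx0.
have [i vi] : exists i, v i *m c^T != 0.
  apply: contrapT => nx; case/eqP: c0; apply: trmx_inj; rewrite trmx0; apply: span => i.
  by apply/eqP; apply: contrapT => /negP h; apply: nx; exists i.
pose g (j : 'I_k.+1) := if unlift ord_max j is Some l then f l else i.
exists g; rewrite -kermx_eq0; apply/negPn/negP => /rowV0Pn [w /sub_kermxP wA w0].
pose A' := \matrix_j v (g j).
have sum : w 0 ord_max *: v i + (\row_l w 0 (lift ord_max l)) *m A = 0.
  rewrite -[RHS]wA mulmx_sum_row [RHS]mulmx_sum_row (bigD1_ord ord_max) //= rowK /g unlift_none.
  by congr (_ + _); apply: eq_bigr => l _; rewrite !rowK mxE /g liftK.
have wm : w 0 ord_max = 0.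
  have := congr1 (fun m => m *m c^T) sum; rewrite mulmxDl -scalemxAl -mulmxA Ac mulmx0 addr0 mul0mx.
  by move/eqP; rewrite scaler_eq0 (negPf vi) orbF => /eqP.
move: sum; rewrite wm scale0r add0r => sum.
have wl : \row_l w 0 (lift ord_max l) = 0.
  by apply: (row_free_inj ff); rewrite sum mul0mx.
case/eqP: w0; apply/matrixP => a b; rewrite ord1 [RHS]mxE.
case: (unliftP ord_max b) => [l ->|->]; last exact: wm.
by move/matrixP/(_ 0 l): wl; rewrite !mxE.
Qed.

End Spanning.

Section Eleven.

Lemma coefs6_map (K L : comNzRingType) (f : {rmorphism K -> L}) (p : forms K) :
  map_mx f (coefs6 p) = coefs6 (map_mpoly f p).
Proof. by apply/matrixP => i j; rewrite !mxE mcoeff_map_mpoly. Qed.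

Lemma sext11_map (K L : comNzRingType) (f : {rmorphism K -> L}) s t (M : 'M[K]_(2, 3)) :
  map_mx f (sext11 s t M) = sext11 (f s) (f t) (map_mx f M).
Proof.
rewrite /sext11 coefs6_map (psi11_map (map_mpoly f)) /=.
have hC a : map_mpoly f a%:MP = (f a)%:MP.
  by apply/mpolyP => m; rewrite mcoeff_map_mpoly !mcoeffC; case: (m == 0%MM) => /=; rewrite ?mulr1 ?mulr0 ?rmorph0.
rewrite !hC.
have h j : map_mpoly f (cform M j) = cform (map_mx f M) j.
  have hX k : map_mpoly f 'X_k = 'X_k :> forms L.
    by apply/mpolyP => m; rewrite mcoeff_map_mpoly !mcoeffX; case: (_ == _); [exact: rmorph1 | exact: rmorph0].
  have hZ a (p : forms K) : map_mpoly f (a *: p) = f a *: map_mpoly f p.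
    by rewrite -!mul_mpolyC rmorphM /= hC.
  by rewrite /cform rmorphB /= !hZ !hX !mxE.
by rewrite !h.
Qed.

(** A plane orthogonal to the normal vector of the parameter t, in a basis for which
    X and N are multiples of the two coordinates. *)
Definition plane11 (K : comNzRingType) (t : K) : 'M[K]_(2, 3) :=
  let w0 := - ((t + 1) ^+ 2 * (t ^+ 2 + 1) * t ^+ 3) in
  let w1 := (t ^+ 4 + 1) * t ^+ 3 in
  let w2 := - ((t ^+ 3 + 1) * (t ^+ 4 + 1) * (t ^+ 3 + t ^+ 2 + t + 1)) in
  \matrix_(i, j) nth 0 (if i == 0 then [:: 0; w2; - w1] else [:: w1; - w0; 0]) j.

Lemma plane11_map (K L : comNzRingType) (f : {rmorphism K -> L}) t :
  map_mx f (plane11 t) = plane11 (f t).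
Proof.
apply/matrixP => i j; rewrite !mxE.
by case: (ord2P i) => ->; case: (ord3P j) => -> /=; rewrite ?rmorph0 //; ring.
Qed.

Lemma cf_plane11 (K : comNzRingType) (t u w : K) :
  ((cf (plane11 t) 0 u w = ((t ^+ 4 + 1) * t ^+ 3 * u)%R) *
   (cf (plane11 t) 1 u w = ((t + 1) ^+ 2 * (t ^+ 2 + 1) * t ^+ 3 * u
      + (t ^+ 3 + 1) * (t ^+ 4 + 1) * (t ^+ 3 + t ^+ 2 + t + 1) * w)%R) *
   (cf (plane11 t) 2 u w = ((t ^+ 4 + 1) * t ^+ 3 * w)%R))%type.
Proof. by rewrite /cf !mxE /=; split; [split|]; ring. Qed.

Variable C : numClosedFieldType.
Implicit Types (M : 'M[C]_(2, 3)).
Notation ii := ('i : C).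

Definition vec7 (a0 a1 a2 a3 a4 a5 a6 : C) : 'rV[C]_7 := \row_i [:: a0; a1; a2; a3; a4; a5; a6]`_i.

Lemma sx_vec7 a0 a1 a2 a3 a4 a5 a6 u w : sx (vec7 a0 a1 a2 a3 a4 a5 a6) u w =
  a0 * u ^+ 6 + a1 * u ^+ 5 * w + a2 * u ^+ 4 * w ^+ 2 + a3 * u ^+ 3 * w ^+ 3
  + a4 * u ^+ 2 * w ^+ 4 + a5 * u * w ^+ 5 + a6 * w ^+ 6.
Proof. by rewrite sxE !big_ord_recl big_ord0 !mxE /= /bump /=; ring. Qed.

Lemma vec7_mul a0 a1 a2 a3 a4 a5 a6 (d : 'cV[C]_7) : (vec7 a0 a1 a2 a3 a4 a5 a6 *m d) 0 0 =
  a0 * d (inord 0) 0 + a1 * d (inord 1) 0 + a2 * d (inord 2) 0 + a3 * d (inord 3) 0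
  + a4 * d (inord 4) 0 + a5 * d (inord 5) 0 + a6 * d (inord 6) 0.
Proof.
have E (i : 'I_7) : d i 0 = d (inord i) 0 by rewrite inord_val.
rewrite mxE; under eq_bigr => i _ do rewrite E.
by rewrite !big_ord_recl big_ord0 !mxE /= /bump /=; ring.
Qed.

Lemma poly7_coef0 (e1 e2 e3 e4 e5 e6 e7 : C) :
  (forall s, e1 * s + e2 * s ^+ 2 + e3 * s ^+ 3 + e4 * s ^+ 4 + e5 * s ^+ 5 + e6 * s ^+ 6 + e7 * s ^+ 7 = 0) ->
  [/\ [/\ e1 = 0, e2 = 0 & e3 = 0], e4 = 0, e5 = 0, e6 = 0 & e7 = 0].
Proof.
move=> h; pose p : {poly C} := \poly_(j < 8) [:: 0; e1; e2; e3; e4; e5; e6; e7]`_j.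
have p0 : p = 0.
  by apply: poly_eq0_fun => s; rewrite -[RHS](h s) horner_poly !big_ord_recl big_ord0 /= /bump /=; ring.
have pj j : p`_j = 0 by rewrite p0 coef0.
have := (pj 1%N, pj 2%N, pj 3%N, (pj 4%N, pj 5%N, pj 6%N, pj 7%N)).
by rewrite /p !coef_poly /= => -[[[-> ->] ->] [[[-> ->] ->] ->]].
Qed.

(** Expanding in the coordinates X and X + 2 N, the conditions on the coefficients
    form a triangular system. *)
Lemma span_at1 (c : 'cV[C]_7) : (forall s, sext11 s (1 + s) (plane11 1) *m c = 0) -> c = 0.
Proof.
move=> h; pose A : 'M[C]_2 := mk2 2 0 (-1) 1.
have uA : A \in unitmx by rewrite unit2 !mk2E mul0r subr0 mulr1 two_neq0.
pose d := invmx (act6 A) *m c.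
pose r s := vec7 (s ^+ 6 * (3 - s)) (s ^+ 5 * (60 + 12 * s)) (s ^+ 4 * (480 + 345 * s + 45 * s ^+ 2))
      (s ^+ 3 * (1920 + 2320 * s + 720 * s ^+ 2))
      (s ^+ 2 * (3840 + 6240 * s + 3105 * s ^+ 2 + 405 * s ^+ 3))
      (s * (3072 + 5376 * s + 2772 * s ^+ 2 + 324 * s ^+ 3))
      (- 1792 * s - 4032 * s ^+ 2 - 2997 * s ^+ 3 - 729 * s ^+ 4).
have row s : sext11 s (1 + s) (plane11 1) *m act6 A = 4 ^+ 6 *: r s.
  apply: sx_inj => p q; rewrite sxZ sx_act6 sx_sext11 !cf_plane11 !mk2E sx_vec7 /psi11 /q6.
  clear; ring.
have n4 : 4 ^+ 6 != 0 :> C by rewrite expf_neq0 ?pnatr_eq0.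
have rd s : (r s *m d) 0 0 = 0.
  have := h s; rewrite -[c](mulKVmx (act6_unit uA)) -/d mulmxA row -scalemxAl.
  move=> /(congr1 (fun m : 'M[C]_1 => m 0 0)); rewrite [LHS]mxE [RHS]mxE => e.
  by apply: (mulfI n4); rewrite e mulr0.
set k6 := d (inord 0) 0; set k5 := d (inord 1) 0; set k4 := d (inord 2) 0; set k3 := d (inord 3) 0.
set k2 := d (inord 4) 0; set k1 := d (inord 5) 0; set k0 := d (inord 6) 0.
have [|[e1 e2 e3] e4 e5 e6 e7] := @poly7_coef0 (- 1792 * k0 + 3072 * k1) (- 4032 * k0 + 5376 * k1 + 3840 * k2)
  (- 2997 * k0 + 2772 * k1 + 6240 * k2 + 1920 * k3)
  (- 729 * k0 + 324 * k1 + 3105 * k2 + 2320 * k3 + 480 * k4)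
  (405 * k2 + 720 * k3 + 345 * k4 + 60 * k5) (45 * k4 + 12 * k5 + 3 * k6) (- k6).
  move=> s; rewrite -[RHS](rd s) /r vec7_mul -/k0 -/k1 -/k2 -/k3 -/k4 -/k5 -/k6.
  move: k0 k1 k2 k3 k4 k5 k6; clear => k0 k1 k2 k3 k4 k5 k6; ring.
have solve n x y e : e = 0 -> n%:R != 0 :> C -> n%:R * (x - y) = e -> x = y :> C.
  by move=> -> n0 /eqP; rewrite mulf_eq0 (negPf n0) subr_eq0 => /eqP.
move: e1 e2 e3 e4 e5 e6 e7 (@inord_val 6) => e1 e2 e3 e4 e5 e6 e7 iv.
have k1E : k1 = 7 / 12 * k0 by apply: (solve 3072 _ _ _ e1); [rewrite pnatr_eq0 | field].
rewrite k1E in e2 e3 e4.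
have k2E : k2 = 7 / 30 * k0 by apply: (solve 3840 _ _ _ e2); [rewrite pnatr_eq0 | field].
rewrite k2E in e3 e4 e5.
have k3E : k3 = - (19 / 480) * k0 by apply: (solve 1920 _ _ _ e3); [rewrite pnatr_eq0 | field].
rewrite k3E in e4 e5.
have k4E : k4 = - (139 / 720) * k0 by apply: (solve 480 _ _ _ e4); [rewrite pnatr_eq0 | field].
rewrite k4E in e5 e6.
have k5E : k5 = 29 / 2880 * k0 by apply: (solve 60 _ _ _ e5); [rewrite pnatr_eq0 | field].
rewrite k5E in e6.
have k6E : k6 = 257 / 90 * k0 by apply: (solve 3 _ _ _ e6); [rewrite pnatr_eq0 | field].
have k0E : k0 = 0.
  move/eqP: e7; rewrite k6E oppr_eq0 !mulf_eq0 invr_eq0 !pnatr_eq0 /= => /eqP //.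
have dz : d = 0.
  apply/matrixP => i j; rewrite ord1 [RHS]mxE -(iv i).
  case: i => -[|[|[|[|[|[|[|//]]]]]]] ? /=; rewrite -/k0 -/k1 -/k2 -/k3 -/k4 -/k5 -/k6;
    by rewrite ?(k6E, k5E, k4E, k3E, k2E, k1E) k0E ?mulr0.
by rewrite -[c](mulKVmx (act6_unit uA)) -/d dz mulmx0.
Qed.

End Eleven.

Section GenericEleven.

Variable C : numClosedFieldType.
Implicit Types (M : 'M[C]_(2, 3)) (t : C).
Notation ii := ('i : C).

(** Spanning is the nonvanishing of a determinant that is a polynomial in t. *)
Lemma generic_span : exists2 D : {poly C}, D != 0 & forall t, D.[t] != 0 ->
  forall c : 'cV[C]_7, (forall a b, sext11 a b (plane11 t) *m c = 0) -> c = 0.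
Proof.
have [f df] := @spanning_basis C 7 C (fun s => sext11 s (1 + s) (plane11 1)) (@span_at1 C).
pose D : {poly C} := \det (\matrix_i sext11 (f i)%:P (1 + (f i)%:P) (plane11 'X)).
have DE t : D.[t] = \det (\matrix_i sext11 (f i) (1 + f i) (plane11 t)).
  rewrite -[LHS]/(horner_eval t _) -det_map_mx; congr (\det _); apply/row_matrixP => i.
  rewrite -map_row !rowK sext11_map plane11_map rmorphD rmorph1 /= /horner_eval.
  by rewrite !hornerC hornerX.
exists D; first by apply: contraNneq df => D0; rewrite -DE D0 horner0.
move=> t; rewrite DE => dt c h.
have uB : \matrix_i sext11 (f i) (1 + f i) (plane11 t) \in unitmx by rewrite unitmxE unitfE.
rewrite -[c](mulKmx uB) [X in _ *m X](_ : _ = 0) ?mulmx0 //.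
by apply/row_matrixP => i; rewrite row_mul rowK h row0.
Qed.

Section GoodParameter.

Variables (t : C) (M : 'M[C]_(2, 3)).
Hypotheses (rM : \rank M = 2%N) (Mw : M *m (normal11 t)^T = 0).
Hypotheses (t0 : t != 0) (t4 : t ^+ 4 != 1) (t4' : t ^+ 4 != -1) (t2 : t ^+ 2 + t + 1 != 0).
Hypothesis span : forall c : 'cV[C]_7, (forall a b, sext11 a b (plane11 t) *m c = 0) -> c = 0.

Notation w0 := (- ((t + 1) ^+ 2 * (t ^+ 2 + 1) * t ^+ 3)).
Notation w1 := ((t ^+ 4 + 1) * t ^+ 3).
Notation w2 := (- ((t ^+ 3 + 1) * (t ^+ 4 + 1) * (t ^+ 3 + t ^+ 2 + t + 1))).

Lemma w1_neq0 : w1 != 0.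
Proof. by apply: mulf_neq0; [rewrite addr_eq0 | apply: expf_neq0]. Qed.

Lemma w0_neq0 : w0 != 0.
Proof.
rewrite oppr_eq0; apply: mulf_neq0; last exact: expf_neq0.
have e : (t + 1) * (t ^+ 2 + 1) != 0.
  apply: contraNneq t4 => z; apply/eqP/subr0_eq.
  by transitivity ((t - 1) * ((t + 1) * (t ^+ 2 + 1))); [ring | rewrite z mulr0].
rewrite (_ : _ * _ = (t + 1) * ((t + 1) * (t ^+ 2 + 1))); last by ring.
by apply: mulf_neq0 => //; apply: contraNneq e => ->; rewrite mul0r.
Qed.

Lemma relation_col i : w0 * M i 0 + w1 * M i 1 + w2 * M i 2 = 0.
Proof.
have := congr1 (fun m : 'cV[C]_2 => m i 0) Mw; rewrite mul3E ![_^T _ _]mxE !normal11E [RHS]mxE => <-.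
ring.
Qed.

Lemma relation_cf u w : w0 * cf M 0 u w + w1 * cf M 1 u w + w2 * cf M 2 u w = 0.
Proof.
transitivity (u * (w0 * M 1 0 + w1 * M 1 1 + w2 * M 1 2) - w * (w0 * M 0 0 + w1 * M 0 1 + w2 * M 0 2)).
  rewrite /cf; ring.
by rewrite !relation_col; ring.
Qed.

Lemma relation_minors : w1 * m01 M + w2 * m02 M = 0 /\ w0 * m02 M + w1 * m12 M = 0.
Proof.
split.
  transitivity (M 0 0 * (w0 * M 1 0 + w1 * M 1 1 + w2 * M 1 2) - M 1 0 * (w0 * M 0 0 + w1 * M 0 1 + w2 * M 0 2)).
    by rewrite /m01 /m02; ring.
  by rewrite !relation_col; ring.
transitivity (M 1 2 * (w0 * M 0 0 + w1 * M 0 1 + w2 * M 0 2) - M 0 2 * (w0 * M 1 0 + w1 * M 1 1 + w2 * M 1 2)).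
  by rewrite /m02 /m12; ring.
by rewrite !relation_col; ring.
Qed.

Lemma m02_neq0 : m02 M != 0.
Proof.
apply/eqP => z; have [r1 r2] := relation_minors; move: r1 r2; rewrite z !mulr0 addr0 add0r.
move=> /eqP; rewrite mulf_eq0 (negPf w1_neq0) => /eqP m1.
move=> /eqP; rewrite mulf_eq0 (negPf w1_neq0) => /eqP m2.
by have [] := (rank2_minors M).1 rM; rewrite ?z ?m1 ?m2 eqxx.
Qed.

Lemma m12_m02 : m12 M != m02 M.
Proof.
apply/eqP => e; have [_] := relation_minors; rewrite e -mulrDl => /eqP.
rewrite mulf_eq0 (negPf m02_neq0) orbF; apply/negP.
rewrite (_ : _ + _ = - (2 * t ^+ 4 * (t ^+ 2 + t + 1))); last by ring.
by rewrite oppr_eq0; apply: mulf_neq0 t2; apply: mulf_neq0; [exact: two_neq0 | exact: expf_neq0].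
Qed.

(** A change of coordinates identifies F11 M with the curve of plane11 t. *)
Lemma full_F11 : linearly_full (F11 M).
Proof.
have m0 := m02_neq0; have n1 := w1_neq0.
pose A := mk2 (- w1 * M 0 2 / m02 M) (w1 * M 0 0 / m02 M) (- w1 * M 1 2 / m02 M) (w1 * M 1 0 / m02 M).
have uA : A \in unitmx.
  rewrite unit2 !mk2E (_ : _ - _ = w1 ^+ 2 / m02 M).
    by apply: mulf_neq0; [exact: expf_neq0 | rewrite invr_eq0].
  by move: w1 m0; rewrite /m02 => k m0; field.
have XA P R : cf M 0 (A 0 0 * P + A 0 1 * R) (A 1 0 * P + A 1 1 * R) = w1 * P.
  by rewrite /cf !mk2E; move: w1 m0; rewrite /m02 => k m0; field.
have NA P R : cf M 2 (A 0 0 * P + A 0 1 * R) (A 1 0 * P + A 1 1 * R) = w1 * R.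
  by rewrite /cf !mk2E; move: w1 m0; rewrite /m02 => k m0; field.
have ZA P R : cf M 1 (A 0 0 * P + A 0 1 * R) (A 1 0 * P + A 1 1 * R) = - (w0 * P + w2 * R).
  have := relation_cf (A 0 0 * P + A 0 1 * R) (A 1 0 * P + A 1 1 * R); rewrite XA NA.
  set z := cf _ _ _ _ => e; apply: (mulfI n1); apply/eqP; rewrite -subr_eq0 -[X in _ == X]e; apply/eqP; ring.
clearbody A.
have coefs a b : mev (F11 M) a b *m act6 A = sext11 a b (plane11 t).
  apply: sx_inj => P R; rewrite sx_act6 sx_F11 XA ZA NA sx_sext11 !cf_plane11.
  by congr (psi11 _ _ _ _ _); ring.
move=> c Ec; pose d := invmx (act6 A) *m c.
have dz : d = 0.
  apply: span => a b; rewrite -coefs /d mulmxA mulmxK ?act6_unit //.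
  by have := congr1 (fun h => mev h a b) Ec; rewrite /= mev_mul mev_const mev0.
by rewrite -[c](mulKVmx (act6_unit uA)) -/d dz mulmx0.
Qed.

Lemma det_g11_neq0 : \det (g11 M) != 0.
Proof.
have -> : \det (g11 M) = alpha4 C * beta4 C * gamma C ^+ 3 *
    (- (2 * m01 M) *: gamma C ^+ 4 - 4 * m02 M *: alpha4 C ^+ 2 + 4 * m12 M *: beta4 C ^+ 2).
  apply: ev_inj => x y; rewrite -mev_det det_g11 !(ev_alpha, ev_beta, ev_gamma, evE); ring.
have n2 := two_neq0 C.
have nzev (f : forms C) x y : ev f x y != 0 -> f != 0 by apply: contraNneq => ->; rewrite ev0.
have a0 : alpha4 C != 0.
  by apply: (nzev _ 1 0); rewrite ev_alpha /al expr0n expr1n subr0 mul1r invr_eq0.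
have b0 : beta4 C != 0.
  by apply: (nzev _ 1 0); rewrite ev_beta /be expr0n expr1n addr0 mul1r invr_eq0.
have g0 : gamma C != 0 by apply: (nzev _ 1 1); rewrite ev_gamma mulr1 oner_neq0.
apply: (mulf_neq0 (mulf_neq0 (mulf_neq0 a0 b0) (expf_neq0 3 g0))).
apply: (nzev _ 1 0); rewrite !(ev_alpha, ev_beta, ev_gamma, evE) /al /be.
rewrite (_ : _ + _ = m12 M - m02 M); first by rewrite subr_eq0 m12_m02.
by field.
Qed.

(** At a common zero x^3 L1 and y^3 L2 vanish. Then a column of M vanishes, or M is
    orthogonal to (1,-1,2); neither is compatible with the orthogonality to normal11
    t. *)
Lemma nocz_g11 : nocz (g11 M).
Proof.
move=> x y xy; apply/eqP => E.
have n2 := two_neq0 C; have m0 := m02_neq0; have [r1 r2] := relation_minors.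
have h1 u w : x ^+ 3 * L1 M x y u w = 0 by rewrite -g11_l1 E !mxE !mul0r subrr.
have h2 u w : y ^+ 3 * L2 M x y u w = 0 by rewrite -g11_l2 E !mxE !mul0r subrr.
have col j : (forall u w, cf M j u w = 0) -> forall i, M i j = 0.
  move=> h i; have := h 1 0; have := h 0 (-1); rewrite /cf !mulr0 mulrN1 opprK add0r mulr1 subr0.
  by case: (ord2P i) => ->.
have X0 : ~ (forall u w, cf M 0 u w = 0).
  by move=> /col h; case/eqP: m0; rewrite /m02 !h; ring.
have N0 : ~ (forall u w, cf M 2 u w = 0).
  by move=> /col h; case/eqP: m0; rewrite /m02 !h; ring.
have Z0 : ~ (forall u w, cf M 1 u w = 0).
  move=> /col h; case/eqP: m0; apply: (mulfI w0_neq0); rewrite mulr0 -[RHS]r2.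
  by rewrite /m12 !h; ring.
have [x0|x0] := eqVneq x 0.
  have y0 : y != 0 by move: xy; rewrite /nz x0 eqxx.
  apply: N0 => u w; apply: (mulfI (_ : - (y ^+ 11 / 2) != 0)).
    by rewrite oppr_eq0; apply: mulf_neq0; [exact: expf_neq0 | rewrite invr_eq0].
  by rewrite mulr0 -[RHS](h2 u w) /L2 x0 /al /be; field.
have [y0|y0] := eqVneq y 0.
  apply: N0 => u w; apply: (mulfI (_ : x ^+ 11 / 2 != 0)).
    by apply: mulf_neq0; [exact: expf_neq0 | rewrite invr_eq0].
  by rewrite mulr0 -[RHS](h1 u w) /L1 y0 /al /be; field.
have {}h1 u w : L1 M x y u w = 0 by apply: (mulfI (expf_neq0 3 x0)); rewrite h1 mulr0.
have {}h2 u w : L2 M x y u w = 0 by apply: (mulfI (expf_neq0 3 y0)); rewrite h2 mulr0.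
have e1 u w : be x y ^+ 2 * cf M 1 u w = al x y ^+ 2 * cf M 0 u w.
  apply: (mulfI n2); apply/eqP; rewrite -subr_eq0; apply/eqP.
  by transitivity (L1 M x y u w - L2 M x y u w); [rewrite /L1 /L2; ring | rewrite h1 h2 subrr].
have e2 u w : al x y * be x y * (cf M 0 u w - cf M 1 u w + 2 * cf M 2 u w) = 0.
  apply: (mulfI n2); rewrite mulr0.
  by transitivity (L1 M x y u w + L2 M x y u w); [rewrite /L1 /L2; ring | rewrite h1 h2 addr0].
have xy4 : (x * y) ^+ 4 != 0 by apply: expf_neq0; apply: mulf_neq0.
have [a0|a0] := eqVneq (al x y) 0.
  apply: Z0 => u w; apply: (mulfI (_ : be x y ^+ 2 != 0)); last by rewrite e1 a0 expr0n mul0r mulr0.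
  by rewrite albe a0 expr0n add0r.
have [b0|b0] := eqVneq (be x y) 0.
  apply: X0 => u w; apply: (mulfI (expf_neq0 2 a0)); by rewrite -e1 b0 expr0n mul0r mulr0.
have H u w : cf M 0 u w - cf M 1 u w + 2 * cf M 2 u w = 0.
  by apply: (mulfI (mulf_neq0 a0 b0)); rewrite e2 mulr0.
have Hc i : M i 0 - M i 1 + 2 * M i 2 = 0.
  have := H 1 0; have := H 0 (-1); rewrite /cf => E0 E1.
  by case: (ord2P i) => ->; [rewrite -[RHS]E0 | rewrite -[RHS]E1]; ring.
case/eqP: m12_m02; apply/eqP; rewrite -subr_eq0; apply/eqP.
transitivity (M 1 2 * - (M 0 0 - M 0 1 + 2 * M 0 2) + M 0 2 * (M 1 0 - M 1 1 + 2 * M 1 2)).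
  by rewrite /m02 /m12; ring.
by rewrite !Hc; ring.
Qed.

(** The linear relation makes the linear factors x^3 L1 and y^3 L2 equal at x = - t
    y, so that F11 M vanishes there, and a linear form splits off. *)
Lemma F11_zero : exists q0 q1, nz q0 q1 /\ mev (F11 M) q0 q1 = 0.
Proof.
have n2 := two_neq0 C.
have a0 : al (- t) 1 != 0.
  rewrite /al; apply: mulf_neq0; last by rewrite invr_eq0.
  by rewrite exprNn expr1n -signr_odd expr0 mul1r subr_eq0.
exists (- al (- t) 1 ^+ 2), ((- t * 1) ^+ 4); split.
  by rewrite /nz oppr_eq0 expf_neq0.
apply: sx_inj => u w; rewrite sx_F11 sx0.
have E : (- t) ^+ 3 * L1 M (- t) 1 u w = 1 ^+ 3 * L2 M (- t) 1 u w.
  apply/eqP; rewrite -subr_eq0; apply/eqP.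
  transitivity ((t - 1) / 2 * (w0 * cf M 0 u w + w1 * cf M 1 u w + w2 * cf M 2 u w)).
    by rewrite /L1 /L2 /al /be; field.
  by rewrite relation_cf mulr0.
apply: (mulfI (mulf_neq0 n2 a0)); rewrite mulr0 -[RHS]oppr0.
transitivity (- (- 2 * al (- t) 1 * psi11 (- al (- t) 1 ^+ 2) ((- t * 1) ^+ 4) (cf M 0 u w) (cf M 1 u w) (cf M 2 u w))).
  ring.
rewrite psi11_factor; congr (- _).
transitivity (L1 M (- t) 1 u w * L2 M (- t) 1 u w *
  (((- t) ^+ 3 * L1 M (- t) 1 u w) ^+ 4 - (1 ^+ 3 * L2 M (- t) 1 u w) ^+ 4)); first by ring.
by rewrite E subrr mulr0.
Qed.

Lemma good_eleven : lift_of_sextic 11 (phi_D4 C) (g11 M).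
Proof.
have [q0 [q1 [q F0]]] := F11_zero; have fF := full_F11; have dg := det_g11_neq0.
have [G GP] : exists G : 'rV[forms C]_7, homogm 6 G /\ F11 M = lform q0 q1 *: G.
  have h j : exists g : forms C, g \is 6.-homog /\ F11 M 0 j = lform q0 q1 * g.
    have [|g hg E] := div_lform (homogm_F11 M 0 j) q; last by exists g.
    by rewrite -mevP F0 mxE.
  have [f fE] := choice h; exists (\row_j f j); split.
    by move=> i j; rewrite mxE; case: (fE j).
  by apply/matrixP => i j; rewrite ord1 [RHS]mxE [X in _ * X]mxE; case: (fE j).
have {GP} [hG GE] := GP.
have fG : linearly_full G.
  by move=> c Ec; apply: fF; rewrite GE -scalemxAl Ec scaler0.
pose k : forms C := lform q0 q1 \mPo [tuple phi_D4 C i 0 | i < 2].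
have h0 : - 2 *: (alpha4 C * gamma C ^+ 3) * k != 0.
  apply: mulf_neq0; first exact: alga_neq0 dg.
  have [s [t' kst]] := ev_neq0 (lform_neq0 q); have [x [y [Es Et]]] := phi_surj s t'.
  by apply: contraNneq kst => z; rewrite -(ev0 x y) -z ev_comp phi0E phi1E Es Et.
have E : f1 (g11 M) = (- 2 *: (alpha4 C * gamma C ^+ 3) * k) *: precomp G (phi_D4 C).
  rewrite f1_g11_form -scalerA; congr (_ *: _); apply: mev_inj => x y.
  by rewrite mevZ !mev_precomp ev_comp GE mevZ.
split; first by apply/curveP; split; [exact: homog_g11 | exact: nocz_g11].
exists G; split; first exact: sextic_of_lift hG fG dg h0 E.
have i0 : - ii != 0 by rewrite oppr_eq0 ii_neq0.
exact: symmetric_galois_lift (homog_g11 M) dg i0 h0 (g11_rot M) (g11_swap M) E.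
Qed.

End GoodParameter.

Lemma poly_root_list (p : {poly C}) : p != 0 -> exists s : seq C, forall t, root p t -> t \in s.
Proof.
move=> p0; have [s ps] := closed_field_poly_normal p; exists s => t.
by rewrite ps rootZ ?lead_coef_eq0 // root_prod_XsubC.
Qed.

Lemma generic_eleven : exists s : seq C, forall t, t \notin s ->
  forall M, unique_perp_plane (normal11 t) M -> lift_of_sextic 11 (phi_D4 C) (g11 M).
Proof.
have [D D0 span] := generic_span.
have nz0 (p : {poly C}) t : p.[t] != 0 -> p != 0 by apply: contraNneq => ->; rewrite horner0.
have [s sP] : exists s : seq C, forall t,
    root (D * 'X * ('X ^+ 4 - 1) * ('X ^+ 4 + 1) * ('X ^+ 2 + 'X + 1)) t -> t \in s.
  apply: poly_root_list; apply: mulf_neq0; [apply: mulf_neq0; [apply: mulf_neq0; [apply: (mulf_neq0 D0) |] |] |].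
  - by rewrite polyX_eq0.
  - by apply: (nz0 _ 0); rewrite !(hornerE, hornerXn) expr0n sub0r oppr_eq0 oner_neq0.
  - by apply: (nz0 _ 0); rewrite !(hornerE, hornerXn) expr0n add0r oner_neq0.
  by apply: (nz0 _ 0); rewrite !(hornerE, hornerXn) expr0n !add0r oner_neq0.
exists s => t ts M [[rM Mw] _].
have : ~~ root (D * 'X * ('X ^+ 4 - 1) * ('X ^+ 4 + 1) * ('X ^+ 2 + 'X + 1)) t.
  by apply: contra ts; apply: sP.
rewrite /root !hornerM !hornerD !hornerN !hornerXn hornerX hornerC.
rewrite !mulf_eq0 !negb_or => /andP[/andP[/andP[/andP[Dt t0] t4] t4'] t2].
by apply: (good_eleven rM Mw t0 _ _ t2 (span t Dt)); [rewrite -subr_eq0 | rewrite -addr_eq0].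
Qed.

End GenericEleven.

(** * Finiteness of equivalence classes *)

Lemma finite_cover (T : eqType) (U : Type) (Q : T -> U -> Prop) (e : U -> U -> bool) (l : seq T) :
  (forall x, exists s, forall u, Q x u -> has (e^~ u) s) ->
  exists s, forall x u, x \in l -> Q x u -> has (e^~ u) s.
Proof.
move=> h; elim: l => [|a l [s sP]]; first by exists [::].
have [r rP] := h a; exists (r ++ s) => x u; rewrite inE has_cat => /orP[/eqP ->|xl] q.
  by rewrite rP.
by rewrite (sP x) ?orbT.
Qed.

Section Finiteness.

Variable C : numClosedFieldType.
Implicit Types (M : 'M[C]_(2, 3)) (mu nu : 'M[C]_2).
Notation ii := ('i : C).

Lemma deck_conj mu nu sigma : covering_equiv (phi_D4 C) (phi_D4 C) mu nu ->
  deck (phi_D4 C) sigma -> deck (phi_D4 C) (mu *m sigma *m invmx mu).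
Proof.
have [hphi nphi] := (iffLR (curveP _ _) (curve_phi C)).
move=> [umu unu E] [us ds]; split; first by rewrite !unitmx_mul umu us unitmx_inv.
have homA X : homogm 8 (precomp (phi_D4 C) (moebius X)).
  by rewrite -[8%N]mul1n; apply: homogm_precomp; [exact: hphi | exact: homogm_moebius].
have [a a0 Ea] := proj_eq_const (homA sigma) hphi nphi ds.
have nE : nocz (const_forms nu *m precomp (phi_D4 C) (moebius mu)).
  by apply: (nocz_Cmul unu); have [] := (iffLR (curveP _ _) (curve_moebius umu (curve_phi C))).
have [b b0 Eb] := proj_eq_const hphi (homogm_Cmul nu (homA mu)) nE E.
have bnu : b *: nu \in unitmx by rewrite unitmxZ ?unitfE.
have Eb' x y : mev (phi_D4 C) x y = (b *: nu) *m
    mev (phi_D4 C) (mu 0 0 * x + mu 0 1 * y) (mu 1 0 * x + mu 1 1 * y).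
  by rewrite -[X in _ *m X]mev_moebius {1}Eb mevZ evC mev_mul mev_const scalemxAl.
apply: (@proj_scale _ _ _ _ _ a%:MP); first by rewrite mpolyC_eq0.
apply: mev_inj => x' y'; have [x [y [<- <-]]] := moebius_onto x' y' umu.
rewrite mevZ evC mev_moebius !mulmx_pt mulmxKV // -!mulmx_pt.
apply: (can_inj (mulKmx bnu)); rewrite -Eb' -scalemxAr -Eb' -mev_moebius Ea mevZ evC //.
Qed.

(** Conjugation by mu maps diag(i,1) and the exchange into the deck group; the first
    condition makes mu diagonal or antidiagonal, the second one makes the ratio of
    its entries an eighth root of unity. *)
Lemma self_equiv_entries mu nu : covering_equiv (phi_D4 C) (phi_D4 C) mu nu ->
  exists c z, [/\ c != 0, z ^+ 8 = 1 & mu = c *: mk2 z 0 0 1 \/ mu = c *: mk2 0 z 1 0].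
Proof.
move=> E; have [umu _ _] := E.
have conj k b : exists c k' b', [/\ c != 0, (k' < 4)%N & mu *m dm C k b = c *: (dm C k' b' *m mu)].
  have h : deck (phi_D4 C) (dm C k b).
    apply/deck_phi_D4; exists 1, (k %% 4)%N, b; split; [exact: oner_neq0 | by rewrite ltn_mod |].
    by rewrite scale1r; case: b; rewrite /= /rotm /refm -ii_mod.
  have /deck_phi_D4 [c [k' [b' [c0 k4 e]]]] := deck_conj E h.
  by exists c, k', b'; split; [exact: c0 | exact: k4 | rewrite scalemxAl -e mulmxKV].
have ii1 : ii - 1 != 0.
  rewrite subr_eq0; apply: contraNneq (two_neq0 C) => e; apply/eqP.
  by transitivity (1 + ii ^+ 2); [rewrite e; ring | rewrite ii2 subrr].
have detE : mu 0 0 * mu 1 1 - mu 0 1 * mu 1 0 != 0 by rewrite -unit2.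
have scE c (A : 'M[C]_2) i j : (c *: A) i j = c * A i j by rewrite mxE.
have eM (A B : 'M[C]_2) : A = B -> (A 0 0 = B 0 0) * (A 0 1 = B 0 1) * (A 1 0 = B 1 0) * (A 1 1 = B 1 1).
  by move->.
have i4 k : (ii ^+ k) ^+ 4 = 1 by rewrite -exprM mulnC exprM ii4 expr1n.
have [z0 [z1 z3]] : True /\ (forall x, ii * x = x -> x = 0) /\ (forall x, x = ii * x -> x = 0).
  have h x : ii * x = x -> x = 0.
    by move=> e; apply: (mulfI ii1); rewrite mulr0 mulrBl mul1r e subrr.
  by split=> //; split=> [x /h|x /esym /h].
have shape : mu 0 1 = 0 /\ mu 1 0 = 0 \/ mu 0 0 = 0 /\ mu 1 1 = 0.
  have [c [k [b [c0 k4 /eM]]]] := conj 1%N false.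
  rewrite !scE; case: b; rewrite !mul2E !mk2E !mulr0 !mulr1 !mul0r !mul1r !add0r !addr0 expr1.
    move=> [[[e00 e01] e10] e11].
    have h00 : mu 0 0 * (c ^+ 2 * ii ^+ k + 1) = 0.
      transitivity (c * ii ^+ k * (c * mu 0 0) - ii * (mu 0 0 * ii)).
        by transitivity (mu 0 0 * (c ^+ 2 * ii ^+ k - ii ^+ 2)); [rewrite ii2; ring | ring].
      by rewrite -e10 e00; ring.
    have h01 : mu 0 1 * (c ^+ 2 * ii ^+ k - 1) = 0.
      transitivity (c * ii ^+ k * (c * mu 0 1) - mu 0 1); first by ring.
      by rewrite -e11 [X in _ - X]e01; ring.
    case/eqP: detE; move/eqP: h00; rewrite mulf_eq0 => /orP[/eqP h|/eqP h].
      have : mu 1 0 * ii = 0 by rewrite e10 h mulr0.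
      by move/eqP; rewrite mulf_eq0 (negPf (ii_neq0 C)) orbF => /eqP h'; rewrite h h'; ring.
    have h1 : mu 0 1 = 0.
      apply: (mulfI (_ : - (2 : C) != 0)); first by rewrite oppr_eq0 two_neq0.
      rewrite mulr0 -[RHS]h01; transitivity (mu 0 1 * (c ^+ 2 * ii ^+ k + 1 - 2)); last by ring.
      by rewrite h; ring.
    by rewrite h1 e11 h1; ring.
  move=> [[[e00 e01] e10] e11].
  have [m0|m0] := eqVneq (mu 0 0) 0.
    right; split=> //; have [m1|m1] := eqVneq (mu 1 1) 0; first by [].
    case/eqP: detE; rewrite m0; have : (1 - c) * mu 1 1 = 0 by rewrite mulrBl mul1r -e11 subrr.
    move/eqP; rewrite mulf_eq0 (negPf m1) orbF subr_eq0 => /eqP c1.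
    by rewrite (z3 (mu 1 0)) ?mulr0 ?mul0r ?subrr // mulrC e10 -c1 mul1r.
  left; have ck : ii - c * ii ^+ k = 0.
    by apply: (mulfI m0); rewrite mulr0 mulrBr e00; ring.
  have h1 : mu 0 1 = 0 by apply: z3; rewrite {1}e01 mulrA -(subr0_eq ck).
  split=> //; have m1 : mu 1 1 != 0 by apply: contraNneq detE => ->; rewrite h1; apply/eqP; ring.
  have c1 : 1 - c = 0 by apply: (mulfI m1); rewrite mulr0 mulrBr mulr1 {1}e11; ring.
  by apply: z1; rewrite mulrC e10 -(subr0_eq c1) mul1r.
have pow8 c k a d : c != 0 -> a = c * (ii ^+ k * d) -> d = c * a -> d != 0 -> (a / d) ^+ 8 = 1.
  move=> c0 ea ed d0; have a0 : a != 0 by apply: contraNneq d0 => z; rewrite ed z mulr0.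
  have -> : a / d = c^-1 by rewrite ed; field; rewrite c0.
  have h : c ^+ 2 * ii ^+ k = 1 by apply: (mulfI a0); rewrite mulr1 [RHS]ea ed; ring.
  have : (c ^+ 2 * ii ^+ k) ^+ 4 = 1 by rewrite h expr1n.
  by rewrite exprMn i4 mulr1 -exprM exprVn => ->; rewrite invr1.
have [c [k [b [c0 k4 /eM]]]] := conj 0%N true.
rewrite !scE; case: b; rewrite !mul2E !mk2E !mulr0 !mulr1 !mul0r !mul1r !add0r !addr0 ?expr0 ?mulr1.
  move=> [[[e00 e01] e10] e11].
  case: shape => [[h01 h10]|[h00 h11]].
    have d0 : mu 1 1 != 0 by apply: contraNneq detE => ->; rewrite h01; apply/eqP; ring.
    exists (mu 1 1), (mu 0 0 / mu 1 1); split; [exact: d0 | exact: (pow8 c k _ _ c0 e01 e10 d0) |].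
    left; apply/mx2P; rewrite [RHS]mxE mk2E ?h01 ?h10 ?mulr0 ?mulr1 //.
    by rewrite mulrC divfK.
  have d0 : mu 1 0 != 0 by apply: contraNneq detE => ->; rewrite h00; apply/eqP; ring.
  exists (mu 1 0), (mu 0 1 / mu 1 0); split; [exact: d0 | exact: (pow8 c k _ _ c0 e00 e11 d0) |].
  right; apply/mx2P; rewrite [RHS]mxE mk2E ?h00 ?h11 ?mulr0 ?mulr1 //.
  by rewrite mulrC divfK.
move=> [[[e00 e01] e10] e11]; exfalso.
case: shape => [[h01 h10]|[h00 h11]].
  by case/eqP: detE; rewrite e10 h10 h01; ring.
by case/eqP: detE; rewrite e00 h00 h11; ring.
Qed.

Lemma g9_inj : injective (@g9 C).
Proof.
move=> M M' E; apply/matrixP => i j; apply/eqP; rewrite -subr_eq0; apply/eqP.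
have h x y : (M i 0 - M' i 0) * (x * al x y ^+ 2) + (M i 1 - M' i 1) * (x * (x * y) ^+ 4)
     - (M i 2 - M' i 2) * (al x y * (x * y) * (2 * y ^+ 3)) = 0.
  have e := etrans (esym (g9E M x y i).1)
    (etrans (congr1 (fun g => mev g x y i 0) E) (g9E M' x y i).1).
  move/eqP: e; rewrite -subr_eq0 => /eqP e.
  rewrite -[RHS]e; clear e.
  move: (M i 0) (M i 1) (M i 2) (M' i 0) (M' i 1) (M' i 2) (al x y); clear.
  by move=> *; ring.
suff [h0 h1 h2] : [/\ M i 0 - M' i 0 = 0, M i 1 - M' i 1 = 0 & M i 2 - M' i 2 = 0] by case: (ord3P j) => ->.
move: (M i 0 - M' i 0) (M i 1 - M' i 1) (M i 2 - M' i 2) h => a b c h.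
have [al10 al11] : al 1 0 = 1 / 2 :> C /\ al 1 1 = 0 :> C by rewrite /al !expr1n expr0n subr0 subrr mul0r.
have n2 := two_neq0 C.
have a0 : a = 0.
  have := h 1 0; rewrite al10 !(mul0r, mulr0, mul1r, expr0n, subr0, addr0) => /eqP.
  by rewrite mulf_eq0 expf_eq0 invr_eq0 (negPf n2) orbF => /eqP.
have b0 : b = 0 by have := h 1 1; rewrite al11 a0 !(mul0r, mulr0, mul1r, expr1n, subr0, add0r, mulr1).
split=> //; have al21 : al 2 1 != 0 :> C.
  rewrite /al expr1n; apply: mulf_neq0; last by rewrite invr_eq0.
  by rewrite subr_eq0 -natrX (eqr_nat _ _ 1).
have := h 2 1; rewrite a0 b0 !mul0r add0r sub0r => /eqP; rewrite oppr_eq0 mulf_eq0 => /orP[/eqP //|].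
by rewrite expr1n !mulr1 (negPf (mulf_neq0 (mulf_neq0 al21 n2) n2)).
Qed.

Lemma g11_inj : injective (@g11 C).
Proof.
move=> M M' E; apply/matrixP => i j; apply/eqP; rewrite -subr_eq0; apply/eqP.
have h x y : (M i 1 - M' i 1) * (x * be x y * (x * y) ^+ 3) - (M i 0 - M' i 0) * (x * al x y * (x * y) ^+ 3)
     - (M i 2 - M' i 2) * (al x y * be x y * (2 * y ^+ 3)) = 0.
  have e := etrans (esym (g11E M x y i).1)
    (etrans (congr1 (fun g => mev g x y i 0) E) (g11E M' x y i).1).
  move/eqP: e; rewrite -subr_eq0 => /eqP e.
  rewrite -[RHS]e; clear e.
  move: (M i 0) (M i 1) (M i 2) (M' i 0) (M' i 1) (M' i 2) (al x y) (be x y); clear.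
  by move=> *; ring.
suff [h0 h1 h2] : [/\ M i 0 - M' i 0 = 0, M i 1 - M' i 1 = 0 & M i 2 - M' i 2 = 0] by case: (ord3P j) => ->.
move: (M i 0 - M' i 0) (M i 1 - M' i 1) (M i 2 - M' i 2) h => a b c h; have n2 := two_neq0 C.
have [al01 al11] : al 0 1 = - (1 / 2) :> C /\ al 1 1 = 0 :> C.
  by rewrite /al !expr1n expr0n sub0r subrr mul0r mulNr.
have [be01 be11] : be 0 1 = 1 / 2 :> C /\ be 1 1 = 1 :> C.
  by rewrite /be !expr1n expr0n add0r -[1 + 1]/(2%:R) divff.
have c0 : c = 0.
  have := h 0 1; rewrite al01 be01 !(mul0r, mulr0, mul1r, expr1n, subr0, sub0r, mulr1) => /eqP.
  rewrite oppr0 sub0r oppr_eq0 => /eqP e; apply: (mulfI (_ : - 2^-1 != 0 :> C)).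
    by rewrite oppr_eq0 invr_eq0.
  by rewrite mulr0 -[RHS]e; field.
have b0 : b = 0.
  by have := h 1 1; rewrite al11 be11 c0 !(mul0r, mulr0, mul1r, expr1n, subr0, mulr1).
split=> //; have al21 : al 2 1 != 0 :> C.
  rewrite /al expr1n; apply: mulf_neq0; last by rewrite invr_eq0.
  by rewrite subr_eq0 -natrX (eqr_nat _ _ 1).
have := h 2 1; rewrite c0 b0 !mul0r subr0 sub0r => /eqP; rewrite oppr_eq0 mulf_eq0 => /orP[/eqP //|].
by rewrite mulr1 (negPf (mulf_neq0 (mulf_neq0 n2 al21) (expf_neq0 3 n2))).
Qed.

Lemma precomp_scalemx n (g : 'M[forms C]_2) c mu x y : homogm n g ->
  mev (precomp g (moebius (c *: mu))) x y = c ^+ n *: mev (precomp g (moebius mu)) x y.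
Proof.
move=> hg; apply: (etrans (mev_moebius _ _ _ _)); apply: (etrans (mev_scalemx _ _ _ _ hg)).
by apply: congr1; apply: esym; apply: mev_moebius.
Qed.

(** A curve equivalent to g is obtained from it by a self-equivalence of the
    covering, an octahedral matrix on the right and a matrix on the left; the first
    two range over finite sets, up to scalars. *)
Lemma equiv_classes n (g : 'M[forms C]_2) : is_curve n g ->
  exists l : seq ('M[C]_2 * 'M[C]_2), forall g', homogm n g' ->
    lift_equiv (phi_D4 C) g (phi_D4 C) g' ->
    exists x A, [/\ x \in l, A \in unitmx &
      g' = const_forms A *m (precomp g (moebius x.1) *m const_forms x.2)].
Proof.
move=> cg; have [hg ng] := (iffLR (curveP _ _) cg).
have [s sP] : exists s : seq C, forall z, z ^+ 8 = 1 -> z \in s.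
  have [|s sP] := @poly_root_list C ('X ^+ 8 - 1).
    apply/eqP => /(congr1 (horner^~ 0)) /eqP; rewrite !(hornerE, hornerXn) expr0n sub0r oppr_eq0.
    by rewrite oner_eq0.
  by exists s => z z8; apply: sP; rewrite /root !(hornerE, hornerXn) z8 subrr.
pose mus := [seq mk2 z 0 0 1 | z <- s] ++ [seq mk2 0 z 1 0 | z <- s].
exists [seq (mu, B) | mu <- mus, B <- octa_reps C] => g' hg' [mu [nu [E [A [B [dA SB P]]]]]].
have [c [z [c0 z8 muE]]] := self_equiv_entries E.
have [r [rs {}muE]] : exists r, r \in mus /\ mu = c *: r.
  case: muE => ->; eexists; split; [|reflexivity| |reflexivity]; rewrite mem_cat; apply/orP.
    by left; apply/map_f/sP.
  by right; apply/map_f/sP.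
have [q qs [d d0 BE]] := octa_repsP (octa_tr (S4star_octa SB)).
have uA : A \in unitmx by rewrite unitmxE dA unitr1.
have umu : mu \in unitmx by case: E.
have homX X : homogm n (precomp g (moebius X)).
  by rewrite -[n]mul1n; apply: homogm_precomp; [exact: hg | exact: homogm_moebius].
have tE : (const_forms B)^T = const_forms B^T by apply/matrixP => i j; rewrite !mxE.
rewrite tE in P.
have uB : B^T \in unitmx := octa_unit (octa_tr (S4star_octa SB)).
have nY : nocz (const_forms A *m precomp g (moebius mu) *m const_forms B^T).
  apply: nocz_mulC => //; apply: nocz_Cmul => //.
  by have [] := (iffLR (curveP _ _) (curve_moebius umu cg)).
have [k k0 kE] := proj_eq_const hg' (homogm_mulC _ (homogm_Cmul _ (homX mu))) nY P.
exists (r, q), (k * c ^+ n * d *: A); split.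
- by apply/allpairsP; exists (r, q).
- by rewrite unitmxZ // unitfE !mulf_neq0 ?expf_neq0.
have sandwich (X Y : 'M[C]_2) (h : 'M[forms C]_2) x y :
    mev (const_forms X *m h *m const_forms Y) x y = X *m mev h x y *m Y.
  by rewrite !mev_mul !mev_const.
apply: mev_inj => x y; rewrite {1}kE mevZ evC sandwich [RHS](congr1 (fun f => mev f x y) (mulmxA _ _ _)) sandwich.
change (mev (precomp g (moebius (r, q).1)) x y) with (mev (precomp g (moebius r)) x y).
change (r, q).2 with q.
have key : mev (precomp g (moebius mu)) x y = c ^+ n *: mev (precomp g (moebius r)) x y.
  by rewrite muE; exact: precomp_scalemx.
rewrite [LHS](congr1 (fun Y => k *: (A *m Y *m B^T)) key) BE.
move: (mev (precomp g (moebius r)) x y) => Y.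
by rewrite -!scalemxAr -!scalemxAl !scalerA; congr (_ *: _); ring.
Qed.

(** For fixed x in the list, G M is determined up to a matrix on the left, so that
    the row space of M is determined. *)
Lemma equiv_planes n (G : 'M[C]_(2, 3) -> 'M[forms C]_2) g :
  (forall A M, const_forms A *m G M = G (A *m M)) -> injective G -> (forall M, homogm n (G M)) ->
  is_curve n g ->
  exists (l : seq ('M[C]_2 * 'M[C]_2)) (Q : 'M[C]_2 * 'M[C]_2 -> 'M[C]_(2, 3) -> Prop),
    (forall M, lift_equiv (phi_D4 C) g (phi_D4 C) (G M) -> exists2 x, x \in l & Q x M) /\
    (forall x M M', Q x M -> Q x M' -> (M == M')%MS).
Proof.
move=> GM Ginj hG cg; have [l lP] := equiv_classes cg.
exists l, (fun x M => exists2 A, A \in unitmx &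
  G M = const_forms A *m (precomp g (moebius x.1) *m const_forms x.2)); split.
  by move=> M /(lP _ (hG M)) [x [A [xl uA E]]]; exists x => //; exists A.
move=> x M M' [A uA E] [A' uA' E'].
have cM (X Y : 'M[C]_2) : const_forms (X *m Y) = const_forms X *m const_forms Y.
  by rewrite /const_forms map_mxM.
have {}E : M = A *m invmx A' *m M'.
  by apply: Ginj; rewrite -GM E E' [RHS]mulmxA -cM mulmxKV.
have u : A *m invmx A' \in unitmx by rewrite unitmx_mul uA unitmx_inv.
by rewrite E; apply/eqmxP; apply: eqmxMfull; rewrite row_full_unit.
Qed.

Lemma finite_nine M : lift_of_sextic 9 (phi_D4 C) (g9 M) ->
  exists s : seq 'M[C]_(2, 3), forall M', \rank M' = 2%N ->
    lift_equiv (phi_D4 C) (g9 M) (phi_D4 C) (g9 M') -> has (fun K => (K == M')%MS) s.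
Proof.
move=> [cg _]; have hM A M' : const_forms A *m g9 M' = g9 (A *m M').
  by rewrite /g9 mulmxA /const_forms map_mxM.
have [l [Q [lQ QQ]]] := equiv_planes hM g9_inj (@homog_g9 C) cg.
have [|s sP] := @finite_cover _ _ Q (fun K M' => (K == M')%MS) l.
  move=> x; have [[M0 q0]|no] := pselect (exists M0, Q x M0).
    by exists [:: M0] => u /(QQ _ _ _ q0) h; rewrite /= h.
  by exists [::] => u q; case: no; exists u.
by exists s => M' _ /lQ [x xl q]; apply: sP xl q.
Qed.

(** Proportionality to v is a polynomial condition on t, which is not satisfied
    identically: look at t = 1 and t = -1. *)
Lemma normal11_finite (v : 'rV[C]_3) : v != 0 ->
  exists s : seq C, forall t, (exists c, normal11 t = c *: v) -> t \in s.
Proof.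
move=> v0.
pose n0 : {poly C} := - (('X + 1) ^+ 2 * ('X ^+ 2 + 1) * 'X ^+ 3).
pose n1 : {poly C} := ('X ^+ 4 + 1) * 'X ^+ 3.
have n0E t : n0.[t] = normal11 t 0 0 by rewrite normal11E /n0 !(hornerE, hornerXn, horner_exp).
have n1E t : n1.[t] = normal11 t 0 1 by rewrite normal11E /n1 !(hornerE, hornerXn, horner_exp).
have root_list (p : {poly C}) t1 : p.[t1] != 0 ->
    (forall t, (exists c, normal11 t = c *: v) -> p.[t] = 0) ->
    exists s : seq C, forall t, (exists c, normal11 t = c *: v) -> t \in s.
  move=> p1 h; have [|s sP] := @poly_root_list C p.
    by apply: contraNneq p1 => ->; rewrite horner0.
  by exists s => t /h pt; apply: sP; apply/rootP.
have N0 : n0.[1] != 0.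
  rewrite n0E normal11E !expr1n mulr1 oppr_eq0; apply: mulf_neq0; last exact: two_neq0.
  exact: expf_neq0 (two_neq0 C).
have [v0E|v0E] := eqVneq (v 0 0) 0.
  apply: (root_list n0 1 N0) => t [c E]; rewrite n0E E mxE v0E mulr0 //.
have M0 : n0.[-1] = 0 by rewrite n0E normal11E addNr expr0n !mul0r oppr0.
apply: (root_list (n0 * (v 0 1)%:P - n1 * (v 0 0)%:P) (-1)).
  rewrite hornerD hornerN hornerM M0 hornerM !hornerC mul0r sub0r oppr_eq0; apply: mulf_neq0 v0E.
  rewrite n1E normal11E (_ : _ * _ = - (2 : C)); last by ring.
  by rewrite oppr_eq0 two_neq0.
move=> t [c E]; rewrite hornerD hornerN (hornerM n0) (hornerM n1) !hornerC n0E n1E E !mxE; ring.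
Qed.

Lemma perp_prop (v w : 'rV[C]_3) M : w != 0 -> \rank M = 2%N -> M *m v^T = 0 -> M *m w^T = 0 ->
  exists c, v = c *: w.
Proof.
move=> w0 rM Mv Mw.
have ker (x : 'rV[C]_3) : M *m x^T = 0 -> (x <= kermx M^T)%MS.
  by move=> e; apply/sub_kermxP; apply: trmx_inj; rewrite trmx_mul trmxK e trmx0.
have rk : \rank (kermx M^T) = 1%N by rewrite mxrank_ker mxrank_tr rM.
have kw : (kermx M^T <= w)%MS.
  by rewrite -(mxrank_leqif_sup (ker w Mw)).2 rk rank_rV w0.
by have /sub_rVP := submx_trans (ker v Mv) kw.
Qed.

Lemma finite_eleven M : lift_of_sextic 11 (phi_D4 C) (g11 M) ->
  exists s : seq C, forall t' M', unique_perp_plane (normal11 t') M' ->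
    lift_equiv (phi_D4 C) (g11 M) (phi_D4 C) (g11 M') -> t' \in s.
Proof.
move=> [cg _]; have hM A M' : const_forms A *m g11 M' = g11 (A *m M').
  by rewrite /g11 mulmxA /const_forms map_mxM.
have [l [Q [lQ QQ]]] := equiv_planes hM g11_inj (@homog_g11 C) cg.
pose R x (t : C) := exists2 M', Q x M' & unique_perp_plane (normal11 t) M'.
have [|s sP] := @finite_cover _ _ R eq_op l.
  move=> x; have [[t0 [M0 q0 [[r0 p0] _]]]|no] := pselect (exists t, R x t); last first.
    by exists [::] => t r; case: no; exists t.
  have [s sP] := normal11_finite (normal11_neq0 t0); exists s => t [M1 q1 [[r1 p1] _]].
  have h : t \in s.
    apply: sP; apply: (perp_prop (normal11_neq0 t0) r0 _ p0).
    have /andP[/submxP [D ->] _] := QQ _ _ _ q0 q1.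
    by rewrite -mulmxA p1 mulmx0.
  by apply/hasP; exists t.
exists s => t' M' u /lQ [x xl q].
have /hasP [t ts /eqP <-] : has (eq_op^~ t') s by apply: (sP x) => //; exists M'.
exact: ts.
Qed.

End Finiteness.

Theorem theorem10p1 (R : realType) :
  [/\ galois_covering 8 (phi_D4 R[i]) D4 /\
      (forall phi : 'cV[forms R[i]]_2, galois_covering 8 phi D4 ->
         exists mu nu : 'M[R[i]]_2, covering_equiv phi (phi_D4 R[i]) mu nu),
      forall (n : nat) (phi : 'cV[forms R[i]]_2) (F : 'rV[forms R[i]]_7)
             (g : 'M[forms R[i]]_2),
        galois_covering 8 phi D4 ->
        is_curve n g -> sextic_curve F -> galois_lift phi F g ->
        [/\ (n = 9 \/ n = 11)%N,
            n = 9%N ->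
              (exists M : 'M[R[i]]_(2, 3), \rank M = 2%N /\
                 lift_equiv phi g (phi_D4 R[i]) (g9 M)) /\
              generally_ramified F &
            n = 11%N ->
              (exists (t : R[i]) (M : 'M[R[i]]_(2, 3)),
                 unique_perp_plane (normal11 t) M /\
                 lift_equiv phi g (phi_D4 R[i]) (g11 M)) /\
              exceptional_transversal F],
      two_free_parameters9 R[i] &
      one_free_parameter11 R[i]].
Proof.
split.
- by split; [exact: galois_phi_D4 | exact: dihedral_covers].
- exact: lift_classification.
- by split; [exact: generic_poly9 | move=> M _; exact: finite_nine].
by split; [exact: generic_eleven | move=> t M _; exact: finite_eleven].
Qed.
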